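(* For any $\epsilon>0$ and any global smooth solution $(c_1,c_2,u)$ (with charge density $\rho_\epsilon=c_1-c_2$) of the Nernst-Planck-Stokes system $$\partial_t c_1+u\cdot\nabla c_1=D_1\,\mathrm{div}(\nabla c_1+c_1\nabla\Phi),\qquad \partial_t c_2+u\cdot\nabla c_2=D_2\,\mathrm{div}(\nabla c_2-c_2\nabla\Phi),$$ $$-\epsilon\Delta\Phi=c_1-c_2=\rho,\qquad \partial_t u-\nu\Delta u+\nabla p=-K\rho\nabla\Phi,\qquad \mathrm{div}\,u=0$$ on $\Omega$, with boundary conditions $c_i|_{\partial\Omega}=\gamma_i$ ($i=1,2$), $\Phi|_{\partial\Omega}=W$, $u|_{\partial\Omega}=0$, there exist a time $T^\epsilon$ (depending on parameters, including $\epsilon$, and on boundary and initial data) and a constant $B_1$ (depending only on boundary data and the parameters $\Omega,D_1,D_2,\nu,K$, but not on initial data or $\epsilon$) such that for any $\tau\ge\epsilon^{2/3}$ and any $T\ge T^\epsilon$, $$\frac1\tau\int_T^{T+\tau}\left(\int_\Omega\rho_\epsilon^2(s,x)\,dx\right)ds\le B_1\epsilon^{1/3}.$$ In particular, $$\limsup_{t\to\infty}\frac1t\int_0^t\left(\int_\Omega\rho_\epsilon^2(s,x)\,dx\right)ds\le B_1\epsilon^{1/3}.$$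
   Context: $\Omega\subset\mathbb{R}^3$ is an open connected bounded domain with smooth boundary; $D_1,D_2,\nu,K>0$ are constants; $\gamma_1,\gamma_2>0$ and $W$ are fixed smooth (time-independent, $\epsilon$-independent) functions on $\partial\Omega$. The unknowns are the ionic concentrations $c_1,c_2\ge0$, the potential $\Phi$, the velocity $u$ and the pressure $p$, as functions of $(t,x)$, $t\ge 0$, $x\in\Omega$. The subscript $\epsilon$ on $\rho_\epsilon$ emphasizes dependence of the solution on $\epsilon$. *)

(* Defs.v *)
From HB Require Import structures.
From mathcomp Require Import all_boot all_order all_algebra.
From mathcomp Require Import all_classical all_reals all_analysis.

Set Implicit Arguments.
Unset Strict Implicit.
Unset Printing Implicit Defensive.

Import Order.TTheory GRing.Theory Num.Theory.
Import numFieldNormedType.Exports.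
Local Open Scope classical_set_scope.
Local Open Scope ring_scope.

Section Smooth.
Context {R : realType} {V W : normedModType R}.

(* Meant for open [U]. *)
Fixpoint Cn_on (n : nat) (U : set V) (f : V -> W) : Prop :=
  (forall x, U x -> {for x, continuous f}) /\
  if n is m.+1 then
    forall v : V, (forall x, U x -> derivable f x v) /\ Cn_on m U ('D_v f)
  else True.

(* Smoothness on an arbitrary, not necessarily open, subset [A]: locally around
   each point of [A], [f] is the restriction to [A] of a C^oo function defined
   on an open set. For the closure of a smooth domain this is smoothness up to
   the boundary; for the boundary, smoothness as a function on that
   submanifold. The values of [f] outside [A] are irrelevant. *)
Definition smooth_on (A : set V) (f : V -> W) : Prop :=
  forall x, A x -> exists (U : set V) (g : V -> W),
    [/\ open_nbhs x U, forall n, Cn_on n U g & forall y, A y -> U y -> g y = f y].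

End Smooth.

Section Space.
Context {R : realType}.
Local Notation E3 := 'rV[R]_3.

Definition ebasis (j : 'I_3) : E3 := delta_mx 0 j.

Definition dot (a b : E3) : R := \sum_(j < 3) a 0 j * b 0 j.

Definition grad (f : E3 -> R) (x : E3) : E3 := \row_j 'D_(ebasis j) f x.

Definition divg (F : E3 -> E3) (x : E3) : R :=
  \sum_(j < 3) 'D_(ebasis j) (fun y => F y 0 j) x.

(* Used both for scalar fields and, componentwise, for vector fields. *)
Definition laplacian {W : normedModType R} (f : E3 -> W) (x : E3) : W :=
  \sum_(j < 3) 'D_(ebasis j) (fun y => 'D_(ebasis j) f y) x.

Definition dt {W : normedModType R} (f : R -> E3 -> W) (t : R) (x : E3) : W :=
  derive1 (fun s => f s x) t.

Definition boundary (A : set E3) : set E3 := closure A `\` interior A.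

(* The domain lies locally on one side of its boundary, which is locally the
   regular zero set of a C^oo function. *)
Definition smooth_boundary (Omega : set E3) : Prop :=
  forall x, boundary Omega x -> exists (U : set E3) (g : E3 -> R),
    [/\ open_nbhs x U, forall n, Cn_on n U g,
        forall y, U y -> grad g y != 0 &
        Omega `&` U = [set y | g y < 0] `&` U].

Definition point3 (q : R * R * R) : E3 :=
  \row_(j < 3) [:: q.1.1; q.1.2; q.2]`_j.

(* Lebesgue integral over [A], R^3 carrying the product Lebesgue measure. *)
Definition volume_integral (A : set E3) (f : E3 -> \bar R) : \bar R :=
  (\int[(lebesgue_measure \x lebesgue_measure) \x lebesgue_measure]_(q in
     point3 @^-1` A) f (point3 q))%E.

End Space.

Section NPS.
Context {R : realType}.
Local Notation E3 := 'rV[R]_3.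

Definition closed_cylinder (Omega : set E3) : set (R * E3) :=
  [set z | 0 <= z.1 /\ closure Omega z.2].

(* The differential equations are required at positive times only, where the
   time derivative is two-sided. *)
Record smooth_NPS_solution (Omega : set E3) (D1 D2 nu K eps : R)
    (gamma1 gamma2 W : E3 -> R)
    (c1 c2 Phi : R -> E3 -> R) (u : R -> E3 -> E3) (p : R -> E3 -> R)
    : Prop := SmoothNPSSolution {
  nps_smooth_c1 : smooth_on (closed_cylinder Omega) (fun z => c1 z.1 z.2);
  nps_smooth_c2 : smooth_on (closed_cylinder Omega) (fun z => c2 z.1 z.2);
  nps_smooth_Phi : smooth_on (closed_cylinder Omega) (fun z => Phi z.1 z.2);
  nps_smooth_u : smooth_on (closed_cylinder Omega) (fun z => u z.1 z.2);
  nps_smooth_p : smooth_on (closed_cylinder Omega) (fun z => p z.1 z.2);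
  nps_c1_ge0 : forall t x, 0 <= t -> closure Omega x -> 0 <= c1 t x;
  nps_c2_ge0 : forall t x, 0 <= t -> closure Omega x -> 0 <= c2 t x;
  nps_eq_c1 : forall t x, 0 < t -> Omega x ->
    dt c1 t x + dot (u t x) (grad (c1 t) x) =
    D1 * divg (fun y => grad (c1 t) y + c1 t y *: grad (Phi t) y) x;
  nps_eq_c2 : forall t x, 0 < t -> Omega x ->
    dt c2 t x + dot (u t x) (grad (c2 t) x) =
    D2 * divg (fun y => grad (c2 t) y - c2 t y *: grad (Phi t) y) x;
  nps_poisson : forall t x, 0 < t -> Omega x ->
    - eps * laplacian (Phi t) x = c1 t x - c2 t x;
  nps_stokes : forall t x, 0 < t -> Omega x ->
    dt u t x - nu *: laplacian (u t) x + grad (p t) x =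
    - (K * (c1 t x - c2 t x)) *: grad (Phi t) x;
  nps_div : forall t x, 0 < t -> Omega x -> divg (u t) x = 0;
  nps_bc_c1 : forall t x, 0 <= t -> boundary Omega x -> c1 t x = gamma1 x;
  nps_bc_c2 : forall t x, 0 <= t -> boundary Omega x -> c2 t x = gamma2 x;
  nps_bc_Phi : forall t x, 0 <= t -> boundary Omega x -> Phi t x = W x;
  nps_bc_u : forall t x, 0 <= t -> boundary Omega x -> u t x = 0 }.

Definition initial_data (Omega : set E3) (c10 c20 : E3 -> R) (u0 : E3 -> E3)
    (c1 c2 : R -> E3 -> R) (u : R -> E3 -> E3) : Prop :=
  forall x, closure Omega x ->
    [/\ c1 0 x = c10 x, c2 0 x = c20 x & u 0 x = u0 x].

(* (1/tau) \int_T^{T+tau} \int_Omega (c1 - c2)^2 dx ds *)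
Definition mean_sq_charge (Omega : set E3) (c1 c2 : R -> E3 -> R)
    (T tau : R) : \bar R :=
  ((tau^-1)%:E * \int[lebesgue_measure]_(s in `[T, (T + tau)%R])
     volume_integral Omega (fun x => ((c1 s x - c2 s x) ^+ 2)%:E))%E.

End NPS.

(* Main.v *)
(** With [a_i = c_i + eta], [A_i] and [PhW] time-independent extensions of the
    boundary data and [psi = Phi - PhW], the free energy
    [F = sum_i \int (a_i ln (a_i / A_i) - a_i + A_i) + eps/2 \int |grad psi|^2
    + 1/(2K) \int |u|^2] dissipates
    [D = \int |grad c_1 + a_1 grad Phi|^2 / a_1
    + \int |grad c_2 - a_2 grad Phi|^2 / a_2]; the shift [eta], proportional to
    [eps], keeps the logarithms regular where [c_i] vanishes.  Testing the
    equations with [(c_i - G)_+^3], [G] a bound of the boundary concentrations,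
    shows that the excess [(c_i - G)_+] decays exponentially in [L^4].  Expanding
    the square in [D] and correcting [c_1 - c_2] in a layer of width [eps^(1/2)]
    at the boundary, so that it can be tested against the Poisson equation, gives
    [1/eps \int rho^2 <= D + C eps^(-1/2)] for large times; testing
    [grad rho + (a_1 + a_2) grad Phi] with a truncation of [psi] bounds the field
    energy by [C (1 + D)].  Hence [F' <= - lam F - c D + C]: [F] is eventually
    bounded independently of the data and of [eps], and integrating in time yields
    [\int_T^(T + tau) \int rho^2 <= C (eps + eps tau + eps^(1/2) tau)], which is
    at most [C eps^(1/3) tau] once [tau >= eps^(2/3)].  No extension of the
    boundary data has to be constructed: if some solution exists, its values at
    time 1 provide one; otherwise there is nothing to prove. *)
Require Import Defs.
From HB Require Import structures.
From mathcomp Require Import all_boot all_order all_algebra.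
From mathcomp Require Import all_classical all_reals all_analysis.
From mathcomp Require finmap.
From mathcomp Require Import measurable_realfun ring lra.
Import Order.TTheory GRing.Theory Num.Theory.
Import numFieldNormedType.Exports.
Local Open Scope classical_set_scope.
Local Open Scope ring_scope.
Set Implicit Arguments.
Unset Strict Implicit.
Unset Printing Implicit Defensive.

(** * Borel sets and measurable functions on R^3, read through [point3] *)

Section MeasureR3.
Context {R : realType}.
Local Notation E3 := 'rV[R]_3.
Local Notation TR := (measurableTypeR R).
Local Notation R3 := (TR * TR * TR)%type.

(** The waiting time may depend on [eps] and on the initial data, but it is fixed before the
    solution is given. Early bounds are therefore stated through majorants of the data, and the
    solution-dependent time up to which these majorants hold is eliminated by starting the decay
    estimates arbitrarily early. Before the waiting time, negative powers of [eps] are harmless;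
    after it every constant must be uniform.

    No surface integral is ever formed: each integration by parts involves a product that vanishes
    on the boundary. Extended by zero, such a product is Lipschitz along the axes, and its
    derivatives integrate to zero by translation invariance. The smoothness of the boundary enters
    through boundary layers, which also show that the boundary is a null set.

    The dissipation degenerates where both concentrations are small, so it does not control the
    field by itself. The truncation of [psi] contains a weight [eps^(1/2)], which compensates
    exactly the [eps^(-1/2)] lost in the layer. *)

Definition mu3 : {measure set R3 -> \bar R} :=
  ((lebesgue_measure \x lebesgue_measure) \x lebesgue_measure)%E.

Lemma norm3_lt (x : E3) (e : R) : 0 < e ->
  (forall j, `|x 0 j| < e) -> `|x| < e.
Proof.
move=> e0 xe; rewrite /Num.Def.normr/= mx_normrE.
by apply: bigmax_lt => // -[i j] _ /=; rewrite ord1.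
Qed.

Lemma norm3_le (x : E3) (e : R) : 0 <= e ->
  (forall j, `|x 0 j| <= e) -> `|x| <= e.
Proof.
move=> e0 xe; rewrite /Num.Def.normr/= mx_normrE.
by apply: bigmax_le => // -[i j] _ /=; rewrite ord1.
Qed.

Lemma le_norm3 (x : E3) (j : 'I_3) : `|x 0 j| <= `|x|.
Proof.
rewrite [leRHS]/Num.Def.normr/= mx_normrE.
by apply: (@le_bigmax _ R _ _ (fun i : 'I_1 * 'I_3 => `|x i.1 i.2|) (0, j)).
Qed.

Lemma point3_continuous : continuous (point3 : R * R * R -> E3).
Proof.
move=> q; apply/cvgrPdist_lt => e e0; near=> p; apply: norm3_lt => // j.
rewrite !mxE; have := ltn_ord j; move: (nat_of_ord j) => -[|[|[|//]]] _ /=.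
- by near: p; apply: (@cvgr_dist_lt _ _ _ _ _ (fun p : R * R * R => p.1.1) q.1.1);
    [exact: (cvg_comp _ _ cvg_fst cvg_fst)|].
- by near: p; apply: (@cvgr_dist_lt _ _ _ _ _ (fun p : R * R * R => p.1.2) q.1.2);
    [exact: (cvg_comp _ _ cvg_fst cvg_snd)|].
- by near: p; apply: (@cvgr_dist_lt _ _ _ _ _ (fun p : R * R * R => p.2) q.2); [exact: cvg_snd|].
Unshelve. all: by end_near. Qed.

Definition rbox (a b c r : rat) : set R3 :=
  (ball (ratr a : R) (ratr r : R) `*` ball (ratr b : R) (ratr r : R))
  `*` ball (ratr c : R) (ratr r : R).

Lemma rat_near (x e : R) : 0 < e -> exists a : rat, `|ratr a - x| < e.
Proof.
move=> e0; have /rat_in_itvoo[a] : x - e < x + e by lra.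
rewrite in_itv/= => /andP[h1 h2]; exists a; rewrite ltr_norml; lra.
Qed.

(** The product sigma-algebra is generated by rectangles, so an open set is written as the countable
    union of the rational cubes that it contains; [F] replaces all other cubes by the empty set. *)
Lemma open_measurable3 (O : set (R * R * R)) : open O -> measurable (O : set R3).
Proof.
move=> oO.
pose F a b c r := if asbool (rbox a b c r `<=` O) then rbox a b c r else set0.
have -> : O = \bigcup_a \bigcup_b \bigcup_c \bigcup_r F a b c r.
  apply/seteqP; split=> [[[x y] z] Oxyz|q]; last first.
    move=> [a _ [b _ [c _ [r _]]]]; rewrite /F; case: asboolP => [sO|_ //].
    exact: sO.
  have /nbhs_ballP[e /= e0 eO] : nbhs (x, y, z) O by exact: open_nbhs_nbhs.
  have e2 : 0 < e / 2 by rewrite divr_gt0.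
  (* The radius lies between [e / 8] and [3 * e / 8]; a cube of radius [r] centred within [r] of the
     point has all its points at distance less than [2 * r], which is below [e]. *)
  have [r] := @rat_near (e / 4) (e / 8) ltac:(by rewrite divr_gt0).
  rewrite ltr_norml => /andP[r1 r2].
  have r0 : 0 < ratr r :> R by lra.
  have [a ha] := rat_near x r0.
  have [b hb] := rat_near y r0.
  have [c hc] := rat_near z r0.
  exists a => //; exists b => //; exists c => //; exists r => //.
  rewrite /F; case: asboolP => [_|].
    by split; [split|]; rewrite /= /ball/=.
  move=> nO; exfalso; apply: nO.
  move=> [[x' y'] z'] /= [[]]; rewrite /ball/= => xa yb zc.
  apply: eO; split; [split|]; rewrite /ball/=.
  - have := ler_distD (ratr a) x x'; rewrite (distrC x (ratr a)); lra.
  - have := ler_distD (ratr b) y y'; rewrite (distrC y (ratr b)); lra.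
  - have := ler_distD (ratr c) z z'; rewrite (distrC z (ratr c)); lra.
do 4 (apply: bigcupT_measurable_rat => ?).
rewrite /F; case: ifP => _ //.
by apply: measurableX; [apply: measurableX|]; rewrite ball_itv; exact: measurable_itv.
Qed.

Lemma open_measurable_point3 (A : set E3) : open A ->
  measurable (point3 @^-1` A : set R3).
Proof.
move=> oA; apply: open_measurable3.
by move/continuousP : point3_continuous; exact.
Qed.

Lemma closed_measurable_point3 (A : set E3) : closed A ->
  measurable (point3 @^-1` A : set R3).
Proof.
move=> cA; rewrite -[X in measurable X]setCK; apply: measurableC.
by apply: (@open_measurable_point3 (~` A)); exact: closed_openC.
Qed.

Lemma continuous_measurable_point3 (A : set E3) (f : E3 -> R) : open A ->
  (forall x, A x -> {for x, continuous f}) ->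
  measurable_fun (point3 @^-1` A : set R3) (f \o point3 : R3 -> R).
Proof.
move=> oA cf.
apply: (measurability _ (RGenOpens.measurableE R)) => // _ [_ [a [b ->]] <-].
rewrite -[X in measurable X]/(point3 @^-1` (A `&` f @^-1` `]a, b[%classic)).
apply: open_measurable_point3; rewrite openE => x [Ax fx].
apply: filterI; first exact: open_nbhs_nbhs.
by apply: (cf x Ax); apply: open_nbhs_nbhs; split.
Qed.

End MeasureR3.

(** * Translation invariance of the volume *)

Section MeasurePreserving.
Context {R : realType}.

Definition preserves d (T : measurableType d) (m : {measure set T -> \bar R})
    (phi : T -> T) :=
  measurable_fun setT phi /\ forall A, measurable A -> m (phi @^-1` A) = m A.

(** Uniqueness of the product measure: the push-forward gives every rectangle the right mass. *)
Lemma preserves_prod d1 d2 (T1 : measurableType d1) (T2 : measurableType d2)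
    (m1 : {sigma_finite_measure set T1 -> \bar R})
    (m2 : {sigma_finite_measure set T2 -> \bar R}) phi1 phi2 :
  preserves m1 phi1 -> preserves m2 phi2 ->
  preserves (m1 \x m2)%E (fun q => (phi1 q.1, phi2 q.2)).
Proof.
move=> [mphi1 p1] [mphi2 p2].
have mphi : measurable_fun setT (fun q : T1 * T2 => (phi1 q.1, phi2 q.2)).
  apply: measurable_fun_pair.
    exact: (measurableT_comp mphi1 measurable_fst).
  exact: (measurableT_comp mphi2 measurable_snd).
split=> // A mA.
pose m' := pushforward (m1 \x m2)%E (fun q : T1 * T2 => (phi1 q.1, phi2 q.2)).
pose m'' := measure_function_pushforward__canonical__measure_function_Measure
  (m1 \x m2)%E mphi.
rewrite -[LHS]/(m'' A); apply/esym.
apply: (@product_measure_unique _ _ _ _ _ m1 m2 m'') => // B C mB mC.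
rewrite /m'' /= /pushforward.
have -> : (fun q : T1 * T2 => (phi1 q.1, phi2 q.2)) @^-1` (B `*` C) =
  (phi1 @^-1` B) `*` (phi2 @^-1` C) by [].
rewrite product_measure1E ?p1 ?p2//.
- by rewrite -[X in measurable X]setTI; exact: mphi1.
- by rewrite -[X in measurable X]setTI; exact: mphi2.
Qed.

Lemma preserves_shift (h : R) :
  preserves lebesgue_measure (fun x : measurableTypeR R => h + x : measurableTypeR R).
Proof.
have mh : measurable_fun setT (fun x : measurableTypeR R => h + x : measurableTypeR R).
  exact: measurable_funD.
split=> // A mA; apply/esym.
pose m'' := measure_function_pushforward__canonical__measure_function_Measure
  (@lebesgue_measure R) mh.
apply: (@lebesgue_measure_unique R m'') => // _ [[a b]] _ <-.
rewrite /m''/= /pushforward.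
have -> : (fun x : measurableTypeR R => h + x) @^-1` `]a, b] = `]a - h, b - h]%classic.
  by apply/seteqP; split=> x /=; rewrite !in_itv/= ltrBlDl lerBrDl.
by rewrite !lebesgue_measure_itv/= !lte_fin ltrD2r; case: ifP => // _; rewrite -!EFinB; congr EFin; ring.
Qed.

Lemma preserves_integral d (T : measurableType d)
    (m : {measure set T -> \bar R}) phi (f : T -> R) :
  preserves m phi -> measurable_fun setT f -> m.-integrable setT (EFin \o (f \o phi)) ->
  \int[m]_q f (phi q) = \int[m]_q f q.
Proof.
move=> [mphi p] mf intf; rewrite /Rintegral; congr fine.
have mf' : measurable_fun setT (EFin \o f) by exact/measurable_EFinP.
have := @integral_pushforward _ _ _ _ _ _ mphi m setT _ mf' intf measurableT.
rewrite preimage_setT => <-.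
by apply: eq_measure_integral => A mA _; rewrite /= -(p A mA).
Qed.

End MeasurePreserving.

Section Shift3.
Context {R : realType}.
Local Notation E3 := 'rV[R]_3.
Local Notation TR := (measurableTypeR R).
Local Notation R3 := (TR * TR * TR)%type.

(** The planar factor of [mu3], named so that it can carry the sigma-finite structure which
    [preserves_prod] demands of its factors. *)
Definition mu2 : set (TR * TR) -> \bar R :=
  (@lebesgue_measure R \x @lebesgue_measure R)%E.

HB.instance Definition _ := Measure.on mu2.

Lemma mu2_sigma_finite : sigma_finite setT mu2.
Proof.
have /sigma_finiteP[F [TF ndF Foo]] := sigma_finiteT (@lebesgue_measure R).
exists (fun n => F n `*` F n) => [|k]; last first.
  have [? ?] := Foo k; split; first exact: measurableX.
  by rewrite /mu2 product_measure1E// lte_mul_pinfty// ge0_fin_numE.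
rewrite -setXTT {1 2}TF predeqE => -[x y]; split.
  move=> [/= [n _ Fnx] [k _ Gky]]; exists (maxn n k) => //; split.
  - by move: x Fnx; exact/subsetPset/ndF/leq_maxl.
  - by move: y Gky; exact/subsetPset/ndF/leq_maxr.
by move=> [n _ []/= ? ?]; split; exists n.
Qed.

HB.instance Definition _ :=
  @Measure_isSigmaFinite.Build _ _ _ mu2 mu2_sigma_finite.

Definition shift3 (j : 'I_3) (h : R) (q : R3) : R3 :=
  ((h * (j == 0)%:R + q.1.1, h * (j == 1)%:R + q.1.2), h * (j == 2%:R)%:R + q.2).

Lemma point3_shift j h q :
  point3 (shift3 j h q) = h *: ebasis j + point3 q :> E3.
Proof.
apply/rowP => k; rewrite !mxE /=.
move: j k => [[|[|[|//]]] ?] [[|[|[|//]]] ?] /=;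
  by rewrite ?mulr1 ?mulr0 ?add0r.
Qed.

Lemma preserves_shift3 j h : preserves mu3 (shift3 j h).
Proof.
have := @preserves_prod R _ _ _ _ mu2 (@lebesgue_measure R)
  (fun q : TR * TR => (h * (j == 0)%:R + q.1, h * (j == 1)%:R + q.2))
  (fun x : TR => h * (j == 2%:R)%:R + x).
apply; last exact: preserves_shift.
by apply: (@preserves_prod R _ _ _ _ (@lebesgue_measure R) (@lebesgue_measure R)
  (fun q : TR => h * (j == 0)%:R + q) (fun x : TR => h * (j == 1)%:R + x));
  exact: preserves_shift.
Qed.

End Shift3.

(** * Integration by parts in space *)

Section IbpKernel.
Context {R : realType}.
Local Notation E3 := 'rV[R]_3.
Local Notation TR := (measurableTypeR R).
Local Notation R3 := (TR * TR * TR)%type.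

Lemma mu3_ball_lty (M : R) :
  (mu3 (point3 @^-1` [set x : E3 | (`|x| < M)%R]) < +oo)%E.
Proof.
apply: (@le_lt_trans _ _
  (mu3 ((ball (0%R : R) M `*` ball (0%R : R) M) `*` ball (0%R : R) M))).
  apply: le_measure; rewrite ?inE.
  - apply: open_measurable_point3.
    rewrite (_ : [set x : E3 | _] = ball (0 : E3) M); first exact: ball_open.
    by apply/seteqP; split=> x; rewrite -ball_normE/= sub0r normrN.
  - by apply: measurableX; [apply: measurableX|];
      rewrite ball_itv; exact: measurable_itv.
  - move=> [[a b] c]; rewrite /= => xM.
    have xjM j := le_lt_trans (le_norm3 (point3 (a, b, c)) j) xM.
    by split; [split|]; rewrite /ball/= sub0r normrN;
     [have := xjM 0|have := xjM 1|have := xjM 2%:R]; rewrite mxE.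
have bM : (lebesgue_measure (ball (0%R : R) M) < +oo)%E.
  rewrite ball_itv lebesgue_measure_itv/=; case: ifP => _ //.
  by rewrite -EFinB ltry.
have mb : measurable (ball (0 : R) M : set TR).
  by rewrite ball_itv; exact: measurable_itv.
rewrite /mu3 /= product_measure1E//; last exact: measurableX.
rewrite /= product_measure1E//.
have b2 : (lebesgue_measure (ball 0%R M) * lebesgue_measure (ball 0%R M) < +oo)%E.
  by apply: lte_mul_pinfty => //; rewrite ge0_fin_numE.
apply: lte_mul_pinfty => //; first exact: mule_ge0.
by rewrite ge0_fin_numE//; exact: mule_ge0.
Qed.

Lemma integrable_bounded3 (D : set R3) (f : R3 -> R) (B : R) :
  measurable D -> (mu3 D < +oo)%E -> measurable_fun D f ->
  (forall q, D q -> `|f q| <= B) -> mu3.-integrable D (EFin \o f).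
Proof.
move=> mD fD mf fB.
apply: measurable_bounded_integrable => //.
exists B; split; first exact: num_real.
by move=> C BC q Dq /=; rewrite (le_trans (fB _ Dq))// ltW.
Qed.

Lemma measurable_shift_point3 (w : E3 -> R) j h :
  measurable_fun setT (w \o point3 : R3 -> R) ->
  measurable_fun setT (fun q : R3 => w (h *: ebasis j + point3 q)).
Proof.
move=> mw; have [ms _] := preserves_shift3 j h.
have := measurableT_comp mw ms.
by apply: eq_measurable_fun => q _ /=; rewrite point3_shift.
Qed.

Lemma norm_ebasis (j : 'I_3) : `|ebasis j : E3| <= 1.
Proof.
apply: norm3_le => // k; rewrite !mxE/=; case: eqP => _ /=; rewrite ?normr1//.
by rewrite normr0.
Qed.

(** By translation invariance every difference quotient has integral 0. The Lipschitz bound along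
    the axis dominates the quotients, which converge to [dw] off the null set [N]. The intended [w]
    is a function on the domain extended by zero, with [N] the boundary. *)
Lemma integral_derive_eq0 (w dw : E3 -> R) (j : 'I_3) (L M B : R) (N : set R3) :
  measurable_fun setT (w \o point3 : R3 -> R) ->
  measurable_fun setT (dw \o point3 : R3 -> R) ->
  (forall x, M <= `|x| -> w x = 0) -> (forall x, `|w x| <= B) ->
  (forall x h, `|w (h *: ebasis j + x) - w x| <= L * `|h|) ->
  measurable N -> mu3 N = 0%E ->
  (forall q, ~ N q -> is_derive (point3 q) (ebasis j) w (dw (point3 q))) ->
  \int[mu3]_q dw (point3 q) = 0.
Proof.
move=> mw mdw wM wB wL mN N0 wdw.
have L0 : 0 <= L by have := wL 0 1; rewrite normr1 mulr1; apply: le_trans.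
(* The increments are at most 1, so that all quotients vanish where the norm is at least [M + 1] and
   a single function dominates them. *)
pose h n : R := n.+1%:R^-1.
have h0 n : 0 < h n by rewrite invr_gt0.
have h1 n : `|h n| <= 1 by rewrite gtr0_norm// invf_le1// ler1n.
pose Q n (q : R3) : R := (h n)^-1 * (w (h n *: ebasis j + point3 q) - w (point3 q)).
have mQ n : measurable_fun setT (Q n).
  apply: measurable_funM; first exact: measurable_cst.
  by apply: measurable_funB => //; exact: measurable_shift_point3.
have intw (f : R3 -> R) : measurable_fun setT f -> (forall q, `|f q| <= B) ->
    (forall q : R3, M + 1 <= `|point3 q : E3| -> f q = 0) ->
    mu3.-integrable setT (EFin \o f).
  move=> mf fB fM.
  have -> : EFin \o f = (EFin \o f) \_ (point3 @^-1` [set x : E3 | (`|x| < M + 1)%R]).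
    apply/funext => q; rewrite patchE; case: ifPn => //.
    by rewrite notin_setE/= => /negP; rewrite -leNgt => /fM ->.
  have mD : measurable (point3 @^-1` [set x : E3 | (`|x| < M + 1)%R] : set R3).
    apply: open_measurable_point3.
    rewrite (_ : [set x : E3 | _] = ball (0 : E3) (M + 1)); first exact: ball_open.
    by apply/seteqP; split=> x; rewrite -ball_normE/= sub0r normrN.
  rewrite -integrable_mkcond//.
  apply: (@integrable_bounded3 _ _ B) => //; first exact: mu3_ball_lty.
  by apply: measurable_funS mf.
have wnear n q : M + 1 <= `|point3 q : E3| -> w (h n *: ebasis j + point3 q) = 0.
  move=> Mq; apply: wM.
  have := ler_normB (h n *: ebasis j + point3 q) (h n *: ebasis j).
  rewrite addrC addKr => le1.
  have : `|h n *: ebasis j : E3| <= 1.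
    by rewrite normrZ mulr_ile1// norm_ebasis.
  lra.
have w0 q : M + 1 <= `|point3 q : E3| -> w (point3 q) = 0.
  by move=> Mq; apply: wM; lra.
have iQ n : \int[mu3]_q Q n q = 0.
  have i1 : mu3.-integrable setT (EFin \o (fun q => w (h n *: ebasis j + point3 q))).
    apply: (intw (fun q : R3 => w (h n *: ebasis j + point3 q))) => //; [exact: measurable_shift_point3|exact: wnear].
  have i2 : mu3.-integrable setT (EFin \o (w \o point3)) by apply: (intw (w \o point3)) => [|q|q]; [exact: mw|exact: wB|exact: w0].
  rewrite RintegralZl//; last first.
    exact: (integrableB _ i1 i2).
  rewrite RintegralB//.
  have := @preserves_integral R _ _ mu3 _ (w \o point3) (preserves_shift3 j (h n)) mw.
  have -> : (w \o point3) \o shift3 j (h n) = (fun q => w (h n *: ebasis j + point3 q)).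
    by apply/funext => q /=; rewrite point3_shift.
  move=> /(_ i1) /=; under eq_Rintegral do rewrite point3_shift.
  by move=> ->; rewrite subrr mulr0.
pose G (q : R3) : \bar R := ((EFin \o cst L) \_
   (point3 @^-1` [set x : E3 | (`|x| < M + 1)%R])) q.
have intG : mu3.-integrable setT G.
  have mD : measurable (point3 @^-1` [set x : E3 | (`|x| < M + 1)%R] : set R3).
    apply: open_measurable_point3.
    rewrite (_ : [set x : E3 | _] = ball (0 : E3) (M + 1)); first exact: ball_open.
    by apply/seteqP; split=> x; rewrite -ball_normE/= sub0r normrN.
  rewrite -integrable_mkcond//.
  apply: (@integrable_bounded3 _ _ L) => //; first exact: mu3_ball_lty.
  by move=> q _ /=; rewrite ger0_norm.
have QG q n : (`|(Q n q)%:E| <= G q)%E.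
  rewrite /G patchE; case: ifPn => [_|].
    rewrite /= lee_fin /Q normrM normfV (gtr0_norm (h0 n)) mulrC ler_pdivrMr//.
    by rewrite (le_trans (wL _ _))// (gtr0_norm (h0 n)).
  rewrite notin_setE/= => /negP; rewrite -leNgt => Mq.
  by rewrite /Q wnear// w0// subrr mulr0 normr0.
have Qcvg : {ae mu3, forall x, setT x -> (Q n x)%:E @[n --> \oo] --> (dw (point3 x))%:E}.
  exists N; split => // q /=; apply: contraPP => /wdw wq; apply.
  move=> _; apply: cvg_EFin; first exact: nearW.
  have [/cvg_ex[l dwl] <-] := wq.
  have -> : 'D_(ebasis j) w (point3 q) = l by apply/cvg_lim.
  have hh : (forall n, h n != 0) /\ h n @[n --> \oo] --> (0 : R).
    by split; [move=> n; rewrite gt_eqF|exact: (@cvg_harmonic R)].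
  exact: ((cvgr_dnbhsP _ _ _).1 dwl h hh).
have mdw' : measurable_fun setT (fun q : R3 => (dw (point3 q))%:E).
  exact/measurable_EFinP.
have mQ' n : measurable_fun setT (fun q : R3 => (Q n q)%:E) by exact/measurable_EFinP.
have [intdw _ cdw] := @dominated_convergence _ _ _ mu3 _ measurableT
  (fun n q => (Q n q)%:E) _ G mQ' mdw' Qcvg intG (aeW _ (fun q n _ => QG q n)).
rewrite /Rintegral.
have := cvg_lim (@ereal_hausdorff R) cdw.
have -> : (fun n => \int[mu3]_q (Q n q)%:E)%E = cst 0%E.
  apply/funext => n; rewrite -[LHS]fineK; first by rewrite -[X in X%:E]/(Rintegral _ _ _) iQ.
  apply: integrable_fin_num => //.
  apply: le_integrable intG => // q _.
  by rewrite (le_trans (QG q n))// lee_abs.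
by rewrite lim_cst// => <-.
Qed.

End IbpKernel.

(** * Directional derivatives and classes of bounded C^1 functions *)

Section DirectionalCalculus.
Context {R : realType} {V : normedModType R}.
Implicit Types (f g : V -> R) (x v : V).

Lemma is_derive_add f g x v df dg :
  is_derive x v f df -> is_derive x v g dg ->
  is_derive x v (fun y => f y + g y) (df + dg).
Proof. by move=> ? ?; exact: is_deriveD. Qed.

Lemma is_derive_opp f x v df :
  is_derive x v f df -> is_derive x v (fun y => - f y) (- df).
Proof. by move=> ?; exact: is_deriveN. Qed.

Lemma is_derive_sub f g x v df dg :
  is_derive x v f df -> is_derive x v g dg ->
  is_derive x v (fun y => f y - g y) (df - dg).
Proof. by move=> ? ?; exact: is_deriveB. Qed.

Lemma is_derive_mul f g x v df dg :
  is_derive x v f df -> is_derive x v g dg ->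
  is_derive x v (fun y => f y * g y) (f x * dg + g x * df).
Proof. by move=> ? ?; exact: is_deriveM. Qed.

(** Only derivability of [f] in the direction [v] is available, so the chain rule is taken from the
    restriction to the line through [x], a function of one real variable, for which derivability and
    differentiability agree. *)
Lemma is_derive_comp1 f (h : R -> R) x v df dh :
  is_derive x v f df -> is_derive (f x) 1 h dh ->
  is_derive x v (fun y => h (f y)) (dh * df).
Proof.
move=> [dfx fdf] [dhx hdh].
pose k (s : R) := f (s *: v + x).
have k0 : k 0 = f x by rewrite /k scale0r add0r.
have dk : derivable k 0 1 by exact: (derivable1P _ _ _).1 dfx.
have Dk : derive1 k 0 = df.
  rewrite derive1E -fdf /derive.
  suff -> : (fun s : R => s^-1 *: (k (s *: 1 + 0) - k 0)) =
    (fun s => s^-1 *: (f (s *: v + x) - f x)) by [].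
  by apply/funext => s /=; rewrite /k addr0 scale0r add0r [_%:A]mulr1.
have dhk : derivable h (k 0) 1 by rewrite k0.
have dc : derivable (h \o k) 0 1.
  by apply/derivable1_diffP/differentiable_comp; apply/derivable1_diffP.
have Dc : derive1 (h \o k) 0 = dh * df.
  by rewrite (derive1_comp dk dhk) Dk k0 derive1E hdh.
have dhf : derivable (fun y => h (f y)) x v by exact: (derivable1P _ _ _).2 dc.
apply: DeriveDef => //.
rewrite -Dc derive1E /derive.
suff -> : (fun s : R => s^-1 *: ((h \o k) (s *: 1 + 0) - (h \o k) 0)) =
  (fun s => s^-1 *: (h (f (s *: v + x)) - h (f x))) by [].
by apply/funext => s /=; rewrite /k addr0 scale0r add0r [_%:A]mulr1.
Qed.

End DirectionalCalculus.

Section Regularity.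
Context {R : realType} {V : normedModType R} {I : Type}.
Variables (D : set V) (S : I -> set V).
Implicit Types (f g : V -> R).

(** The family [S] says on which pieces of [D] boundedness is asked. It is the one-element family
    [whole] for domains in space and the family [before] of time strips for the cylinder, where
    bounds may grow with time. *)
Definition bdcont f :=
  (forall z, D z -> {for z, continuous f}) /\
  (forall i, exists M, forall z, D z -> S i z -> `|f z| <= M).

Definition C1bd f :=
  bdcont f /\ forall v, (forall z, D z -> derivable f z v) /\ bdcont ('D_v f).

Lemma bdcont_cst c : bdcont (fun=> c).
Proof. by split=> [z _|i]; [exact: cvg_cst|exists `|c|]. Qed.

Lemma bdcontD f g : bdcont f -> bdcont g -> bdcont (fun z => f z + g z).
Proof.
move=> [cf bf] [cg bg]; split=> [z Dz|i].
  by apply: cvgD; [exact: cf|exact: cg].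
have [[M fM] [N gN]] := (bf i, bg i); exists (M + N) => z Dz Sz.
by rewrite (le_trans (ler_normD _ _))// lerD ?fM ?gN.
Qed.

Lemma bdcontN f : bdcont f -> bdcont (fun z => - f z).
Proof.
move=> [cf bf]; split=> [z Dz|i]; first by apply: cvgN; exact: cf.
by have [M fM] := bf i; exists M => z Dz Sz; rewrite normrN fM.
Qed.

Lemma bdcontB f g : bdcont f -> bdcont g -> bdcont (fun z => f z - g z).
Proof. by move=> bf bg; apply: bdcontD => //; exact: bdcontN. Qed.

Lemma bdcontM f g : bdcont f -> bdcont g -> bdcont (fun z => f z * g z).
Proof.
move=> [cf bf] [cg bg]; split=> [z Dz|i].
  by apply: cvgM; [exact: cf|exact: cg].
have [[M fM] [N gN]] := (bf i, bg i); exists (M * N) => z Dz Sz.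
by rewrite normrM ler_pM ?fM ?gN.
Qed.

Lemma continuous_bounded_itv (A : set R) (h : R -> R) M : closed A ->
  (forall y, A y -> {for y, continuous h}) ->
  exists K, forall y, A y -> `|y| <= M -> `|h y| <= K.
Proof.
move=> cA ch.
have cK : compact (A `&` `[- M, M]).
  apply: (@subclosed_compact _ _ `[- M, M]).
  - by apply: closedI => //; exact: interval_closed.
  - exact: segment_compact.
  - by move=> y [].
move/compact_near_coveringP : cK => /(_ R +oo%R
  (fun K y => `|h y| <= K)) H.
have : \forall K \near +oo%R, A `&` `[- M, M] `<=` (fun y => `|h y| <= K).
  apply: (H _) => y [Ay _].
  have hy : \forall z \near y, `|h z| < `|h y| + 1.
    move/cvgrPdist_lt : (ch y Ay) => /(_ 1 ltr01); apply: filterS => z /= hz.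
    by have := ler_normB (h y) (h y - h z); rewrite subKr; lra.
  exists ([set z | `|h z| < `|h y| + 1], [set K | `|h y| + 1 < K]).
    by split=> //=; exists (`|h y| + 1); split => //; exact: num_real.
  by move=> [z K] /= [/ltW h1 /ltW h2]; exact: le_trans h1 h2.
move=> [K [_ HK]]; exists (K + 1) => y Ay yM.
have /HK : K < K + 1 by lra.
by apply; split => //=; rewrite in_itv/= -ler_norml.
Qed.

Lemma bdcont_comp f (A : set R) (h : R -> R) : bdcont f -> closed A ->
  (forall z, D z -> A (f z)) -> (forall y, A y -> {for y, continuous h}) ->
  bdcont (fun z => h (f z)).
Proof.
move=> [cf bf] cA DA ch; split=> [z Dz|i].
  by apply: continuous_comp; [exact: cf|exact/ch/DA].
have [M fM] := bf i; have [K hK] := continuous_bounded_itv M cA ch.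
by exists K => z Dz Sz; apply: hK; [exact: DA|exact: fM].
Qed.

Lemma bdcont_eq f g : open D -> {in D, f =1 g} -> bdcont f -> bdcont g.
Proof.
move=> oD fg [cf bf]; split=> [z Dz|i].
  have := cf z Dz; rewrite /prop_for /continuous_at -(fg z (mem_set Dz)).
  apply: cvg_trans; apply: near_eq_cvg.
  by apply: filterS (open_nbhs_nbhs (conj oD Dz)) => y Dy; rewrite fg ?inE.
have [M fM] := bf i; exists M => z Dz Sz.
by rewrite -fg ?inE//; exact: fM.
Qed.

Lemma C1bd_bdcont f : C1bd f -> bdcont f. Proof. by case. Qed.

Lemma C1bd_is_derive f z v : C1bd f -> D z -> is_derive z v f ('D_v f z).
Proof. by move=> [_ /(_ v)[df _]] Dz; exact/derivableP/df. Qed.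

Lemma C1bd_derive f v : C1bd f -> bdcont ('D_v f).
Proof. by move=> [_ /(_ v)[]]. Qed.

Lemma C1bd_intro (oD : open D) f (df : V -> V -> R) : bdcont f ->
  (forall z v, D z -> is_derive z v f (df v z)) -> (forall v, bdcont (df v)) ->
  C1bd f.
Proof.
move=> bf fdf bdf; split=> // v; split=> [z Dz|]; first by case: (fdf z v Dz).
apply: (bdcont_eq oD _ (bdf v)) => z /set_mem Dz.
by case: (fdf z v Dz).
Qed.

Hypothesis oD : open D.

Lemma C1bd_cst c : C1bd (fun=> c).
Proof.
apply: (@C1bd_intro oD _ (fun _ _ => 0)) => [|v]; exact: bdcont_cst.
Qed.

Lemma C1bdD f g : C1bd f -> C1bd g -> C1bd (fun z => f z + g z).
Proof.
move=> cf cg; apply: (@C1bd_intro oD _ (fun v z => 'D_v f z + 'D_v g z)) => [|z v Dz|v].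
- by apply: bdcontD; exact: C1bd_bdcont.
- by apply: is_derive_add; exact: C1bd_is_derive.
- by apply: bdcontD; exact: C1bd_derive.
Qed.

Lemma C1bdN f : C1bd f -> C1bd (fun z => - f z).
Proof.
move=> cf; apply: (@C1bd_intro oD _ (fun v z => - 'D_v f z)) => [|z v Dz|v].
- by apply: bdcontN; exact: C1bd_bdcont.
- by apply: is_derive_opp; exact: C1bd_is_derive.
- by apply: bdcontN; exact: C1bd_derive.
Qed.

Lemma C1bdB f g : C1bd f -> C1bd g -> C1bd (fun z => f z - g z).
Proof. by move=> cf cg; apply: C1bdD => //; exact: C1bdN. Qed.

Lemma C1bdM f g : C1bd f -> C1bd g -> C1bd (fun z => f z * g z).
Proof.
move=> cf cg; apply: (@C1bd_intro oD _
  (fun v z => f z * 'D_v g z + g z * 'D_v f z)) => [|z v Dz|v].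
- by apply: bdcontM; exact: C1bd_bdcont.
- by apply: is_derive_mul; exact: C1bd_is_derive.
- by apply: bdcontD; apply: bdcontM; (exact: C1bd_derive || exact: C1bd_bdcont).
Qed.

Lemma is_derive_continuous (h : R -> R) (y dh : R) : is_derive y 1 h dh ->
  {for y, continuous h}.
Proof. by move=> [dh1 _]; apply/differentiable_continuous/derivable1_diffP. Qed.

Lemma C1bd_comp f (A : set R) (h dh : R -> R) : C1bd f -> closed A ->
  (forall z, D z -> A (f z)) -> (forall y, A y -> is_derive y 1 h (dh y)) ->
  (forall y, A y -> {for y, continuous dh}) ->
  C1bd (fun z => h (f z)).
Proof.
move=> cf cA DA hdh cdh; apply: (@C1bd_intro oD _
  (fun v z => dh (f z) * 'D_v f z)) => [|z v Dz|v].
- apply: (bdcont_comp _ cA) => //; first exact: C1bd_bdcont.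
  by move=> y Ay; exact: is_derive_continuous (hdh y Ay).
- by apply: is_derive_comp1; [exact: C1bd_is_derive|exact/hdh/DA].
- apply: bdcontM; last exact: C1bd_derive.
  by apply: (bdcont_comp _ cA) => //; exact: C1bd_bdcont.
Qed.

End Regularity.

Section CompactBounded.
Context {R : realType} {T : topologicalType}.

Lemma compact_bounded_fun (K : set T) (f : T -> R) : compact K ->
  (forall x, K x -> {for x, continuous f}) ->
  exists M, forall x, K x -> `|f x| <= M.
Proof.
move/compact_near_coveringP => /(_ R +oo%R (fun M x => `|f x| <= M)) H cf.
have : \forall M \near +oo%R, K `<=` (fun x => `|f x| <= M).
  apply: (H _) => y Ky.
  have hy : \forall z \near y, `|f z| < `|f y| + 1.
    move/cvgrPdist_lt : (cf y Ky) => /(_ 1 ltr01); apply: filterS => z /= hz.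
    by have := ler_normB (f y) (f y - f z); rewrite subKr; lra.
  exists ([set z | `|f z| < `|f y| + 1], [set M | `|f y| + 1 < M]).
    by split=> //=; exists (`|f y| + 1); split => //; exact: num_real.
  by move=> [z M] /= [/ltW h1 /ltW h2]; exact: le_trans h1 h2.
move=> [M [_ HM]]; exists (M + 1) => x Kx.
have /HM HK : M < M + 1 by lra.
exact: HK.
Qed.

End CompactBounded.

(** * Integrals over bounded open sets *)

Section Vol.
Context {R : realType}.
Local Notation E3 := 'rV[R]_3.
Local Notation TR := (measurableTypeR R).
Local Notation R3 := (TR * TR * TR)%type.

Definition whole (_ : unit) : set E3 := setT.

Definition vol (A : set E3) (f : E3 -> R) : R :=
  \int[mu3]_(q in point3 @^-1` A) f (point3 q).

Variable A : set E3.
Hypotheses (oA : open A) (bA : bounded_set A).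
Local Notation bc := (bdcont A whole).

Lemma measurable_dom : measurable (point3 @^-1` A : set R3).
Proof. exact: open_measurable_point3. Qed.

Lemma bounded_dom_lt : exists M, forall x, A x -> `|x| < M.
Proof.
have [M [_ hM]] := bA; exists (M + 2) => x Ax.
have M1 : M < M + 1 by rewrite ltrDl.
have /= := hM _ M1 x Ax; move/le_lt_trans; apply.
by rewrite ltrD2l ltr1n.
Qed.

Lemma dom_lty : (mu3 (point3 @^-1` A : set R3) < +oo)%E.
Proof.
have [M AM] := bounded_dom_lt.
apply: le_lt_trans (mu3_ball_lty M); apply: le_measure; rewrite ?inE.
- exact: measurable_dom.
- apply: open_measurable_point3.
  rewrite (_ : [set x : E3 | _] = ball (0 : E3) M); first exact: ball_open.
  by apply/seteqP; split=> x; rewrite -ball_normE/= sub0r normrN.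
- by move=> q /AM.
Qed.

Lemma bc_measurable f : (forall z, A z -> {for z, continuous f}) ->
  measurable_fun (point3 @^-1` A : set R3) (f \o point3 : R3 -> R).
Proof. by move=> cf; exact: continuous_measurable_point3. Qed.

Lemma bc_integrable f : bc f ->
  mu3.-integrable (point3 @^-1` A) (EFin \o (fun q => f (point3 q))).
Proof.
move=> [cf /(_ tt)[M fM]].
apply: (@integrable_bounded3 _ _ _ M).
- exact: measurable_dom.
- exact: dom_lty.
- exact: bc_measurable.
- by move=> q Aq; exact: fM.
Qed.

Lemma volD f g : bc f -> bc g -> vol A (fun x => f x + g x) = vol A f + vol A g.
Proof.
by move=> bf bg; apply: RintegralD; [exact: measurable_dom|exact: bc_integrable..].
Qed.

Lemma volB f g : bc f -> bc g -> vol A (fun x => f x - g x) = vol A f - vol A g.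
Proof.
by move=> bf bg; apply: RintegralB; [exact: measurable_dom|exact: bc_integrable..].
Qed.

Lemma volZ c f : bc f -> vol A (fun x => c * f x) = c * vol A f.
Proof.
by move=> bf; apply: RintegralZl; [exact: measurable_dom|exact: bc_integrable].
Qed.

Lemma volN f : bc f -> vol A (fun x => - f x) = - vol A f.
Proof.
move=> bf; rewrite -mulN1r -volZ//.
by congr (vol A _); apply/funext => x; rewrite mulN1r.
Qed.

Lemma eq_vol f g : (forall x, A x -> f x = g x) -> vol A f = vol A g.
Proof. by move=> fg; apply: eq_Rintegral => q /set_mem/= Aq; rewrite fg. Qed.

Lemma vol_le f g : bc f -> bc g -> (forall x, A x -> f x <= g x) ->
  vol A f <= vol A g.
Proof.
move=> bf bg fg; apply: le_Rintegral; [exact: measurable_dom|exact: bc_integrable..|].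
by move=> q; exact: fg.
Qed.

Lemma vol_ge0 f : (forall x, A x -> 0 <= f x) -> 0 <= vol A f.
Proof. by move=> f0; apply: Rintegral_ge0 => q; exact: f0. Qed.

Lemma vol0 : vol A (fun=> 0) = 0.
Proof. by rewrite /vol /Rintegral integral0. Qed.

Lemma vol_cst c : vol A (fun=> c) = c * vol A (fun=> 1).
Proof.
rewrite -volZ; last exact: bdcont_cst.
by congr (vol A _); apply/funext => x; rewrite mulr1.
Qed.

Lemma vol_sum (f : 'I_3 -> E3 -> R) : (forall j, bc (f j)) ->
  vol A (fun x => \sum_(j < 3) f j x) = \sum_(j < 3) vol A (f j).
Proof.
move=> bf; rewrite !big_ord_recl big_ord0 addr0 addrA -!volD//; last exact: bdcontD.
by congr (vol A _); apply/funext => x; rewrite !big_ord_recl big_ord0 addr0 addrA.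
Qed.

End Vol.

(** * Positive parts, segments and cut-offs *)

Section Calculus1.
Context {R : realType}.

Definition pos (t : R) := Num.max t 0.

Lemma pos_ge0 t : 0 <= pos t. Proof. by rewrite /pos le_max lexx orbT. Qed.
Lemma pos_id t : 0 <= t -> pos t = t. Proof. by move=> t0; apply/max_idPl. Qed.
Lemma pos_0 t : t <= 0 -> pos t = 0. Proof. by move=> t0; apply/max_idPr. Qed.

Lemma pos_continuous : continuous pos.
Proof.
move=> t; rewrite /pos; apply: (@continuous_max R _ (fun t => t) (cst 0)).
- exact: cvg_id.
- exact: cvg_cst.
Qed.

(** The exponent starts at 2 because [pos] has a corner at 0; there the power is at most the square
    of the increment, which makes the difference quotient vanish in the limit. *)
Lemma is_derive_pos n (t : R) :
  is_derive t 1 (fun s => pos s ^+ n.+2) (n.+2%:R * pos t ^+ n.+1).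
Proof.
have [t0|t0|->] := ltgtP t 0.
- rewrite pos_0 ?ltW// expr0n/= mulr0.
  apply: (@near_eq_is_derive _ _ _ (cst 0)).
  near=> s; rewrite /= pos_0 ?expr0n//; apply/ltW.
  by near: s; exact: lt_nbhsl.
- rewrite pos_id ?ltW//.
  have dX : is_derive t 1 (fun s : R => s ^+ n.+2) (n.+2%:R * t ^+ n.+1).
    apply: DeriveDef; first exact: exprn_derivable.
    by rewrite exp_derive /GRing.scale/= mulr1.
  apply: near_eq_is_derive dX; near=> s; rewrite pos_id//; apply/ltW.
  by near: s; exact: lt_nbhsr.
- rewrite pos_0// expr0n/= mulr0.
  have cv : h^-1 *: (((fun s => pos s ^+ n.+2) \o shift 0) (h *: 1) - pos 0 ^+ n.+2)
      @[h --> 0^'] --> (0 : R).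
    apply/cvgrPdist_lt => e e0; near=> h.
    rewrite /= addr0 [_%:A]mulr1 (pos_0 (lexx 0)) expr0n/= subr0 sub0r normrN.
    have h0 : h != 0 by near: h; exact: nbhs_dnbhs_neq.
    have he : `|h| < e by near: h; exact: dnbhs0_lt.
    have h1 : `|h| < 1 by near: h; exact: dnbhs0_lt.
    have ph : pos h <= `|h| by rewrite /pos ge_max ler_norm normr_ge0.
    rewrite /GRing.scale/= normrM normfV mulrC ltr_pdivrMr ?normr_gt0//.
    rewrite ger0_norm ?exprn_ge0 ?pos_ge0//.
    apply: (@le_lt_trans _ _ (`|h| * `|h|)).
      rewrite !exprS mulrA -[leRHS]mulr1 ler_pM ?mulr_ge0 ?pos_ge0 ?exprn_ge0 ?pos_ge0//.
        by rewrite ler_pM ?pos_ge0.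
      by rewrite exprn_ile1 ?pos_ge0// (le_trans ph)// ltW.
    by rewrite ltr_pM2r// normr_gt0.
  by apply: DeriveDef; [apply/cvg_ex; exists 0|apply/cvg_lim].
Unshelve. all: by end_near. Qed.

Lemma continuous_posX n : continuous (fun t => pos t ^+ n).
Proof.
move=> t; apply: (@continuous_comp _ _ _ pos (fun t => t ^+ n)).
  exact: pos_continuous.
exact: exprn_continuous.
Qed.

Lemma is_derive_coord (x v : 'rV[R]_3) k : is_derive x v (fun y : 'rV[R]_3 => y 0 k) (v 0 k).
Proof.
have dx : differentiable (fun y : 'rV[R]_3 => y 0 k) x by exact: differentiable_coord.
apply: DeriveDef; first exact: diff_derivable.
rewrite /derive; apply: cvg_lim => //.
have -> : (fun h : R => h^-1 *: (((fun y : 'rV[R]_3 => y 0 k) \o shift x) (h *: v) - x 0 k))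
  = (fun h => h^-1 *: (h * v 0 k)).
  by apply/funext => h /=; rewrite !mxE addrK.
apply: (@cvg_trans _ (cst (v 0 k) @ (0:R)^')); last exact: cvg_cst.
apply: near_eq_cvg; near=> h.
have h0 : h != 0 by near: h; exact: nbhs_dnbhs_neq.
by rewrite /GRing.scale/= mulKf.
Unshelve. all: by end_near. Qed.

End Calculus1.

Section LineDerivative.
Context {R : realType} {V : normedModType R}.

Lemma is_derive_line (f : V -> R) (x v : V) (s d : R) :
  is_derive (s *: v + x) v f d -> is_derive s 1 (fun r => f (r *: v + x)) d.
Proof.
move=> [df Df].
have E : (fun h : R => h^-1 *: (((fun r => f (r *: v + x)) \o shift s) (h *: 1) -
      f (s *: v + x)))
  = (fun h => h^-1 *: ((f \o shift (s *: v + x)) (h *: v) - f (s *: v + x))).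
  by apply/funext => h /=; rewrite [_%:A]mulr1 scalerDl addrA.
apply: DeriveDef; first by rewrite /derivable E.
by rewrite /derive E.
Qed.

Lemma derive_line_bound (f : V -> R) (x v : V) (a b L : R) : a <= b ->
  (forall s, a <= s <= b -> derivable f (s *: v + x) v) ->
  (forall s, a <= s <= b -> `|'D_v f (s *: v + x)| <= L) ->
  `|f (b *: v + x) - f (a *: v + x)| <= L * (b - a).
Proof.
move=> ab df fL.
pose k r := f (r *: v + x).
have dk s : s \in `[a, b] -> is_derive s 1 k ('D_v f (s *: v + x)).
  by rewrite in_itv/= => sab; apply/is_derive_line/derivableP/df.
have ck : {within `[a, b], continuous k}.
  apply: derivable_within_continuous => s sab.
  by have [] := dk s sab.
have dk' (s : R) : s \in `]a, b[ -> is_derive s 1 k ('D_v f (s *: v + x)).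
  by move=> /subset_itv_oo_cc; exact: dk.
have [c cab E] := MVT_segment ab dk' ck.
rewrite -[f (b *: v + x)]/(k b) -[f (a *: v + x)]/(k a) E.
rewrite normrM (ger0_norm (x := b - a)) ?subr_ge0//.
by rewrite ler_wpM2r ?subr_ge0// fL// -in_itv.
Qed.

End LineDerivative.

Lemma continuous_near0 (R : realType) (T : topologicalType) (g : T -> R) (x : T) :
  (\forall y \near x, g y = 0) -> {for x, continuous g}.
Proof.
move=> g0; have gx : g x = 0 by exact: (nbhs_singleton g0).
apply/cvgrPdist_lt => e e0; near=> y.
have -> : g y = 0 by near: y; exact: g0.
by rewrite gx subrr normr0.
Unshelve. all: by end_near. Qed.

Section CompactSupport.
Context {R : realType}.
Local Notation E3 := 'rV[R]_3.
Local Notation TR := (measurableTypeR R).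
Local Notation R3 := (TR * TR * TR)%type.

(** The complement of [K] is open and [f] is locally zero on it; together with [B] it covers the
    whole space. *)
Lemma C1bd_glue (f : E3 -> R) (B K : set E3) : open B -> closed K -> K `<=` B ->
  (forall x, ~ K x -> f x = 0) -> C1bd B (@whole R) f -> C1bd setT (@whole R) f.
Proof.
move=> oB cK KB f0 [[cf bf] df].
have nearK x : ~ K x -> \forall y \near x, f y = 0.
  move=> nK; have : nbhs x (~` K) by apply: open_nbhs_nbhs; split=> //; exact: closed_openC.
  by apply: filterS => y; exact: f0.
have dK x v : ~ K x -> is_derive x v f 0.
  move=> nK; have := nearK x nK => h.
  have h' : \near x, cst 0 x = f x by near=> y; apply/esym; near: y; exact: h.
  exact: near_eq_is_derive h' (is_derive_cst _ _ _).
split; [split|move=> v; split; [|split]].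
- move=> x _; have [Kx|nK] := pselect (K x); first by apply/cf/KB.
  exact/continuous_near0/nearK.
- move=> i; have [M fM] := bf i; exists (Num.max M 0) => x _ _.
  have [Kx|nK] := pselect (K x); last by rewrite f0// normr0 le_max lexx orbT.
  by rewrite le_max fM//; exact: KB.
- move=> x _; have [Kx|nK] := pselect (K x); first by apply/(df v).1/KB.
  by have [] := dK x v nK.
- move=> x _; have [Kx|nK] := pselect (K x); first by apply/(df v).2.1/KB.
  apply: continuous_near0.
  have : nbhs x (~` K) by apply: open_nbhs_nbhs; split=> //; exact: closed_openC.
  by apply: filterS => y /= nKy; have [_ ->] := dK y v nKy.
- move=> i; have [M fM] := (df v).2.2 i; exists (Num.max M 0) => x _ _.
  have [Kx|nK] := pselect (K x).
    by rewrite le_max fM//; exact: KB.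
  by have [_ ->] := dK x v nK; rewrite normr0 le_max lexx orbT.
Unshelve. all: by end_near. Qed.

Definition box (M : R) : set E3 := [set x | `|x| < M].

Lemma open_box M : open (box M).
Proof.
rewrite (_ : box M = ball (0 : E3) M); first exact: ball_open.
by apply/seteqP; split=> x; rewrite -ball_normE/= sub0r normrN.
Qed.

Lemma bounded_box M : bounded_set (box M).
Proof. by exists M; split; [exact: num_real|move=> N MN x /ltW/le_trans]; apply; exact: ltW. Qed.

(** The margin 1 in the support condition forces the derivative to vanish off the box, so the
    integral over the box is the integral over the whole space. *)
Lemma vol_box_derive0 (f : E3 -> R) (M : R) j : C1bd setT (@whole R) f ->
  (forall x, M - 1 <= `|x| -> f x = 0) -> vol (box M) ('D_(ebasis j) f) = 0.
Proof.
move=> cf fM.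
have [[ctf /(_ tt)[B fB]] /(_ (ebasis j))[df [cdf /(_ tt)[L dfL]]]] := cf.
have out x : M <= `|x| -> 'D_(ebasis j) f x = 0.
  move=> Mx.
  have : \near x, cst 0 x = f x.
    have : nbhs x [set y : E3 | `|y - x| < 1].
      apply/nbhs_ballP; exists 1 => //= y; rewrite -ball_normE/=.
      by rewrite distrC.
    apply: filterS => y /= yx; rewrite fM//.
    by have := ler_normB x (x - y); rewrite subKr [`|x - y|]distrC;
      have := ler_normD y (x - y); rewrite addrC subrK [`|x - y|]distrC; lra.
  by move/(near_eq_derive (ebasis j)) => <-; rewrite derive_cst.
have -> : vol (box M) ('D_(ebasis j) f) =
    \int[mu3]_q ('D_(ebasis j) f) (point3 q).
  rewrite /vol Rintegral_mkcond; apply: eq_Rintegral => q _; rewrite patchE.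
  case: ifPn => //; rewrite notin_setE/= => /negP; rewrite -leNgt => /out.
  by move=> ->.
apply: (@integral_derive_eq0 _ f ('D_(ebasis j) f) j L M B set0) => //.
- by have := @bc_measurable _ setT openT f ctf; rewrite preimage_setT.
- by have := @bc_measurable _ setT openT _ cdf; rewrite preimage_setT.
- by move=> x Mx; apply: fM; lra.
- by move=> x; exact: fB.
- move=> x h.
  have [h0|h0] := leP 0 h.
    rewrite (ger0_norm h0).
    have := @derive_line_bound _ _ f x (ebasis j) 0 h L h0
      (fun s _ => df _ I) (fun s _ => dfL _ I I).
    by rewrite scale0r add0r subr0.
  rewrite (ltr0_norm h0) distrC.
  have := @derive_line_bound _ _ f x (ebasis j) h 0 L (ltW h0)
      (fun s _ => df _ I) (fun s _ => dfL _ I I).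
  by rewrite scale0r add0r sub0r.
- by move=> q _; exact: derivableP (df _ I).
Qed.

End CompactSupport.

Section Cutoff.
Context {R : realType}.
Local Notation E3 := 'rV[R]_3.

Lemma C1bd_pos (V : normedModType R) (I : Type) (D : set V) (S : I -> set V) n
    (f : V -> R) : open D -> C1bd D S f -> C1bd D S (fun z => pos (f z) ^+ n.+2).
Proof.
move=> oD cf; apply: (@C1bd_comp _ _ _ _ _ oD f setT (fun t => pos t ^+ n.+2)
  (fun t => n.+2%:R * pos t ^+ n.+1)) => //.
- by move=> y _; exact: is_derive_pos.
- move=> y _; apply: cvgM; first exact: cvg_cst.
  exact: continuous_posX.
Qed.

Lemma C1bd_X (V : normedModType R) (I : Type) (D : set V) (S : I -> set V) n
    (f : V -> R) : open D -> C1bd D S f -> C1bd D S (fun z => f z ^+ n).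
Proof.
move=> oD cf; elim: n => [|n IH].
  by rewrite (_ : (fun z => _) = fun=> 1); [exact: C1bd_cst|apply/funext].
rewrite (_ : (fun z => _) = fun z => f z * f z ^+ n); first exact: C1bdM.
by apply/funext => z; rewrite exprS.
Qed.

(** A C^1 transition from 0, for [t <= 0], to 1, for [1 <= t], built from squares of [pos] so that
    [is_derive_pos] covers it. *)
Definition step (t : R) := 1 - pos (1 - pos t ^+ 2) ^+ 2.

Lemma step_range t : 0 <= step t <= 1.
Proof.
rewrite /step; set p := pos (1 - _).
have p0 : 0 <= p by exact: pos_ge0.
have p1 : p <= 1.
  by rewrite /p {1}/pos ge_max ler01 andbT gerBl sqr_ge0.
have : p ^+ 2 <= 1 by rewrite expr_le1.
have := sqr_ge0 p; lra.
Qed.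

Lemma step1 t : 1 <= t -> step t = 1.
Proof.
move=> t1; rewrite /step (@pos_id _ t); last lra.
rewrite pos_0 ?expr0n ?subr0// subr_le0.
by rewrite exprn_ege1.
Qed.

Lemma step0 t : t <= 0 -> step t = 0.
Proof. by move=> t0; rewrite /step (pos_0 t0) expr0n subr0 pos_id// expr1n subrr. Qed.

Lemma C1bd_step (V : normedModType R) (I : Type) (D : set V) (S : I -> set V)
    (f : V -> R) : open D -> C1bd D S f -> C1bd D S (fun z => step (f z)).
Proof.
move=> oD cf; apply: C1bdB => //; first exact: C1bd_cst.
apply: C1bd_pos => //; apply: C1bdB => //; first exact: C1bd_cst.
exact: C1bd_pos.
Qed.

Lemma C1bd_coord k (B : set E3) : open B -> bounded_set B ->
  C1bd B (@whole R) (fun x => x 0 k).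
Proof.
move=> oB bB; apply: (@C1bd_intro _ _ _ _ _ oB _ (fun v _ => v 0 k)).
- split=> [x _|i]; first exact: coord_continuous.
  have [M BM] := bounded_dom_lt bB; exists M => x Bx _.
  by rewrite (le_trans (le_norm3 _ _))// ltW// BM.
- by move=> x v _; exact: is_derive_coord.
- by move=> v; exact: bdcont_cst.
Qed.

(** The norm of [E3] is the maximum norm, which is not differentiable; the cut-offs are radial for
    the Euclidean distance instead. *)
Definition sqdist (y x : E3) : R := \sum_(k < 3) (x 0 k - y 0 k) ^+ 2.

Lemma C1bd_sum (V : normedModType R) (I : Type) (D : set V) (S : I -> set V)
    (f : 'I_3 -> V -> R) : open D -> (forall j, C1bd D S (f j)) ->
  C1bd D S (fun x => \sum_(j < 3) f j x).
Proof.
move=> oD bf.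
rewrite (_ : (fun x => _) = (fun x => f ord0 x + f (lift ord0 ord0) x +
    f (lift ord0 (lift ord0 ord0)) x)); last first.
  by apply/funext => x; rewrite !big_ord_recl big_ord0 addr0 addrA.
by apply: C1bdD => //; exact: C1bdD.
Qed.

Lemma C1bd_sqdist y (B : set E3) : open B -> bounded_set B ->
  C1bd B (@whole R) (sqdist y).
Proof.
move=> oB bB; apply: C1bd_sum => // k; apply: C1bd_X => //; apply: C1bdB => //.
  exact: C1bd_coord.
exact: C1bd_cst.
Qed.

Lemma sqdist_norm y x r : 0 <= r -> sqdist y x <= r ^+ 2 -> `|x - y| <= r.
Proof.
move=> r0 h; apply: norm3_le => // k; rewrite !mxE.
rewrite -(ler_pXn2r (n := 2)) ?nnegrE// real_normK ?num_real//.
apply: le_trans h; rewrite /sqdist (bigD1 k)//= lerDl.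
by apply: sumr_ge0 => i _; exact: sqr_ge0.
Qed.

Lemma sqdist_continuous y : continuous (sqdist y).
Proof.
move=> x.
have [] := @C1bd_sqdist y (box (`|x| + 1)) (@open_box R _) (@bounded_box R _).
move=> [cf _] _; apply: cf.
by rewrite /box/= ltrDl.
Qed.

End Cutoff.

(** * Boundary layers *)

Section Layer.
Context {R : realType}.
Local Notation E3 := 'rV[R]_3.
Local Notation whole := (@whole R).
Variables (Om : set E3) (M : R).
Hypotheses (oOm : open Om) (smOm : smooth_boundary Om).
Hypothesis OmM : forall x, closure Om x -> `|x| <= M - 2.

(** A cut-off of width [d] near the part of the boundary lying in [A]. Closeness to the boundary is
    recorded by integrals, volume O(d) and squared gradient O(1/d), instead of by a distance
    function; [C] is to be the same for every [d]. *)
Record layer (A : set E3) (C d : R) (chi : E3 -> R) : Prop := Layer {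
  layer_C1 : C1bd setT whole chi;
  layer_range : forall x, 0 <= chi x <= 1;
  layer_bdry : forall x, boundary Om x -> A x -> chi x = 1;
  layer_grad : forall j x, `|'D_(ebasis j) chi x| <= C / d;
  layer_vol : vol (box M) chi <= C * d;
  layer_vol_grad : forall j, vol (box M) (fun x => 'D_(ebasis j) chi x ^+ 2) <= C / d }.

Definition layered (A : set E3) := exists C, forall d, 0 < d <= 1 ->
  exists chi, layer A C d chi.

Let oB := @open_box R M.
Let bB := @bounded_box R M.

Lemma bc_box f : bdcont setT whole f -> bdcont (box M) whole f.
Proof.
move=> [cf bf]; split=> [x _|i]; first exact: cf.
by have [K fK] := bf i; exists K => x _ _; exact: fK.
Qed.

Lemma layered_set0 : layered set0.
Proof.
exists 0 => d /andP[d0 _]; exists (fun=> 0).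
have D0 j x : 'D_(ebasis j) (fun=> 0 : R) x = 0 by exact: derive_cst.
split => //.
- by apply: C1bd_cst; exact: openT.
- by move=> x; rewrite lexx ler01.
- by move=> j x; rewrite D0 normr0 mul0r.
- by rewrite vol0 mul0r.
- move=> j; rewrite mul0r (_ : (fun x => _) = fun=> 0) ?vol0//.
  by apply/funext => x; rewrite D0 expr0n.
Qed.

(** The two cut-offs are merged into [1 - (1 - chi1) * (1 - chi2)], which stays between 0 and 1,
    equals 1 wherever one of them does, and whose gradient is at most the sum of theirs. *)
Lemma layeredU A1 A2 : layered A1 -> layered A2 -> layered (A1 `|` A2).
Proof.
move=> [C1 H1] [C2 H2]; exists (2 * (C1 + C2)) => d d01.
have [[chi1 L1] [chi2 L2]] := (H1 d d01, H2 d d01).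
have d0 : 0 < d by case/andP: d01.
have [c1 r1 b1 g1 v1 w1] := L1; have [c2 r2 b2 g2 v2 w2] := L2.
pose chi x := chi1 x + chi2 x - chi1 x * chi2 x.
have Dchi j x : 'D_(ebasis j) chi x =
    (1 - chi2 x) * 'D_(ebasis j) chi1 x + (1 - chi1 x) * 'D_(ebasis j) chi2 x.
  have e1 := C1bd_is_derive (ebasis j) c1 (I : setT x).
  have e2 := C1bd_is_derive (ebasis j) c2 (I : setT x).
  have [_ ->] := is_derive_sub (is_derive_add e1 e2) (is_derive_mul e1 e2).
  ring.
have cchi : C1bd setT whole chi.
  by apply: C1bdB; [exact: openT|apply: C1bdD|apply: C1bdM] => //; exact: openT.
have C10 : 0 <= C1 / d by exact: le_trans (normr_ge0 _) (g1 0 0).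
have C20 : 0 <= C2 / d by exact: le_trans (normr_ge0 _) (g2 0 0).
have C1d : 0 <= C1 * d.
  by apply: le_trans v1; apply: vol_ge0 => x _; case/andP: (r1 x).
have C2d : 0 <= C2 * d.
  by apply: le_trans v2; apply: vol_ge0 => x _; case/andP: (r2 x).
have bc1 := bc_box (C1bd_bdcont c1); have bc2 := bc_box (C1bd_bdcont c2).
exists chi; split => //.
- move=> x; rewrite /chi; case/andP: (r1 x); case/andP: (r2 x) => *; nra.
- by move=> x bx [Ax|Ax]; rewrite /chi ?(b1 x bx Ax) ?(b2 x bx Ax); ring.
- move=> j x; rewrite Dchi (le_trans (ler_normD _ _))// !normrM.
  have := g1 j x; have := g2 j x.
  have h1 : `|1 - chi1 x| <= 1 by rewrite ler_norml; case/andP: (r1 x) => *; lra.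
  have h2 : `|1 - chi2 x| <= 1 by rewrite ler_norml; case/andP: (r2 x) => *; lra.
  have := ler_wpM2r (normr_ge0 ('D_(ebasis j) chi1 x)) h2.
  have := ler_wpM2r (normr_ge0 ('D_(ebasis j) chi2 x)) h1.
  rewrite !mul1r -mulrA mulrDl; lra.
- apply: (@le_trans _ _ (vol (box M) (fun x => chi1 x + chi2 x))).
    apply: vol_le => //; first by apply/bc_box/C1bd_bdcont.
      exact: bdcontD.
    by move=> x _; rewrite /chi gerBl mulr_ge0//; [case/andP: (r1 x)|case/andP: (r2 x)].
  rewrite (volD oB bB bc1 bc2) -mulrA mulrDl.
  move: v1 v2; move: (vol _ chi1) (vol _ chi2) => a b *; lra.
- move=> j.
  have bd1 := bc_box (C1bd_derive (ebasis j) c1).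
  have bd2 := bc_box (C1bd_derive (ebasis j) c2).
  have sq f : bdcont (box M) whole f -> bdcont (box M) whole (fun x => f x ^+ 2).
    by move=> bf; under eq_fun do rewrite expr2; exact: bdcontM.
  apply: (@le_trans _ _ (vol (box M) (fun x => 2 * ('D_(ebasis j) chi1 x) ^+ 2 +
      2 * ('D_(ebasis j) chi2 x) ^+ 2))).
    apply: vol_le => //.
    + by apply: sq; apply/bc_box/C1bd_derive.
    + by apply: bdcontD; apply: bdcontM; (exact: bdcont_cst || exact: sq).
    + move=> x _; rewrite Dchi.
      set p := 'D_(_) _ _; set q := 'D_(_) _ _.
      have s1 : (1 - chi1 x) ^+ 2 <= 1 by case/andP: (r1 x) => *; nra.
      have s2 : (1 - chi2 x) ^+ 2 <= 1 by case/andP: (r2 x) => *; nra.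
      have t1 := ler_wpM2r (sqr_ge0 p) s2.
      have t2 := ler_wpM2r (sqr_ge0 q) s1.
      have t3 := sqr_ge0 ((1 - chi2 x) * p - (1 - chi1 x) * q).
      lra.
  have b1' : bdcont (box M) whole (fun x => 2 * 'D_(ebasis j) chi1 x ^+ 2).
    by apply: bdcontM; [exact: bdcont_cst|exact: sq].
  have b2' : bdcont (box M) whole (fun x => 2 * 'D_(ebasis j) chi2 x ^+ 2).
    by apply: bdcontM; [exact: bdcont_cst|exact: sq].
  rewrite (volD oB bB b1' b2') (volZ oB bB 2 (sq _ bd1)) (volZ oB bB 2 (sq _ bd2)).
  by rewrite -mulrDr -mulrA ler_wpM2l// mulrDl lerD.
Qed.

Lemma layered_sub A1 A2 : A1 `<=` A2 -> layered A2 -> layered A1.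
Proof.
move=> A12 [C H]; exists C => d /H[chi [c r b g v w]]; exists chi; split => //.
by move=> x bx /A12; exact: b.
Qed.

Lemma compact_boundary : compact (boundary Om).
Proof.
apply: bounded_closed_compact.
  exists M; split; first exact: num_real.
  move=> N MN x [cx _]; apply: le_trans (OmM cx) _.
  by rewrite ler_wnDr ?ltW// oppr_le0.
apply: closedI; first exact: closed_closure.
by apply: open_closedC; exact: open_interior.
Qed.

(** By compactness finitely many patches cover the boundary, and [layeredU] merges them one after
    the other. *)
Lemma layered_boundary :
  (forall y, boundary Om y -> exists2 N, open_nbhs y N & layered N) ->
  layered (boundary Om).
Proof.
move=> loc.
have /choice[N HN] : forall y, exists N : set E3,
    boundary Om y -> open_nbhs y N /\ layered N.
  move=> y; have [/loc[N oN lN]|nb] := pselect (boundary Om y); first by exists N.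
  by exists set0.
have := compact_boundary; rewrite compact_cover.
move=> /(_ _ (boundary Om) N)[||s sD cov].
- by move=> y /HN[[]].
- by move=> y by_; exists y => //; have [[_]] := HN y by_.
apply: layered_sub cov _.
have : forall y, y \in finmap.enum_fset s -> boundary Om y.
  by move=> y ys; apply/set_mem/sD.
rewrite (_ : cover _ _ = \bigcup_(y in [set` finmap.enum_fset s]) N y)//.
elim: (finmap.enum_fset s) => [|y l IH] hl.
  by apply: layered_sub layered_set0 => x [].
apply: (@layered_sub _ (N y `|` \bigcup_(y in [set` l]) N y)).
  move=> x [z /=]; rewrite inE => /orP[/eqP ->|zl] Nx; first by left.
  by right; exists z.
apply: layeredU; first by have [] := HN y (hl y (mem_head _ _)).
by apply: IH => z zl; apply: hl; rewrite inE zl orbT.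
Qed.

End Layer.

Lemma continuous_near_eq (T : topologicalType) (R : realType) (f g : T -> R) (x : T) :
  (\forall y \near x, f y = g y) -> {for x, continuous f} -> {for x, continuous g}.
Proof.
move=> fg cf; rewrite /prop_for /continuous_at -(nbhs_singleton fg).
by apply: cvg_trans cf; exact: near_eq_cvg.
Qed.

Section Patch.
Context {R : realType}.
Local Notation E3 := 'rV[R]_3.
Local Notation whole := (@whole R).
Variables (Om : set E3) (M : R).
Hypotheses (oOm : open Om) (smOm : smooth_boundary Om).
Hypothesis OmM : forall x, closure Om x -> `|x| <= M - 2.

Lemma Cn_on_continuous (U : set E3) (g : E3 -> R) n x : Cn_on n U g -> U x ->
  {for x, continuous g}.
Proof. by case: n => [|n] [cg _]; exact: cg. Qed.

Lemma Cn_on_opp (U : set E3) (g : E3 -> R) : open U ->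
  Cn_on 1 U g -> Cn_on 1 U (fun x => - g x).
Proof.
move=> oU [cg dg]; split=> [x Ux|v]; first (have c : {for x, continuous g} := cg x Ux; exact: (cvgN c)).
have [dgv [cdg _]] := dg v.
split=> [x Ux|]; first by apply: derivableN; exact: dgv.
split=> [x Ux|//].
have c : {for x, continuous (fun y => - 'D_v g y)}.
  by have c : {for x, continuous ('D_v g)} := cdg x Ux; exact: (cvgN c).
apply: continuous_near_eq c; have : nbhs x U by apply: open_nbhs_nbhs.
by apply: filterS => y Uy; rewrite deriveN//; exact: dgv.
Qed.

(** On the boundary [g > 0] would keep nearby points out of the domain and [g < 0] would put the
    point itself into it, hence [g = 0]. Some component of the gradient is nonzero; replacing [g] by
    its opposite makes it positive, at the price of forgetting on which side the domain lies. Only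
    the zero set is retained. *)
Lemma boundary_chart y : boundary Om y -> exists (U : set E3) (g : E3 -> R) j,
  [/\ open_nbhs y U, Cn_on 1 U g, 0 < 'D_(ebasis j) g y &
      forall x, boundary Om x -> U x -> g x = 0].
Proof.
move=> bdy; have [U [g [[oU Uy] cg dg OmU]]] := smOm bdy.
have g0 x : boundary Om x -> U x -> g x = 0.
  move=> [cx /=]; rewrite ((interior_id Om).1 oOm) => nOx Ux.
  have gx := Cn_on_continuous (cg 0%N) Ux.
  apply/eqP; rewrite eq_le; apply/andP; split; rewrite leNgt; apply/negP => gx0.
    have : nbhs x (g @^-1` [set r | 0 < r] `&` U).
      apply: filterI; last exact: open_nbhs_nbhs.
      by apply: gx; exact: lt_nbhsr.
    move/cx => [z [Oz [/= gz Uz]]].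
    have : (Om `&` U) z by [].
    by rewrite OmU => -[/= ]; rewrite ltNge (ltW gz).
  have : (Om `&` U) x by rewrite OmU.
  by case.
have [j dj] : exists j, 'D_(ebasis j) g y != 0.
  have := dg y Uy; apply: contra_neqP => nj; apply/rowP => j; rewrite !mxE.
  by apply/eqP/negPn/negP => h; apply: nj; exists j.
have [dpos|dneg|d0] := ltgtP 0 ('D_(ebasis j) g y).
- by exists U, g, j; split.
- exists U, (fun x => - g x), j; split => //; first exact: Cn_on_opp.
  + have [_ /(_ (ebasis j))[dgj _]] := cg 1%N.
    by rewrite (deriveN (dgj y Uy)) oppr_gt0.
  + by move=> x bx Ux; rewrite g0// oppr0.
- by rewrite -d0 eqxx in dj.
Qed.

(* [X d s] is the derivative of [d * atan (s / d)] *)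
Definition X (d s : R) : R := (1 + (s / d) ^+ 2)^-1.

Lemma X_pos (d s : R) : 0 < 1 + (s / d) ^+ 2.
Proof. by have := sqr_ge0 (s / d); lra. Qed.

Lemma X_range (d s : R) : 0 <= X d s <= 1.
Proof.
rewrite invr_ge0 ltW ?X_pos//= invf_le1 ?X_pos//.
by rewrite lerDl sqr_ge0.
Qed.

Lemma is_derive_X (d s : R) :
  is_derive s 1 (X d) (- (2 * (s / d) / d) * X d s ^+ 2).
Proof.
have h : is_derive s 1 (fun s : R => s / d) d^-1.
  have := @is_derive_mul _ _ id (fun=> d^-1) s 1 1 0 (is_derive_id _ _) (is_derive_cst _ _ _).
  by rewrite mulr0 add0r mulr1.
have h2 := is_derive_add (is_derive_cst (1 : R) s 1) (is_derive_mul h h).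
pose k (s : R) := 1 + s / d * (s / d).
have kE : k = (fun s => 1 + (s / d) ^+ 2) by apply/funext => r; rewrite /k expr2.
have k0 : k s != 0 by rewrite kE gt_eqF// X_pos.
have [dk Dk] := h2.
have XE r : X d r = (k r)^-1 by rewrite kE.
have -> : X d = (fun s => (k s)^-1) by apply/funext.
apply: DeriveDef; first by apply: derivableV => //.
rewrite deriveV// Dk /GRing.scale/= -exprVn.
by move: (k s)^-1 => i; ring.
Qed.

Lemma C1bd_Xf (D : set E3) (g : E3 -> R) d : open D -> C1bd D whole g ->
  C1bd D whole (fun x => X d (g x)).
Proof.
move=> oD cg; apply: (@C1bd_comp _ _ _ _ _ oD g setT (X d)
  (fun s => - (2 * (s / d) / d) * X d s ^+ 2)) => //.
- by move=> s _; exact: is_derive_X.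
- move=> s _.
  have cX := is_derive_continuous (is_derive_X d s).
  apply: cvgM; last by rewrite /prop_for /continuous_at; apply: cvgM.
  apply: cvgN; apply: cvgM; last exact: cvg_cst.
  apply: cvgM; first exact: cvg_cst.
  by apply: cvgM; [exact: cvg_id|exact: cvg_cst].
Qed.

Lemma is_derive_atand (d s : R) : d != 0 ->
  is_derive s 1 (fun s : R => d * atan (s / d)) (X d s).
Proof.
move=> d0.
have h : is_derive s 1 (fun s : R => s / d) d^-1.
  have := @is_derive_mul _ _ id (fun=> d^-1) s 1 1 0 (is_derive_id _ _) (is_derive_cst _ _ _).
  by rewrite mulr0 add0r mulr1.
have h2 := is_derive_comp1 h (is_derive1_atan (s / d)).
have := is_derive_mul (is_derive_cst d s 1) h2.
rewrite mulr0 addr0 mulrCA mulfV// mulr1; exact.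
Qed.

Lemma C1bd_atand (D : set E3) (g : E3 -> R) d : d != 0 -> open D -> C1bd D whole g ->
  C1bd D whole (fun x => d * atan (g x / d)).
Proof.
move=> d0 oD cg; apply: (@C1bd_comp _ _ _ _ _ oD g setT (fun s => d * atan (s / d))
  (X d)) => //.
- by move=> s _; exact: is_derive_atand.
- by move=> s _; exact: is_derive_continuous (is_derive_X d s).
Qed.

Lemma C1bd_compact (K B U : set E3) (g : E3 -> R) : compact K -> B `<=` K ->
  K `<=` U -> Cn_on 1 U g -> C1bd B whole g.
Proof.
move=> cK BK KU [cg dg].
have [G gG] := compact_bounded_fun cK (fun x Kx => cg x (KU x Kx)).
split=> [|v].
  by split=> [x Bx|i]; [exact/cg/KU/BK|exists G => x Bx _; exact/gG/BK].
have [dgv [cdg _]] := dg v.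
have [L dL] := compact_bounded_fun cK (fun x Kx => cdg x (KU x Kx)).
split=> [x Bx|]; first exact/dgv/KU/BK.
by split=> [x Bx|i]; [exact/cdg/KU/BK|exists L => x Bx _; exact/dL/BK].
Qed.

Lemma patch_cutoff y (r : R) : 0 < r -> exists kap : E3 -> R,
  [/\ C1bd setT whole kap, forall x, 0 <= kap x <= 1,
      exists2 N, open_nbhs y N & forall x, N x -> kap x = 1 &
      forall x, r / 2 < `|x - y| -> kap x = 0].
Proof.
move=> r0.
(* With this [a] the cut-off is 1 where [sqdist] is below [a] and 0 once it exceeds [2 * a], the
   square of [r / 2]. *)
pose a := r ^+ 2 / 8.
have a0 : 0 < a by rewrite divr_gt0 ?exprn_gt0.
pose kap x := step (2 - sqdist y x / a).
have kap0 x : r / 2 < `|x - y| -> kap x = 0.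
  move=> xy; apply: step0; rewrite subr_le0 ler_pdivlMr// leNgt; apply/negP => h.
  have : `|x - y| <= r / 2.
    apply: sqdist_norm; first by rewrite divr_ge0// ltW.
    by apply/ltW/(lt_le_trans h); rewrite /a expr_div_n; lra.
  by rewrite leNgt xy.
have cb (B : set E3) : open B -> bounded_set B -> C1bd B whole kap.
  move=> oB bB; apply: C1bd_step => //; apply: C1bdB => //; first exact: C1bd_cst.
  by apply: C1bdM => //; [exact: C1bd_sqdist|exact: C1bd_cst].
exists kap; split => //.
- pose K := [set x : E3 | `|x - y| <= r / 2].
  pose B := box (`|y| + r).
  apply: (@C1bd_glue _ kap B K).
  + exact: open_box.
  + rewrite (_ : K = closed_ball y (r / 2)); first exact: closed_ball_closed.
    rewrite closed_ballE ?divr_gt0//; apply/seteqP; split=> x;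
      by rewrite /K /closed_ball_/= distrC.
  + move=> x; rewrite /K /B /box/= => h.
    have := ler_normD (x - y) y; rewrite subrK; lra.
  + by move=> x; rewrite /K/= => /negP; rewrite -ltNge; exact: kap0.
  + by apply: cb; [exact: open_box|exact: bounded_box].
- by move=> x; exact: step_range.
- exists [set x | sqdist y x < a].
    split; last first.
      by rewrite /= /sqdist big1 // => k _; rewrite subrr expr0n.
    apply: (@open_comp _ _ (sqdist y) [set s | s < a]); last exact: open_lt.
    by move=> x _; exact: sqdist_continuous.
  move=> x /= xa; apply: step1.
  by rewrite lerBrDl -lerBrDr ler_pdivrMr//; lra.
Qed.

End Patch.

Section LayerPatch.
Context {R : realType}.
Local Notation E3 := 'rV[R]_3.
Local Notation whole := (@whole R).
Variables (Om : set E3) (M : R).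
Hypotheses (oOm : open Om) (smOm : smooth_boundary Om).
Hypothesis OmM : forall x, closure Om x -> `|x| <= M - 2.

Lemma closed_ball_norm (y : E3) (r : R) : 0 < r ->
  [set x : E3 | `|x - y| <= r] = closed_ball y r.
Proof.
move=> r0; rewrite closed_ballE//; apply/seteqP; split=> x;
  by rewrite /closed_ball_/= distrC.
Qed.

(** The layer is the Lorentzian profile [X d] of the chart, cut off by [kap]. Its volume is
    estimated without any change of variables: [g] increases along the axis [j] at a rate above [m],
    so [m * chi] is at most the derivative along [j] of [kap * (d * atan (g / d))] plus an error
    O(d) from the derivative of [kap]. The derivative integrates to 0, and the primitive is bounded
    by [2 * d] because pi/2 is less than 2. *)
Lemma layer_patch y : boundary Om y ->
  exists2 N, open_nbhs y N & layered Om M N.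
Proof.
move=> bdy; have [U [g [j [[oU Uy] cg dg0 g0]]]] := boundary_chart oOm smOm bdy.
pose m := 'D_(ebasis j) g y / 2.
have m0 : 0 < m by rewrite divr_gt0.
have [rho rho0 rhoU] : exists2 rho : R, 0 < rho &
    forall x, `|x - y| < rho -> U x /\ m < 'D_(ebasis j) g x.
  have [_ /(_ (ebasis j))[_ [cdg _]]] := cg.
  have : nbhs y (U `&` ('D_(ebasis j) g) @^-1` [set s | m < s]).
    apply: filterI; first exact: open_nbhs_nbhs.
    have c : {for y, continuous ('D_(ebasis j) g)} := cdg y Uy.
    apply: c; apply: lt_nbhsr; rewrite /m; lra.
  move=> /nbhs_ballP[rho /= rho0 h]; exists rho => // x xy.
  by apply: h; rewrite -ball_normE/= distrC.
(* The bound 1 keeps the patch inside the box with the margin that [vol_box_derive0] asks for. *)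
pose r := Num.min (rho / 2) 1.
have r0 : 0 < r by rewrite lt_min ltr01 divr_gt0.
have r1 : r <= 1 by rewrite ge_min lexx orbT.
have rrho : r < rho.
  by rewrite gt_min; apply/orP; left; rewrite ltr_pdivrMr// ltr_pMr// ltr1n.
have [kap [ckap kap01 [N oN N1] kap0]] := patch_cutoff y r0.
exists N => //.
pose B := ball y r.
have oB : open B by exact: ball_open.
have Bxy x : B x <-> `|x - y| < r by rewrite /B -ball_normE/= distrC.
pose K := [set x : E3 | `|x - y| <= r].
have cK : compact K.
  apply: bounded_closed_compact; last by rewrite /K closed_ball_norm//; exact: closed_ball_closed.
  exists (`|y| + r); split; first exact: num_real.
  move=> L yrL x; rewrite /K/= => h; apply: le_trans (ltW yrL).
  by have := ler_normD (x - y) y; rewrite subrK; lra.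
have BK : B `<=` K by move=> x /Bxy/ltW.
have KU : K `<=` U by move=> x; rewrite /K/= => h; case: (rhoU x (le_lt_trans h rrho)).
have cgB := C1bd_compact cK BK KU cg.
pose K2 := [set x : E3 | `|x - y| <= r / 2].
have r2 : 0 < r / 2 by rewrite divr_gt0.
have cK2 : closed K2 by rewrite /K2 closed_ball_norm//; exact: closed_ball_closed.
have K2B : K2 `<=` B.
  by move=> x; rewrite /K2/= => h; apply/Bxy; apply: le_lt_trans h _; lra.
have kapout x : ~ K2 x -> kap x = 0 by rewrite /K2/= => /negP; rewrite -ltNge; exact: kap0.
have ckapB : C1bd B whole kap.
  have [[c b] d] := ckap; split=> [|v].
    by split=> [x _|i]; [exact: c|have [L kL] := b i; exists L => x _; exact: kL].
  have [dv [cv bv]] := d v; split=> [x _|]; first exact: dv.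
  by split=> [x _|i]; [exact: cv|have [L kL] := bv i; exists L => x _; exact: kL].
have glue f : C1bd B whole f -> C1bd setT whole (fun x => kap x * f x).
  move=> cf; apply: (@C1bd_glue _ _ B K2) => //.
  - by move=> x nK; rewrite kapout// mul0r.
  - exact: C1bdM.
have out f v x : ~ K2 x -> 'D_v (fun x => kap x * f x) x = 0.
  move=> nK; rewrite -(derive_cst (0 : R) x v); apply: near_eq_derive.
  have : nbhs x (~` K2) by apply: open_nbhs_nbhs; split=> //; exact: closed_openC.
  by apply: filterS => z nz; rewrite kapout// mul0r.
have farK2 x : M - 1 <= `|x| -> ~ K2 x.
  rewrite /K2/= => Mx xy; have [cy _] := bdy; have := OmM cy.
  have := ler_normD (x - y) y; rewrite subrK; lra.
have [_ /(_ tt)[L1 dkap]] := C1bd_derive (ebasis j) ckap.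
have [Lk dkapk] : exists L, forall k x, `|'D_(ebasis k) kap x| <= L.
  have /choice[L HL] : forall k, exists L, forall x, `|'D_(ebasis k) kap x| <= L.
    move=> k; have [_ /(_ tt)[L h]] := C1bd_derive (ebasis k) ckap.
    by exists L => x; exact: h.
  exists (\sum_(k < 3) L k) => k x; apply: le_trans (HL k x) _.
  rewrite (bigD1 k)//= lerDl; apply: sumr_ge0 => i _.
  exact: le_trans (normr_ge0 _) (HL i x).
have [Lg dgk] : exists L, forall k x, B x -> `|'D_(ebasis k) g x| <= L.
  have /choice[L HL] : forall k, exists L, forall x, B x -> `|'D_(ebasis k) g x| <= L.
    move=> k; have [_ /(_ tt)[L h]] := C1bd_derive (ebasis k) cgB.
    by exists L => x Bx; exact: h.
  exists (\sum_(k < 3) L k) => k x Bx; apply: le_trans (HL k x Bx) _.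
  rewrite (bigD1 k)//= lerDl; apply: sumr_ge0 => i _.
  exact: le_trans (normr_ge0 _) (HL i x Bx).
have By : B y by exact: ballxx.
have Lk0 : 0 <= Lk by exact: le_trans (normr_ge0 _) (dkapk 0 y).
have Lg0 : 0 <= Lg by exact: le_trans (normr_ge0 _) (dgk 0 y By).
pose V := vol (box M) (fun=> 1 : R).
have V0 : 0 <= V by apply: vol_ge0.
have obox := @open_box R M.
have bbox := @bounded_box R M.
pose Cv := 2 * Lk * V / m.
have Cv0 : 0 <= Cv by apply: divr_ge0; [do 2 apply: mulr_ge0 => //|exact: ltW].
exists (Cv + (Lk + Lg) + (2 * Lk ^+ 2 * V + 2 * Lg ^+ 2 * Cv)) => d /andP[d0 d1].
have dn0 : d != 0 by rewrite gt_eqF.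
pose chi x := kap x * X d (g x).
have cXg := C1bd_Xf d oB cgB.
have cchi : C1bd setT whole chi by exact: glue.
have chi01 x : 0 <= chi x <= 1.
  have := kap01 x; have := X_range d (g x); rewrite /chi => /andP[a1 a2] /andP[b1 b2].
  by rewrite mulr_ge0//= mulr_ile1.
have bchi : bdcont (box M) whole chi by apply: bc_box; exact: C1bd_bdcont.
pose w x := kap x * (d * atan (g x / d)).
have cwB := C1bd_atand dn0 oB cgB.
have cw : C1bd setT whole w by exact: glue.
have Dw x : B x -> 'D_(ebasis j) w x =
    kap x * (X d (g x) * 'D_(ebasis j) g x) + d * atan (g x / d) * 'D_(ebasis j) kap x.
  move=> Bx.
  have e1 := C1bd_is_derive (ebasis j) ckap (I : setT x).
  have e2 := is_derive_comp1 (C1bd_is_derive (ebasis j) cgB Bx) (is_derive_atand (g x) dn0).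
  by have [_ ->] := is_derive_mul e1 e2.
have Dchi k x : B x -> 'D_(ebasis k) chi x =
    kap x * (- (2 * (g x / d) / d) * X d (g x) ^+ 2 * 'D_(ebasis k) g x)
    + X d (g x) * 'D_(ebasis k) kap x.
  move=> Bx.
  have e1 := C1bd_is_derive (ebasis k) ckap (I : setT x).
  have e2 := is_derive_comp1 (C1bd_is_derive (ebasis k) cgB Bx) (is_derive_X d (g x)).
  by have [_ ->] := is_derive_mul e1 e2.
have low x : m * chi x <= 'D_(ebasis j) w x + 2 * d * Lk.
  have [Kx|nK] := pselect (K2 x); last first.
    rewrite /chi kapout// mul0r mulr0 (out (fun x => d * atan (g x / d)))// add0r.
    by rewrite !mulr_ge0// ltW.
  have Bx := K2B _ Kx; rewrite Dw//.
  have [_ mg] := rhoU x (lt_trans ((Bxy x).1 Bx) rrho).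
  have h1 : m * chi x <= kap x * (X d (g x) * 'D_(ebasis j) g x).
    rewrite /chi mulrC -mulrA; apply: ler_wpM2l; first by case/andP: (kap01 x).
    by apply: ler_wpM2l; [case/andP: (X_range d (g x))|exact: ltW].
  have h2 : `|d * atan (g x / d) * 'D_(ebasis j) kap x| <= 2 * d * Lk.
    have at2 : `|atan (g x / d)| <= 2.
      rewrite ler_norml; have := atan_ltpi2 (g x / d).
      by have := atan_gtNpi2 (g x / d); have := pihalf_lt2 R; lra.
    rewrite !normrM (gtr0_norm d0) (mulrC 2); apply: ler_pM => //.
      by rewrite mulr_ge0// ltW.
    by rewrite ler_wpM2l// ltW.
  by move: h2; rewrite ler_norml => /andP[h2 _]; lra.
have volchi : vol (box M) chi <= Cv * d.
  have vw : vol (box M) ('D_(ebasis j) w) = 0.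
    by apply: vol_box_derive0 => // x Mx; rewrite /w kapout ?mul0r//; exact: farK2.
  have bDw : bdcont (box M) whole ('D_(ebasis j) w).
    by apply: bc_box; exact: C1bd_derive.
  have := @vol_le _ (box M) obox bbox (fun x => m * chi x)
    (fun x => 'D_(ebasis j) w x + 2 * d * Lk).
  move=> /(_ (bdcontM (bdcont_cst _ _ _) bchi) (bdcontD bDw (bdcont_cst _ _ _)) (fun x _ => low x)).
  rewrite (volZ obox bbox m bchi) (volD obox bbox bDw (bdcont_cst _ _ _)) vw add0r.
  rewrite (vol_cst obox bbox) -/V => h.
  rewrite -(ler_pM2l m0); apply: le_trans h _.
  by rewrite /Cv le_eqVlt; apply/orP; left; apply/eqP; field; rewrite gt_eqF.
(* Equivalently, the derivative of [X d] is at most [X d / d] in absolute value, since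
   [2 * t <= 1 + t ^+ 2]. The gradient of the layer is thus controlled by the layer itself, and its
   square integrates through [volchi]. *)
have Xbd s : `|2 * (s / d) / d * X d s| <= d^-1.
  have q0 := X_pos d s.
  have -> : 2 * (s / d) / d * X d s = d^-1 * (2 * (s / d) / (1 + (s / d) ^+ 2)).
    by rewrite /X; ring.
  have di : 0 <= d^-1 by rewrite invr_ge0 ltW.
  rewrite normrM (ger0_norm di) ler_piMr//.
  rewrite normrM normfV (gtr0_norm q0) ler_pdivrMr// mul1r ler_norml.
  move: (s / d) => t; have := sqr_ge0 (1 - t); have := sqr_ge0 (1 + t); lra.
have gradbd k x : `|'D_(ebasis k) chi x| <= Lk + Lg / d * (kap x * X d (g x)).
  have [Kx|nK] := pselect (K2 x); last first.
    rewrite /chi (out (fun x => X d (g x)))// kapout// mul0r mulr0 normr0.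
    by rewrite addr0.
  have Bx := K2B _ Kx; rewrite Dchi// addrC (le_trans (ler_normD _ _))// lerD//.
    rewrite normrM; case/andP: (X_range d (g x)) => X0 X1.
    by rewrite (ger0_norm X0) -[leRHS]mul1r ler_pM.
  case/andP: (X_range d (g x)) => X0 X1; case/andP: (kap01 x) => k0 k1.
  have Lgx := dgk k x Bx.
  have {}Xbd := Xbd (g x).
  have -> : kap x * (- (2 * (g x / d) / d) * X d (g x) ^+ 2 * 'D_(ebasis k) g x) =
    - ((kap x * X d (g x)) * ((2 * (g x / d) / d * X d (g x)) * 'D_(ebasis k) g x)) by ring.
  rewrite normrN normrM ger0_norm ?mulr_ge0// mulrC ler_wpM2r ?mulr_ge0//.
  by rewrite normrM mulrC ler_pM.
have dinv : 1 <= d^-1 by rewrite -invr1 lef_pV2 ?posrE.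
have rest0 : 0 <= 2 * Lk ^+ 2 * V + 2 * Lg ^+ 2 * Cv.
  by apply: addr_ge0; do 2 (apply: mulr_ge0 => //); exact: exprn_ge0.
exists chi; split => //.
- move=> x bx Nx.
  have Ux : U x.
    apply: (rhoU x _).1; apply: (@le_lt_trans _ _ (r / 2)); last lra.
    rewrite leNgt; apply/negP => /kap0; rewrite N1// => /eqP.
    by rewrite oner_eq0.
  by rewrite /chi N1// mul1r g0// /X mul0r expr0n addr0 invr1.
- move=> k x; apply: le_trans (gradbd k x) _.
  have := chi01 x; rewrite -/(chi x); move: (chi x) => t /andP[t0 t1].
  apply: (@le_trans _ _ (Lk / d + Lg / d)).
    apply: lerD; first by rewrite ler_peMr.
    by rewrite ler_piMr// divr_ge0// ltW.
  rewrite -mulrDl; apply: ler_wpM2r; first by rewrite invr_ge0 ltW.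
  by move: rest0; move: (2 * _ * _ + _) => P *; lra.
- apply: le_trans volchi _; apply: ler_wpM2r; first exact: ltW.
  by move: rest0; move: (2 * _ * _ + _) => P *; lra.
- move=> k.
  have bD : bdcont (box M) whole ('D_(ebasis k) chi) by apply: bc_box; exact: C1bd_derive.
  have bg1 : bdcont (box M) whole (fun=> 2 * Lk ^+ 2) by exact: bdcont_cst.
  have bg2 : bdcont (box M) whole (fun x => 2 * (Lg / d) ^+ 2 * chi x).
    by apply: bdcontM => //; exact: bdcont_cst.
  apply: (@le_trans _ _ (vol (box M) (fun x => 2 * Lk ^+ 2 + 2 * (Lg / d) ^+ 2 * chi x))).
    apply: vol_le => //.
    - by under eq_fun do rewrite expr2; exact: bdcontM.
    - exact: bdcontD.
    move=> x _; rewrite -real_normK ?num_real//.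
    apply: (@le_trans _ _ ((Lk + Lg / d * chi x) ^+ 2)).
      have gb : `|'D_(ebasis k) chi x| <= Lk + Lg / d * chi x := gradbd k x.
      apply: lerXn2r => //; rewrite nnegrE//.
      by apply: addr_ge0 => //; apply: mulr_ge0; [rewrite divr_ge0// ltW|case/andP: (chi01 x)].
    move: (chi01 x) (Lg / d) => /andP[]; move: (chi x) => t t0 t1 l.
    have : l ^+ 2 * t ^+ 2 <= l ^+ 2 * t.
      by rewrite ler_wpM2l ?sqr_ge0// expr2 ler_piMl.
    have := sqr_ge0 (Lk - l * t); lra.
  rewrite (volD obox bbox bg1 bg2) (volZ obox bbox _ bchi) (vol_cst obox bbox) -/V.
  have e1 : 2 * (Lg / d) ^+ 2 * vol (box M) chi <= 2 * Lg ^+ 2 * Cv / d.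
    apply: le_trans (ler_wpM2l _ volchi) _; first by rewrite mulr_ge0// sqr_ge0.
    rewrite le_eqVlt; apply/orP; left; apply/eqP; field; exact: dn0.
  have e2 : 2 * Lk ^+ 2 * V <= 2 * Lk ^+ 2 * V / d.
    by rewrite ler_peMr// !mulr_ge0// sqr_ge0.
  apply: le_trans (lerD e2 e1) _.
  rewrite -mulrDl ler_wpM2r ?invr_ge0 ?(ltW d0)//.
  by rewrite lerDr addr_ge0// addr_ge0.
Qed.

End LayerPatch.

Section IbpDomain.
Context {R : realType}.
Local Notation E3 := 'rV[R]_3.
Local Notation TR := (measurableTypeR R).
Local Notation R3 := (TR * TR * TR)%type.
Local Notation whole := (@whole R).
Variables (Om : set E3).
Hypotheses (oOm : open Om) (bOm : bounded_set Om) (smOm : smooth_boundary Om).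

Lemma closure_bounded : exists M, forall x, closure Om x -> `|x| <= M.
Proof.
have [M OM] := bounded_dom_lt bOm; exists M => x cx.
have : closure [set y : E3 | `|y| <= M] x.
  by apply: closureS cx => y /OM/ltW.
rewrite -(closure_id _).1//.
rewrite (_ : [set y : E3 | _] = (fun y : E3 => `|y|) @^-1` [set s | s <= M])//.
apply: closed_comp; last exact: closed_le.
by move=> y _; exact: norm_continuous.
Qed.

(** Every layer equals 1 on the boundary, so the measure of the boundary is at most [C * d] for all
    small [d]. *)
Lemma boundary_null : mu3 (point3 @^-1` boundary Om : set R3) = 0%E.
Proof.
have [M0 HM0] := closure_bounded.
pose M := M0 + 2.
have OmM x : closure Om x -> `|x| <= M - 2 by move/HM0; rewrite /M addrK.
have [C HC] := layered_boundary OmM (layer_patch oOm smOm OmM).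
have mB : measurable (point3 @^-1` boundary Om : set R3).
  apply: closed_measurable_point3; apply: closedI; first exact: closed_closure.
  by apply: open_closedC; exact: open_interior.
have mbox : measurable (point3 @^-1` box M : set R3).
  by apply: open_measurable_point3; exact: open_box.
have bound d : 0 < d <= 1 -> (mu3 (point3 @^-1` boundary Om : set R3) <= (C * d)%:E)%E.
  move=> /HC[chi [c r b _ v _]].
  have ichi := bc_integrable (@open_box R M) (@bounded_box R M)
    (bc_box M (C1bd_bdcont c)).
  apply: (@le_trans _ _ (\int[mu3]_(q in point3 @^-1` box M) (chi (point3 q))%:E)%E).
    have <- : (\int[mu3]_(q in point3 @^-1` boundary Om) (chi (point3 q))%:E
        = mu3 (point3 @^-1` boundary Om : set R3))%E.
      transitivity (\int[mu3]_(q in point3 @^-1` boundary Om) (cst 1 q))%E.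
        by apply: eq_integral => q /set_mem/= bq; rewrite b.
      by rewrite integral_cst// mul1e.
    apply: ge0_subset_integral => //.
    - by apply/measurable_EFinP; case/integrableP: ichi => /measurable_EFinP.
    - by move=> q _; rewrite lee_fin; case/andP: (r (point3 q)).
    - by move=> q [cq _]; rewrite /box/=; have := HM0 _ cq; rewrite /M; lra.
  rewrite -[leLHS]fineK; first by rewrite lee_fin.
  exact: integrable_fin_num.
have := measure_ge0 mu3 (point3 @^-1` boundary Om : set R3).
rewrite le_eqVlt => /predU1P[<-//|pos0].
have fin : (mu3 (point3 @^-1` boundary Om : set R3) \is a fin_num)%E.
  rewrite ge0_fin_numE//; apply: le_lt_trans (bound 1 _) _; first by rewrite ltr01 lexx.
  by rewrite ltry.
pose a := fine (mu3 (point3 @^-1` boundary Om : set R3)).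
have a0 : 0 < a by apply: fine_gt0; rewrite pos0 ltey_eq fin.
(* This width would make [C * d] less than half of the supposed positive measure [a]. *)
pose d := Num.min 1 (a / (2 * (`|C| + 1))).
have C1 : 0 < 2 * (`|C| + 1) by have := normr_ge0 C; lra.
have d0 : 0 < d by rewrite lt_min ltr01 divr_gt0.
have aC : a <= C * d by rewrite -lee_fin fineK//; apply: bound; rewrite d0 ge_min lexx.
have ad : d * (2 * (`|C| + 1)) <= a.
  by rewrite -ler_pdivlMr// ge_min lexx orbT.
have Cd : C * d <= `|C| * d by apply: ler_wpM2r; [exact: ltW|exact: ler_norm].
have Cd0 : 0 <= `|C| * d by apply: mulr_ge0; [exact: normr_ge0|exact: ltW].
exfalso; clear pos0; lra.
Qed.

(** Zero trace as a limit from inside the domain; it says nothing about the values of [v] on the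
    boundary or outside. *)
Definition tr0 (v : E3 -> R) := forall y, boundary Om y ->
  forall e, 0 < e -> \forall x \near y, Om x -> `|v x| < e.

(** The segment leaves the domain for the first time at the supremum [t] of [S], at a boundary point
    where [v] tends to 0. The mean value inequality on the part before [t] carries this smallness
    back to [x]. *)
Lemma exit_bound (v : E3 -> R) (e x : E3) (L h : R) :
  C1bd Om whole v -> tr0 v -> (forall x, Om x -> `|'D_e v x| <= L) ->
  0 <= h -> Om x -> ~ Om (h *: e + x) -> `|v x| <= L * h.
Proof.
move=> cv tv dvL h0 Ox nOh.
have L0 : 0 <= L by exact: le_trans (normr_ge0 _) (dvL x Ox).
have contl : continuous (fun s : R => s *: e + x).
  by move=> s; apply: cvgD; [apply: cvgZr_tmp; exact: cvg_id|exact: cvg_cst].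
pose S := [set s : R | 0 <= s <= h /\ forall r, 0 <= r <= s -> Om (r *: e + x)].
have S0 : S 0.
  split; first by rewrite lexx.
  move=> r /andP[r0 r1]; have -> : r = 0 by apply/eqP; rewrite eq_le r0 r1.
  by rewrite scale0r add0r.
have ubS : has_ubound S by exists h => s [/andP[]].
have hsS : has_sup S by split; [exists 0|].
pose t := sup S.
have t0 : 0 <= t by exact: (ub_le_sup ubS S0).
have th : t <= h by apply: ge_sup; [exists 0|move=> s [/andP[]]].
have below r : 0 <= r < t -> Om (r *: e + x).
  move=> /andP[r0 rt].
  have [s [_ Ss] rs] := @sup_gt _ S r (ex_intro _ 0 S0) rt.
  by apply: Ss; rewrite r0/= ltW.
have nOt : ~ Om (t *: e + x).
  move=> Ot.
  have nt : \forall s \near t, Om (s *: e + x).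
    by apply: contl; apply: open_nbhs_nbhs.
  have tlth : t < h.
    by rewrite lt_neqAle th andbT; apply/eqP => teq; rewrite -teq in nOh.
  have [d /= d0 dO] := nt.
  pose s := Num.min h (t + d / 2).
  have ts : t < s by rewrite lt_min tlth/= ltrDl divr_gt0.
  have : S s.
    split; first by rewrite (le_trans t0 (ltW ts))/= ge_min lexx.
    move=> r /andP[r0 rs]; have [rt|tr] := ltP r t; first by apply: below; rewrite r0.
    apply: dO; rewrite /= ler0_norm ?subr_le0// opprB.
    have : s <= t + d / 2 by rewrite ge_min lexx orbT.
    lra.
  by move/(ub_le_sup ubS); rewrite leNgt ts.
have tpos : 0 < t.
  rewrite lt_neqAle t0 andbT; apply/eqP => teq.
  by apply: nOt; rewrite -teq scale0r add0r.
have bdt : boundary Om (t *: e + x).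
  split; last by rewrite /= ((interior_id Om).1 oOm).
  move=> B /contl[d /= d0 dB].
  pose r := Num.max 0 (t - d / 2).
  have rt : r < t by rewrite gt_max tpos/= gtrBl divr_gt0.
  have r0 : 0 <= r by rewrite le_max lexx.
  exists (r *: e + x); split; first by apply: below; rewrite r0.
  apply: dB; rewrite /= ger0_norm ?subr_ge0 ?ltW//.
  have : t - d / 2 <= r by rewrite le_max lexx orbT.
  lra.
apply/ler_addgt0Pr => eps eps0.
have /contl[d /= d0 dv] := tv _ bdt eps eps0.
pose r := Num.max 0 (t - d / 2).
have rt : r < t by rewrite gt_max tpos/= gtrBl divr_gt0.
have r0 : 0 <= r by rewrite le_max lexx.
have vr : `|v (r *: e + x)| < eps.
  apply: dv; last by apply: below; rewrite r0.
  rewrite /= ger0_norm ?subr_ge0 ?ltW//.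
  have : t - d / 2 <= r by rewrite le_max lexx orbT.
  lra.
have line s : 0 <= s <= r -> Om (s *: e + x).
  by move=> /andP[s0 sr]; apply: below; rewrite s0 (le_lt_trans sr).
have := @derive_line_bound _ _ v x e 0 r L r0
  (fun s sr => (cv.2 e).1 _ (line s sr)) (fun s sr => dvL _ (line s sr)).
rewrite scale0r add0r subr0 => lb.
have lr : L * r <= L * h by rewrite ler_wpM2l// (le_trans (ltW rt)).
have := ler_normB (v (r *: e + x)) (v (r *: e + x) - v x).
rewrite subKr; move: lb lr vr; move: (L * r) (L * h) => A B *; lra.
Qed.

Let ext (v : E3 -> R) (x : E3) : R := if x \in Om then v x else 0.

(** If the segment stays in the domain, the mean value inequality applies. Otherwise some
    intermediate point lies outside, and [exit_bound] is applied towards it from each endpoint that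
    lies inside; the two lengths add up to at most the length of the segment. *)
Lemma ext_lipschitz (v : E3 -> R) (e : E3) : C1bd Om whole v -> tr0 v ->
  exists L, forall x h, `|ext v (h *: e + x) - ext v x| <= L * `|h|.
Proof.
move=> cv tv.
have [_ /(_ tt)[L1 vL1]] := C1bd_derive e cv.
have [_ /(_ tt)[L2 vL2]] := C1bd_derive (- e) cv.
pose L := Num.max 0 (Num.max L1 L2).
have L0 : 0 <= L by rewrite le_max lexx.
have vLe x : Om x -> `|'D_e v x| <= L.
  by move=> Ox; rewrite !le_max vL1 ?orbT.
have vLn x : Om x -> `|'D_(- e) v x| <= L.
  by move=> Ox; rewrite !le_max vL2 ?orbT.
exists L.
have main x h : 0 <= h -> `|ext v (h *: e + x) - ext v x| <= L * h.
  move=> h0; have Lh0 : 0 <= L * h by exact: mulr_ge0.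
  have back (s : R) z : s *: (- e) + (s *: e + z) = z.
    by rewrite scalerN addrA addNr add0r.
  rewrite /ext; case: ifPn; case: ifPn; rewrite ?(notin_setE, inE).
  - move=> Ox Oh.
    have [seg|] := pselect (forall s, 0 <= s <= h -> Om (s *: e + x)).
      have := @derive_line_bound _ _ v x e 0 h L h0
        (fun s sr => (cv.2 e).1 _ (seg s sr)) (fun s sr => vLe _ (seg s sr)).
      by rewrite scale0r add0r subr0.
    move/existsNP => [s /not_implyP[/andP[s0 sh] nOs]].
    have e1 := exit_bound cv tv vLe s0 Ox nOs.
    have e2 : `|v (h *: e + x)| <= L * (h - s).
      apply: (@exit_bound v (- e) _ L (h - s) cv tv vLn) => //.
        by rewrite subr_ge0.
      have -> // : (h - s) *: - e + (h *: e + x) = s *: e + x.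
      by rewrite scalerN scalerBl opprB addrA subrK.
    have := ler_normB (v (h *: e + x)) (v x); move: e1 e2; rewrite mulrBr.
    by move: (L * s) (L * h) => A B *; lra.
  - move=> nOx Oh; rewrite subr0.
    by apply: (@exit_bound v (- e) _ L h cv tv vLn) => //; rewrite back.
  - move=> Ox nOh; rewrite sub0r normrN.
    exact: exit_bound vLe _ Ox nOh.
  - by move=> _ _; rewrite subrr normr0.
move=> x h; have [h0|h0] := leP 0 h; first by rewrite (ger0_norm h0); exact: main.
rewrite (ltr0_norm h0) distrC.
have := main (h *: e + x) (- h); rewrite oppr_ge0 => /(_ (ltW h0)).
by rewrite scaleNr addrA addNr add0r.
Qed.

(** The divergence theorem for functions of zero trace: the extension by zero is Lipschitz along the
    axis and derivable off the boundary, which is a null set, so [integral_derive_eq0] applies. *)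
Lemma vol_derive0 (v : E3 -> R) j : C1bd Om whole v -> tr0 v ->
  vol Om ('D_(ebasis j) v) = 0.
Proof.
move=> cv tv.
have [L extL] := ext_lipschitz (ebasis j) cv tv.
have [[ctv /(_ tt)[B vB]] /(_ (ebasis j))[dv [cdv _]]] := cv.
have [M OM] := bounded_dom_lt bOm.
have mOm := measurable_dom oOm.
have mext (f : E3 -> R) : (forall x, Om x -> {for x, continuous f}) ->
    measurable_fun setT (ext f \o point3 : R3 -> R).
  move=> cf.
  rewrite (_ : _ \o _ = (f \o point3) \_ (point3 @^-1` Om)); last first.
    by apply/funext => q; rewrite /ext patchE.
  apply/(measurable_restrictT _ _).1 => //.
  exact: continuous_measurable_point3.
have -> : vol Om ('D_(ebasis j) v) = \int[mu3]_q ext ('D_(ebasis j) v) (point3 q).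
  by rewrite /vol Rintegral_mkcond; apply: eq_Rintegral => q _; rewrite /ext patchE.
have mB : measurable (point3 @^-1` boundary Om : set R3).
  apply: closed_measurable_point3; apply: closedI; first exact: closed_closure.
  by apply: open_closedC; exact: open_interior.
apply: (@integral_derive_eq0 _ (ext v) (ext ('D_(ebasis j) v)) j L M (Num.max 0 B)
  (point3 @^-1` boundary Om)) => //.
- exact: mext.
- exact: mext.
- move=> x Mx; rewrite /ext; case: ifPn => // /set_mem/OM.
  by rewrite ltNge Mx.
- move=> x; rewrite /ext le_max; case: ifPn => [/set_mem Ox|_].
    by rewrite vB ?orbT.
  by rewrite normr0 lexx.
- exact: boundary_null.
- move=> q /= nbq; rewrite /ext; case: ifPn => [/set_mem Oq|].
    apply: near_eq_is_derive (derivableP (dv _ Oq)).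
    have : nbhs (point3 q) Om by apply: open_nbhs_nbhs.
    by apply: filterS => x Ox; rewrite mem_set.
  rewrite notin_setE => nOq.
  have ncl : ~ closure Om (point3 q).
    by move=> cq; apply: nbq; split => //; rewrite /= ((interior_id Om).1 oOm).
  apply: near_eq_is_derive (is_derive_cst (0 : R) _ _).
  have : nbhs (point3 q) (~` closure Om).
    by apply: open_nbhs_nbhs; split=> //; exact/closed_openC/closed_closure.
  apply: filterS => x ncx; rewrite memNset//.
  by move=> Ox; apply: ncx; exact: subset_closure.
Qed.

End IbpDomain.

(** * Regularity on the space-time cylinder *)

Section IteratedDerivatives.
Context {R : realType} {V W : normedModType R}.

Definition iterD (l : seq V) (f : V -> W) : V -> W := foldr (fun v h => 'D_v h) f l.

Lemma Cn_on_eq n (U : set V) (f g : V -> W) : open U ->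
  (forall x, U x -> f x = g x) -> Cn_on n U f -> Cn_on n U g.
Proof.
move=> oU; elim: n f g => [|n IH] f g fg [cf df].
all: have near_fg x : U x -> \forall y \near x, f y = g y by
  move=> Ux; have : nbhs x U; [by apply: open_nbhs_nbhs|apply: filterS => y; exact: fg].
all: have cg x : U x -> {for x, continuous g} by
  move=> Ux; rewrite /prop_for /continuous_at -(fg x Ux);
  apply: cvg_trans (cf x Ux); exact: near_eq_cvg (near_fg x Ux).
  by split.
split => // v; have [dfv cdf] := df v; split=> [x Ux|].
  exact: near_eq_derivable (near_fg x Ux) (dfv x Ux).
apply: IH cdf => x Ux; exact: near_eq_derive (near_fg x Ux).
Qed.

Lemma Cn_on_iterD (U : set V) (f : V -> W) l : (forall n, Cn_on n U f) ->
  forall n, Cn_on n U (iterD l f).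
Proof.
move=> cf; elim: l => [|v l IH] n //=.
by have [_ /(_ v)[]] := IH n.+1.
Qed.

Lemma iterD_eq (U : set V) (f g : V -> W) l : open U ->
  (forall x, U x -> f x = g x) -> forall x, U x -> iterD l f x = iterD l g x.
Proof.
move=> oU fg; elim: l => [|v l IH] x Ux /=; first exact: fg.
apply: near_eq_derive; have : nbhs x U by apply: open_nbhs_nbhs.
by apply: filterS => y; exact: IH.
Qed.

End IteratedDerivatives.

Section Cylinder.
Context {R : realType}.
Local Notation E3 := 'rV[R]_3.
Local Notation V := (R * 'rV[R]_3)%type.
Variables (Om : set E3).
Hypotheses (oOm : open Om) (bOm : bounded_set Om).

Definition cyl : set V := [set z | 0 < z.1 /\ Om z.2].
Definition before (b : R) : set V := [set z | z.1 < b].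

Lemma open_cyl : open cyl.
Proof.
rewrite (_ : cyl = (fst @^-1` [set s : R | 0 < s]) `&` (snd @^-1` Om)).
  apply: openI; apply: open_comp => //; try exact: open_gt.
    by move=> z _; exact: cvg_fst.
  by move=> z _; exact: cvg_snd.
by apply/seteqP; split.
Qed.

Lemma cyl_closed_cylinder z : cyl z -> closed_cylinder Om z.
Proof. by move=> [z1 z2]; split; [exact: ltW|exact: subset_closure]. Qed.

Lemma smooth_on_local (W : normedModType R) (f : V -> W) (z : V) :
  smooth_on (closed_cylinder Om) f -> closed_cylinder Om z ->
  exists U (g : V -> W), [/\ open_nbhs z U,
    forall l n, Cn_on n U (iterD l g),
    forall z', closed_cylinder Om z' -> U z' -> g z' = f z' &
    forall l z', cyl z' -> U z' -> iterD l g z' = iterD l f z'].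
Proof.
move=> sf cz; have [U [g [[oU Uz] cg gf]]] := sf z cz.
exists U, g; split => //; first by move=> l n; exact: Cn_on_iterD.
move=> l z' cz' Uz'; apply: (@iterD_eq _ _ _ (cyl `&` U)) => //.
  by apply: openI => //; exact: open_cyl.
by move=> x [cx Ux]; apply: gf => //; exact: cyl_closed_cylinder.
Qed.

Lemma smooth_on_Cn (W : normedModType R) (f : V -> W) n :
  smooth_on (closed_cylinder Om) f -> Cn_on n cyl f.
Proof.
move=> sf.
have nb z : cyl z -> exists U (g : V -> W), [/\ U z,
    forall l n, Cn_on n U (iterD l g), forall l, iterD l g z = iterD l f z &
    forall l, \forall z' \near z, iterD l g z' = iterD l f z'].
  move=> Qz.
  have [U [g [oUz cg _ gf]]] := smooth_on_local sf (cyl_closed_cylinder Qz).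
  have [oU Uz] := oUz.
  exists U, g; split => // l; first exact: gf.
  have : nbhs z (cyl `&` U).
    by apply: open_nbhs_nbhs; split=> //; apply: openI => //; exact: open_cyl.
  by apply: filterS => z' [Qz' Uz']; exact: gf.
have cont l z : cyl z -> {for z, continuous (iterD l f)}.
  move=> Qz; have [U [g [Uz cg gfz gf]]] := nb z Qz.
  rewrite /prop_for /continuous_at -(gfz l).
  by apply: cvg_trans ((cg l 0%N).1 z Uz); exact: near_eq_cvg (gf l).
have key m : forall l, Cn_on m cyl (iterD l f).
  elim: m => [|m IH] l; split; try exact: cont; first by [].
  move=> v; split; last exact: (IH (v :: l)).
  move=> z Qz; have [U [g [Uz cg _ gf]]] := nb z Qz.
  apply: near_eq_derivable (gf l) _.
  by have [_ /(_ v)[dg _]] := cg l 1%N; exact: dg.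
exact: (key n [::]).
Qed.

Lemma compact_cylinder b : compact (`[0, b]%classic `*` closure Om : set V).
Proof.
apply: compact_setX; first exact: segment_compact.
have [M HM] := closure_bounded bOm.
apply: bounded_closed_compact; last exact: closed_closure.
exists M; split; first exact: num_real.
by move=> N MN x /HM/le_trans; apply; exact: ltW.
Qed.

(** Compactness of [[0, b]] times the closure. The set [P] selects the points for which a bound is
    claimed. With the open cylinder it bounds derivatives up to the boundary; with a set of
    undesirable points and a reciprocal for [f] it excludes such points quantitatively. *)
Lemma local_bounded (P : set V) (f : V -> R) b :
  (forall z, closed_cylinder Om z -> exists c, \forall z' \near z, P z' -> `|f z'| <= c) ->
  exists M, forall z, P z -> 0 <= z.1 <= b -> closure Om z.2 -> `|f z| <= M.
Proof.
move=> loc.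
have cK : compact (`[0, b]%classic `*` closure Om : set V) := @compact_cylinder b.
move/compact_near_coveringP : cK => /(_ R +oo%R (fun M z => P z -> `|f z| <= M)) H.
have : \forall M \near +oo%R, `[0, b]%classic `*` closure Om `<=`
    (fun z => P z -> `|f z| <= M).
  apply: (H _) => z [z1 z2].
  have [c hc] : exists c, \forall z' \near z, P z' -> `|f z'| <= c.
    by apply: loc; split => //; move: z1; rewrite /= in_itv/= => /andP[].
  exists ([set z' | P z' -> `|f z'| <= c], [set M | c < M]).
    by split=> //=; exists c; split => //; exact: num_real.
  by move=> [z' M] /= [h1 /ltW h2] Pz'; exact: le_trans (h1 Pz') h2.
move=> [M [_ HM]]; exists (M + 1) => z Pz z1 z2.
have /HM HK : M < M + 1 by lra.
by apply: HK => //; split => //=; rewrite in_itv.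
Qed.

Lemma smooth_on_continuous (f : V -> R) z e : smooth_on (closed_cylinder Om) f ->
  closed_cylinder Om z -> 0 < e ->
  \forall z' \near z, closed_cylinder Om z' -> `|f z' - f z| < e.
Proof.
move=> sf cz e0.
have [U [g [[oU Uz] cg gf _]]] := smooth_on_local sf cz.
have cgz : {for z, continuous g} := (cg [::] 0%N).1 z Uz.
have [h1 h2] : (\forall z' \near z, `|g z - g z'| < e) /\ nbhs z U.
  by split; [move/cvgrPdist_lt : cgz; exact|exact: open_nbhs_nbhs].
apply: filterS2 h1 h2 => z' h Uz' cz'.
by rewrite -gf// -(gf z)// distrC.
Qed.

Lemma smooth_on_bounded (f : V -> R) b : smooth_on (closed_cylinder Om) f ->
  exists M, forall z, 0 <= z.1 <= b -> closure Om z.2 -> `|f z| <= M.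
Proof.
move=> sf; have [|M HM] := @local_bounded (closed_cylinder Om) f b.
  move=> z cz; exists (`|f z| + 1).
  apply: filterS (smooth_on_continuous sf cz ltr01) => z' h /h.
  have := ler_normD (f z' - f z) (f z); rewrite subrK; lra.
by exists M => z /andP[z0 zb] cz; apply: HM => //; rewrite z0.
Qed.

(** Derivatives of [f] are formed in the open cylinder only. Near each point of the closed cylinder
    they agree with those of a smooth extension, so they are bounded on every time strip, down to
    time 0 and up to the boundary. *)
Lemma smooth_on_C1bd (f : V -> R) l : smooth_on (closed_cylinder Om) f ->
  C1bd cyl before (iterD l f).
Proof.
move=> sf.
have key l' : bdcont cyl before (iterD l' f).
  split=> [z Qz|b].
    exact: ((Cn_on_iterD l' (fun n => smooth_on_Cn n sf) 0%N).1 z Qz).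
  have [|M HM] := @local_bounded cyl (iterD l' f) b.
    move=> z cz; have [U [g [[oU Uz] cg _ gf]]] := smooth_on_local sf cz.
    have cgz : {for z, continuous (iterD l' g)} := (cg l' 0%N).1 z Uz.
    have [h1 h2] : (\forall z' \near z, `|iterD l' g z - iterD l' g z'| < 1) /\ nbhs z U.
      by split; [move/cvgrPdist_lt : cgz; exact|exact: open_nbhs_nbhs].
    exists (`|iterD l' g z| + 1).
    apply: filterS2 h1 h2 => z' h Uz' Qz'; rewrite -gf//.
    have := ler_normB (iterD l' g z) (iterD l' g z - iterD l' g z'); rewrite subKr; lra.
  exists M => z Qz zb; apply: HM => //; last by apply: subset_closure; case: Qz.
  by case: Qz => z0 _; rewrite (ltW z0)/= ltW.
split; first exact: key.
move=> v; split; last exact: (key (v :: l)).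
move=> z Qz.
by have [_ /(_ v)[h _]] := Cn_on_iterD l (fun n => smooth_on_Cn n sf) 1%N; exact: h.
Qed.

End Cylinder.

Lemma continuous_pairr (S T : topologicalType) (t : S) (x : T) :
  {for x, continuous (fun x => (t, x))}.
Proof. by apply: cvg_pair; [exact: cvg_cst|exact: cvg_id]. Qed.

(** * Integrals over time slices and traces *)

Section TimeIntegrals.
Context {R : realType}.
Local Notation E3 := 'rV[R]_3.
Local Notation V := (R * 'rV[R]_3)%type.
Local Notation whole := (@whole R).
Variables (Om : set E3).
Hypotheses (oOm : open Om) (bOm : bounded_set Om) (smOm : smooth_boundary Om).

Definition cb (F : V -> R) := bdcont (cyl Om) (@before R) F.
Definition reg (F : V -> R) := C1bd (cyl Om) (@before R) F.
Definition It (F : V -> R) (t : R) := vol Om (fun x => F (t, x)).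
Definition dx (j : 'I_3) (F : V -> R) : V -> R := 'D_(0, ebasis j) F.
Definition dtt (F : V -> R) : V -> R := 'D_(1, 0) F.

Let ocyl := open_cyl oOm.

Lemma cb_slice F t : cb F -> 0 < t -> bdcont Om whole (fun x => F (t, x)).
Proof.
move=> [cF bF] t0; split=> [x Ox|i].
  apply: (@continuous_comp _ _ _ (fun x : E3 => (t, x) : V) F).
    exact: continuous_pairr.
  exact: cF.
have [M FM] := bF (t + 1); exists M => x Ox _.
by apply: FM; [split|rewrite /before/= ltrDl].
Qed.

Lemma derive_slice (F : V -> R) (t : R) (x v : E3) :
  'D_v (fun x => F (t, x)) x = 'D_(0, v) F (t, x).
Proof.
rewrite /derive; congr (lim _).
suff -> : (fun h : R => h^-1 *: (((fun x => F (t, x)) \o shift x) (h *: v) - F (t, x)))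
  = (fun h => h^-1 *: ((F \o shift (t, x)) (h *: (0, v)) - F (t, x))) by [].
apply/funext => h /=; congr (_ *: (F _ - _)).
by congr pair; rewrite /= scaler0 add0r.
Qed.

Lemma derivable_slice (F : V -> R) (t : R) (x v : E3) :
  derivable F (t, x) (0, v) -> derivable (fun x => F (t, x)) x v.
Proof.
rewrite /derivable.
suff -> : (fun h : R => h^-1 *: (((fun x => F (t, x)) \o shift x) (h *: v) - F (t, x)))
  = (fun h => h^-1 *: ((F \o shift (t, x)) (h *: (0, v)) - F (t, x))) by [].
apply/funext => h /=; congr (_ *: (F _ - _)).
by congr pair; rewrite /= scaler0 add0r.
Qed.

Lemma reg_slice F t : reg F -> 0 < t -> C1bd Om whole (fun x => F (t, x)).
Proof.
move=> [bF dF] t0; split; first exact: cb_slice.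
move=> v; have [dFv cdF] := dF (0, v); split=> [x Ox|].
  by apply: derivable_slice; exact: dFv.
have -> : 'D_v (fun x => F (t, x)) = (fun x => 'D_(0, v) F (t, x)).
  by apply/funext => x; exact: derive_slice.
exact: (cb_slice cdF t0).
Qed.

Lemma derive_tslice (F : V -> R) (t : R) (x : E3) : derive1 (fun s => F (s, x)) t = dtt F (t, x).
Proof.
rewrite derive1E /dtt /derive; congr (lim _).
suff -> : (fun h : R => h^-1 *: (((fun s => F (s, x)) \o shift t) (h *: 1) - F (t, x)))
  = (fun h => h^-1 *: ((F \o shift (t, x)) (h *: (1, 0)) - F (t, x))) by [].
apply/funext => h /=; congr (_ *: (F _ - _)).
by congr pair; rewrite /= ?scaler0 ?add0r.
Qed.

Lemma derivable_tslice (F : V -> R) (t : R) (x : E3) :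
  derivable F (t, x) (1, 0) -> derivable (fun s => F (s, x)) t 1.
Proof.
rewrite /derivable.
suff -> : (fun h : R => h^-1 *: (((fun s => F (s, x)) \o shift t) (h *: 1) - F (t, x)))
  = (fun h => h^-1 *: ((F \o shift (t, x)) (h *: (1, 0)) - F (t, x))) by [].
apply/funext => h /=; congr (_ *: (F _ - _)).
by congr pair; rewrite /= ?scaler0 ?add0r.
Qed.

Lemma is_derive_It (F : V -> R) (t : R) : reg F -> 0 < t -> is_derive t 1 (It F) (It (dtt F) t).
Proof.
move=> rF t0; have [bF dF] := rF.
(* On this window of times, away from 0 and bounded above, the time derivative has a constant
   majorant, as differentiation under the integral requires. *)
pose u := t / 2; pose v := t + 1.
have tI : `]u, v[%classic t by rewrite /= in_itv/= /u /v; apply/andP; split; lra.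
have I0 s : `]u, v[%classic s -> 0 < s.
  by rewrite /= in_itv/= => /andP[+ _]; apply: lt_trans; rewrite divr_gt0.
have [M HM] := (dF (1, 0)).2.2 v.
pose f (s : R) (q : R * R * R) := F (s, point3 q).
have intf s : `]u, v[%classic s ->
    mu3.-integrable (point3 @^-1` Om) (EFin \o f s).
  by move=> /I0 s0; have := bc_integrable oOm bOm (cb_slice bF s0).
have df s y : `]u, v[%classic s -> (point3 @^-1` Om) y -> derivable (f ^~ y) s 1.
  by move=> /I0 s0 Oy; apply: derivable_tslice; apply: (dF (1, 0)).1.
have G0 (y : R * R * R) : 0 <= Num.max 0 M by rewrite le_max lexx.
have intG : mu3.-integrable (point3 @^-1` Om) (EFin \o (fun _ : R * R * R => Num.max 0 M)).
  exact: (bc_integrable oOm bOm (bdcont_cst _ _ _)).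
have Gub s y : `]u, v[%classic s -> (point3 @^-1` Om) y ->
    `|partial1of2 f s y| <= Num.max 0 M.
  move=> Is Oy; rewrite /partial1of2 derive_tslice le_max; apply/orP; right.
  apply: HM; first by split; [exact: I0 Is|].
  by move: Is; rewrite /= in_itv/= => /andP[].
have mO := measurable_dom oOm.
have d1 := derivable_under_integral mO tI intf df G0 intG Gub.
have d2 := differentiation_under_integral mO tI intf df G0 intG Gub.
have d3 : \int[mu3]_(x in point3 @^-1` Om) partial1of2 f t x = It (dtt F) t.
  by apply: eq_Rintegral => y _; rewrite /partial1of2 derive_tslice.
have d4 : derive1 (It F) t = It (dtt F) t by rewrite -d3 -d2.
have d5 : derivable (It F) t 1 := d1.
by rewrite derive1E in d4; exact: DeriveDef d5 d4.
Qed.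

Lemma ItD F G (t : R) : cb F -> cb G -> 0 < t ->
  It (fun z => F z + G z) t = It F t + It G t.
Proof. by move=> bF bG t0; apply: volD => //; exact: cb_slice. Qed.

Lemma ItB F G (t : R) : cb F -> cb G -> 0 < t ->
  It (fun z => F z - G z) t = It F t - It G t.
Proof. by move=> bF bG t0; apply: volB => //; exact: cb_slice. Qed.

Lemma ItN F (t : R) : cb F -> 0 < t -> It (fun z => - F z) t = - It F t.
Proof. by move=> bF t0; apply: volN => //; exact: cb_slice. Qed.

Lemma ItZ c F t : cb F -> 0 < t -> It (fun z => c * F z) t = c * It F t.
Proof. by move=> bF t0; apply: volZ => //; exact: cb_slice. Qed.

Lemma It_le F G (t : R) : cb F -> cb G -> 0 < t ->
  (forall x, Om x -> F (t, x) <= G (t, x)) -> It F t <= It G t.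
Proof. by move=> bF bG t0 FG; apply: vol_le => //; exact: cb_slice. Qed.

Lemma It_ge0 F (t : R) : (forall x, Om x -> 0 <= F (t, x)) -> 0 <= It F t.
Proof. exact: vol_ge0. Qed.

Lemma eq_It (F G : V -> R) (t : R) : (forall x, Om x -> F (t, x) = G (t, x)) -> It F t = It G t.
Proof. exact: eq_vol. Qed.

Lemma It_cst c t : It (fun=> c) t = c * vol Om (fun=> 1).
Proof. exact: vol_cst. Qed.

Lemma cb_sum (F : 'I_3 -> V -> R) : (forall j, cb (F j)) ->
  cb (fun z => \sum_(j < 3) F j z).
Proof.
move=> bf.
rewrite (_ : (fun x => _) = (fun x => F ord0 x + F (lift ord0 ord0) x +
    F (lift ord0 (lift ord0 ord0)) x)); last first.
  by apply/funext => x; rewrite !big_ord_recl big_ord0 addr0 addrA.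
apply: bdcontD; last exact: bf.
by apply: bdcontD; exact: bf.
Qed.

Lemma It_sum (F : 'I_3 -> V -> R) t : (forall j, cb (F j)) -> 0 < t ->
  It (fun z => \sum_(j < 3) F j z) t = \sum_(j < 3) It (F j) t.
Proof.
move=> bF t0; apply: (vol_sum oOm bOm (f := fun j x => F j (t, x))) => j.
exact: cb_slice (bF j) t0.
Qed.

(** A trace at every positive time, taken from inside the domain, because fields are only known to
    be regular in the open cylinder. The value [b] is independent of time, as the boundary data
    are. *)
Definition btr (F : V -> R) (b : E3 -> R) := forall t, 0 < t ->
  forall y, boundary Om y -> F (t, x) @[x --> within Om (nbhs y)] --> b y.

Lemma btr_cst c : btr (fun=> c) (fun=> c).
Proof. by move=> t _ y _; exact: cvg_cst. Qed.

Lemma btrD F G a b : btr F a -> btr G b ->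
  btr (fun z => F z + G z) (fun y => a y + b y).
Proof. by move=> hF hG t t0 y by_; apply: cvgD; [exact: hF|exact: hG]. Qed.

Lemma btrN F a : btr F a -> btr (fun z => - F z) (fun y => - a y).
Proof. by move=> hF t t0 y by_; apply: cvgN; exact: hF. Qed.

Lemma btrB F G a b : btr F a -> btr G b ->
  btr (fun z => F z - G z) (fun y => a y - b y).
Proof. by move=> hF hG; apply: btrD => //; exact: btrN. Qed.

Lemma btrM F G a b : btr F a -> btr G b ->
  btr (fun z => F z * G z) (fun y => a y * b y).
Proof. by move=> hF hG t t0 y by_; apply: cvgM; [exact: hF|exact: hG]. Qed.

Lemma btr_comp F a (h : R -> R) : btr F a ->
  (forall y, boundary Om y -> {for a y, continuous h}) ->
  btr (fun z => h (F z)) (fun y => h (a y)).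
Proof.
move=> hF ch t t0 y by_.
exact: (cvg_comp _ _ (hF t t0 y by_) (ch y by_)).
Qed.

Lemma btr_eq F G a b : btr F a -> (forall t x, 0 < t -> Om x -> F (t, x) = G (t, x)) ->
  (forall y, boundary Om y -> a y = b y) -> btr G b.
Proof.
move=> hF FG ab t t0 y by_; rewrite -ab//.
apply: cvg_trans (hF t t0 y by_); apply: near_eq_cvg.
by rewrite near_withinE; near=> x => Ox; exact: FG.
Unshelve. all: by end_near. Qed.

Definition trz F := btr F (fun=> 0).

Lemma trz_bounded F G : trz F -> cb G -> trz (fun z => F z * G z).
Proof.
move=> tF [_ bG] t t0 y by_.
have [M GM] := bG (t + 1).
apply/cvgrPdist_lt => e e0.
have M0 : 0 < `|M| + 1 by have := normr_ge0 M; lra.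
have := tF t t0 y by_ => /cvgrPdist_lt /(_ (e / (`|M| + 1)) (divr_gt0 e0 M0)).
rewrite !near_withinE; apply: filterS => x h Ox; have {h} := h Ox.
rewrite !sub0r !normrN normrM ltr_pdivlMr//; apply: le_lt_trans.
apply: ler_wpM2l => //.
have := GM (t, x) (conj t0 Ox); rewrite /before/= ltrDl => /(_ ltr01).
have := ler_norm M; lra.
Qed.

Lemma trz_tr0 F t : trz F -> 0 < t -> tr0 Om (fun x => F (t, x)).
Proof.
move=> tF t0 y by_ e e0.
have := tF t t0 y by_ => /cvgrPdist_lt /(_ e e0).
by rewrite near_withinE; apply: filterS => x h /h; rewrite sub0r normrN.
Qed.

Lemma It_dx0 F j (t : R) : reg F -> trz F -> 0 < t -> It (dx j F) t = 0.
Proof.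
move=> rF tF t0.
rewrite /It (_ : (fun x => _) = 'D_(ebasis j) (fun x => F (t, x))).
  by apply: vol_derive0 => //; [exact: reg_slice|exact: trz_tr0].
by apply/funext => x; rewrite derive_slice.
Qed.

Lemma dxM F G j z : reg F -> reg G -> cyl Om z ->
  dx j (fun z => F z * G z) z = F z * dx j G z + G z * dx j F z.
Proof.
move=> rF rG Qz.
by have [_] := is_derive_mul (C1bd_is_derive (0, ebasis j) rF Qz)
  (C1bd_is_derive (0, ebasis j) rG Qz).
Qed.

Lemma cb_dx F j : reg F -> cb (dx j F).
Proof. by move=> rF; exact: C1bd_derive. Qed.

Lemma cb_dtt F : reg F -> cb (dtt F).
Proof. by move=> rF; exact: C1bd_derive. Qed.

Lemma reg_cb F : reg F -> cb F. Proof. exact: C1bd_bdcont. Qed.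

Lemma It_ibp F G j (t : R) : reg F -> reg G -> trz (fun z => F z * G z) -> 0 < t ->
  It (fun z => F z * dx j G z) t = - It (fun z => dx j F z * G z) t.
Proof.
move=> rF rG tFG t0.
have rFG : reg (fun z => F z * G z) by exact: C1bdM.
apply/eqP; rewrite -subr_eq0 opprK -ItD//; last 2 first.
  by apply: bdcontM; [exact: reg_cb|exact: cb_dx].
  by apply: bdcontM; [exact: cb_dx|exact: reg_cb].
apply/eqP; rewrite -[RHS](It_dx0 j rFG tFG t0); apply: eq_It => x Ox.
by rewrite dxM//; ring.
Qed.

Lemma It_ibp_div F (G : 'I_3 -> V -> R) t : reg F -> (forall j, reg (G j)) ->
  trz F -> 0 < t ->
  It (fun z => F z * \sum_(j < 3) dx j (G j) z) t =
  - It (fun z => \sum_(j < 3) dx j F z * G j z) t.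
Proof.
move=> rF rG tF t0.
rewrite It_sum//; last by move=> j; apply: bdcontM; [exact: cb_dx|exact: reg_cb].
rewrite -sumrN.
rewrite (_ : (fun z => F z * _) = (fun z => \sum_(j < 3) F z * dx j (G j) z)); last first.
  by apply/funext => z; rewrite mulr_sumr.
rewrite It_sum//; last by move=> j; apply: bdcontM; [exact: reg_cb|exact: cb_dx].
apply: eq_bigr => j _; apply: It_ibp => //.
by apply: trz_bounded => //; exact: reg_cb.
Qed.

End TimeIntegrals.

(** * Differential inequalities *)

Section Ode.
Context {R : realType}.

Lemma nincr_derive (F dF : R -> R) (s t : R) : s <= t ->
  (forall r, s <= r <= t -> is_derive r 1 F (dF r)) ->
  (forall r, s <= r <= t -> dF r <= 0) -> F t <= F s.
Proof.
move=> st FdF dF0.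
have cF : {within `[s, t], continuous F}.
  apply: derivable_within_continuous => r; rewrite in_itv/= => rst.
  by have [] := FdF r rst.
have h (r : R) : r \in `]s, t[ -> is_derive r 1 F (dF r).
  by move=> /subset_itv_oo_cc; rewrite in_itv/=; exact: FdF.
have [c cst E] := MVT_segment st h cF.
rewrite -subr_le0 E mulr_le0_ge0 ?subr_ge0//; apply: dF0.
by move: cst; rewrite in_itv.
Qed.

(** Integrating factor [expR (lam * r)]. The resulting exponential is then weakened by
    [1 + x <= expR x]: rational decay is enough, and it makes waiting times computable by a
    division. *)
Lemma gronwall (F dF : R -> R) (s t lam C : R) : 0 < lam -> 0 <= C -> s <= t ->
  (forall r, s <= r <= t -> is_derive r 1 F (dF r)) ->
  (forall r, s <= r <= t -> dF r <= - lam * F r + C) -> 0 <= F s ->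
  F t <= C / lam + F s / (1 + lam * (t - s)).
Proof.
move=> lam0 C0 st FdF dFb Fs0.
have C0' : 0 <= C / lam by rewrite divr_ge0// ltW.
pose E (r : R) := expR (lam * r).
have dE (r : R) : is_derive r 1 E (E r * lam).
  have := is_derive_mul (is_derive_cst lam r 1) (is_derive_id r 1).
  rewrite mulr0 addr0 mulr1 => h.
  exact: (is_derive_comp1 h (is_derive_expR _)).
pose G r := E r * (F r - C / lam).
have dG (r : R) : s <= r <= t -> is_derive r 1 G (E r * (dF r - 0) + (F r - C / lam) * (E r * lam)).
  move=> rst.
  exact: (is_derive_mul (dE r) (is_derive_sub (FdF r rst) (is_derive_cst (C / lam) r 1))).
have : G t <= G s.
  apply: (nincr_derive st dG) => r rst; rewrite subr0.
  have -> : E r * dF r + (F r - C / lam) * (E r * lam) =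
      E r * (dF r - (- lam * F r + C)) by field; rewrite gt_eqF.
  by rewrite mulr_ge0_le0 ?expR_ge0// subr_le0 dFb.
rewrite /G => h.
have Et0 : 0 < E t by exact: expR_gt0.
have EE : E s / E t = (expR (lam * (t - s)))^-1.
  by rewrite /E -expRN -!expRD -expRN; congr expR; ring.
have : F t - C / lam <= E s / E t * (F s - C / lam).
  by rewrite mulrAC ler_pdivlMr// mulrC.
rewrite EE; set k := expR _ => h2.
have k1 : 1 + lam * (t - s) <= k by exact: expR_ge1Dx.
have q0 : 0 < 1 + lam * (t - s).
  by rewrite ltr_pwDl// mulr_ge0 ?subr_ge0// ltW.
have kp : 0 < k by exact: expR_gt0.
have : k^-1 * (F s - C / lam) <= (1 + lam * (t - s))^-1 * F s.
  apply: (@le_trans _ _ (k^-1 * F s)).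
    by rewrite ler_wpM2l ?invr_ge0 ?(ltW kp)// gerBl.
  by rewrite ler_wpM2r// lef_pV2.
rewrite [_^-1 * F s]mulrC; lra.
Qed.

End Ode.

Lemma continuous_freeze (S T : topologicalType) (s : S) (z : S * T) :
  {for z, continuous (fun z => (s, z.2))}.
Proof. by apply: cvg_pair; [exact: cvg_cst|exact: cvg_snd]. Qed.

(** * Calculus of regular fields and the Poincaré inequality *)

Section RegTools.
Context {R : realType}.
Local Notation E3 := 'rV[R]_3.
Local Notation V := (R * 'rV[R]_3)%type.
Local Notation whole := (@whole R).
Variables (Om : set E3).
Hypotheses (oOm : open Om) (bOm : bounded_set Om) (smOm : smooth_boundary Om).
Local Notation cb := (cb Om).
Local Notation reg := (reg Om).
Local Notation It := (It Om).
Let ocyl := open_cyl oOm.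

Lemma reg_cst c : reg (fun=> c). Proof. exact: C1bd_cst. Qed.
Lemma regD F G : reg F -> reg G -> reg (fun z => F z + G z). Proof. exact: C1bdD. Qed.
Lemma regB F G : reg F -> reg G -> reg (fun z => F z - G z). Proof. exact: C1bdB. Qed.
Lemma regN F : reg F -> reg (fun z => - F z). Proof. exact: C1bdN. Qed.
Lemma regM F G : reg F -> reg G -> reg (fun z => F z * G z). Proof. exact: C1bdM. Qed.
Lemma regX n F : reg F -> reg (fun z => F z ^+ n). Proof. exact: C1bd_X. Qed.
Lemma reg_sum (F : 'I_3 -> V -> R) : (forall j, reg (F j)) ->
  reg (fun z => \sum_(j < 3) F j z).
Proof. exact: C1bd_sum. Qed.

Lemma cb_cst c : cb (fun=> c). Proof. exact: bdcont_cst. Qed.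
Lemma cbD F G : cb F -> cb G -> cb (fun z => F z + G z). Proof. exact: bdcontD. Qed.
Lemma cbB F G : cb F -> cb G -> cb (fun z => F z - G z). Proof. exact: bdcontB. Qed.
Lemma cbN F : cb F -> cb (fun z => - F z). Proof. exact: bdcontN. Qed.
Lemma cbM F G : cb F -> cb G -> cb (fun z => F z * G z). Proof. exact: bdcontM. Qed.
Lemma cbX n F : cb F -> cb (fun z => F z ^+ n).
Proof.
move=> cF; elim: n => [|n IH].
  by rewrite (_ : (fun z => _) = fun=> 1); [exact: cb_cst|apply/funext].
rewrite (_ : (fun z => _) = fun z => F z * F z ^+ n); first exact: cbM.
by apply/funext => z; rewrite exprS.
Qed.

Lemma cb_comp F (A : set R) (h : R -> R) : cb F -> closed A ->
  (forall z, cyl Om z -> A (F z)) -> (forall y, A y -> {for y, continuous h}) ->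
  cb (fun z => h (F z)).
Proof. exact: bdcont_comp. Qed.

Lemma reg_comp F (A : set R) (h dh : R -> R) : reg F -> closed A ->
  (forall z, cyl Om z -> A (F z)) -> (forall y, A y -> is_derive y 1 h (dh y)) ->
  (forall y, A y -> {for y, continuous dh}) -> reg (fun z => h (F z)).
Proof. exact: C1bd_comp. Qed.

Lemma reg_inv F m : reg F -> 0 < m -> (forall z, cyl Om z -> m <= F z) ->
  reg (fun z => (F z)^-1).
Proof.
move=> rF m0 mF.
have d (y : R) : m <= y -> is_derive y 1 (fun y => y^-1) (- (y^-1 * y^-1)).
  move=> my; have y0 : y != 0 by rewrite gt_eqF// (lt_le_trans m0).
  apply: DeriveDef; first exact: (@derivableV _ _ id).
  by rewrite (@deriveV _ _ id)//= derive_id /GRing.scale/= mulr1 -exprVn expr2.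
apply: (@reg_comp F [set y | m <= y] (fun y => y^-1) (fun y => - (y^-1 * y^-1))
  rF (@closed_ge R m) mF d).
- move=> y my; have ci := is_derive_continuous (d y my).
  by apply: cvgN; apply: cvgM.
Qed.

Lemma cb_inv F m : cb F -> 0 < m -> (forall z, cyl Om z -> m <= F z) ->
  cb (fun z => (F z)^-1).
Proof.
move=> rF m0 mF; apply: (@cb_comp F [set y | m <= y] (fun y => y^-1) rF (@closed_ge R m) mF).
by move=> y /= my; apply: inv_continuous; rewrite gt_eqF// (lt_le_trans m0).
Qed.

Lemma reg_ln F m : reg F -> 0 < m -> (forall z, cyl Om z -> m <= F z) ->
  reg (fun z => ln (F z)).
Proof.
move=> rF m0 mF; apply: (@reg_comp F [set y | m <= y] (@ln R) (fun y => y^-1) rF (@closed_ge R m) mF).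
- by move=> y my; apply: is_derive1_ln; exact: lt_le_trans my.
- by move=> y /= my; apply: inv_continuous; rewrite gt_eqF// (lt_le_trans m0).
Qed.

Lemma reg_is_derive F v z : reg F -> cyl Om z -> is_derive z v F ('D_v F z).
Proof. exact: C1bd_is_derive. Qed.

(** Time is frozen at [s]. Frozen fields serve to compare two times inside one integral and to
    extend the boundary data independently of time. *)
Definition fz (s : R) (F : V -> R) : V -> R := fun z => F (s, z.2).

Lemma is_derive_fz (F : V -> R) (s : R) (z v : V) : reg F -> 0 < s -> Om z.2 ->
  is_derive z v (fz s F) ('D_(0, v.2) F (s, z.2)).
Proof.
move=> rF s0 Oz.
have [h1 _] : is_derive (s, z.2) (0, v.2) F ('D_(0, v.2) F (s, z.2)).
  by apply: reg_is_derive.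
have E : (fun h : R => h^-1 *: ((fz s F \o shift z) (h *: v) - fz s F z))
  = (fun h => h^-1 *: ((F \o shift (s, z.2)) (h *: (0, v.2)) - F (s, z.2))).
  apply/funext => h /=; rewrite /fz/=; congr (_ *: (F _ - _)).
  by congr pair; rewrite /= scaler0 add0r.
by apply: DeriveDef; rewrite /derivable /derive E.
Qed.

Lemma cb_fz F s : cb F -> 0 < s -> cb (fz s F).
Proof.
move=> [cF bF] s0; split=> [z Qz|b].
  apply: (@continuous_comp _ _ _ (fun z : V => (s, z.2)) F).
    exact: continuous_freeze.
  exact: (cF (s, z.2) (conj s0 Qz.2)).
have [M FM] := bF (s + 1); exists M => z [_ Oz] _.
by apply: FM; [split|rewrite /before/= ltrDl].
Qed.

Lemma reg_fz F s : reg F -> 0 < s -> reg (fz s F).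
Proof.
move=> rF s0.
apply: (@C1bd_intro _ _ _ _ _ ocyl _ (fun v => fz s ('D_(0, v.2) F))).
- by apply: cb_fz => //; exact: reg_cb.
- by move=> z v [_ Oz]; exact: is_derive_fz.
- by move=> v; apply: cb_fz => //; exact: C1bd_derive.
Qed.

Lemma dx_fz F s j z : reg F -> 0 < s -> cyl Om z -> dx j (fz s F) z = dx j F (s, z.2).
Proof. by move=> rF s0 [_ Oz]; have [_] := is_derive_fz (0, ebasis j) rF s0 Oz. Qed.

Lemma dtt_fz F s z : reg F -> 0 < s -> cyl Om z -> dtt (fz s F) z = 0.
Proof.
move=> rF s0 [_ Oz]; have [_ E] := is_derive_fz (1, 0) rF s0 Oz.
rewrite /dtt E /= (_ : (0, 0) = 0 :> V)//; exact: derive0.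
Qed.

Lemma btr_fz F s b : btr Om F b -> 0 < s -> btr Om (fz s F) b.
Proof. by move=> hF s0 t _ y by_; exact: hF. Qed.

Lemma reg_static (f : E3 -> R) : C1bd setT whole f -> reg (fun z => f z.2).
Proof.
move=> [bf df].
have cbs (g : E3 -> R) : bdcont setT whole g -> cb (fun z => g z.2).
  move=> [cg bg]; split=> [z _|b].
    apply: (@continuous_comp _ _ _ (fun z : V => z.2) g); first exact: cvg_snd.
    exact: cg.
  by have [M gM] := bg tt; exists M => z _ _; exact: gM.
have d z v : is_derive z v (fun z : V => f z.2) ('D_(v.2) f z.2).
  have [h1 _] : is_derive z.2 v.2 f ('D_(v.2) f z.2) by apply/derivableP/(df v.2).1.
  by apply: DeriveDef.
apply: (@C1bd_intro _ _ _ _ _ ocyl _ (fun v z => 'D_(v.2) f z.2)).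
- exact: cbs.
- by move=> v; exact: (cbs _ (df v.2).2).
Qed.

Lemma dx_static (f : E3 -> R) j z : dx j (fun z => f z.2) z = 'D_(ebasis j) f z.2.
Proof. by []. Qed.

Lemma reg_coord k : reg (fun z => z.2 0 k).
Proof.
have [M OM] := bounded_dom_lt bOm.
have d (z v : V) : is_derive z v (fun z : V => z.2 0 k) (v.2 0 k).
  by have [h1 h2] := is_derive_coord z.2 v.2 k; apply: DeriveDef.
apply: (@C1bd_intro _ _ _ _ _ ocyl _ (fun v _ => v.2 0 k)).
- split=> [z _|b].
    apply: (@continuous_comp _ _ _ (fun z : V => z.2) (fun x : E3 => x 0 k)).
      exact: cvg_snd.
    exact: coord_continuous.
  exists M => z [_ Oz] _.
  by rewrite (le_trans (le_norm3 _ _))// ltW// OM.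
- by move=> v; exact: bdcont_cst.
Qed.

Lemma dx_coord0 z : dx 0 (fun z : V => z.2 0 0) z = 1.
Proof.
have [h1 h2] := is_derive_coord z.2 (ebasis 0) 0.
by apply: etrans h2 _; rewrite mxE.
Qed.

(** The derivative along the first axis of [x_0 * F ^+ 2] integrates to 0. Hence the integral of
    [F ^+ 2] equals that of [- 2 * x_0 * F * dx 0 F], which is absorbed by Young's inequality with
    [M] bounding [x_0]. The 1 added to the constant only secures [1 <= CP]. *)
Lemma poincare : exists2 CP, 1 <= CP & forall F t, reg F -> trz Om F -> 0 < t ->
  It (fun z => F z ^+ 2) t <= CP * It (fun z => \sum_(j < 3) dx j F z ^+ 2) t.
Proof.
have [M OM] := bounded_dom_lt bOm.
exists (4 * M ^+ 2 + 1) => [|F t rF tF t0]; first by rewrite lerDr mulr_ge0// sqr_ge0.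
have cF := reg_cb rF; have cdF j := cb_dx j rF.
have rx := reg_coord 0.
have i0 : It (dx 0 (fun z => z.2 0 0 * (F z * F z))) t = 0.
  apply: (It_dx0 oOm bOm smOm 0 (regM rx (regM rF rF))); last exact: t0.
  have cx := reg_cb rx.
  have -> : (fun z : V => z.2 0 0 * (F z * F z)) = (fun z => F z * (z.2 0 0 * F z)).
    by apply/funext => z; ring.
  by apply: trz_bounded => //; exact: cbM.
have e0 : It (fun z => 1 / 2 * F z ^+ 2) t <=
    It (fun z => dx 0 (fun z => z.2 0 0 * (F z * F z)) z +
      (2 * M ^+ 2) * \sum_(j < 3) dx j F z ^+ 2) t.
  apply: It_le => //.
  - by apply: cbM; [exact: cb_cst|exact: cbX].
  - apply: cbD; first exact: (cb_dx 0 (regM rx (regM rF rF))).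
    by apply: cbM; [exact: cb_cst|apply: cb_sum => j; exact: cbX].
  move=> x Ox; have Qz : cyl Om (t, x) by [].
  rewrite (dxM 0 rx (regM rF rF) Qz) (dxM 0 rF rF Qz) dx_coord0/=.
  have xM : x 0 0 ^+ 2 <= M ^+ 2.
    rewrite -[leLHS]real_normK ?num_real//.
    have h := le_trans (le_norm3 x 0) (ltW (OM x Ox)).
    by apply: lerXn2r => //; rewrite nnegrE// (le_trans _ h).
  have s0 : dx 0 F (t, x) ^+ 2 <= \sum_(j < 3) dx j F (t, x) ^+ 2.
    by rewrite (bigD1 0)//= lerDl; apply: sumr_ge0 => i _; exact: sqr_ge0.
  have h1 : x 0 0 ^+ 2 * dx 0 F (t, x) ^+ 2 <= M ^+ 2 * \sum_(j < 3) dx j F (t, x) ^+ 2.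
    by apply: ler_pM => //; exact: sqr_ge0.
  rewrite -[2 * M ^+ 2 * _]mulrA; move: h1; move: (M ^+ 2 * _) => B; move: (x 0 0) (dx 0 F (t, x)) (F (t, x)) => a b f.
  have := sqr_ge0 (f + 2 * a * b); lra.
move: e0; rewrite ItD//; last 2 first.
- exact: (cb_dx 0 (regM rx (regM rF rF))).
- by apply: cbM; [exact: cb_cst|apply: cb_sum => j; exact: cbX].
rewrite i0 add0r !ItZ//; last 2 first.
- by apply: cb_sum => j; exact: cbX.
- exact: cbX.
have : 0 <= It (fun z => \sum_(j < 3) dx j F z ^+ 2) t.
  by apply: It_ge0 => x _; apply: sumr_ge0 => j _; exact: sqr_ge0.
move: (It _ t) (It _ t) (M ^+ 2) => A B C; lra.
Qed.

End RegTools.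

Ltac atomtac := match goal with
  | h : reg _ ?F |- reg _ ?F => exact h
  | h : cb _ ?F |- cb _ ?F => exact h
  | h : reg _ ?F |- cb _ ?F => exact (reg_cb h)
  | h : reg _ ?F |- reg _ (fun z => ?F z) => exact h
  | h : cb _ ?F |- cb _ (fun z => ?F z) => exact h
  | h : forall j, reg _ (?F j) |- reg _ (?F _) => exact (h _)
  | h : forall j, reg _ (?F j) |- reg _ (fun z => ?F _ z) => exact (h _)
  | h : forall j, cb _ (?F j) |- cb _ (?F _) => exact (h _)
  | h : forall j, cb _ (?F j) |- cb _ (fun z => ?F _ z) => exact (h _)
  | h : forall j, reg _ (dx j ?F) |- reg _ (dx _ ?F) => exact (h _)
  | h : forall j, reg _ (dx j ?F) |- reg _ (fun z => dx _ ?F z) => exact (h _)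
  | h : forall k j, reg _ (dx j (?F k)) |- reg _ (dx _ (?F _)) => exact (h _ _)
  | h : forall k j, reg _ (dx j (?F k)) |- reg _ (fun z => dx _ (?F _) z) => exact (h _ _)
  end.

Ltac regtac := repeat (first [ atomtac |
  match goal with
  | oO : open ?O |- reg ?O (fun _ => ?c) => exact (reg_cst oO c)
  | oO : open ?O |- reg ?O (fun z => @?F z + - (@?G z)) => apply (@regB _ _ oO F G)
  | oO : open ?O |- reg ?O (fun z => @?F z + @?G z) => apply (@regD _ _ oO F G)
  | oO : open ?O |- reg ?O (fun z => - (@?F z)) => apply (@regN _ _ oO F)
  | oO : open ?O |- reg ?O (fun z => @?F z * @?G z) => apply (@regM _ _ oO F G)
  | oO : open ?O |- reg ?O (fun z => @?F z ^+ ?n) => apply (@regX _ _ oO n F)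
  | oO : open ?O |- reg ?O (fun z => bigop.body _ _ _) => (apply (reg_sum oO); intro)
  | |- cb _ (fun _ => ?c) => exact (cb_cst _ c)
  | |- cb ?O (fun z => @?F z + - (@?G z)) => apply (@cbB _ O F G)
  | |- cb ?O (fun z => @?F z + @?G z) => apply (@cbD _ O F G)
  | |- cb ?O (fun z => - (@?F z)) => apply (@cbN _ O F)
  | |- cb ?O (fun z => @?F z * @?G z) => apply (@cbM _ O F G)
  | |- cb ?O (fun z => @?F z ^+ ?n) => apply (@cbX _ O n F)
  | |- cb ?O (dx ?j ?F) => apply (@cb_dx _ O F j)
  | |- cb ?O (fun z => dx ?j ?F z) => apply (@cb_dx _ O F j)
  | |- cb ?O (dtt ?F) => apply (@cb_dtt _ O F)
  | |- cb ?O (fun z => dtt ?F z) => apply (@cb_dtt _ O F)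
  | |- cb _ (fun z => bigop.body _ _ _) => (apply cb_sum; intro)
  | |- cb _ _ => apply reg_cb
  end ]; cbv beta).

(** * Transport terms and the weak form of the concentration equations *)

Section Transport.
Context {R : realType}.
Local Notation E3 := 'rV[R]_3.
Local Notation V := (R * 'rV[R]_3)%type.
Variables (Om : set E3).
Hypotheses (oOm : open Om) (bOm : bounded_set Om) (smOm : smooth_boundary Om).
Local Notation cb := (cb Om).
Local Notation reg := (reg Om).
Local Notation It := (It Om).

Variables (u : 'I_3 -> V -> R) (Phi : V -> R).
Hypotheses (ru : forall j, reg (u j)) (tu : forall j, trz Om (u j)).
Hypothesis divu : forall q, cyl Om q -> \sum_(j < 3) dx j (u j) q = 0.
Hypotheses (rPhi : reg Phi) (rdPhi : forall j, reg (dx j Phi)).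

(** As [u] is divergence-free, the integrand is the divergence of [F] times [u], and [u] vanishes on
    the boundary. *)
Lemma conv0 F t : reg F -> 0 < t -> It (fun q => \sum_(j < 3) u j q * dx j F q) t = 0.
Proof.
move=> rF t0.
transitivity (It (fun q => \sum_(j < 3) dx j (fun q => u j q * F q) q) t).
  apply: eq_It => x Ox; have Qx : cyl Om (t, x) by [].
  rewrite [RHS](eq_bigr (fun j => u j (t, x) * dx j F (t, x) + F (t, x) * dx j (u j) (t, x))).
    by rewrite big_split/= -mulr_sumr divu// mulr0 addr0.
  by move=> j _; rewrite (dxM j (ru j) rF Qx).
rewrite (It_sum oOm bOm)//; last by move=> j; apply: cb_dx; regtac.
rewrite big1// => j _; apply: (It_dx0 oOm bOm smOm j _ _ t0); first by regtac.
by apply: trz_bounded => //; exact: reg_cb.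
Qed.

(** The number [z] is the valence: 1 for [c1] and -1 for [c2]. *)
Definition flux (z : R) (c : V -> R) (j : 'I_3) (q : V) := dx j c q + z * (c q * dx j Phi q).

Record species (z D : R) (c : V -> R) : Prop := Species {
  sp_reg : reg c;
  sp_dreg : forall j, reg (dx j c);
  sp_ge0 : forall q, cyl Om q -> 0 <= c q;
  sp_eq : forall q, cyl Om q -> dtt c q + \sum_(j < 3) u j q * dx j c q =
    D * \sum_(j < 3) dx j (flux z c j) q }.

Lemma reg_flux z c j : reg c -> (forall j, reg (dx j c)) -> reg (flux z c j).
Proof. by move=> rc rdc; rewrite /flux; regtac. Qed.

Lemma species_test z D c phi t : species z D c -> reg phi -> trz Om phi -> 0 < t ->
  It (fun q => phi q * dtt c q) t =
  - D * It (fun q => \sum_(j < 3) dx j phi q * flux z c j q) t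
  - It (fun q => phi q * \sum_(j < 3) u j q * dx j c q) t.
Proof.
move=> [rc rdc _ ec] rphi tphi t0.
have rfl j := @reg_flux z c j rc rdc.
have cs : cb (fun q => \sum_(j < 3) dx j (flux z c j) q) by regtac.
have cs2 : cb (fun q => \sum_(j < 3) u j q * dx j c q) by regtac.
transitivity (It (fun q => D * (phi q * \sum_(j < 3) dx j (flux z c j) q) -
    phi q * \sum_(j < 3) u j q * dx j c q) t).
  apply: eq_It => x Ox; have := ec (t, x) (conj t0 Ox).
  move/(canRL (addrK _)) => ->; ring.
have c1 : cb (fun q => phi q * \sum_(j < 3) dx j (flux z c j) q) by regtac.
rewrite (ItB oOm bOm)//; [|by regtac|by regtac].
by rewrite (ItZ oOm bOm)// (It_ibp_div oOm bOm smOm rphi rfl tphi t0) mulrN mulNr.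
Qed.

End Transport.

(** * Decay of the excess concentration *)

Section Decay.
Context {R : realType}.
Local Notation E3 := 'rV[R]_3.
Local Notation V := (R * 'rV[R]_3)%type.
Variables (Om : set E3).
Hypotheses (oOm : open Om) (bOm : bounded_set Om) (smOm : smooth_boundary Om).
Local Notation cb := (cb Om).
Local Notation reg := (reg Om).
Local Notation It := (It Om).

Variable G0 : R.
Definition exc (c : V -> R) (q : V) := pos (c q - G0).

Lemma reg_excX n c : reg c -> reg (fun q => exc c q ^+ n.+2).
Proof.
move=> rc; have h : reg (fun q => c q - G0) by regtac.
exact: (@C1bd_pos _ _ _ _ _ n (fun q => c q - G0) (open_cyl oOm) h).
Qed.

Lemma cb_excX n c : reg c -> cb (fun q => exc c q ^+ n).
Proof.
move=> rc; apply: cbX.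
apply: (@cb_comp _ _ (fun q => c q - G0) setT pos) => //; first by regtac.
by move=> y _; exact: pos_continuous.
Qed.

Lemma D_excX v n c q : reg c -> cyl Om q ->
  'D_v (fun q => exc c q ^+ n.+2) q = n.+2%:R * exc c q ^+ n.+1 * 'D_v c q.
Proof.
move=> rc Qq.
have rcG : reg (fun q => c q - G0) by regtac.
have h1 := is_derive_sub (reg_is_derive v rc Qq) (is_derive_cst G0 q v).
have [_ E] := is_derive_comp1 h1 (is_derive_pos n (c q - G0)).
by apply: etrans E _; rewrite subr0.
Qed.

Lemma trz_excX n c g : btr Om c g -> (forall y, boundary Om y -> g y <= G0) ->
  trz Om (fun q => exc c q ^+ n.+1).
Proof.
move=> tc gG.
apply: (@btr_eq _ _ (fun q => pos (c q - G0) ^+ n.+1) _ (fun y => pos (g y - G0) ^+ n.+1)) => //.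
  apply: (@btr_comp _ _ (fun q => c q - G0) (fun y => g y - G0) (fun s => pos s ^+ n.+1)).
    by apply: btrB => //; exact: btr_cst.
  by move=> y _; exact: continuous_posX.
by move=> y by_; rewrite pos_0 ?expr0n// subr_le0 gG.
Qed.

Variables (u : 'I_3 -> V -> R) (Phi : V -> R).
Hypotheses (ru : forall j, reg (u j)) (tu : forall j, trz Om (u j)).
Hypothesis divu : forall q, cyl Om q -> \sum_(j < 3) dx j (u j) q = 0.
Hypotheses (rPhi : reg Phi) (rdPhi : forall j, reg (dx j Phi)).

Variables (D1 D2 eps CP : R) (c1 c2 : V -> R) (g1 g2 : E3 -> R).
Hypotheses (D10 : 0 < D1) (D20 : 0 < D2) (eps0 : 0 < eps) (CP1 : 1 <= CP).
Hypotheses (sc1 : species Om u Phi 1 D1 c1) (sc2 : species Om u Phi (-1) D2 c2).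
Hypotheses (t1 : btr Om c1 g1) (t2 : btr Om c2 g2).
Hypothesis poin : forall F t, reg F -> trz Om F -> 0 < t ->
  It (fun z => F z ^+ 2) t <= CP * It (fun z => \sum_(j < 3) dx j F z ^+ 2) t.
Hypothesis poisson : forall q, cyl Om q ->
  - eps * \sum_(j < 3) dx j (dx j Phi) q = c1 q - c2 q.
Hypotheses (G00 : 0 <= G0) (g1G : forall y, boundary Om y -> g1 y <= G0)
  (g2G : forall y, boundary Om y -> g2 y <= G0).

(** The weights cancel the diffusivities in the time derivative, so that the drift terms of the two
    species enter with equal weight and opposite signs. *)
Definition Yd (q : V) := exc c1 q ^+ 4 / (4 * D1) + exc c2 q ^+ 4 / (4 * D2).

Lemma reg_Yd : reg Yd.
Proof.
have rc1 := sp_reg sc1; have rc2 := sp_reg sc2.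
have e1 := reg_excX 2 rc1; have e2 := reg_excX 2 rc2.
by rewrite /Yd; regtac.
Qed.

(** As a function of the value of [c], this is a primitive of [3 * exc c ^+ 2 * c]. It turns the
    drift term, [c] times the gradient of [exc c ^+ 3] against that of [Phi], into the gradient of
    [Hc c] against that of [Phi], ready for integration by parts. *)
Let Hc (c : V -> R) (q : V) := 3 / 4 * exc c q ^+ 4 + G0 * exc c q ^+ 3.

Lemma exc_decay z D c g t : D != 0 -> species Om u Phi z D c -> btr Om c g ->
  (forall y, boundary Om y -> g y <= G0) -> 0 < t ->
  It (fun q => exc c q ^+ 3 * dtt c q) t =
  - D * It (fun q => \sum_(j < 3) (3 / 4 * dx j (fun q => exc c q ^+ 2) q ^+ 2 +
      z * (dx j (Hc c) q * dx j Phi q))) t.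
Proof.
move=> D0 sc tc gG t0; have rc := sp_reg sc.
have e0 := reg_excX 0 rc; have e1 := reg_excX 1 rc; have e2 := reg_excX 2 rc.
have rH : reg (Hc c) by rewrite /Hc; regtac.
rewrite (species_test oOm bOm smOm ru rdPhi sc e1 (trz_excX 2 tc gG) t0).
have -> : It (fun q => exc c q ^+ 3 * \sum_(j < 3) u j q * dx j c q) t = 0.
  transitivity (It (fun q => \sum_(j < 3) u j q * dx j (fun q => 1 / 4 * exc c q ^+ 4) q) t).
    apply: eq_It => x Ox; have Qx : cyl Om (t, x) by [].
    rewrite mulr_sumr; apply: eq_bigr => j _.
    rewrite (dxM j (reg_cst oOm (1 / 4)) e2 Qx) {2}/dx (D_excX _ 2 rc Qx).
    have -> : dx j (fun=> 1 / 4 : R) (t, x) = 0 by exact: derive_cst.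
    rewrite -/(dx j c (t, x)); by field.
  have r4 : reg (fun q => 1 / 4 * exc c q ^+ 4) by regtac.
  exact: (conv0 oOm bOm smOm ru tu divu r4 t0).
rewrite subr0; congr (_ * _); apply: eq_It => x Ox; have Qx : cyl Om (t, x) by [].
apply: eq_bigr => j _; rewrite /flux.
have -> : dx j (Hc c) (t, x) = 3 * exc c (t, x) ^+ 2 * (exc c (t, x) + G0) * dx j c (t, x).
  have h1 := is_derive_mul (is_derive_cst (3 / 4 : R) (t, x) (0, ebasis j)) (reg_is_derive (0, ebasis j) e2 Qx).
  have h2 := is_derive_mul (is_derive_cst G0 (t, x) (0, ebasis j)) (reg_is_derive (0, ebasis j) e1 Qx).
  have [_ E] := is_derive_add h1 h2; apply: etrans E _.
  rewrite (D_excX _ 2 rc Qx) (D_excX _ 1 rc Qx) -/(dx j c (t, x)) /cst; by field.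
rewrite [dx j (fun q => exc c q ^+ 3) _](D_excX _ 1 rc Qx).
rewrite [dx j (fun q => exc c q ^+ 2) _](D_excX _ 0 rc Qx) -/(dx j c (t, x)).
have cexc : exc c (t, x) ^+ 2 * (exc c (t, x) + G0) = exc c (t, x) ^+ 2 * c (t, x).
  rewrite /exc; have [h|h] := leP 0 (c (t, x) - G0).
    by rewrite pos_id// subrK.
  by rewrite pos_0 ?ltW// expr0n !mul0r.
rewrite -[3 * _ * (_ + _)]mulrA cexc; by field.
Qed.

(** After integration by parts and Poisson's equation, the drift terms contribute
    [- (Hc c1 - Hc c2) * (c1 - c2) / eps], which is nonpositive because [Hc] increases with the
    concentration. Diffusion alone then gives the rate, by the Poincaré inequality for [exc c ^+ 2];
    hence the rate does not involve [eps]. *)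
Lemma excess_decay t : 0 < t ->
  It (dtt Yd) t <= - (3 * Num.min D1 D2 / CP) * It Yd t.
Proof.
move=> t0.
have rc1 := sp_reg sc1; have rc2 := sp_reg sc2.
have e01 := reg_excX 0 rc1; have e02 := reg_excX 0 rc2.
have e11 := reg_excX 1 rc1; have e12 := reg_excX 1 rc2.
have e21 := reg_excX 2 rc1; have e22 := reg_excX 2 rc2.
have rH1 : reg (Hc c1) by rewrite /Hc; regtac.
have rH2 : reg (Hc c2) by rewrite /Hc; regtac.
have D1n : D1 != 0 by rewrite gt_eqF.
have D2n : D2 != 0 by rewrite gt_eqF.
pose v1 := fun q => exc c1 q ^+ 2; pose v2 := fun q => exc c2 q ^+ 2.
pose A1 := It (fun q => \sum_(j < 3) dx j v1 q ^+ 2) t.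
pose A2 := It (fun q => \sum_(j < 3) dx j v2 q ^+ 2) t.
pose B1 := It (fun q => \sum_(j < 3) dx j (Hc c1) q * dx j Phi q) t.
pose B2 := It (fun q => \sum_(j < 3) dx j (Hc c2) q * dx j Phi q) t.
have rv1 : reg v1 := e01; have rv2 : reg v2 := e02.
have split z c : reg (fun q => exc c q ^+ 2) -> reg (Hc c) ->
    It (fun q => \sum_(j < 3) (3 / 4 * dx j (fun q => exc c q ^+ 2) q ^+ 2 +
      z * (dx j (Hc c) q * dx j Phi q))) t =
    3 / 4 * It (fun q => \sum_(j < 3) dx j (fun q => exc c q ^+ 2) q ^+ 2) t +
    z * It (fun q => \sum_(j < 3) dx j (Hc c) q * dx j Phi q) t.
  move=> r2 rH.
  rewrite -(ItZ oOm bOm (3 / 4)); [|by regtac|exact: t0].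
  rewrite -(ItZ oOm bOm z); [|by regtac|exact: t0].
  rewrite -(ItD oOm bOm); [|by regtac|by regtac|exact: t0].
  by apply: eq_It => x _; rewrite !mulr_sumr -big_split.
have dY : It (dtt Yd) t = - (3 / 4 * A1 + B1) - (3 / 4 * A2 - B2).
  transitivity (It (fun q => D1^-1 * (exc c1 q ^+ 3 * dtt c1 q) +
      D2^-1 * (exc c2 q ^+ 3 * dtt c2 q)) t).
    apply: eq_It => x Ox; have Qx : cyl Om (t, x) by [].
    have h1 := is_derive_mul (reg_is_derive (1, 0) e21 Qx) (is_derive_cst (4 * D1)^-1 (t, x) (1, 0)).
    have h2 := is_derive_mul (reg_is_derive (1, 0) e22 Qx) (is_derive_cst (4 * D2)^-1 (t, x) (1, 0)).
    have [_ E] := is_derive_add h1 h2; apply: etrans E _.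
    rewrite (D_excX _ 2 rc1 Qx) (D_excX _ 2 rc2 Qx) -/(dtt c1 (t, x)) -/(dtt c2 (t, x)) /cst.
    by field; rewrite D1n D2n.
  rewrite (ItD oOm bOm); [|by regtac|by regtac|exact: t0].
  rewrite (ItZ oOm bOm _ (F := fun q => exc c1 q ^+ 3 * dtt c1 q)); [|by regtac|exact: t0].
  rewrite (ItZ oOm bOm _ (F := fun q => exc c2 q ^+ 3 * dtt c2 q)); [|by regtac|exact: t0].
  rewrite (exc_decay D1n sc1 t1 g1G t0) (exc_decay D2n sc2 t2 g2G t0).
  rewrite (split 1 c1 e01 rH1) (split (-1) c2 e02 rH2) -/A1 -/A2 -/B1 -/B2.
  by field; rewrite D1n D2n.
have B12 : 0 <= B1 - B2.
  have tHc c g : btr Om c g -> (forall y, boundary Om y -> g y <= G0) -> trz Om (Hc c).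
    move=> tc gG.
    have h : btr Om (Hc c) (fun=> 3 / 4 * 0 + G0 * 0).
      exact (btrD (btrM (@btr_cst R Om (3 / 4)) (trz_excX 3 tc gG))
        (btrM (@btr_cst R Om G0) (trz_excX 2 tc gG))).
    apply: (@btr_eq _ _ _ _ _ _ h) => //.
    by move=> y _; rewrite !mulr0 addr0.
  have t12 : trz Om (fun q => Hc c1 q - Hc c2 q).
    have h : btr Om (fun q => Hc c1 q - Hc c2 q) (fun=> 0 - 0).
      exact (btrB (tHc _ _ t1 g1G) (tHc _ _ t2 g2G)).
    apply: (@btr_eq _ _ _ _ _ _ h) => // y _.
    by rewrite subrr.
  have r12 : reg (fun q => Hc c1 q - Hc c2 q) by regtac.
  have -> : B1 - B2 = It (fun q => \sum_(j < 3) dx j (fun q => Hc c1 q - Hc c2 q) q * dx j Phi q) t.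
    rewrite -(ItB oOm bOm); [|by regtac|by regtac|exact: t0].
    apply: eq_It => x Ox; have Qx : cyl Om (t, x) by [].
    rewrite -sumrB; apply: eq_bigr => j _.
    have [_ E] := is_derive_sub (reg_is_derive (0, ebasis j) rH1 Qx) (reg_is_derive (0, ebasis j) rH2 Qx).
    by rewrite [X in _ = X * _]E -mulrBl.
  rewrite -[leRHS]opprK -(It_ibp_div oOm bOm smOm r12 rdPhi t12 t0) oppr_ge0.
  rewrite -oppr_ge0 -(ItN oOm bOm); [|by regtac|exact: t0].
  apply: It_ge0 => x Ox; have Qx : cyl Om (t, x) by [].
  have := poisson Qx; have c10 := sp_ge0 sc1 Qx; have c20 := sp_ge0 sc2 Qx.
  set L := \sum_(j < 3) _ => hL.
  have mono a b : a <= b -> 3 / 4 * pos (a - G0) ^+ 4 + G0 * pos (a - G0) ^+ 3 <=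
      3 / 4 * pos (b - G0) ^+ 4 + G0 * pos (b - G0) ^+ 3.
    move=> ab.
    have pab : pos (a - G0) <= pos (b - G0).
      rewrite /pos ge_max !le_max lexx orbT andbT; apply/orP; left; lra.
    by apply: lerD; rewrite ler_wpM2l//; apply: lerXn2r => //; rewrite nnegrE pos_ge0.
  suff : 0 <= (Hc c1 (t, x) - Hc c2 (t, x)) * (- eps * L).
    by rewrite mulrCA mulNr !oppr_ge0 pmulr_rle0.
  rewrite hL; have [h|h] := leP (c1 (t, x)) (c2 (t, x)).
    by apply: mulr_le0; rewrite subr_le0//; exact: mono.
  by apply: mulr_ge0; rewrite subr_ge0 ?(ltW h)//; apply: mono; exact: ltW.
have p1 := poin rv1 (trz_excX 1 t1 g1G) t0.
have p2 := poin rv2 (trz_excX 1 t2 g2G) t0.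
have E1 : It (fun q => v1 q ^+ 2) t = It (fun q => exc c1 q ^+ 4) t.
  by apply: eq_It => x _; rewrite /v1 -exprM.
have E2 : It (fun q => v2 q ^+ 2) t = It (fun q => exc c2 q ^+ 4) t.
  by apply: eq_It => x _; rewrite /v2 -exprM.
rewrite -/A1 E1 in p1; rewrite -/A2 E2 in p2.
have YE : It Yd t = (4 * D1)^-1 * It (fun q => exc c1 q ^+ 4) t +
    (4 * D2)^-1 * It (fun q => exc c2 q ^+ 4) t.
  rewrite -(ItZ oOm bOm); [|by regtac|exact: t0].
  rewrite -(ItZ oOm bOm (4 * D2)^-1); [|by regtac|exact: t0].
  rewrite -(ItD oOm bOm); [|by regtac|by regtac|exact: t0].
  by apply: eq_It => x _; rewrite /Yd; congr (_ + _); rewrite mulrC.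
rewrite dY YE; clear dY YE E1 E2.
have Q1 : 0 <= It (fun q => exc c1 q ^+ 4) t.
  by apply: It_ge0 => x _; rewrite exprn_ge0// pos_ge0.
have Q2 : 0 <= It (fun q => exc c2 q ^+ 4) t.
  by apply: It_ge0 => x _; rewrite exprn_ge0// pos_ge0.
move: p1 p2 B12 Q1 Q2; move: (It _ t) (It _ t) A1 A2 B1 B2 => a b A1 A2 B1 B2 p1 p2 B12 a0 b0.
have CP0 : 0 < CP by exact: lt_le_trans ltr01 CP1.
have aux D x A : 0 < D -> 0 <= x -> x <= CP * A -> 3 * Num.min D1 D2 / CP * ((4 * D)^-1 * x) <= 3 / 4 * A * (Num.min D1 D2 / D).
  move=> D0 x0 xA.
  have -> : 3 * Num.min D1 D2 / CP * ((4 * D)^-1 * x) = 3 / 4 * (x / CP) * (Num.min D1 D2 / D).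
    by field; rewrite !gt_eqF.
  apply: ler_wpM2r; first by rewrite divr_ge0 ?(ltW D0)// le_min !ltW.
  by rewrite ler_wpM2l// ler_pdivrMr// mulrC.
have q1 := aux D1 b A1 D10 a0 p1.
have q2 := aux D2 a A2 D20 b0 p2.
have A10 : 0 <= A1 by rewrite -(pmulr_rge0 _ CP0); exact: le_trans p1.
have A20 : 0 <= A2 by rewrite -(pmulr_rge0 _ CP0); exact: le_trans p2.
have r1 : 3 / 4 * A1 * (Num.min D1 D2 / D1) <= 3 / 4 * A1.
  by rewrite ler_piMr// ?mulr_ge0// ler_pdivrMr// mul1r ge_min lexx.
have r2 : 3 / 4 * A2 * (Num.min D1 D2 / D2) <= 3 / 4 * A2.
  by rewrite ler_piMr// ?mulr_ge0// ler_pdivrMr// mul1r ge_min lexx orbT.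
rewrite mulNr mulrDr; lra.
Qed.

End Decay.

(** * Free energy *)

Section SpeciesEnergy.
Context {R : realType}.
Local Notation E3 := 'rV[R]_3.
Local Notation V := (R * 'rV[R]_3)%type.
Variables (Om : set E3).
Hypotheses (oOm : open Om) (bOm : bounded_set Om) (smOm : smooth_boundary Om).
Local Notation cb := (cb Om).
Local Notation reg := (reg Om).
Local Notation It := (It Om).

Record static (M : R) (f : V -> R) : Prop := Static {
  st_reg : reg f;
  st_time : forall s t x, f (s, x) = f (t, x);
  st_bound : forall q, cyl Om q -> `|f q| <= M;
  st_dbound : forall j q, cyl Om q -> `|dx j f q| <= M }.

(** Here [P] is the drift of the shifted concentration [a], [P - z * (e * q)] the true flux and
    [P / a - v] a derivative of the test function. Half of [P ^+ 2 / a] survives Young's inequality;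
    the mismatch between the two fluxes costs [e * q ^+ 2]. *)
Lemma energy_pointwise (P a v q e z : R) : 0 < e -> e <= a -> z ^+ 2 = 1 ->
  - ((P / a - v) * (P - z * (e * q))) <=
  - (1 / 2 * (P ^+ 2 / a)) + 3 / 2 * (e * q ^+ 2) + 3 / 2 * (a * v ^+ 2).
Proof.
move=> e0 ea z1.
have a0 : 0 < a by exact: lt_le_trans ea.
set x := P / a; have -> : P = a * x by rewrite /x; field; rewrite gt_eqF.
have -> : (a * x) ^+ 2 / a = a * x ^+ 2 by field; rewrite gt_eqF.
have h1 : 0 <= a * (x - 2 * v) ^+ 2 by rewrite mulr_ge0 ?sqr_ge0// ltW.
have h2 : 0 <= a * x ^+ 2 - e * x ^+ 2 by rewrite -mulrBl mulr_ge0 ?sqr_ge0// subr_ge0.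
have h3 : 0 <= e * (x - 2 * (z * q)) ^+ 2 by rewrite mulr_ge0 ?sqr_ge0// ltW.
have h4 : 0 <= e * (v + z * q) ^+ 2 by rewrite mulr_ge0 ?sqr_ge0// ltW.
have h5 : 0 <= a * v ^+ 2 - e * v ^+ 2 by rewrite -mulrBl mulr_ge0 ?sqr_ge0// subr_ge0.
have e3 : e * (x - 2 * (z * q)) ^+ 2 = e * x ^+ 2 - 4 * (e * x * (z * q)) + 4 * (e * q ^+ 2).
  transitivity (e * x ^+ 2 - 4 * (e * x * (z * q)) + 4 * (e * q ^+ 2) * z ^+ 2); first ring.
  by rewrite z1 mulr1.
have e4 : e * (v + z * q) ^+ 2 = e * v ^+ 2 + 2 * (e * v * (z * q)) + e * q ^+ 2.
  transitivity (e * v ^+ 2 + 2 * (e * v * (z * q)) + e * q ^+ 2 * z ^+ 2); first ring.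
  by rewrite z1 mulr1.
rewrite e3 in h3; rewrite e4 in h4.
have -> : - ((x - v) * (a * x - z * (e * q))) =
  - (a * x ^+ 2) + (e * x * (z * q)) + a * v * x - e * v * (z * q) by ring.
have e1 : a * (x - 2 * v) ^+ 2 = a * x ^+ 2 - 4 * (a * v * x) + 4 * (a * v ^+ 2) by ring.
rewrite e1 in h1.
move: h1 h2 h3 h4 h5; clear; move: (a * x ^+ 2) (e * x ^+ 2) (e * x * (z * q)) (a * v * x)
  (e * v * (z * q)) (e * q ^+ 2) (a * v ^+ 2) (e * v ^+ 2) => *; lra.
Qed.

Variables (u : 'I_3 -> V -> R) (Phi PhW : V -> R).
Hypotheses (ru : forall j, reg (u j)) (tu : forall j, trz Om (u j)).
Hypothesis divu : forall q, cyl Om q -> \sum_(j < 3) dx j (u j) q = 0.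
Hypotheses (rPhi : reg Phi) (rdPhi : forall j, reg (dx j Phi)).
Variables (M m : R).
Hypotheses (sW : static M PhW) (m0 : 0 < m).
Hypothesis tpsi : trz Om (fun q => Phi q - PhW q).

Variables (eta z D : R) (c Ga : V -> R) (g : E3 -> R).
Hypotheses (eta0 : 0 < eta) (z1 : z ^+ 2 = 1) (D0 : 0 < D).
Hypotheses (sc : species Om u Phi z D c) (sG : static M Ga).
Hypothesis Gam : forall q, cyl Om q -> m <= Ga q.
Hypotheses (tc : btr Om c g) (tG : btr Om Ga g) (g0 : forall y, boundary Om y -> 0 < g y).

Definition drift (j : 'I_3) (q : V) := dx j c q + z * ((c q + eta) * dx j Phi q).
(** Derivative of the reference electrochemical potential [ln (Ga + eta) + z * PhW]. The test
    function [chem + z * (Phi - PhW)] has the derivative [drift / (c + eta) - drag]. *)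
Definition drag (j : 'I_3) (q : V) := dx j Ga q / (Ga q + eta) + z * dx j PhW q.
Definition chem (q : V) := ln (c q + eta) - ln (Ga q + eta).

Let rc := sp_reg sc.
Let rdc := sp_dreg sc.
Let rG := st_reg sG.
Let rW := st_reg sW.

Lemma conc_ge q : cyl Om q -> eta <= c q + eta.
Proof. by move=> Qq; rewrite lerDr; exact: sp_ge0 sc _ Qq. Qed.

Lemma ref_ge q : cyl Om q -> m <= Ga q + eta.
Proof. by move=> Qq; have := Gam Qq; have := ltW eta0; move: (Ga q) => *; lra. Qed.

Lemma reg_lnc : reg (fun q => ln (c q + eta)).
Proof.
have h : reg (fun q => c q + eta) by regtac.
exact: (@reg_ln _ _ oOm (fun q => c q + eta) eta h eta0 conc_ge).
Qed.

Lemma reg_lnG : reg (fun q => ln (Ga q + eta)).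
Proof.
have h : reg (fun q => Ga q + eta) by regtac.
exact: (@reg_ln _ _ oOm (fun q => Ga q + eta) m h m0 ref_ge).
Qed.

Lemma cb_invc : cb (fun q => (c q + eta)^-1).
Proof.
have h : cb (fun q => c q + eta) by regtac.
exact: (@cb_inv _ _ (fun q => c q + eta) eta h eta0 conc_ge).
Qed.

Lemma cb_invG : cb (fun q => (Ga q + eta)^-1).
Proof.
have h : cb (fun q => Ga q + eta) by regtac.
exact: (@cb_inv _ _ (fun q => Ga q + eta) m h m0 ref_ge).
Qed.

Lemma dx_ln (f : V -> R) v q : reg f -> 0 < f q + eta -> cyl Om q ->
  'D_v (fun q => ln (f q + eta)) q = 'D_v f q / (f q + eta).
Proof.
move=> rf f0 Qq.
have h1 := is_derive_add (reg_is_derive v rf Qq) (is_derive_cst eta q v).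
have [_ E] := is_derive_comp1 h1 (is_derive1_ln f0).
by apply: etrans E _; rewrite addr0 mulrC.
Qed.

Lemma trz_chem : trz Om chem.
Proof.
have cl y : boundary Om y -> {for g y + eta, continuous (@ln R)}.
  by move=> by_; apply: continuous_ln; rewrite addr_gt0// g0.
have h1 : btr Om (fun q => ln (c q + eta)) (fun y => ln (g y + eta)).
  by apply: (@btr_comp _ _ (fun q => c q + eta) (fun y => g y + eta)) => //; apply: btrD => //; exact: btr_cst.
have h2 : btr Om (fun q => ln (Ga q + eta)) (fun y => ln (g y + eta)).
  by apply: (@btr_comp _ _ (fun q => Ga q + eta) (fun y => g y + eta)) => //; apply: btrD => //; exact: btr_cst.
apply: (@btr_eq _ _ _ _ _ _ (btrB h1 h2)) => // y _.
by rewrite subrr.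
Qed.

Lemma drag_bound j q : cyl Om q -> `|drag j q| <= M / m + M.
Proof.
move=> Qq; rewrite /drag (le_trans (ler_normD _ _))//.
have nz : `|z| = 1.
  by apply/eqP; rewrite -sqrp_eq1// real_normK ?num_real// z1.
rewrite !normrM nz mul1r lerD ?(st_dbound sW)//.
have A0 : 0 < Ga q + eta by exact: lt_le_trans (ref_ge Qq).
rewrite normfV (gtr0_norm A0) ler_pM ?invr_ge0 ?(ltW A0)// ?(st_dbound sG)//.
by rewrite lef_pV2//; exact: ref_ge.
Qed.

Lemma cb_drag j : cb (drag j).
Proof. by have := cb_invG; rewrite /drag => h; regtac. Qed.

Lemma reg_drift j : reg (drift j).
Proof. by rewrite /drift; regtac. Qed.

(** The transport terms of [(c + eta) * ln (c + eta) - c] and of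
    [c * (z * (Phi - PhW) - ln (Ga + eta))] integrate to zero by [conv0]. Subtracting them moves the
    derivative from [c] onto [Phi] and onto the reference fields. *)
Lemma chem_convection t : 0 < t ->
  It (fun q => (chem q + z * (Phi q - PhW q)) * \sum_(j < 3) u j q * dx j c q) t =
  It (fun q => c q * \sum_(j < 3) u j q * drag j q) t -
  z * It (fun q => c q * \sum_(j < 3) u j q * dx j Phi q) t.
Proof.
move=> t0.
have rl := reg_lnc; have rlG := reg_lnG; have cd := cb_drag.
have r1 : reg (fun q => (c q + eta) * ln (c q + eta) - c q) by regtac.
have r2 : reg (fun q => c q * (z * (Phi q - PhW q) - ln (Ga q + eta))) by regtac.
have e1 := conv0 oOm bOm smOm ru tu divu r1 t0.
have e2 := conv0 oOm bOm smOm ru tu divu r2 t0.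
set I0 := LHS; have -> : I0 = I0 - 0 - 0 by rewrite !subr0.
rewrite -[X in I0 - X - _]e1 -[X in I0 - _ - X]e2 /I0 => {I0}.
have k1 : cb (fun q => chem q + z * (Phi q - PhW q)) by rewrite /chem; regtac.
have k2 : cb (fun q => (chem q + z * (Phi q - PhW q)) * \sum_(j < 3) u j q * dx j c q) by regtac.
have k3 : cb (fun q => \sum_(j < 3) u j q * dx j (fun q => (c q + eta) * ln (c q + eta) - c q) q).
  by regtac.
have k4 : cb (fun q => \sum_(j < 3) u j q * dx j (fun q => c q * (z * (Phi q - PhW q) - ln (Ga q + eta))) q).
  by regtac.
rewrite -!(ItB oOm bOm)//; [|by regtac].
rewrite -(ItZ oOm bOm z)//; [|by regtac].
rewrite -!(ItB oOm bOm)//; [|by regtac|by regtac].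
apply: eq_It => x Ox; have Qx : cyl Om (t, x) by [].
rewrite !mulr_sumr -!sumrB; apply: eq_bigr => j _.
have c0 : 0 < c (t, x) + eta by exact: lt_le_trans (conc_ge Qx).
have A0 : 0 < Ga (t, x) + eta by exact: lt_le_trans (ref_ge Qx).
have rca : reg (fun q => c q + eta) by regtac.
have h1 := is_derive_sub (is_derive_mul (reg_is_derive (0, ebasis j) rca Qx)
  (reg_is_derive (0, ebasis j) rl Qx)) (reg_is_derive (0, ebasis j) rc Qx).
have [_ E1] := h1.
have h2 := is_derive_mul (reg_is_derive (0, ebasis j) rc Qx)
  (is_derive_sub (is_derive_mul (is_derive_cst z (t, x) (0, ebasis j))
     (is_derive_sub (reg_is_derive (0, ebasis j) rPhi Qx) (reg_is_derive (0, ebasis j) rW Qx)))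
   (reg_is_derive (0, ebasis j) rlG Qx)).
have [_ E2] := h2.
have E3' : 'D_(0, ebasis j) (fun q => c q + eta) (t, x) = 'D_(0, ebasis j) c (t, x).
  have [_ E] := is_derive_add (reg_is_derive (0, ebasis j) rc Qx) (is_derive_cst eta (t, x) (0, ebasis j)).
  by apply: etrans E _; rewrite addr0.
rewrite [X in _ - u j _ * X - _]E1 [X in _ - _ - u j _ * X]E2 /chem /drag.
rewrite E3' (dx_ln _ rc c0 Qx) (dx_ln _ rG A0 Qx) /dx /cst.
by field; rewrite !gt_eqF.
Qed.

(** The last term is kept exactly: added over both species it is the power of the electric force,
    which the Stokes equation cancels later. The factor 9/2 is 3/2 for each of the three
    coordinates. *)
Lemma species_energy t : 0 < t ->
  It (fun q => (chem q + z * (Phi q - PhW q)) * dtt c q) t <=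
  - (D / 2) * It (fun q => \sum_(j < 3) drift j q ^+ 2 / (c q + eta)) t
  + 3 / 2 * D * eta * It (fun q => \sum_(j < 3) dx j Phi q ^+ 2) t
  + 9 / 2 * D * (M / m + M) ^+ 2 * It (fun q => c q + eta) t
  - It (fun q => c q * \sum_(j < 3) u j q * drag j q) t
  + z * It (fun q => c q * \sum_(j < 3) u j q * dx j Phi q) t.
Proof.
move=> t0.
have rl := reg_lnc; have rlG := reg_lnG; have cd := cb_drag; have ci := cb_invc.
have rmu : reg (fun q => chem q + z * (Phi q - PhW q)) by rewrite /chem; regtac.
have tmu : trz Om (fun q => chem q + z * (Phi q - PhW q)).
  have h : btr Om (fun q => chem q + z * (Phi q - PhW q)) (fun=> 0 + z * 0).
    exact (btrD trz_chem (btrM (@btr_cst R Om z) tpsi)).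
  by apply: (@btr_eq _ _ _ _ _ _ h) => // y _; rewrite mulr0 addr0.
rewrite (species_test oOm bOm smOm ru rdPhi sc rmu tmu t0) (chem_convection t0).
suff : - D * It (fun q => \sum_(j < 3) dx j (fun q => chem q + z * (Phi q - PhW q)) q * flux Phi z c j q) t <=
  - (D / 2) * It (fun q => \sum_(j < 3) drift j q ^+ 2 / (c q + eta)) t
  + 3 / 2 * D * eta * It (fun q => \sum_(j < 3) dx j Phi q ^+ 2) t
  + 9 / 2 * D * (M / m + M) ^+ 2 * It (fun q => c q + eta) t.
  move: (It _ t) (It _ t) (It _ t) (It _ t) (It _ t) (It _ t) => *; lra.
have rfl j := @reg_flux _ _ oOm Phi rdPhi z c j rc rdc.
have rdr := reg_drift.
set I0 := It _ t.
have -> : - D * I0 = D * - I0 by ring.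
rewrite /I0 -(ItN oOm bOm)//; [|by regtac].
apply: (@le_trans _ _ (D * It (fun q => - (1 / 2) * (\sum_(j < 3) drift j q ^+ 2 / (c q + eta)) +
   3 / 2 * eta * (\sum_(j < 3) dx j Phi q ^+ 2) + 9 / 2 * (M / m + M) ^+ 2 * (c q + eta)) t)); last first.
  rewrite [X in D * X](ItD oOm bOm)//; [|by regtac|by regtac].
  rewrite [X in D * (X + _)](ItD oOm bOm)//; [|by regtac|by regtac].
  rewrite (ItZ oOm bOm (- (1 / 2)))//; [|by regtac].
  rewrite (ItZ oOm bOm (3 / 2 * eta))//; [|by regtac].
  rewrite (ItZ oOm bOm (9 / 2 * (M / m + M) ^+ 2))//; [|by regtac].
  by move: (It _ t) (It _ t) (It _ t) => *; lra.
apply: ler_wpM2l; first exact: ltW.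
apply: (It_le oOm bOm) => //; [by regtac|by regtac|].
move=> x Ox; have Qx : cyl Om (t, x) by [].
have ca := conc_ge Qx.
have c0 : 0 < c (t, x) + eta by exact: lt_le_trans ca.
have A0 : 0 < Ga (t, x) + eta by exact: lt_le_trans (ref_ge Qx).
have Dmu j : dx j (fun q => chem q + z * (Phi q - PhW q)) (t, x) =
    drift j (t, x) / (c (t, x) + eta) - drag j (t, x).
  have h2 := is_derive_add (is_derive_sub (reg_is_derive (0, ebasis j) rl Qx) (reg_is_derive (0, ebasis j) rlG Qx))
  (is_derive_mul (is_derive_cst z (t, x) (0, ebasis j))
     (is_derive_sub (reg_is_derive (0, ebasis j) rPhi Qx) (reg_is_derive (0, ebasis j) rW Qx))).
  have [_ E2] := h2; apply: etrans E2 _.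
  rewrite (dx_ln _ rc c0 Qx) (dx_ln _ rG A0 Qx) /drift /drag /dx /cst.
  by field; rewrite !gt_eqF.
have key j : - (dx j (fun q => chem q + z * (Phi q - PhW q)) (t, x) * flux Phi z c j (t, x)) <=
   - (1 / 2 * (drift j (t, x) ^+ 2 / (c (t, x) + eta))) + 3 / 2 * (eta * dx j Phi (t, x) ^+ 2)
   + 3 / 2 * ((c (t, x) + eta) * (M / m + M) ^+ 2).
  rewrite Dmu; have -> : flux Phi z c j (t, x) = drift j (t, x) - z * (eta * dx j Phi (t, x)).
    by rewrite /flux /drift; ring.
  apply: le_trans (energy_pointwise _ _ _ eta0 ca z1) _.
  rewrite lerD2l ler_wpM2l// ler_wpM2l ?(ltW c0)//.
  rewrite -[leLHS]real_normK ?num_real//; apply: lerXn2r; rewrite ?nnegrE//; last exact: drag_bound.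
  exact: le_trans (normr_ge0 _) (drag_bound j Qx).
rewrite -sumrN; apply: le_trans (ler_sum _ (fun j _ => key j)) _.
rewrite !big_split/= sumrN -!mulr_sumr sumr_const card_ord.
set S1 := \sum_j _; set S2 := \sum_j _.
have -> : 9 / 2 * (M / m + M) ^+ 2 * (c (t, x) + eta) =
  3 / 2 * ((c (t, x) + eta) * (M / m + M) ^+ 2) * 3 by ring.
have -> : (M / m + M) * ((M / m + M) *+ 3) = (M / m + M) ^+ 2 * 3.
  by rewrite -[_ *+ 3]mulr_natr; ring.
by rewrite [(_ + eta) * (_ * 3)]mulrA; move: (S1) (S2) (_ * _ ^+ 2) => a b k; lra.
Qed.

End SpeciesEnergy.

Lemma eq_It_time (R : realType) (Om : set 'rV[R]_3) (F G : R * 'rV[R]_3 -> R) s t :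
  (forall x, Om x -> F (s, x) = G (t, x)) -> It Om F s = It Om G t.
Proof. exact: eq_vol. Qed.

(* Keeps unification from comparing integrals by unfolding them. *)
Opaque It.

(** * The coupled system and the energy of the field *)

Section System.
Context {R : realType}.
Local Notation E3 := 'rV[R]_3.
Local Notation V := (R * 'rV[R]_3)%type.
Variables (Om : set E3).
Hypotheses (oOm : open Om) (bOm : bounded_set Om) (smOm : smooth_boundary Om).
Local Notation cb := (cb Om).
Local Notation reg := (reg Om).
Local Notation It := (It Om).

Record nps (D1 D2 nu K eps : R) (g1 g2 w : E3 -> R) (c1 c2 Phi : V -> R)
    (u : 'I_3 -> V -> R) (p : V -> R) : Prop := Nps {
  n_c1 : species Om u Phi 1 D1 c1;
  n_c2 : species Om u Phi (-1) D2 c2;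
  n_ru : forall k, reg (u k);
  n_rdu : forall k j, reg (dx j (u k));
  n_tu : forall k, trz Om (u k);
  n_div : forall q, cyl Om q -> \sum_(j < 3) dx j (u j) q = 0;
  n_rPhi : reg Phi;
  n_rdPhi : forall j, reg (dx j Phi);
  n_rp : reg p;
  n_poisson : forall q, cyl Om q -> - eps * \sum_(j < 3) dx j (dx j Phi) q = c1 q - c2 q;
  n_stokes : forall k q, cyl Om q ->
    dtt (u k) q - nu * \sum_(j < 3) dx j (dx j (u k)) q + dx k p q =
    - (K * (c1 q - c2 q)) * dx k Phi q;
  n_t1 : btr Om c1 g1;
  n_t2 : btr Om c2 g2;
  n_tPhi : btr Om Phi w }.

(** Time-independent extensions of the boundary data. The bounds [m] and [M] enter the final
    constant, so one and the same reference has to serve every [eps] and every solution. *)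
Record reference (M m : R) (g1 g2 w : E3 -> R) (Ga1 Ga2 PhW : V -> R) : Prop := Reference {
  r_s1 : static Om M Ga1;
  r_s2 : static Om M Ga2;
  r_sW : static Om M PhW;
  r_m0 : 0 < m;
  r_mM : m <= M;
  r_m1 : forall q, cyl Om q -> m <= Ga1 q;
  r_m2 : forall q, cyl Om q -> m <= Ga2 q;
  r_t1 : btr Om Ga1 g1;
  r_t2 : btr Om Ga2 g2;
  r_tW : btr Om PhW w;
  r_g1 : forall y, boundary Om y -> 0 < g1 y;
  r_g2 : forall y, boundary Om y -> 0 < g2 y }.

Lemma dtt_static M f q : static Om M f -> dtt f q = 0.
Proof.
move=> sf; case: q => t x; rewrite -derive_tslice.
rewrite (_ : (fun s => f (s, x)) = fun=> f (t, x)) ?derive1_cst//.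
by apply/funext => s; exact: st_time sf _ _ _.
Qed.

Lemma dx_static_time M f j s t x : static Om M f -> dx j f (s, x) = dx j f (t, x).
Proof.
move=> sf; rewrite /dx -!derive_slice; congr ('D_(_) _ x).
by apply/funext => y; exact: st_time sf _ _ _.
Qed.

Definition grad2 (F : V -> R) (q : V) := \sum_(j < 3) dx j F q ^+ 2.

Lemma grad2_ge0 F q : 0 <= grad2 F q.
Proof. by apply: sumr_ge0 => j _; exact: sqr_ge0. Qed.

Variables (D1 D2 nu K eps : R) (g1 g2 w : E3 -> R) (c1 c2 Phi : V -> R)
  (u : 'I_3 -> V -> R) (p : V -> R).
Hypothesis S : nps D1 D2 nu K eps g1 g2 w c1 c2 Phi u p.
Variables (M m : R) (Ga1 Ga2 PhW : V -> R).
Hypothesis Rf : reference M m g1 g2 w Ga1 Ga2 PhW.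
Hypotheses (eps0 : 0 < eps) (D10 : 0 < D1) (D20 : 0 < D2) (nu0 : 0 < nu) (K0 : 0 < K).

Let rc1 := sp_reg (n_c1 S).
Let rc2 := sp_reg (n_c2 S).
Let rdc1 := sp_dreg (n_c1 S).
Let rdc2 := sp_dreg (n_c2 S).
Let ru := n_ru S.
Let rdu := n_rdu S.
Let rPhi := n_rPhi S.
Let rdPhi := n_rdPhi S.
Let rp := n_rp S.
Let rW := st_reg (r_sW Rf).
Let rG1 := st_reg (r_s1 Rf).
Let rG2 := st_reg (r_s2 Rf).

Definition psi (q : V) := Phi q - PhW q.
Definition rho (q : V) := c1 q - c2 q.

Lemma reg_psi : reg psi. Proof. by rewrite /psi; regtac. Qed.
Lemma reg_rho : reg rho. Proof. by rewrite /rho; regtac. Qed.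

Lemma trz_psi : trz Om psi.
Proof.
by apply: (@btr_eq _ _ _ _ _ _ (btrB (n_tPhi S) (r_tW Rf))) => // y _; rewrite subrr.
Qed.

Lemma dx_psi j q : cyl Om q -> dx j psi q = dx j Phi q - dx j PhW q.
Proof.
move=> Qq.
by have [_ E] := is_derive_sub (reg_is_derive (0, ebasis j) rPhi Qq) (reg_is_derive (0, ebasis j) rW Qq).
Qed.

Lemma poisson_test f t : reg f -> trz Om f -> 0 < t ->
  It (fun q => f q * rho q) t = eps * It (fun q => \sum_(j < 3) dx j f q * dx j Phi q) t.
Proof.
move=> rf tf t0.
transitivity (It (fun q => - eps * (f q * \sum_(j < 3) dx j (dx j Phi) q)) t).
  apply: eq_It => x Ox; rewrite /rho -(n_poisson S (conj t0 Ox : cyl Om (t, x))); ring.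
rewrite (ItZ oOm bOm)//; last by regtac.
by rewrite (It_ibp_div oOm bOm smOm rf rdPhi tf t0) mulNr mulrN opprK.
Qed.

Definition field_energy (t : R) := eps / 2 * It (grad2 psi) t.

(** This avoids differentiating the gradient of [psi] in time. A difference of squares is a product
    of sum and difference, and Poisson's equation, at both times [s] and [t], is tested with [psi]
    at time [s] plus [psi] at time [t]. What results depends on [s] through integrals of products
    without spatial derivatives. *)
Lemma field_energy_diff s t : 0 < s -> 0 < t ->
  field_energy s = field_energy t + 1 / 2 * (It (fun q => psi q * rho q) s +
    It (fun q => fz t psi q * rho q) s - It (fun q => psi q * fz t rho q) s -
    It (fun q => psi q * rho q) t).
Proof.
move=> s0 t0.
have rps := reg_psi; have rrh := reg_rho; have tps := trz_psi.
have rf1 := reg_fz oOm rps t0; have rf2 := reg_fz oOm rps s0; have rf3 := reg_fz oOm rrh t0.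
have rP1 := reg_fz oOm rPhi t0.
have hs := poisson_test (regD oOm rps rf1) _ s0.
have ht := poisson_test (regD oOm rf2 rps) _ t0.
have tz1 : trz Om (fun q => psi q + fz t psi q).
  by apply: (@btr_eq _ _ _ _ _ _ (btrD tps (btr_fz tps t0))) => // y _; rewrite addr0.
have tz2 : trz Om (fun q => fz s psi q + psi q).
  by apply: (@btr_eq _ _ _ _ _ _ (btrD (btr_fz tps s0) tps)) => // y _; rewrite addr0.
have {}hs := hs tz1; have {}ht := ht tz2.
have e1 : It (fun q => (psi q + fz t psi q) * rho q) s =
   It (fun q => psi q * rho q) s + It (fun q => fz t psi q * rho q) s.
  rewrite -(ItD oOm bOm)//; [|by regtac|by regtac].
  by apply: eq_It => x _; rewrite mulrDl.
have e2 : It (fun q => (fz s psi q + psi q) * rho q) t =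
   It (fun q => psi q * fz t rho q) s + It (fun q => psi q * rho q) t.
  have -> : It (fun q => psi q * fz t rho q) s = It (fun q => fz s psi q * rho q) t.
    exact: eq_It_time.
  rewrite -(ItD oOm bOm)//; [|by regtac|by regtac].
  by apply: eq_It => x _; rewrite mulrDl.
suff : eps * (It (grad2 psi) s - It (grad2 psi) t) =
    It (fun q => (psi q + fz t psi q) * rho q) s - It (fun q => (fz s psi q + psi q) * rho q) t.
  rewrite e1 e2 /field_energy.
  move: (It _ s) (It _ s) (It _ s) (It _ t) (It (grad2 psi) s) (It (grad2 psi) t) => a b c d A B h.
  have -> : eps / 2 * A = eps / 2 * B + 1 / 2 * (eps * (A - B)) by field.
  rewrite h; ring.
apply: etrans _ (esym (congr2 (fun a b => a - b) hs ht)).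
apply: etrans _ (mulrBr _ _ _); apply: (congr1 ( *%R eps)).
have dfz j F a b x : reg F -> 0 < a -> 0 < b -> Om x -> dx j (fz a F) (b, x) = dx j F (a, x).
  by move=> rF a0 b0 Ox; rewrite (dx_fz j rF a0 (conj b0 Ox : cyl Om (b, x))).
have -> : It (fun q => \sum_(j < 3) dx j (fun q => fz s psi q + psi q) q * dx j Phi q) t =
  It (fun q => \sum_(j < 3) dx j (fun q => psi q + fz t psi q) q * dx j (fz t Phi) q) s.
  apply: eq_It_time => x Ox; apply: eq_bigr => j _.
  have [_ E1] := is_derive_add (reg_is_derive (0, ebasis j) rf2 (conj t0 Ox : cyl Om (t, x)))
    (reg_is_derive (0, ebasis j) rps (conj t0 Ox : cyl Om (t, x))).
  have [_ E2] := is_derive_add (reg_is_derive (0, ebasis j) rps (conj s0 Ox : cyl Om (s, x)))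
    (reg_is_derive (0, ebasis j) rf1 (conj s0 Ox : cyl Om (s, x))).
  rewrite [X in X * _ = _]E1 [X in _ = X * _]E2 -!/(dx j _ _).
  by rewrite !dfz.
have -> : It (grad2 psi) t = It (grad2 (fz t psi)) s.
  apply: eq_It_time => x Ox; apply: eq_bigr => j _.
  by rewrite dfz.
have c12 : cb (grad2 psi) by rewrite /grad2; regtac.
have c13 : cb (grad2 (fz t psi)) by rewrite /grad2; regtac.
have rs := regD oOm rps rf1.
have c14 : cb (fun q => \sum_(j < 3) dx j (fun q => psi q + fz t psi q) q * dx j Phi q) by regtac.
have c15 : cb (fun q => \sum_(j < 3) dx j (fun q => psi q + fz t psi q) q * dx j (fz t Phi) q) by regtac.
apply: etrans (esym (ItB oOm bOm c12 c13 s0)) _; apply: etrans _ (ItB oOm bOm c14 c15 s0).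
apply: eq_It => x Ox; rewrite /grad2 -!sumrB; apply: eq_bigr => j _.
have Qs : cyl Om (s, x) by []. have Qt : cyl Om (t, x) by [].
have [_ E2] := is_derive_add (reg_is_derive (0, ebasis j) rps Qs) (reg_is_derive (0, ebasis j) rf1 Qs).
rewrite [X in _ = X * _ - X * _]E2 -!/(dx j _ _) !dfz// !dx_psi// (dx_static_time j s t x (r_sW Rf)).
ring.
Qed.

(** In the symmetric expression for the difference, the two terms containing the time derivative of
    [psi] cancel at [s = t], and those containing the time derivative of [rho] add up. *)
Lemma is_derive_field_energy (t : R) : 0 < t ->
  is_derive t 1 field_energy (It (fun q => psi q * dtt rho q) t).
Proof.
move=> t0.
have rps := reg_psi; have rrh := reg_rho.
have rf1 := reg_fz oOm rps t0; have rf3 := reg_fz oOm rrh t0.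
have ra : reg (fun q => psi q * rho q) by regtac.
have rb : reg (fun q => fz t psi q * rho q) by regtac.
have rc : reg (fun q => psi q * fz t rho q) by regtac.
pose J s := field_energy t + 1 / 2 * (It (fun q => psi q * rho q) s +
    It (fun q => fz t psi q * rho q) s - It (fun q => psi q * fz t rho q) s -
    It (fun q => psi q * rho q) t).
have dJ : is_derive t 1 J (It (fun q => psi q * dtt rho q) t).
  have h := is_derive_add (is_derive_cst (field_energy t) t 1) (is_derive_mul (is_derive_cst (1 / 2 : R) t 1)
   (is_derive_sub (is_derive_sub (is_derive_add (is_derive_It oOm bOm ra t0) (is_derive_It oOm bOm rb t0))
     (is_derive_It oOm bOm rc t0)) (is_derive_cst (It (fun q => psi q * rho q) t) t 1))).
  have [h1 h2] := h; apply: DeriveDef h1 _; rewrite [LHS]h2.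
  rewrite !mulr0 addr0 add0r subr0 /cst.
  rewrite -(ItD oOm bOm)//; [|by regtac|by regtac].
  rewrite -(ItB oOm bOm)//; [|by regtac|by regtac].
  rewrite -(ItZ oOm bOm)//; [|by regtac].
  apply: eq_It => x Ox; have Qx : cyl Om (t, x) by [].
  have [_ Ea] := is_derive_mul (reg_is_derive (1, 0) rps Qx) (reg_is_derive (1, 0) rrh Qx).
  have [_ Eb] := is_derive_mul (reg_is_derive (1, 0) rf1 Qx) (reg_is_derive (1, 0) rrh Qx).
  have [_ Ec] := is_derive_mul (reg_is_derive (1, 0) rps Qx) (reg_is_derive (1, 0) rf3 Qx).
  rewrite [X in _ * (X + _ - _)]Ea [X in _ * (_ + X - _)]Eb [X in _ * (_ - X)]Ec -!/(dtt _ _).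
  rewrite (dtt_fz rps t0 Qx) (dtt_fz rrh t0 Qx) /fz/=.
  by field.
have nJ : \forall s \near t, J s = field_energy s.
  have : \forall s \near t, 0 < s by exact: lt_nbhsr.
  apply: filterS => s s0.
  by rewrite (field_energy_diff s0 t0).
have [h1 h2] := dJ.
apply: DeriveDef; first exact: near_eq_derivable nJ h1.
by rewrite -h2; apply/esym; exact: near_eq_derive nJ.
Qed.

End System.

Section FreeEnergy.
Context {R : realType}.
Local Notation E3 := 'rV[R]_3.
Local Notation V := (R * 'rV[R]_3)%type.
Variables (Om : set E3).
Hypotheses (oOm : open Om) (bOm : bounded_set Om) (smOm : smooth_boundary Om).
Local Notation cb := (cb Om).
Local Notation reg := (reg Om).
Local Notation It := (It Om).

Variables (D1 D2 nu K eps : R) (g1 g2 w : E3 -> R) (c1 c2 Phi : V -> R)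
  (u : 'I_3 -> V -> R) (p : V -> R).
Hypothesis S : nps Om D1 D2 nu K eps g1 g2 w c1 c2 Phi u p.
Variables (M m : R) (Ga1 Ga2 PhW : V -> R).
Hypothesis Rf : reference Om M m g1 g2 w Ga1 Ga2 PhW.
Hypotheses (eps0 : 0 < eps) (D10 : 0 < D1) (D20 : 0 < D2) (nu0 : 0 < nu) (K0 : 0 < K).
Variable eta : R.
Hypothesis eta0 : 0 < eta.

Let rc1 := sp_reg (n_c1 S).
Let rc2 := sp_reg (n_c2 S).
Let rdc1 := sp_dreg (n_c1 S).
Let rdc2 := sp_dreg (n_c2 S).
Let ru := n_ru S.
Let rdu := n_rdu S.
Let rPhi := n_rPhi S.
Let rdPhi := n_rdPhi S.
Let rp := n_rp S.
Let rW := st_reg (r_sW Rf).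
Let rG1 := st_reg (r_s1 Rf).
Let rG2 := st_reg (r_s2 Rf).
Local Notation psi := (psi Phi PhW).
Local Notation rho := (rho c1 c2).

Definition sdens (c Ga : V -> R) (q : V) :=
  (c q + eta) * (ln (c q + eta) - ln (Ga q + eta)) - (c q + eta) + (Ga q + eta).

Lemma sdens_ge0 c Ga q : 0 < c q + eta -> 0 < Ga q + eta -> 0 <= sdens c Ga q.
Proof.
rewrite /sdens; move: (c q + eta) (Ga q + eta) => a A a0 A0.
have h : ln A - ln a <= A / a - 1.
  have y0 := divr_gt0 A0 a0.
  rewrite -ln_div ?posrE//.
  have := @le_ln1Dx R (A / a - 1).
  have -> : 1 + (A / a - 1) = A / a by ring.
  by apply; move: y0; move: (A / a) => y; lra.
have : a * (ln A - ln a) <= a * (A / a - 1) by rewrite ler_wpM2l// ltW.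
have -> : a * (A / a - 1) = A - a by field; rewrite gt_eqF.
rewrite !mulrBr; lra.
Qed.

Lemma species_entropy z D c Ga : species Om u Phi z D c -> static Om M Ga ->
  (forall q, cyl Om q -> m <= Ga q) -> 0 < m ->
  reg (sdens c Ga) /\ forall q, cyl Om q -> dtt (sdens c Ga) q = chem eta c Ga q * dtt c q.
Proof.
move=> sc sG Gam m0.
have rc := sp_reg sc; have rG := st_reg sG.
have rl := reg_lnc oOm eta0 sc; have rlG := reg_lnG oOm m0 eta0 sG Gam.
split=> [|q Qq]; first by rewrite /sdens; regtac.
have c0 : 0 < c q + eta by exact: lt_le_trans eta0 (conc_ge eta sc Qq).
have A0 : 0 < Ga q + eta by exact: lt_le_trans (ref_ge eta0 Gam Qq).
have Dc := is_derive_add (reg_is_derive (1, 0) rc Qq) (is_derive_cst eta q (1, 0)).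
have DG := is_derive_add (reg_is_derive (1, 0) rG Qq) (is_derive_cst eta q (1, 0)).
have [_ E] := is_derive_add (is_derive_sub (is_derive_mul Dc (is_derive_sub (reg_is_derive (1, 0) rl Qq)
  (reg_is_derive (1, 0) rlG Qq))) Dc) DG.
apply: etrans E _; rewrite (dx_ln _ rc c0 Qq) (dx_ln _ rG A0 Qq) -!/(dtt _ _).
rewrite (dtt_static q sG) /cst /chem -/(dtt c q).
by field; rewrite !gt_eqF.
Qed.

Let speed2 (q : V) := \sum_(k < 3) u k q ^+ 2.
Let power (q : V) := \sum_(k < 3) u k q * dtt (u k) q.
Let gradu2 (q : V) := \sum_(k < 3) grad2 (u k) q.

Lemma reg_speed2 : reg speed2. Proof. by rewrite /speed2; regtac. Qed.

Lemma dtt_speed2 q : cyl Om q -> dtt speed2 q = 2 * power q.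
Proof.
move=> Qq.
have sq k : is_derive q (1, 0) (fun q => u k q * u k q) (u k q * dtt (u k) q + u k q * dtt (u k) q).
  exact: (is_derive_mul (reg_is_derive (1, 0) (ru k) Qq) (reg_is_derive (1, 0) (ru k) Qq)).
have [_ E] := is_derive_add (is_derive_add (sq ord0) (sq (lift ord0 ord0))) (sq (lift ord0 (lift ord0 ord0))).
have -> : speed2 = (fun q => u ord0 q * u ord0 q + u (lift ord0 ord0) q * u (lift ord0 ord0) q +
    u (lift ord0 (lift ord0 ord0)) q * u (lift ord0 (lift ord0 ord0)) q).
  by apply/funext => z; rewrite /speed2 !big_ord_recl big_ord0 addr0 addrA -!expr2.
apply: etrans E _; rewrite /power !big_ord_recl big_ord0; ring.
Qed.

(** The pressure term is a transport term of [p], removed by [conv0]; viscosity is integrated by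
    parts componentwise. *)
Lemma fluid_power t : 0 < t ->
  It power t = - nu * It gradu2 t - K * It (fun q => \sum_(k < 3) u k q * (rho q * dx k Phi q)) t.
Proof.
move=> t0.
have rrh := reg_rho oOm S.
have p0 := conv0 oOm bOm smOm ru (n_tu S) (n_div S) rp t0.
have cf k : cb (fun q => u k q * (rho q * dx k Phi q)) by regtac.
have cl k : cb (fun q => u k q * \sum_(j < 3) dx j (dx j (u k)) q) by regtac.
have cp : cb (fun q => \sum_(k < 3) u k q * dx k p q) by regtac.
have cls : cb (fun q => \sum_(k < 3) u k q * \sum_(j < 3) dx j (dx j (u k)) q) by exact: cb_sum.
have cfs : cb (fun q => \sum_(k < 3) u k q * (rho q * dx k Phi q)) by exact: cb_sum.
have cg k : cb (grad2 (u k)) by rewrite /grad2; regtac.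
transitivity (It (fun q => nu * (\sum_(k < 3) u k q * \sum_(j < 3) dx j (dx j (u k)) q) -
    \sum_(k < 3) u k q * dx k p q - K * (\sum_(k < 3) u k q * (rho q * dx k Phi q))) t).
  apply: eq_It => x Ox; have Qx : cyl Om (t, x) by [].
  rewrite !mulr_sumr -!sumrB; apply: eq_bigr => k _.
  have := n_stokes S k Qx; set L := \sum_(j < 3) _ => h.
  have -> : dtt (u k) (t, x) = nu * L - dx k p (t, x) - (K * (c1 (t, x) - c2 (t, x))) * dx k Phi (t, x).
    by rewrite -mulNr -h; ring.
  by rewrite /rho; ring.
have i1 : cb (fun q => nu * (\sum_(k < 3) u k q * \sum_(j < 3) dx j (dx j (u k)) q)).
  by apply: cbM => //; exact: cb_cst.
have i2 : cb (fun q => K * (\sum_(k < 3) u k q * (rho q * dx k Phi q))).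
  by apply: cbM => //; exact: cb_cst.
rewrite (ItB oOm bOm (cbB i1 cp) i2 t0) (ItB oOm bOm i1 cp t0) p0 subr0.
rewrite (ItZ oOm bOm _ cls t0) (ItZ oOm bOm _ cfs t0); congr (_ - _).
rewrite mulNr -mulrN; congr (_ * _).
rewrite (It_sum oOm bOm cl t0) (It_sum oOm bOm cg t0) -sumrN.
apply: eq_bigr => k _.
by rewrite (It_ibp_div oOm bOm smOm (ru k) (rdu k) (n_tu S k) t0).
Qed.

Definition free_energy (t : R) := It (sdens c1 Ga1) t + It (sdens c2 Ga2) t +
  field_energy Om eps Phi PhW t + (2 * K)^-1 * It speed2 t.

Definition free_energy_rate (t : R) :=
  It (fun q => (chem eta c1 Ga1 q + 1 * psi q) * dtt c1 q) t +
  It (fun q => (chem eta c2 Ga2 q + (-1) * psi q) * dtt c2 q) t + K^-1 * It power t.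

Lemma is_derive_free_energy (t : R) : 0 < t ->
  is_derive t 1 free_energy (free_energy_rate t).
Proof.
move=> t0.
have [rs1 ds1] := species_entropy (n_c1 S) (r_s1 Rf) (r_m1 Rf) (r_m0 Rf).
have [rs2 ds2] := species_entropy (n_c2 S) (r_s2 Rf) (r_m2 Rf) (r_m0 Rf).
have rsp := reg_speed2; have rps := reg_psi oOm S Rf.
have h := is_derive_add (is_derive_add (is_derive_add (is_derive_It oOm bOm rs1 t0)
  (is_derive_It oOm bOm rs2 t0)) (is_derive_field_energy oOm bOm smOm S Rf t0))
  (is_derive_mul (is_derive_cst ((2 * K)^-1 : R) t 1) (is_derive_It oOm bOm rsp t0)).
have [h1 h2] := h; apply: DeriveDef h1 _; rewrite [LHS]h2 {h h2}.
have rl1 := reg_lnc oOm eta0 (n_c1 S); have rlG1 := reg_lnG oOm (r_m0 Rf) eta0 (r_s1 Rf) (r_m1 Rf).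
have rl2 := reg_lnc oOm eta0 (n_c2 S); have rlG2 := reg_lnG oOm (r_m0 Rf) eta0 (r_s2 Rf) (r_m2 Rf).
have rch1 : reg (chem eta c1 Ga1) by rewrite /chem; regtac.
have rch2 : reg (chem eta c2 Ga2) by rewrite /chem; regtac.
have e1 : It (dtt (sdens c1 Ga1)) t = It (fun q => chem eta c1 Ga1 q * dtt c1 q) t.
  by apply: eq_It => x Ox; rewrite ds1.
have e2 : It (dtt (sdens c2 Ga2)) t = It (fun q => chem eta c2 Ga2 q * dtt c2 q) t.
  by apply: eq_It => x Ox; rewrite ds2.
have e3 : It (fun q => psi q * dtt rho q) t =
    It (fun q => psi q * dtt c1 q) t - It (fun q => psi q * dtt c2 q) t.
  rewrite -(ItB oOm bOm); [|by regtac|by regtac|exact: t0].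
  apply: eq_It => x Ox; have Qx : cyl Om (t, x) by [].
  have [_ E] := is_derive_sub (reg_is_derive (1, 0) rc1 Qx) (reg_is_derive (1, 0) rc2 Qx).
  by rewrite [X in _ * X = _]E mulrBr.
have cpw : cb power by rewrite /power; regtac.
have e4 : It (dtt speed2) t = 2 * It power t.
  by rewrite -(ItZ oOm bOm _ cpw t0); apply: eq_It => x Ox; rewrite dtt_speed2.
have e5 : It (fun q => (chem eta c1 Ga1 q + 1 * psi q) * dtt c1 q) t =
  It (fun q => chem eta c1 Ga1 q * dtt c1 q) t + It (fun q => psi q * dtt c1 q) t.
  rewrite -(ItD oOm bOm); [|by regtac|by regtac|exact: t0].
  by apply: eq_It => x _; rewrite mul1r mulrDl.
have e6 : It (fun q => (chem eta c2 Ga2 q + (-1) * psi q) * dtt c2 q) t =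
  It (fun q => chem eta c2 Ga2 q * dtt c2 q) t - It (fun q => psi q * dtt c2 q) t.
  rewrite -(ItB oOm bOm); [|by regtac|by regtac|exact: t0].
  by apply: eq_It => x _; rewrite mulN1r mulrBl.
rewrite /free_energy_rate e1 e2 e3 e4 e5 e6 mulr0 addr0 /cst.
move: (It _ t) (It _ t) (It _ t) (It _ t) (It _ t) => *.
by field; rewrite gt_eqF.
Qed.

Variable CP : R.
Hypothesis CP1 : 1 <= CP.
Hypothesis poin : forall (F : V -> R) t, reg F -> trz Om F -> 0 < t ->
  It (fun z => F z ^+ 2) t <= CP * It (grad2 F) t.

Definition sig (q : V) := (c1 q + eta) + (c2 q + eta).
Definition diss (t : R) :=
  It (fun q => \sum_(j < 3) drift Phi eta 1 c1 j q ^+ 2 / (c1 q + eta)) t +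
  It (fun q => \sum_(j < 3) drift Phi eta (-1) c2 j q ^+ 2 / (c2 q + eta)) t.

Definition grip := M / m + M.

Lemma drag_work z D c Ga t : z ^+ 2 = 1 -> species Om u Phi z D c -> static Om M Ga ->
  (forall q, cyl Om q -> m <= Ga q) -> (forall q, cyl Om q -> c q <= sig q) -> 0 < t ->
  - It (fun q => c q * \sum_(j < 3) u j q * drag PhW eta z Ga j q) t <=
  nu / (4 * K) * It gradu2 t + 3 * K * CP / nu * grip ^+ 2 * It (fun q => sig q ^+ 2) t.
Proof.
move=> z1 sc sG Gam cs t0.
have rc := sp_reg sc.
have rsig : reg sig by rewrite /sig; regtac.
have cdr := cb_drag (r_sW Rf) (r_m0 Rf) z eta0 sG Gam.
have cg : cb gradu2 by rewrite /gradu2 /grad2; regtac.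
have CP0 : 0 < CP := lt_le_trans ltr01 CP1.
(* Weight in Young's inequality. After the Poincaré inequality each species consumes [nu / (4 * K)]
   times the squared gradient of [u], so both together leave half of the viscous dissipation. *)
pose d := nu / (4 * K * CP).
have d0 : 0 < d by rewrite /d divr_gt0// !mulr_gt0.
have i1 : It speed2 t <= CP * It gradu2 t.
  have e1 : It speed2 t = \sum_(k < 3) It (fun q => u k q ^+ 2) t.
    by apply: (It_sum oOm bOm) => // k; regtac.
  have e2 : It gradu2 t = \sum_(k < 3) It (grad2 (u k)) t.
    by apply: (It_sum oOm bOm) => // k; rewrite /grad2; regtac.
  rewrite e1 e2 mulr_sumr; apply: ler_sum => k _.
  by apply: poin => //; exact: n_tu S k.
have i2 : - It (fun q => c q * \sum_(j < 3) u j q * drag PhW eta z Ga j q) t <=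
    It (fun q => d * speed2 q + 3 / (4 * d) * grip ^+ 2 * sig q ^+ 2) t.
  have cc : cb (fun q => c q * \sum_(j < 3) u j q * drag PhW eta z Ga j q) by regtac.
  rewrite -(ItN oOm bOm cc t0); apply: (It_le oOm bOm _ _ t0).
  - exact: cbN cc.
  - have rsp := reg_speed2; regtac.
  move=> x Ox; have Qx : cyl Om (t, x) by [].
  rewrite /speed2 !mulr_sumr -sumrN.
  have -> : 3 / (4 * d) * grip ^+ 2 * sig (t, x) ^+ 2 = \sum_(j < 3) (1 / (4 * d) * grip ^+ 2 * sig (t, x) ^+ 2).
    by rewrite sumr_const card_ord -[RHS]mulr_natl; field; rewrite gt_eqF.
  rewrite -big_split/=; apply: ler_sum => j _.
  have hd := drag_bound (r_sW Rf) (r_m0 Rf) eta0 z1 sG Gam j Qx.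
  have {hd}hd2 : drag PhW eta z Ga j (t, x) ^+ 2 <= grip ^+ 2.
    rewrite -[leLHS]real_normK ?num_real//; apply: lerXn2r; rewrite ?nnegrE//.
    exact: le_trans (normr_ge0 _) hd.
  have c0 := sp_ge0 sc Qx; have cS := cs _ Qx.
  have cS2 : c (t, x) ^+ 2 <= sig (t, x) ^+ 2 by apply: lerXn2r => //; rewrite nnegrE// (le_trans c0).
  have h2 := ler_pM (sqr_ge0 (drag PhW eta z Ga j (t, x))) (sqr_ge0 (c (t, x))) hd2 cS2.
  have h3 : 0 <= (d * u j (t, x) + 1 / 2 * (c (t, x) * drag PhW eta z Ga j (t, x))) ^+ 2 by exact: sqr_ge0.
  rewrite -(ler_pM2l d0).
  have -> : d * (d * u j (t, x) ^+ 2 + 1 / (4 * d) * grip ^+ 2 * sig (t, x) ^+ 2) =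
    d ^+ 2 * u j (t, x) ^+ 2 + 1 / 4 * (grip ^+ 2 * sig (t, x) ^+ 2) by field; rewrite gt_eqF.
  move: h2 h3; move: (grip ^+ 2 * _) (drag _ _ _ _ _ _) (c _) (u _ _) => a b c' v.
  have -> : (d * v + 1 / 2 * (c' * b)) ^+ 2 = d ^+ 2 * v ^+ 2 + d * (c' * (v * b)) + 1 / 4 * (b ^+ 2 * c' ^+ 2).
    by field.
  rewrite mulrN; move: (d * (c' * (v * b))) (d ^+ 2 * v ^+ 2) (b ^+ 2 * c' ^+ 2) => k1 k2 k3 *; lra.
apply: le_trans i2 _.
have rsp := reg_speed2.
rewrite (ItD oOm bOm) //; [|by regtac|by regtac].
rewrite (ItZ oOm bOm d (F := speed2)) //; [|by regtac].
rewrite (ItZ oOm bOm _ (F := fun q => sig q ^+ 2)) //; [|by regtac].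
have e1 : d * (CP * It gradu2 t) = nu / (4 * K) * It gradu2 t.
  by rewrite /d; field; rewrite !gt_eqF.
have e2 : 3 / (4 * d) = 3 * K * CP / nu by rewrite /d; field; rewrite !gt_eqF.
by rewrite e2 lerD2r -e1 ler_pM2l.
Qed.

(** The electric power in the two concentration equations cancels that in the Stokes equation. The
    term with [eta] is the price of the shift: it has the wrong sign, and it is absorbed once [eta]
    is a small multiple of [eps] and the field energy is controlled by the dissipation. *)
Lemma free_energy_ineq t : 0 < t -> free_energy_rate t <=
  - (Num.min D1 D2 / 2) * diss t + 3 / 2 * (D1 + D2) * eta * It (grad2 Phi) t +
  (9 / 2 * (D1 + D2) + 6 * K * CP / nu) * grip ^+ 2 * It (fun q => 1 + sig q ^+ 2) t -
  nu / (2 * K) * It gradu2 t.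
Proof.
move=> t0.
have tps := trz_psi S Rf.
have [[[[sc1 sc2] s1] s2] sW] := (n_c1 S, n_c2 S, r_s1 Rf, r_s2 Rf, r_sW Rf).
have N1 : (-1 : R) ^+ 2 = 1 by rewrite sqrrN expr1n.
have P1 : (1 : R) ^+ 2 = 1 by rewrite expr1n.
have k1 q : cyl Om q -> c1 q <= sig q.
  by move=> Qq; rewrite /sig; have := sp_ge0 sc2 Qq; have := eta0; move: (c1 q) (c2 q) => *; lra.
have k2 q : cyl Om q -> c2 q <= sig q.
  by move=> Qq; rewrite /sig; have := sp_ge0 sc1 Qq; have := eta0; move: (c1 q) (c2 q) => *; lra.
have rsig : reg sig by rewrite /sig; regtac.
have csig : cb (fun q => sig q ^+ 2) by regtac.
have aS (q : V) : cyl Om q -> (c1 q + eta) + (c2 q + eta) <= 1 + sig q ^+ 2.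
  by move=> _; rewrite -/(sig q); have := sqr_ge0 (1 - sig q); have := sqr_ge0 (sig q); lra.
have a1 : It (fun q => c1 q + eta) t <= It (fun q => 1 + sig q ^+ 2) t.
  apply: (It_le oOm bOm _ _ t0); [by regtac|by regtac|] => x Ox.
  have Qx : cyl Om (t, x) by []; apply: le_trans (aS _ Qx).
  by have := sp_ge0 sc2 Qx; have := eta0; move: (c2 _) (c1 _) => *; lra.
have a2 : It (fun q => c2 q + eta) t <= It (fun q => 1 + sig q ^+ 2) t.
  apply: (It_le oOm bOm _ _ t0); [by regtac|by regtac|] => x Ox.
  have Qx : cyl Om (t, x) by []; apply: le_trans (aS _ Qx).
  by have := sp_ge0 sc1 Qx; have := eta0; move: (c2 _) (c1 _) => *; lra.
have a3 : It (fun q => sig q ^+ 2) t <= It (fun q => 1 + sig q ^+ 2) t.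
  by apply: (It_le oOm bOm _ _ t0); [by regtac|by regtac|] => x _; rewrite lerDr.
have dr1 := reg_drift oOm rdPhi eta sc1; have dr2 := reg_drift oOm rdPhi eta sc2.
have q1 : 0 <= It (fun q => \sum_(j < 3) drift Phi eta 1 c1 j q ^+ 2 / (c1 q + eta)) t.
  apply: It_ge0 => x Ox; apply: sumr_ge0 => j _; rewrite divr_ge0 ?sqr_ge0//.
  by rewrite addr_ge0 ?(ltW eta0)//; exact: sp_ge0 sc1 _ (conj t0 Ox : cyl Om (t, x)).
have q2 : 0 <= It (fun q => \sum_(j < 3) drift Phi eta (-1) c2 j q ^+ 2 / (c2 q + eta)) t.
  apply: It_ge0 => x Ox; apply: sumr_ge0 => j _; rewrite divr_ge0 ?sqr_ge0//.
  by rewrite addr_ge0 ?(ltW eta0)//; exact: sp_ge0 sc2 _ (conj t0 Ox : cyl Om (t, x)).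
have e : It (fun q => \sum_(k < 3) u k q * (rho q * dx k Phi q)) t =
  It (fun q => c1 q * \sum_(j < 3) u j q * dx j Phi q) t - It (fun q => c2 q * \sum_(j < 3) u j q * dx j Phi q) t.
  rewrite -(ItB oOm bOm); [|by regtac|by regtac|exact: t0].
  apply: eq_It => x _; rewrite -mulrBl mulr_sumr; apply: eq_bigr => j _.
  by rewrite /rho; ring.
have h1 := species_energy oOm bOm smOm ru (n_tu S) (n_div S) rPhi rdPhi sW (r_m0 Rf) tps eta0
  P1 D10 sc1 s1 (r_m1 Rf) (n_t1 S) (r_t1 Rf) (r_g1 Rf) t0.
have h2 := species_energy oOm bOm smOm ru (n_tu S) (n_div S) rPhi rdPhi sW (r_m0 Rf) tps eta0
  N1 D20 sc2 s2 (r_m2 Rf) (n_t2 S) (r_t2 Rf) (r_g2 Rf) t0.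
have w1 := drag_work P1 sc1 s1 (r_m1 Rf) k1 t0.
have w2 := drag_work N1 sc2 s2 (r_m2 Rf) k2 t0.
have fl := fluid_power t0.
rewrite e in fl.
have fl' : K^-1 * It power t = - (nu / K) * It gradu2 t -
  (It (fun q => c1 q * \sum_(j < 3) u j q * dx j Phi q) t - It (fun q => c2 q * \sum_(j < 3) u j q * dx j Phi q) t).
  rewrite fl; move: (It _ t) (It _ t) (It _ t) => x y z.
  by field; rewrite gt_eqF.
rewrite /free_energy_rate fl' /diss.
rewrite -/(grad2 Phi) in h1 h2.
have m1 : Num.min D1 D2 <= D1 by rewrite ge_min lexx.
have m2 : Num.min D1 D2 <= D2 by rewrite ge_min lexx orbT.
have gr : 0 <= grip ^+ 2 by exact: sqr_ge0.
clear fl fl' e.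
rewrite -!/grip in h1 h2.
pose kk := 3 * K * CP / nu; pose nK := nu / K.
have e1 : 3 * K * CP / nu = kk by [].
have e2 : 6 * K * CP / nu = 2 * kk by rewrite /kk; field; rewrite gt_eqF.
have e3 : nu / (4 * K) = nK / 4 by rewrite /nK; field; rewrite gt_eqF.
have e4 : nu / (2 * K) = nK / 2 by rewrite /nK; field; rewrite gt_eqF.
have e5 : nu / K = nK by [].
have kk0 : 0 <= kk by rewrite /kk divr_ge0 ?ltW// !mulr_gt0// (lt_le_trans ltr01 CP1).
rewrite e1 e3 in w1 w2; rewrite e2 e4 e5.
move: (grip ^+ 2) (kk) (nK) (Num.min D1 D2) kk0 gr m1 m2 h1 h2 w1 w2 a1 a2 a3 q1 q2 => G2 k n dm.
move: (It (fun q => c1 q + eta) t) (It (fun q => c2 q + eta) t) => A1 A2.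
move: (It (fun q => 1 + sig q ^+ 2) t) (It (fun q => sig q ^+ 2) t) => B S2.
move: (It (fun q => \sum_(j < 3) drift Phi eta 1 c1 j q ^+ 2 / (c1 q + eta)) t)
  (It (fun q => \sum_(j < 3) drift Phi eta (-1) c2 j q ^+ 2 / (c2 q + eta)) t) => Q1 Q2.
move: (It gradu2 t) (It (grad2 Phi) t) => Gu n2.
move: (It (fun q => (chem eta c1 Ga1 q + 1 * psi q) * dtt c1 q) t)
  (It (fun q => (chem eta c2 Ga2 q + (-1) * psi q) * dtt c2 q) t) => X1 X2.
move: (It _ t) (It _ t) (It _ t) (It _ t) => F2 C2 F1 C1 k0 gr m1 m2 h1 h2 w1 w2 a1 a2 a3 q1 q2.
have b1 := ler_wpM2r q1 m1.
have b2 := ler_wpM2r q2 m2.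
have b3 := ler_wpM2l (mulr_ge0 (ltW D10) gr) a1.
have b4 := ler_wpM2l (mulr_ge0 (ltW D20) gr) a2.
have b5 := ler_wpM2l (mulr_ge0 k0 gr) a3.
have {}h1 : X1 <= - 1 / 2 * (D1 * Q1) + 3 / 2 * (D1 * eta * n2) + 9 / 2 * (D1 * G2 * A1) - C1 + F1.
  by apply: le_trans h1 _; rewrite le_eqVlt; apply/orP; left; apply/eqP; ring.
have {}h2 : X2 <= - 1 / 2 * (D2 * Q2) + 3 / 2 * (D2 * eta * n2) + 9 / 2 * (D2 * G2 * A2) - C2 - F2.
  by apply: le_trans h2 _; rewrite le_eqVlt; apply/orP; left; apply/eqP; ring.
have -> : - (dm / 2) * (Q1 + Q2) + 3 / 2 * (D1 + D2) * eta * n2 +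
  (9 / 2 * (D1 + D2) + 2 * k) * G2 * B - n / 2 * Gu =
  - 1 / 2 * (dm * Q1) - 1 / 2 * (dm * Q2) + 3 / 2 * (D1 * eta * n2) + 3 / 2 * (D2 * eta * n2) +
  9 / 2 * (D1 * G2 * B) + 9 / 2 * (D2 * G2 * B) + 2 * (k * G2 * B) - 1 / 2 * (n * Gu) by ring.
have {}w1 : - C1 <= 1 / 4 * (n * Gu) + k * G2 * S2.
  by apply: le_trans w1 _; rewrite le_eqVlt; apply/orP; left; apply/eqP; ring.
have {}w2 : - C2 <= 1 / 4 * (n * Gu) + k * G2 * S2.
  by apply: le_trans w2 _; rewrite le_eqVlt; apply/orP; left; apply/eqP; ring.
have -> : X1 + X2 + (- n * Gu - (F1 - F2)) = X1 + X2 - n * Gu - F1 + F2 by ring.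
clear a1 a2 a3 m1 m2.
move: (D1 * Q1) (D2 * Q2) (dm * Q1) (dm * Q2) (D1 * eta * n2) (D2 * eta * n2) (D1 * G2 * A1)
  (D2 * G2 * A2) (D1 * G2 * B) (D2 * G2 * B) (k * G2 * B) (k * G2 * S2) (n * Gu) b1 b2 b3 b4 b5 h1 h2 w1 w2.
move=> *; lra.
Qed.

End FreeEnergy.

(** * Dissipation estimates *)

Section BoundaryLayer.
Context {R : realType}.
Local Notation E3 := 'rV[R]_3.
Local Notation V := (R * 'rV[R]_3)%type.
Local Notation whole := (@whole R).
Variables (Om : set E3).
Hypotheses (oOm : open Om) (bOm : bounded_set Om) (smOm : smooth_boundary Om).
Local Notation cb := (cb Om).
Local Notation reg := (reg Om).
Local Notation It := (It Om).

Lemma vol_subset (A B : set E3) (f : E3 -> R) : open A -> bounded_set A -> open B -> bounded_set B ->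
  A `<=` B -> bdcont B whole f -> (forall x, B x -> 0 <= f x) -> vol A f <= vol B f.
Proof.
move=> oA bA oB bB AB cf f0.
have iB := bc_integrable oB bB cf.
have cfA : bdcont A whole f.
  have [c1 b1] := cf; split=> [x Ax|i]; first exact/c1/AB.
  by have [K fK] := b1 i; exists K => x /AB; exact: fK.
have iA := bc_integrable oA bA cfA.
rewrite /vol /Rintegral; apply: fine_le.
- by apply: integrable_fin_num => //; exact: measurable_dom.
- by apply: integrable_fin_num => //; exact: measurable_dom.
apply: ge0_subset_integral; [exact: measurable_dom|exact: measurable_dom| | |].
- by case/integrableP: iB.
- by move=> q Bq; rewrite lee_fin; exact: f0.
- by move=> q; exact: AB.
Qed.

(** The boundary layers as time-independent fields on the cylinder; [L] is to be chosen once for all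
    widths [r]. *)
Record collar (L r : R) (X : V -> R) : Prop := Collar {
  co_reg : reg X;
  co_ge0 : forall q, cyl Om q -> 0 <= X q;
  co_le1 : forall q, cyl Om q -> X q <= 1;
  co_btr : btr Om X (fun=> 1);
  co_grad : forall j q, cyl Om q -> `|dx j X q| <= L / r;
  co_vol : forall t, 0 < t -> It X t <= L * r;
  co_vol_grad : forall j t, 0 < t -> It (fun q => dx j X q ^+ 2) t <= L / r }.

Lemma collar_exists : exists2 L, 0 <= L & forall r, 0 < r <= 1 -> exists X, collar L r X.
Proof.
have [M0 HM0] := closure_bounded bOm.
pose M := M0 + 2.
have OmM x : closure Om x -> `|x| <= M - 2 by move/HM0; rewrite /M addrK.
have [C HC] := layered_boundary OmM (layer_patch oOm smOm OmM).
have OB : Om `<=` box M.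
  move=> x Ox; have := HM0 x (@subset_closure _ _ _ Ox); rewrite /box/= /M => h.
  by apply: le_lt_trans h _; rewrite ltrDl.
exists `|C| => // r r01; have [chi [c ra bd gr v vg]] := HC r r01.
have r0 : 0 < r by case/andP: r01.
exists (fun z => chi z.2); split.
- exact: reg_static.
- by move=> q _; case/andP: (ra q.2).
- by move=> q _; case/andP: (ra q.2).
- move=> t t0 y by_; rewrite -(bd y by_ by_).
  by apply: cvg_within_filter; have [[+ _] _] := c; apply.
- move=> j q _; rewrite dx_static (le_trans (gr j _))//.
  by rewrite ler_wpM2r ?invr_ge0 ?(ltW r0)// ler_norm.
- move=> t t0; apply: (@le_trans _ _ (vol (box M) chi)).
    apply: (vol_subset oOm bOm (@open_box R M) (@bounded_box R M) OB).
      exact: bc_box (C1bd_bdcont c).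
    by move=> x _; case/andP: (ra x).
  apply: le_trans v _.
  by rewrite ler_wpM2r ?(ltW r0)// ler_norm.
- move=> j t t0; apply: (@le_trans _ _ (vol (box M) (fun x => 'D_(ebasis j) chi x ^+ 2))).
    apply: (vol_subset oOm bOm (@open_box R M) (@bounded_box R M) OB).
      have h := bc_box M (C1bd_derive (ebasis j) c).
      have -> : (fun x => 'D_(ebasis j) chi x ^+ 2) = (fun x => 'D_(ebasis j) chi x * 'D_(ebasis j) chi x).
        by apply/funext => x; rewrite expr2.
      exact: bdcontM.
    by move=> x _; exact: sqr_ge0.
  apply: le_trans (vg j) _.
  by rewrite ler_wpM2r ?invr_ge0 ?(ltW r0)// ler_norm.
Qed.

End BoundaryLayer.

Section CollarBounds.
Context {R : realType}.
Local Notation E3 := 'rV[R]_3.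
Local Notation V := (R * 'rV[R]_3)%type.
Variables (Om : set E3).
Hypotheses (oOm : open Om) (bOm : bounded_set Om) (smOm : smooth_boundary Om).
Local Notation cb := (cb Om).
Local Notation reg := (reg Om).
Local Notation It := (It Om).
Local Notation v0 := (vol Om (fun=> 1)).

Variables (D1 D2 nu K eps : R) (g1 g2 w : E3 -> R) (c1 c2 Phi : V -> R)
  (u : 'I_3 -> V -> R) (p : V -> R).
Hypothesis S : nps Om D1 D2 nu K eps g1 g2 w c1 c2 Phi u p.
Variables (M m : R) (Ga1 Ga2 PhW : V -> R).
Hypothesis Rf : reference Om M m g1 g2 w Ga1 Ga2 PhW.
Variables (eta r t L G0 CP : R) (X : V -> R).
Hypotheses (eta0 : 0 < eta) (eta1 : eta <= 1) (r0 : 0 < r) (r1 : r <= 1) (er : eps = r ^+ 2).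
Hypotheses (t0 : 0 < t) (L0 : 0 <= L) (cX : collar Om L r X) (G00 : 0 <= G0).

Let rc1 := sp_reg (n_c1 S).
Let rc2 := sp_reg (n_c2 S).
Let rdc1 := sp_dreg (n_c1 S).
Let rdc2 := sp_dreg (n_c2 S).
Let rPhi := n_rPhi S.
Let rdPhi := n_rdPhi S.
Let rW := st_reg (r_sW Rf).
Let rG1 := st_reg (r_s1 Rf).
Let rG2 := st_reg (r_s2 Rf).
Let rX := co_reg cX.
Local Notation psi := (psi Phi PhW).
Local Notation rho := (rho c1 c2).
Local Notation sig := (sig c1 c2 eta).
Local Notation s1 := (exc G0 c1).
Local Notation s2 := (exc G0 c2).

Hypothesis small1 : It (fun q => s1 q ^+ 4) t <= r ^+ 8.
Hypothesis small2 : It (fun q => s2 q ^+ 4) t <= r ^+ 8.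

Let v00 : 0 <= v0. Proof. by apply: vol_ge0. Qed.

(** Interpolation by [s ^+ 2 <= r ^+ 2 + s ^+ 4 / r ^+ 2]. The threshold [r ^+ 8] on the fourth
    powers leaves room both here and in the analogous bound of the first power. *)
Lemma It_exc2 c : reg c -> It (fun q => exc G0 c q ^+ 4) t <= r ^+ 8 ->
  It (fun q => exc G0 c q ^+ 2) t <= (v0 + 1) * r ^+ 2.
Proof.
move=> rc small; have r20 : 0 < r ^+ 2 by rewrite exprn_gt0.
have ce4 := cb_excX G0 4 rc; have ce2 := cb_excX G0 2 rc.
apply: (@le_trans _ _ (It (fun q => r ^+ 2 + (r ^+ 2)^-1 * exc G0 c q ^+ 4) t)).
  apply: (It_le oOm bOm ce2 _ t0); first by regtac.
  move=> x _; move: (exc _ _ _) => s.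
  rewrite -(ler_pM2l r20).
  have -> : r ^+ 2 * (r ^+ 2 + (r ^+ 2)^-1 * s ^+ 4) = r ^+ 2 * r ^+ 2 + s ^+ 4.
    by field; rewrite gt_eqF.
  have := sqr_ge0 (r ^+ 2 - s ^+ 2); have := sqr_ge0 (r ^+ 2); have := sqr_ge0 (s ^+ 2).
  have -> : s ^+ 4 = s ^+ 2 * s ^+ 2 by ring.
  move: (r ^+ 2) (s ^+ 2) => a b; nra.
rewrite (ItD oOm bOm); [|by regtac|by regtac|exact: t0].
rewrite (It_cst oOm bOm).
rewrite (ItZ oOm bOm _ ce4 t0) mulrDl mul1r [r ^+ 2 * _]mulrC lerD2l.
apply: (@le_trans _ _ ((r ^+ 2)^-1 * r ^+ 8)); first by rewrite ler_pM2l// invr_gt0.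
have -> : (r ^+ 2)^-1 * r ^+ 8 = r ^+ 2 * r ^+ 4 by field; rewrite gt_eqF.
by rewrite ler_piMr ?(ltW r20)// exprn_ile1// ltW.
Qed.

Lemma It_exc1 c : reg c -> It (fun q => exc G0 c q ^+ 4) t <= r ^+ 8 ->
  It (exc G0 c) t <= (v0 + 1) * r.
Proof.
move=> rc small; have r30 : 0 < r ^+ 3 by rewrite exprn_gt0.
have ce4 := cb_excX G0 4 rc; have ce1 := cb_excX G0 1 rc.
apply: (@le_trans _ _ (It (fun q => r + (r ^+ 3)^-1 * exc G0 c q ^+ 4) t)).
  apply: (It_le oOm bOm ce1 _ t0); first by regtac.
  move=> x _; have := pos_ge0 (c (t, x) - G0); rewrite -/(exc G0 c (t, x)); move: (exc _ _ _) => s s0.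
  rewrite expr1 -(ler_pM2l r30).
  have -> : r ^+ 3 * (r + (r ^+ 3)^-1 * s ^+ 4) = r ^+ 4 + s ^+ 4 by field; rewrite gt_eqF.
  have h1 := mulr_ge0 s0 (exprn_ge0 3 (ltW r0)).
  have [sr|rs] := leP s r.
    apply: (@le_trans _ _ (r ^+ 3 * r)); first by rewrite ler_pM2l.
    by rewrite -exprSr lerDl exprn_ge0.
  apply: (@le_trans _ _ (s ^+ 3 * s)); last by rewrite -exprSr lerDr exprn_ge0// ltW.
  by rewrite ler_wpM2r// lerXn2r ?nnegrE// ltW.
rewrite (ItD oOm bOm); [|by regtac|by regtac|exact: t0].
rewrite (It_cst oOm bOm) (ItZ oOm bOm _ ce4 t0) mulrDl mul1r [r * _]mulrC lerD2l.
apply: (@le_trans _ _ ((r ^+ 3)^-1 * r ^+ 8)); first by rewrite ler_pM2l// invr_gt0.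
have -> : (r ^+ 3)^-1 * r ^+ 8 = r * r ^+ 4 by field; rewrite gt_eqF.
by rewrite ler_piMr ?(ltW r0)// exprn_ile1// ltW.
Qed.

(** Bound of [sig] where neither concentration exceeds [G0], given [eta <= 1]. *)
Definition height := 2 * G0 + 2.

Lemma sig_ge0 q : cyl Om q -> 0 <= sig q.
Proof.
move=> Qq; rewrite /sig; have := sp_ge0 (n_c1 S) Qq; have := sp_ge0 (n_c2 S) Qq.
by have := eta0; move: (c1 q) (c2 q) => *; lra.
Qed.

Lemma sig_le q : sig q <= height + (s1 q + s2 q).
Proof.
rewrite /sig /height /exc.
have h y : y <= G0 + pos (y - G0) by rewrite /pos -lerBlDl le_max lexx.
by have := h (c1 q); have := h (c2 q); have := eta1; move: (pos _) (pos _) => *; lra.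
Qed.

Lemma reg_sig : reg sig. Proof. by rewrite /sig; regtac. Qed.

Lemma sig2_le q : cyl Om q -> sig q ^+ 2 <= 3 * (height ^+ 2 + s1 q ^+ 2 + s2 q ^+ 2).
Proof.
move=> Qq; have a0 := sig_ge0 Qq; have al := sig_le q.
have h : sig q ^+ 2 <= (height + (s1 q + s2 q)) ^+ 2.
  by apply: lerXn2r => //; rewrite nnegrE// (le_trans a0).
apply: le_trans h _; move: (height) (s1 q) (s2 q) => a b c.
have := sqr_ge0 (a - b); have := sqr_ge0 (a - c); have := sqr_ge0 (b - c); lra.
Qed.

Lemma It_sig2 : It (fun q => sig q ^+ 2) t <= 3 * (height ^+ 2 * v0 + 2 * (v0 + 1)).
Proof.
have rs := reg_sig.
have ce1 := cb_excX G0 2 rc1; have ce2 := cb_excX G0 2 rc2.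
apply: (@le_trans _ _ (It (fun q => 3 * (height ^+ 2 + s1 q ^+ 2 + s2 q ^+ 2)) t)).
  apply: (It_le oOm bOm _ _ t0); [by regtac|by regtac|].
  by move=> x Ox; exact: sig2_le.
rewrite (ItZ oOm bOm); [|by regtac|exact: t0].
rewrite (ItD oOm bOm); [|by regtac|by regtac|exact: t0].
rewrite (ItD oOm bOm); [|by regtac|by regtac|exact: t0].
rewrite (It_cst oOm bOm) ler_pM2l// -addrA lerD2l.
have h1 := It_exc2 rc1 small1; have h2 := It_exc2 rc2 small2.
have h3 : (v0 + 1) * r ^+ 2 <= v0 + 1 by rewrite ler_piMr ?addr_ge0// exprn_ile1// ltW.
by move: h1 h2 h3; move: (It _ t) (It _ t) ((v0 + 1) * r ^+ 2) => *; lra.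
Qed.

Lemma It_collar_sig2 : It (fun q => X q * sig q ^+ 2) t <=
  (3 * height ^+ 2 * L + 6 * (v0 + 1)) * r.
Proof.
have rs := reg_sig.
have ce1 := cb_excX G0 2 rc1; have ce2 := cb_excX G0 2 rc2.
apply: (@le_trans _ _ (It (fun q => 3 * (height ^+ 2 * X q + s1 q ^+ 2 + s2 q ^+ 2)) t)).
  apply: (It_le oOm bOm _ _ t0); [by regtac|by regtac|].
  move=> x Ox; have Qx : cyl Om (t, x) by [].
  have X0 := co_ge0 cX Qx; have X1 := co_le1 cX Qx.
  have := ler_wpM2l X0 (sig2_le Qx).
  have h1 : X (t, x) * s1 (t, x) ^+ 2 <= s1 (t, x) ^+ 2 by rewrite ler_piMl// sqr_ge0.
  have h2 : X (t, x) * s2 (t, x) ^+ 2 <= s2 (t, x) ^+ 2 by rewrite ler_piMl// sqr_ge0.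
  by move: h1 h2; move: (s1 _ ^+ 2) (s2 _ ^+ 2) (X _) (height ^+ 2) (sig _ ^+ 2) => a b c d e *; lra.
rewrite (ItZ oOm bOm); [|by regtac|exact: t0].
rewrite (ItD oOm bOm); [|by regtac|by regtac|exact: t0].
rewrite (ItD oOm bOm); [|by regtac|by regtac|exact: t0].
rewrite (ItZ oOm bOm _ (F := X)); [|by regtac|exact: t0].
have h1 := It_exc2 rc1 small1; have h2 := It_exc2 rc2 small2.
have h3 : (v0 + 1) * r ^+ 2 <= (v0 + 1) * r.
  by rewrite expr2 mulrA ler_piMr// mulr_ge0 ?addr_ge0// ltW.
have h4 := ler_wpM2l (sqr_ge0 height) (co_vol cX t0).
move: h1 h2 h3 h4; move: (It X t) (It _ t) (It _ t) ((v0 + 1) * r ^+ 2) (height ^+ 2) (v0) => a b c d e v *.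
have -> : (3 * e * L + 6 * (v + 1)) * r = 3 * (e * (L * r)) + 6 * ((v + 1) * r) by ring.
lra.
Qed.

(** The bounded part of [sig] is paid by the integral [L / r] of the squared derivative; the excess
    is paid by the pointwise bound [(L / r) ^+ 2] times its integral, which is O(r). *)
Lemma It_sig_dcollar j : It (fun q => sig q * dx j X q ^+ 2) t <=
  (height * L + 2 * L ^+ 2 * (v0 + 1)) / r.
Proof.
have rs := reg_sig.
have ce1 := cb_excX G0 1 rc1; have ce2 := cb_excX G0 1 rc2.
have LL : 0 <= (L / r) ^+ 2 by exact: sqr_ge0.
apply: (@le_trans _ _ (It (fun q => height * dx j X q ^+ 2 + (L / r) ^+ 2 * (s1 q ^+ 1 + s2 q ^+ 1)) t)).
  apply: (It_le oOm bOm _ _ t0); [by regtac|by regtac|].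
  move=> x Ox; have Qx : cyl Om (t, x) by [].
  have := ler_wpM2r (sqr_ge0 (dx j X (t, x))) (sig_le (t, x)).
  have hd : dx j X (t, x) ^+ 2 <= (L / r) ^+ 2.
    rewrite -[leLHS]real_normK ?num_real//; apply: lerXn2r; rewrite ?nnegrE//; last exact: co_grad cX _ _ Qx.
    by rewrite divr_ge0// ltW.
  have a1 : 0 <= s1 (t, x) by exact: pos_ge0. have a2 : 0 <= s2 (t, x) by exact: pos_ge0.
  have := ler_wpM2l (addr_ge0 a1 a2) hd.
  rewrite !expr1; move: (s1 _) (s2 _) (dx j X _ ^+ 2) ((L / r) ^+ 2) (sig _) (height) => a b c d e f h h'.
  apply: le_trans h' _; rewrite mulrDl lerD2l; apply: le_trans h _.
  by rewrite mulrC.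
rewrite (ItD oOm bOm); [|by regtac|by regtac|exact: t0].
rewrite (ItZ oOm bOm height); [|by regtac|exact: t0].
rewrite (ItZ oOm bOm ((L / r) ^+ 2)); [|by regtac|exact: t0].
rewrite (ItD oOm bOm ce1 ce2 t0).
have e1 c : It (fun q => exc G0 c q ^+ 1) t = It (exc G0 c) t by apply: eq_It => x _; rewrite expr1.
rewrite !e1.
have h1 := It_exc1 rc1 small1; have h2 := It_exc1 rc2 small2.
have hh : 0 <= height by rewrite /height; have := G00; lra.
have h3 := ler_wpM2l hh (co_vol_grad cX j t0).
have h4 : (L / r) ^+ 2 * (It s1 t + It s2 t) <= (L / r) ^+ 2 * (2 * ((v0 + 1) * r)).
  by rewrite ler_wpM2l//; move: h1 h2; move: (It _ t) (It _ t) => *; lra.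
have -> : (height * L + 2 * L ^+ 2 * (v0 + 1)) / r = height * (L / r) + (L / r) ^+ 2 * (2 * ((v0 + 1) * r)).
  by field; rewrite gt_eqF.
exact: lerD.
Qed.

End CollarBounds.

Section DissipationBound.
Context {R : realType}.
Local Notation E3 := 'rV[R]_3.
Local Notation V := (R * 'rV[R]_3)%type.
Variables (Om : set E3).
Hypotheses (oOm : open Om) (bOm : bounded_set Om) (smOm : smooth_boundary Om).
Local Notation cb := (cb Om).
Local Notation reg := (reg Om).
Local Notation It := (It Om).
Local Notation v0 := (vol Om (fun=> 1)).

Variables (D1 D2 nu K eps : R) (g1 g2 w : E3 -> R) (c1 c2 Phi : V -> R)
  (u : 'I_3 -> V -> R) (p : V -> R).
Hypothesis S : nps Om D1 D2 nu K eps g1 g2 w c1 c2 Phi u p.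
Variables (M m : R) (Ga1 Ga2 PhW : V -> R).
Hypothesis Rf : reference Om M m g1 g2 w Ga1 Ga2 PhW.
Variables (eta r t L G0 CP : R) (X : V -> R).
Hypotheses (eta0 : 0 < eta) (eta1 : eta <= 1) (r0 : 0 < r) (r1 : r <= 1) (er : eps = r ^+ 2).
Hypotheses (t0 : 0 < t) (L0 : 0 <= L) (cX : collar Om L r X) (G00 : 0 <= G0).

Let rc1 := sp_reg (n_c1 S).
Let rc2 := sp_reg (n_c2 S).
Let rdc1 := sp_dreg (n_c1 S).
Let rdc2 := sp_dreg (n_c2 S).
Let rPhi := n_rPhi S.
Let rdPhi := n_rdPhi S.
Let rW := st_reg (r_sW Rf).
Let rG1 := st_reg (r_s1 Rf).
Let rG2 := st_reg (r_s2 Rf).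
Let rX := co_reg cX.
Local Notation psi := (psi Phi PhW).
Local Notation rho := (rho c1 c2).
Local Notation sig := (sig c1 c2 eta).
Local Notation diss := (diss Om c1 c2 Phi eta).
Local Notation s1 := (exc G0 c1).
Local Notation s2 := (exc G0 c2).

Hypothesis small1 : It (fun q => s1 q ^+ 4) t <= r ^+ 8.
Hypothesis small2 : It (fun q => s2 q ^+ 4) t <= r ^+ 8.

Let v00 : 0 <= v0. Proof. by apply: vol_ge0. Qed.

(** On the boundary this is [rho / sig]. Hence [rho - X * tilt * sig] has zero trace and differs
    from [rho] only where the collar [X] is nonzero. A correction proportional to [sig] fits into
    the quadratic form of the dissipation, provided that [tilt] stays away from 1 and -1. *)
Definition tilt (q : V) := (Ga1 q - Ga2 q) * (Ga1 q + Ga2 q + 2 * eta)^-1.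
(** Half of a lower bound for [1 - |tilt|]: this difference is at least [2 * m] divided by
    [Ga1 + Ga2 + 2 * eta], a sum that is at most [2 * (M + 1)]. *)
Definition kap := m / (2 * (M + 1)).

Let m0 := r_m0 Rf.
Let mM := r_mM Rf.
Let M0 : 0 < M := lt_le_trans m0 mM.

Lemma kap_gt0 : 0 < kap.
Proof. by rewrite /kap divr_gt0// mulr_gt0// addr_gt0. Qed.

Lemma refsum_ge q : cyl Om q -> 2 * m <= Ga1 q + Ga2 q + 2 * eta.
Proof.
move=> Qq; have := r_m1 Rf Qq; have := r_m2 Rf Qq; have := eta0.
by move: (Ga1 q) (Ga2 q) => *; lra.
Qed.

Lemma reg_tilt : reg tilt.
Proof.
have h : reg (fun q => Ga1 q + Ga2 q + 2 * eta) by regtac.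
have m20 : 0 < 2 * m by rewrite mulr_gt0.
have hi := @reg_inv _ _ oOm (fun q => Ga1 q + Ga2 q + 2 * eta) (2 * m) h m20 refsum_ge.
by rewrite /tilt; regtac.
Qed.

Lemma tilt_bound q : cyl Om q -> `|tilt q| <= 1 - 2 * kap.
Proof.
move=> Qq; have h := refsum_ge Qq.
have p0 : 0 < Ga1 q + Ga2 q + 2 * eta by apply: lt_le_trans h; rewrite mulr_gt0.
rewrite /tilt normrM normfV (gtr0_norm p0) ler_pdivrMr//.
have := r_m1 Rf Qq; have := r_m2 Rf Qq.
have := le_trans (ler_norm _) (st_bound (r_s1 Rf) Qq).
have := le_trans (ler_norm _) (st_bound (r_s2 Rf) Qq).
have e0 := eta0; have e1 := eta1; have mm := m0; have MM := M0.
have k0 := kap_gt0.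
have kM : 2 * kap * (M + 1) = m by rewrite /kap; field; rewrite gt_eqF// addr_gt0.
move: kM k0; move: (kap) (Ga1 q) (Ga2 q) => k a b kM k0 h1 h2 h3 h4.
have h5 : 2 * k * (a + b + 2 * eta) <= 2 * m.
  by rewrite -kM mulrCA ler_pM2l ?mulr_gt0//; lra.
rewrite ler_norml; apply/andP; split; lra.
Qed.

Lemma tilt_bound1 q : cyl Om q -> `|tilt q| <= 1.
Proof. by move=> /tilt_bound/le_trans; apply; have := kap_gt0; lra. Qed.

Lemma dtilt_bound j q : cyl Om q -> `|dx j tilt q| <= 2 * M / m.
Proof.
move=> Qq; have h := refsum_ge Qq.
have p0 : 0 < Ga1 q + Ga2 q + 2 * eta by apply: lt_le_trans h; rewrite mulr_gt0.
have rt := reg_tilt.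
have rs : reg (fun q => Ga1 q + Ga2 q + 2 * eta) by regtac.
have e : dx j (fun q => tilt q * (Ga1 q + Ga2 q + 2 * eta)) q = dx j (fun q => Ga1 q - Ga2 q) q.
  rewrite /dx; apply: near_eq_derive.
  have [oC nC] : open_nbhs q (cyl Om) by split => //; exact: open_cyl.
  have : nbhs q (cyl Om) by exact: open_nbhs_nbhs.
  apply: filterS => z Qz; rewrite /tilt mulfVK// gt_eqF//.
  by apply: lt_le_trans (refsum_ge Qz); rewrite mulr_gt0.
have [_ E1] := is_derive_sub (reg_is_derive (0, ebasis j) rG1 Qq) (reg_is_derive (0, ebasis j) rG2 Qq).
have [_ E2] := is_derive_add (is_derive_add (reg_is_derive (0, ebasis j) rG1 Qq)
  (reg_is_derive (0, ebasis j) rG2 Qq)) (is_derive_cst (2 * eta) q (0, ebasis j)).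
move: e; rewrite (dxM j rt rs Qq) [X in _ * X + _ = _]E2 [X in _ = X]E1 addr0 -!/(dx j _ _).
have b1 := st_dbound (r_s1 Rf) j Qq; have b2 := st_dbound (r_s2 Rf) j Qq.
have b3 := tilt_bound1 Qq.
set A := dx j Ga1 q; set B := dx j Ga2 q; set T := dx j tilt q; set s := _ + _ + 2 * eta; set f := tilt q => e.
have Ts : `|T| * s <= 4 * M.
  have ss : `|s| = s := gtr0_norm p0.
  rewrite -[X in _ * X]ss -normrM.
  have -> : T * s = A - B - f * (A + B) by rewrite -e; ring.
  rewrite (le_trans (ler_normB _ _))// normrM.
  have n1 := ler_normB A B; have n2 := ler_normD A B.
  have := ler_pM (normr_ge0 f) (normr_ge0 (A + B)) b3 (le_trans n2 (lerD b1 b2)).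
  move: n1 b1 b2; move: `|A - B| `|A| `|B| (`|f| * _) => *; lra.
have : `|T| * (2 * m) <= 4 * M by apply: le_trans Ts; rewrite ler_wpM2l.
rewrite ler_pdivlMr//; move: `|T| => x; lra.
Qed.

Let bend (q : V) := X q * tilt q.

Lemma reg_bend : reg bend. Proof. by have h := reg_tilt; rewrite /bend; regtac. Qed.

Lemma bend_bound q : cyl Om q -> `|bend q| <= 1 - 2 * kap.
Proof.
move=> Qq; rewrite /bend normrM (ger0_norm (co_ge0 cX Qq)).
apply: le_trans (tilt_bound Qq).
by rewrite ler_piMl// (co_le1 cX Qq).
Qed.

Lemma dbend2 j q : cyl Om q -> dx j bend q ^+ 2 <= 2 * dx j X q ^+ 2 + 8 * (M / m) ^+ 2.
Proof.
move=> Qq; rewrite (dxM j rX reg_tilt Qq).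
have X0 := co_ge0 cX Qq; have X1 := co_le1 cX Qq.
have b3 : tilt q ^+ 2 <= 1.
  by rewrite -[leLHS]real_normK ?num_real//; apply: exprn_ile1 => //; exact: tilt_bound1.
have bt : dx j tilt q ^+ 2 <= (2 * M / m) ^+ 2.
  rewrite -[leLHS]real_normK ?num_real//; apply: lerXn2r; rewrite ?nnegrE//; last exact: dtilt_bound.
  by rewrite divr_ge0 ?mulr_ge0// ltW.
have bX : X q ^+ 2 <= 1 by apply: exprn_ile1.
have h1 : X q ^+ 2 * dx j tilt q ^+ 2 <= 4 * (M / m) ^+ 2.
  have -> : 4 * (M / m) ^+ 2 = 1 * (2 * M / m) ^+ 2 by field; rewrite gt_eqF.
  by apply: ler_pM => //; exact: sqr_ge0.
have h2 : tilt q ^+ 2 * dx j X q ^+ 2 <= dx j X q ^+ 2 by rewrite ler_piMl// sqr_ge0.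
have := sqr_ge0 (X q * dx j tilt q - tilt q * dx j X q).
move: h1 h2; move: (X q) (dx j tilt q) (tilt q) (dx j X q) ((M / m) ^+ 2) => a b c d e; lra.
Qed.

Lemma trz_bend : trz Om (fun q => rho q - bend q * sig q).
Proof.
have tr := btrB (n_t1 S) (n_t2 S).
have ts := btrD (btrD (n_t1 S) (@btr_cst R Om eta)) (btrD (n_t2 S) (@btr_cst R Om eta)).
have s0 y : boundary Om y -> 0 < g1 y + g2 y + 2 * eta.
  by move=> by_; have := r_g1 Rf by_; have := r_g2 Rf by_; have := eta0; move: (g1 y) (g2 y) => *; lra.
have ti : btr Om (fun q => (Ga1 q + Ga2 q + 2 * eta)^-1) (fun y => (g1 y + g2 y + 2 * eta)^-1).
  apply: (@btr_comp _ _ (fun q => Ga1 q + Ga2 q + 2 * eta) (fun y => g1 y + g2 y + 2 * eta) (fun y => y^-1)).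
    exact (btrD (btrD (r_t1 Rf) (r_t2 Rf)) (@btr_cst R Om (2 * eta))).
  by move=> y by_; apply: inv_continuous; rewrite gt_eqF// s0.
have tb := btrM (co_btr cX) (btrM (btrB (r_t1 Rf) (r_t2 Rf)) ti).
apply: (@btr_eq _ _ _ _ _ _ (btrB tr (btrM tb ts))) => // y by_.
have := s0 y by_; move: (g1 y) (g2 y) => a b h.
rewrite mul1r; apply/eqP; rewrite subr_eq0; apply/eqP.
by field; rewrite gt_eqF.
Qed.

(** With [x_i = A_i / a_i], the right side minus the part of the first term without [y] is a sum of
    forms [a_i * (x_i ^+ 2 + 2 * b * x_i * q + q ^+ 2)]. Each is at least [2 * k * a_i * q ^+ 2],
    because [b ^+ 2 <= 1 - 2 * k]. Half of this gain stays in the conclusion, the other half pays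
    for [y] by Young's inequality. *)
Lemma dissipation_pointwise (a1 a2 A1 A2 q b y k : R) : 0 < a1 -> 0 < a2 -> 0 < k ->
  `|b| <= 1 - 2 * k ->
  2 * ((A1 - A2 - (b * (A1 + A2) + (a1 + a2) * y)) * q) + k * ((a1 + a2) * q ^+ 2) -
    k^-1 * ((a1 + a2) * y ^+ 2) <=
  (A1 + 1 * (a1 * q)) ^+ 2 / a1 + (A2 + (-1) * (a2 * q)) ^+ 2 / a2.
Proof.
move=> a10 a20 k0 bk.
pose x1 := A1 / a1; pose x2 := A2 / a2.
have -> : A1 = a1 * x1 by rewrite /x1; field; rewrite gt_eqF.
have -> : A2 = a2 * x2 by rewrite /x2; field; rewrite gt_eqF.
have -> : (a1 * x1 + 1 * (a1 * q)) ^+ 2 / a1 = a1 * (x1 + q) ^+ 2 by field; rewrite gt_eqF.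
have -> : (a2 * x2 + (-1) * (a2 * q)) ^+ 2 / a2 = a2 * (x2 - q) ^+ 2 by field; rewrite gt_eqF.
pose y' := y / k; have -> : y = k * y' by rewrite /y'; field; rewrite gt_eqF.
have -> : k^-1 * ((a1 + a2) * (k * y') ^+ 2) = k * ((a1 + a2) * y' ^+ 2) by field; rewrite gt_eqF.
have b2 : b ^+ 2 <= 1 - 2 * k.
  have n0 := normr_ge0 b.
  rewrite -[leLHS]real_normK ?num_real// expr2.
  apply: le_trans (ler_pM n0 n0 bk bk) _.
  by rewrite ler_piMr//; [exact: le_trans bk|lra].
have h (a x : R) : 0 < a -> 0 <= a * ((1 - 2 * k) * q ^+ 2 + 2 * (b * x * q) + x ^+ 2).
  move=> a0; rewrite mulr_ge0 ?(ltW a0)//.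
  have := ler_wpM2r (sqr_ge0 q) b2; have := sqr_ge0 (x + b * q); lra.
have e (a : R) : 0 < a -> 0 <= k * (a * (q + y') ^+ 2).
  by move=> a0; rewrite mulr_ge0 ?(ltW k0)// mulr_ge0 ?sqr_ge0// ltW.
have := h a1 x1 a10; have := h a2 x2 a20; have := e a1 a10; have := e a2 a20.
move=> *; lra.
Qed.

Let C0 := v0 + 3 * (height G0 ^+ 2 * v0 + 2 * (v0 + 1)).

Lemma It_1sig2 : It (fun q => 1 + sig q ^+ 2) t <= C0.
Proof.
have rs := reg_sig oOm S eta.
rewrite (ItD oOm bOm); [|by regtac|by regtac|exact: t0].
rewrite (It_cst oOm bOm) mul1r lerD2l.
exact: (It_sig2 oOm bOm S eta0 eta1 r0 r1 t0 small1 small2).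
Qed.

Definition Cdiss := (3 * height G0 ^+ 2 * L + 6 * (v0 + 1)) +
  kap^-1 * (6 * (height G0 * L + 2 * L ^+ 2 * (v0 + 1)) + 24 * (M / m) ^+ 2 * C0).

(** Poisson's equation is tested with [f = rho - bend * sig], and [2 * f * rho] is at least
    [rho ^+ 2 - bend ^+ 2 * sig ^+ 2]. Since [bend ^+ 2 <= X], the loss sits in the collar and is
    O(r), that is O(1/r) after division by [eps = r ^+ 2]. The derivatives of [bend] cost O(1/r) as
    well, which is why the width of the layer is the square root of [eps]. *)
Lemma dissipation_bound :
  kap * It (fun q => sig q * grad2 Phi q) t + eps^-1 * It (fun q => rho q ^+ 2) t <=
  diss t + Cdiss / r.
Proof.
have rs := reg_sig oOm S eta; have rr := reg_rho oOm S; have rb := reg_bend.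
have k0 := kap_gt0.
have e0 : 0 < eps by rewrite er exprn_gt0.
have sc1 := n_c1 S; have sc2 := n_c2 S.
pose f q := rho q - bend q * sig q.
have rf : reg f by rewrite /f; regtac.
have i1 := poisson_test oOm bOm smOm S rf trz_bend t0.
have ci1 := cb_invc eta0 sc1; have ci2 := cb_invc eta0 sc2.
have rd1 := reg_drift oOm rdPhi eta sc1; have rd2 := reg_drift oOm rdPhi eta sc2.
pose Y (q : V) := \sum_(j < 3) dx j bend q ^+ 2.
have cY : cb Y by rewrite /Y; regtac.
have cG : cb (grad2 Phi) by rewrite /grad2; regtac.
have cF : cb (fun q => \sum_(j < 3) dx j f q * dx j Phi q) by regtac.
have i2 : 2 * It (fun q => \sum_(j < 3) dx j f q * dx j Phi q) t +
    kap * It (fun q => sig q * grad2 Phi q) t - kap^-1 * It (fun q => sig q * Y q) t <= diss t.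
  rewrite /diss -(ItD oOm bOm); [|by regtac|by regtac|exact: t0].
  rewrite -(ItZ oOm bOm 2 cF t0).
  rewrite -(ItZ oOm bOm kap); [|by regtac|exact: t0].
  rewrite -(ItZ oOm bOm kap^-1); [|by regtac|exact: t0].
  rewrite -(ItD oOm bOm); [|by regtac|by regtac|exact: t0].
  rewrite -(ItB oOm bOm); [|by regtac|by regtac|exact: t0].
  apply: (It_le oOm bOm _ _ t0); [by regtac|by regtac|].
  move=> x Ox; have Qx : cyl Om (t, x) by [].
  rewrite /grad2 /Y !mulr_sumr -!big_split/= -sumrB; apply: ler_sum => j _.
  have a10 : 0 < c1 (t, x) + eta by exact: lt_le_trans eta0 (conc_ge eta sc1 Qx).
  have a20 : 0 < c2 (t, x) + eta by exact: lt_le_trans eta0 (conc_ge eta sc2 Qx).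
  have := dissipation_pointwise (dx j c1 (t, x)) (dx j c2 (t, x)) (dx j Phi (t, x))
    (dx j bend (t, x)) a10 a20 k0 (bend_bound Qx).
  have -> : dx j f (t, x) = dx j c1 (t, x) - dx j c2 (t, x) -
    (bend (t, x) * (dx j c1 (t, x) + dx j c2 (t, x)) + sig (t, x) * dx j bend (t, x)).
    have h1 := is_derive_add (reg_is_derive (0, ebasis j) rc1 Qx) (is_derive_cst eta (t, x) (0, ebasis j)).
    have h2 := is_derive_add (reg_is_derive (0, ebasis j) rc2 Qx) (is_derive_cst eta (t, x) (0, ebasis j)).
    have [_ E] := is_derive_sub (is_derive_sub (reg_is_derive (0, ebasis j) rc1 Qx) (reg_is_derive (0, ebasis j) rc2 Qx))
      (is_derive_mul (reg_is_derive (0, ebasis j) rb Qx) (is_derive_add h1 h2)).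
    by apply: etrans E _; rewrite !addr0.
  by rewrite /sig /drift.
have i3 : It (fun q => sig q * Y q) t <=
    (6 * (height G0 * L + 2 * L ^+ 2 * (v0 + 1)) + 24 * (M / m) ^+ 2 * C0) / r.
  clear i1 i2; apply: (@le_trans _ _ (It (fun q => \sum_(j < 3) (2 * (sig q * dx j X q ^+ 2) +
     8 * (M / m) ^+ 2 * (1 + sig q ^+ 2))) t)).
    apply: (It_le oOm bOm _ _ t0); [by regtac|by regtac|].
    move=> x Ox; have Qx : cyl Om (t, x) by [].
    rewrite /Y mulr_sumr; apply: ler_sum => j _.
    have sg := sig_ge0 S eta0 Qx.
    have := ler_wpM2l sg (dbend2 j Qx).
    have : sig (t, x) <= 1 + sig (t, x) ^+ 2.
      by have := sqr_ge0 (1 - sig (t, x)); have := sqr_ge0 (sig (t, x)); move: (sig _) => *; lra.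
    move=> /(ler_wpM2l (sqr_ge0 (M / m))).
    move: (sig _) (dx j X _ ^+ 2) (dx j bend _ ^+ 2) ((M / m) ^+ 2) => a b c d *; lra.
  have cj j : cb (fun q => 2 * (sig q * dx j X q ^+ 2) + 8 * (M / m) ^+ 2 * (1 + sig q ^+ 2)) by regtac.
  rewrite (It_sum oOm bOm cj t0).
  have hj (j : 'I_3) : It (fun q => 2 * (sig q * dx j X q ^+ 2) + 8 * (M / m) ^+ 2 * (1 + sig q ^+ 2)) t <=
    2 * ((height G0 * L + 2 * L ^+ 2 * (v0 + 1)) / r) + 8 * (M / m) ^+ 2 * (C0 / r).
    rewrite (ItD oOm bOm); [|by regtac|by regtac|exact: t0].
    rewrite (ItZ oOm bOm 2); [|by regtac|exact: t0].
    rewrite (ItZ oOm bOm (8 * (M / m) ^+ 2)); [|by regtac|exact: t0].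
    apply: lerD.
      rewrite ler_pM2l//.
      exact: (It_sig_dcollar oOm bOm S eta1 r0 r1 t0 L0 cX G00 small1 small2).
    apply: ler_wpM2l; first by apply: mulr_ge0 => //; exact: sqr_ge0.
    apply: le_trans It_1sig2 _.
    have C00 : 0 <= C0.
      apply: addr_ge0 => //; apply: mulr_ge0 => //; apply: addr_ge0.
        by apply: mulr_ge0 => //; exact: sqr_ge0.
      by apply: mulr_ge0 => //; exact: addr_ge0.
    by rewrite ler_pdivlMr// ler_piMr.
  apply: le_trans (ler_sum _ (fun j _ => hj j)) _.
  rewrite sumr_const card_ord -[leLHS]mulr_natl le_eqVlt; apply/orP; left; apply/eqP.
  by move: (height G0) (v0) (C0) ((M / m) ^+ 2) => a b c d; field; rewrite gt_eqF.
have i4 : eps^-1 * It (fun q => rho q ^+ 2) t - eps^-1 * It (fun q => X q * sig q ^+ 2) t <=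
    2 * It (fun q => \sum_(j < 3) dx j f q * dx j Phi q) t.
  have -> : It (fun q => \sum_(j < 3) dx j f q * dx j Phi q) t = eps^-1 * It (fun q => f q * rho q) t.
    by rewrite i1 mulrA mulVf ?gt_eqF// mul1r.
  rewrite mulrCA -mulrBr ler_pM2l ?invr_gt0//.
  rewrite -(ItB oOm bOm); [|by regtac|by regtac|exact: t0].
  rewrite -(ItZ oOm bOm 2); [|by regtac|exact: t0].
  apply: (It_le oOm bOm _ _ t0); [by regtac|by regtac|].
  move=> x Ox; have Qx : cyl Om (t, x) by [].
  have b1 : bend (t, x) ^+ 2 <= X (t, x).
    have X0 := co_ge0 cX Qx; have X1 := co_le1 cX Qx.
    rewrite /bend exprMn expr2 -mulrA ler_piMr// mulr_ile1 ?sqr_ge0//.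
    by rewrite -[leLHS]real_normK ?num_real//; apply: exprn_ile1 => //; exact: tilt_bound1.
  have := ler_wpM2r (sqr_ge0 (sig (t, x))) b1.
  clear i1 i2 i3; rewrite /f; have := sqr_ge0 (rho (t, x) - bend (t, x) * sig (t, x)).
  move: (rho _) (bend _) (sig _) (X _) => a b c d *; lra.
have i5 := It_collar_sig2 oOm bOm S eta0 eta1 r0 r1 t0 cX small1 small2.
have i6 : eps^-1 * It (fun q => X q * sig q ^+ 2) t <= (3 * height G0 ^+ 2 * L + 6 * (v0 + 1)) / r.
  apply: (@le_trans _ _ (eps^-1 * ((3 * height G0 ^+ 2 * L + 6 * (v0 + 1)) * r))).
    by rewrite ler_pM2l// invr_gt0.
  by rewrite er le_eqVlt; apply/orP; left; apply/eqP; field; rewrite gt_eqF.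
have ik : 0 <= kap^-1 by rewrite invr_ge0 ltW.
have i7 := ler_wpM2l ik i3.
have -> : Cdiss / r = (3 * height G0 ^+ 2 * L + 6 * (v0 + 1)) / r +
   kap^-1 * ((6 * (height G0 * L + 2 * L ^+ 2 * (v0 + 1)) + 24 * (M / m) ^+ 2 * C0) / r).
  rewrite /Cdiss mulrDl; congr (_ + _); exact: esym (mulrA _ _ _).
clear i1 i3 i5; move: i2 i4 i6 i7; move: (kap * It _ t) (kap^-1 * It _ t) (eps^-1 * It _ t) (eps^-1 * It _ t) (It _ t) (diss t).
move: (_ / r) (kap^-1 * (_ / r)) => *; lra.
Qed.

End DissipationBound.

(** * The truncated potential and the field energy *)

Section FieldBound.
Context {R : realType}.
Local Notation E3 := 'rV[R]_3.
Local Notation V := (R * 'rV[R]_3)%type.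
Variables (Om : set E3).
Hypotheses (oOm : open Om) (bOm : bounded_set Om) (smOm : smooth_boundary Om).
Local Notation cb := (cb Om).
Local Notation reg := (reg Om).
Local Notation It := (It Om).
Local Notation v0 := (vol Om (fun=> 1)).

Variables (D1 D2 nu K eps : R) (g1 g2 w : E3 -> R) (c1 c2 Phi : V -> R)
  (u : 'I_3 -> V -> R) (p : V -> R).
Hypothesis S : nps Om D1 D2 nu K eps g1 g2 w c1 c2 Phi u p.
Variables (M m : R) (Ga1 Ga2 PhW : V -> R).
Hypothesis Rf : reference Om M m g1 g2 w Ga1 Ga2 PhW.
Variables (eta r t L G0 CP : R) (X : V -> R).
Hypotheses (eta0 : 0 < eta) (eta1 : eta <= 1) (r0 : 0 < r) (r1 : r <= 1) (er : eps = r ^+ 2).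
Hypotheses (t0 : 0 < t) (L0 : 0 <= L) (cX : collar Om L r X) (G00 : 0 <= G0).

Let rc1 := sp_reg (n_c1 S).
Let rc2 := sp_reg (n_c2 S).
Let rdc1 := sp_dreg (n_c1 S).
Let rdc2 := sp_dreg (n_c2 S).
Let rPhi := n_rPhi S.
Let rdPhi := n_rdPhi S.
Let rW := st_reg (r_sW Rf).
Let rG1 := st_reg (r_s1 Rf).
Let rG2 := st_reg (r_s2 Rf).
Let rX := co_reg cX.
Local Notation psi := (psi Phi PhW).
Local Notation rho := (rho c1 c2).
Local Notation sig := (sig c1 c2 eta).
Local Notation diss := (diss Om c1 c2 Phi eta).
Local Notation s1 := (exc G0 c1).
Local Notation s2 := (exc G0 c2).

Hypothesis small1 : It (fun q => s1 q ^+ 4) t <= r ^+ 8.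
Hypothesis small2 : It (fun q => s2 q ^+ 4) t <= r ^+ 8.

Let v00 : 0 <= v0. Proof. by apply: vol_ge0. Qed.

Hypothesis CP1 : 1 <= CP.
Hypothesis poin : forall (F : V -> R) t, reg F -> trz Om F -> 0 < t ->
  It (fun z => F z ^+ 2) t <= CP * It (grad2 F) t.

Let sum3 (k : R) : \sum_(j < 3) k = 3 * k.
Proof. by rewrite sumr_const card_ord -[LHS]mulr_natl. Qed.

Let m0 := r_m0 Rf.
Let mM := r_mM Rf.
Let M0 : 0 < M := lt_le_trans m0 mM.
Let C0 := v0 + 3 * (height G0 ^+ 2 * v0 + 2 * (v0 + 1)).
Local Notation kap := (kap M m).
Local Notation Cdiss := (Cdiss Om M m L G0).

Let damp (q : V) := (1 + r * psi q ^+ 2)^-1.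
(** Equal to [r * psi ^+ 2 / (1 + r * psi ^+ 2)]: zero on the boundary and near 1 where [psi] is
    large compared with [r^(-1/2)]. On the complementary part [psi * damp] is at most [r^(-1/2)], a
    size that the layer estimate of [rho] can afford. *)
Let Th (q : V) := 1 - damp q.

Let dampE q : damp q * (1 + r * psi q ^+ 2) = 1.
Proof. by rewrite /damp mulVf// gt_eqF// ltr_pwDl// mulr_ge0 ?sqr_ge0// ltW. Qed.

Let damp0 q : 0 < damp q.
Proof. by rewrite /damp invr_gt0 ltr_pwDl// mulr_ge0 ?sqr_ge0// ltW. Qed.

Let damp1 q : damp q <= 1.
Proof.
have h : 0 <= r * psi q ^+ 2 by rewrite mulr_ge0 ?sqr_ge0// ltW.
by rewrite /damp invf_le1 ?ltr_pwDl// lerDl.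
Qed.

Let reg_den : reg (fun q => 1 + r * psi q ^+ 2).
Proof. by have h := reg_psi oOm S Rf; regtac. Qed.

Let reg_damp : reg damp.
Proof.
apply: (@reg_inv _ _ oOm (fun q => 1 + r * psi q ^+ 2) 1 reg_den ltr01) => q _.
by rewrite lerDl mulr_ge0 ?sqr_ge0// ltW.
Qed.

Let reg_Th : reg Th. Proof. by rewrite /Th; regtac. Qed.

Let trz_Th : trz Om Th.
Proof.
have tp := trz_psi S Rf.
have h : btr Om (fun q => 1 + r * (psi q * psi q)) (fun y => 1 + r * (0 * 0)).
  exact (btrD (@btr_cst R Om 1) (btrM (@btr_cst R Om r) (btrM tp tp))).
have h2 : btr Om (fun q => (1 + r * (psi q * psi q))^-1) (fun y => (1 + r * (0 * 0))^-1).
  apply: (@btr_comp _ _ (fun q => 1 + r * (psi q * psi q)) (fun y => 1 + r * (0 * 0)) (fun y => y^-1) h).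
  by move=> y _; apply: inv_continuous; rewrite mulr0 mulr0 addr0 oner_eq0.
apply: (@btr_eq _ _ _ _ _ _ (btrB (@btr_cst R Om 1) h2)) => //.
by move=> y _; rewrite mulr0 mulr0 addr0 invr1 subrr.
Qed.

Let slope (q : V) := 2 * r * psi q * damp q ^+ 2.

Let dTh j q : cyl Om q -> dx j Th q = slope q * dx j psi q.
Proof.
move=> Qq; have rp := reg_psi oOm S Rf.
have e : dx j (fun q => damp q * (1 + r * psi q ^+ 2)) q = 0.
  have -> : (fun q => damp q * (1 + r * psi q ^+ 2)) = fun=> 1 by apply/funext => z; rewrite dampE.
  exact: derive_cst.
have [_ E] := is_derive_add (is_derive_cst (1 : R) q (0, ebasis j)) (is_derive_mul (is_derive_cst r q (0, ebasis j))
  (is_derive_mul (reg_is_derive (0, ebasis j) rp Qq) (reg_is_derive (0, ebasis j) rp Qq))).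
have E' : dx j (fun q => 1 + r * psi q ^+ 2) q = 2 * r * psi q * dx j psi q.
  have -> : (fun q => 1 + r * psi q ^+ 2) = (fun q => 1 + r * (psi q * psi q)).
    by apply/funext => z; rewrite expr2.
  by apply: etrans E _; rewrite -!/(dx j _ _) /cst; ring.
rewrite (dxM j reg_damp reg_den Qq) E' in e.
have [_ F] := is_derive_sub (is_derive_cst (1 : R) q (0, ebasis j)) (reg_is_derive (0, ebasis j) reg_damp Qq).
apply: etrans F _; rewrite -/(dx j damp q) sub0r /slope.
have d := dampE q.
have hD : dx j damp q = damp q * ((1 + r * psi q ^+ 2) * dx j damp q) by rewrite mulrA d mul1r.
have e2 : (1 + r * psi q ^+ 2) * dx j damp q = - (damp q * (2 * r * psi q * dx j psi q)).
  by apply/eqP; rewrite -subr_eq0 opprK addrC e.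
rewrite hD e2; ring.
Qed.

(** From [2 * x <= x ^+ 2 / 2 + 2]. The share proportional to [Th] can be absorbed by the
    dissipation; the remaining share carries a factor [r]. *)
Let slope_bound q : `|slope q| <= 1 / 2 * Th q + 2 * r.
Proof.
have d0 := damp0 q; have d1 := damp1 q; have dE := dampE q.
have tE : Th q = r * psi q ^+ 2 * damp q by rewrite /Th -dE; ring.
rewrite tE /slope; move: (psi q) (damp q) d0 d1 => y d d0 d1.
have n20 : (0 : R) < 2 by [].
rewrite 3!normrM normrX (gtr0_norm r0) (gtr0_norm d0) (gtr0_norm n20).
have n0 := normr_ge0 y.
have n2 : y ^+ 2 = `|y| ^+ 2 by rewrite real_normK ?num_real.
rewrite n2; move: `|y| n0 => x x0.
have h1 : 2 * x <= 1 / 2 * x ^+ 2 + 2 by have := sqr_ge0 (x - 2); lra.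
have h2 : d ^+ 2 <= d by rewrite expr2 ler_piMr// ltW.
have rd : 0 <= r * d ^+ 2 by rewrite mulr_ge0 ?sqr_ge0// ltW.
have h3 := ler_wpM2l rd h1.
have h4 : r * d ^+ 2 <= r * d by rewrite ler_pM2l.
have h5 : r * d <= r by rewrite ler_piMr// ltW.
have h6 := ler_wpM2r (sqr_ge0 x) h4.
have -> : 2 * r * x * d ^+ 2 = r * d ^+ 2 * (2 * x) by ring.
lra.
Qed.

(** Completing the square leaves a gain of [3 / 4 * T * q ^+ 2] per unit of each concentration,
    exactly what the share [T / 2] of the bound on [s] consumes. The share [2 * rr] produces the
    term with the factor [3 * rr]. *)
Lemma theta_pointwise (a1 a2 A1 A2 q v T s rr W : R) : 0 < a1 -> 0 < a2 -> 0 <= T -> T <= 1 -> 0 <= rr -> rr <= 1 ->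
  v = q - W -> `|s| <= 1 / 2 * T + 2 * rr ->
  (T * (A1 - A2) + (a1 - a2) * (s * v)) * q <=
  ((A1 + 1 * (a1 * q)) ^+ 2 / a1 + (A2 + (-1) * (a2 * q)) ^+ 2 / a2) + 3 * rr * ((a1 + a2) * q ^+ 2)
   + 5 / 4 * ((a1 + a2) * W ^+ 2).
Proof.
move=> a10 a20 T0 T1 k0 k1 -> sb.
pose x1 := A1 / a1; pose x2 := A2 / a2.
have -> : A1 = a1 * x1 by rewrite /x1; field; rewrite gt_eqF.
have -> : A2 = a2 * x2 by rewrite /x2; field; rewrite gt_eqF.
have -> : (a1 * x1 + 1 * (a1 * q)) ^+ 2 / a1 = a1 * (x1 + q) ^+ 2 by field; rewrite gt_eqF.
have -> : (a2 * x2 + (-1) * (a2 * q)) ^+ 2 / a2 = a2 * (x2 - q) ^+ 2 by field; rewrite gt_eqF.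
have sq : `|s * ((q - W) * q)| <= (1 / 2 * T + 2 * rr) * (3 / 2 * q ^+ 2 + 1 / 2 * W ^+ 2).
  rewrite normrM ler_pM// ler_norml; apply/andP.
  have := sqr_ge0 (q - W); have := sqr_ge0 (q + W); have := sqr_ge0 q; have := sqr_ge0 W => *; split; lra.
move: sq; rewrite ler_norml => /andP[s1' s2'].
have b1 : 0 <= a1 * T * (x1 + q - 1 / 2 * q) ^+ 2 by rewrite mulr_ge0 ?sqr_ge0// mulr_ge0// ltW.
have b2 : 0 <= a2 * T * (x2 - q + 1 / 2 * q) ^+ 2 by rewrite mulr_ge0 ?sqr_ge0// mulr_ge0// ltW.
have b3 := ler_wpM2r (mulr_ge0 (ltW a10) (sqr_ge0 (x1 + q))) T1.
have b4 := ler_wpM2r (mulr_ge0 (ltW a20) (sqr_ge0 (x2 - q))) T1.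
have b5 := ler_wpM2l (ltW a10) s2'.
have b6 := ler_wpM2l (ltW a20) s1'.
have b7 := ler_wpM2r (mulr_ge0 (ltW a10) (sqr_ge0 W)) T1.
have b8 := ler_wpM2r (mulr_ge0 (ltW a20) (sqr_ge0 W)) T1.
have b9 := ler_wpM2r (mulr_ge0 (ltW a10) (sqr_ge0 W)) k1.
have b10 := ler_wpM2r (mulr_ge0 (ltW a20) (sqr_ge0 W)) k1.
clear s1' s2' sb; lra.
Qed.

Let e0 : 0 < eps. Proof. by rewrite er exprn_gt0. Qed.

Let It_sig : It sig t <= C0.
Proof.
have rs := reg_sig oOm S eta.
apply: le_trans (It_1sig2 oOm bOm S eta0 eta1 r0 r1 t0 small1 small2).
apply: (It_le oOm bOm _ _ t0); [by regtac|by regtac|] => x _.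
have := sqr_ge0 (1 - sig (t, x)); have := sqr_ge0 (sig (t, x)); move: (sig _) => *; lra.
Qed.

Let diss_ge0 : 0 <= diss t.
Proof.
apply: addr_ge0; apply: It_ge0 => x Ox; have Qx : cyl Om (t, x) by [].
  by apply: sumr_ge0 => j _; rewrite divr_ge0 ?sqr_ge0// ltW// (lt_le_trans eta0 (conc_ge eta (n_c1 S) Qx)).
by apply: sumr_ge0 => j _; rewrite divr_ge0 ?sqr_ge0// ltW// (lt_le_trans eta0 (conc_ge eta (n_c2 S) Qx)).
Qed.

(** [Th * rho] has zero trace, so Poisson's equation can be tested with it without a layer. The term
    with the factor [3 * r] meets the [Cdiss / r] of [dissipation_bound], and no negative power of
    [r] survives. *)
Lemma theta_bound : eps^-1 * It (fun q => rho q ^+ 2 * Th q) t <=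
  (1 + 3 / kap) * diss t + (3 / kap * Cdiss + 4 * M ^+ 2 * C0).
Proof.
have rs := reg_sig oOm S eta; have rr := reg_rho oOm S.
have sc1 := n_c1 S; have sc2 := n_c2 S.
have rf : reg (fun q => Th q * rho q) by regtac.
have tf : trz Om (fun q => Th q * rho q) by apply: trz_bounded trz_Th _; exact: reg_cb.
have i1 := poisson_test oOm bOm smOm S rf tf t0.
have ci1 := cb_invc eta0 sc1; have ci2 := cb_invc eta0 sc2.
have rd1 := reg_drift oOm rdPhi eta sc1; have rd2 := reg_drift oOm rdPhi eta sc2.
have cG : cb (grad2 Phi) by rewrite /grad2; regtac.
have cW : cb (grad2 PhW) by rewrite /grad2; regtac.
have -> : eps^-1 * It (fun q => rho q ^+ 2 * Th q) t =
    It (fun q => \sum_(j < 3) dx j (fun q => Th q * rho q) q * dx j Phi q) t.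
  have -> : It (fun q => rho q ^+ 2 * Th q) t = It (fun q => Th q * rho q * rho q) t.
    by apply: eq_It => x _; ring.
  by rewrite i1 mulrA mulVf ?mul1r// gt_eqF.
clear i1.
have i2 : It (fun q => \sum_(j < 3) dx j (fun q => Th q * rho q) q * dx j Phi q) t <=
    diss t + 3 * r * It (fun q => sig q * grad2 Phi q) t + 5 / 4 * It (fun q => sig q * grad2 PhW q) t.
  rewrite /diss -(ItD oOm bOm); [|by regtac|by regtac|exact: t0].
  rewrite -(ItZ oOm bOm (3 * r)); [|by regtac|exact: t0].
  rewrite -(ItZ oOm bOm (5 / 4)); [|by regtac|exact: t0].
  rewrite -(ItD oOm bOm); [|by regtac|by regtac|exact: t0].
  rewrite -(ItD oOm bOm); [|by regtac|by regtac|exact: t0].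
  apply: (It_le oOm bOm _ _ t0); [by regtac|by regtac|].
  move=> x Ox; have Qx : cyl Om (t, x) by [].
  rewrite /grad2 !mulr_sumr -!big_split/=; apply: ler_sum => j _.
  have a10 : 0 < c1 (t, x) + eta by exact: lt_le_trans eta0 (conc_ge eta sc1 Qx).
  have a20 : 0 < c2 (t, x) + eta by exact: lt_le_trans eta0 (conc_ge eta sc2 Qx).
  have Th0 : 0 <= Th (t, x) by rewrite /Th subr_ge0.
  have Th1 : Th (t, x) <= 1 by rewrite /Th gerBl ltW.
  have := theta_pointwise (dx j c1 (t, x)) (dx j c2 (t, x)) a10 a20 Th0 Th1 (ltW r0) r1
    (dx_psi S Rf j Qx) (slope_bound (t, x)).
  have -> : dx j (fun q => Th q * rho q) (t, x) = Th (t, x) * (dx j c1 (t, x) - dx j c2 (t, x)) +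
     (c1 (t, x) + eta - (c2 (t, x) + eta)) * (slope (t, x) * dx j psi (t, x)).
    rewrite (dxM j reg_Th rr Qx) (dTh j Qx).
    have [_ E] := is_derive_sub (reg_is_derive (0, ebasis j) rc1 Qx) (reg_is_derive (0, ebasis j) rc2 Qx).
    by rewrite [X in _ * X + _]E -!/(dx j _ _) /rho; congr (_ + _ * _); ring.
  by rewrite /sig /drift.
apply: le_trans i2 _.
have k0 : 0 < kap := kap_gt0 Rf.
have h1 := dissipation_bound oOm bOm smOm S Rf eta0 eta1 r0 r1 er t0 L0 cX G00 small1 small2.
have h2 : 0 <= eps^-1 * It (fun q => rho q ^+ 2) t.
  by rewrite mulr_ge0 ?invr_ge0 ?(ltW e0)//; apply: It_ge0 => x _; exact: sqr_ge0.
have h3 : kap * It (fun q => sig q * grad2 Phi q) t <= diss t + Cdiss / r.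
  by apply: le_trans h1; rewrite lerDl.
have h4 : It (fun q => sig q * grad2 PhW q) t <= 3 * M ^+ 2 * C0.
  apply: (@le_trans _ _ (It (fun q => 3 * M ^+ 2 * sig q) t)).
    apply: (It_le oOm bOm _ _ t0); [by regtac|by regtac|].
    move=> x Ox; have Qx : cyl Om (t, x) by [].
    rewrite mulrC ler_wpM2r ?(sig_ge0 S eta0 Qx)//.
    apply: (@le_trans _ _ (\sum_(j < 3) M ^+ 2)).
      apply: ler_sum => j _; rewrite -[leLHS]real_normK ?num_real//.
      by apply: lerXn2r; rewrite ?nnegrE ?(ltW M0)//; exact: st_dbound (r_sW Rf) _ _ Qx.
    by rewrite sum3.
  rewrite (ItZ oOm bOm _ (F := sig)); [|by regtac|exact: t0].
  by apply: ler_wpM2l It_sig; apply: mulr_ge0 => //; exact: sqr_ge0.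
have C00 : 0 <= M ^+ 2 * C0.
  by apply: mulr_ge0; [exact: sqr_ge0|apply: le_trans It_sig; apply: It_ge0 => x Ox; exact: (sig_ge0 S eta0 (conj t0 Ox : cyl Om (t, x)))].
have h5 : 3 * r * It (fun q => sig q * grad2 Phi q) t <= 3 / kap * diss t + 3 / kap * Cdiss.
  have -> : 3 * r * It (fun q => sig q * grad2 Phi q) t = 3 / kap * (r * (kap * It (fun q => sig q * grad2 Phi q) t)).
    by move: (It _ t) (kap) k0 => y k k0; field; rewrite gt_eqF.
  have k3 : 0 < 3 / kap by exact: divr_gt0.
  rewrite -mulrDr (ler_pM2l k3).
  apply: (@le_trans _ _ (r * (diss t + Cdiss / r))); first by rewrite ler_pM2l.
  rewrite mulrDr; apply: lerD; first by rewrite ler_piMl.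
  by rewrite mulrCA divff ?mulr1// gt_eqF.
clear h1 h2 h3.
have -> : (1 + 3 / kap) * diss t = diss t + 3 / kap * diss t by rewrite mulrDl mul1r.
rewrite -mulrA in h4; rewrite -[4 * M ^+ 2 * C0]mulrA.
move: h4 h5 C00; move: (M ^+ 2 * C0) (3 / kap * diss t) (3 / kap * Cdiss) => N a b.
by move: (3 * r * It _ t) (It _ t) (diss t) => *; lra.
Qed.

Definition Cfield1 := 2 * CP * (1 + 3 / kap) + 1.
Definition Cfield0 := 2 * CP * (3 / kap * Cdiss + 4 * M ^+ 2 * C0) + Cdiss + v0 + 6 * M ^+ 2 * v0.

(** Up to a bounded term, the field energy is the integral of [psi * rho], which is split with the
    weights [Th] and [damp]. The first part is paired with [psi] by the Poincaré inequality and
    controlled by [theta_bound]. In the second, [r * psi ^+ 2 * damp ^+ 2 <= 1] leaves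
    [rho ^+ 2 / (2 * r)], that is [r / 2] times the quantity bounded by [diss + Cdiss / r]. *)
Lemma field_bound : eps * It (grad2 psi) t <= Cfield1 * diss t + Cfield0.
Proof.
have rs := reg_sig oOm S eta; have rr := reg_rho oOm S; have rp := reg_psi oOm S Rf.
have tp := trz_psi S Rf.
have CP0 : 0 < CP := lt_le_trans ltr01 CP1.
have i1 := poisson_test oOm bOm smOm S rp tp t0.
have cG : cb (grad2 psi) by rewrite /grad2; regtac.
have i2 : 3 / 4 * It (grad2 psi) t <= It (fun q => \sum_(j < 3) dx j psi q * dx j Phi q) t + 3 * M ^+ 2 * v0.
  rewrite -(It_cst oOm bOm (3 * M ^+ 2) t) -(ItZ oOm bOm _ cG t0).
  rewrite -(ItD oOm bOm); [|by regtac|by regtac|exact: t0].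
  apply: (It_le oOm bOm _ _ t0); [by regtac|by regtac|].
  move=> x Ox; have Qx : cyl Om (t, x) by [].
  have -> : 3 * M ^+ 2 = \sum_(j < 3) M ^+ 2 by rewrite sum3.
  rewrite /grad2 mulr_sumr -big_split/=; apply: ler_sum => j _.
  have hW : dx j PhW (t, x) ^+ 2 <= M ^+ 2.
    rewrite -[leLHS]real_normK ?num_real//.
    by apply: lerXn2r; rewrite ?nnegrE ?(ltW M0)//; exact: st_dbound (r_sW Rf) _ _ Qx.
  have -> : dx j Phi (t, x) = dx j psi (t, x) + dx j PhW (t, x) by rewrite (dx_psi S Rf j Qx) subrK.
  have := sqr_ge0 (1 / 2 * dx j psi (t, x) + dx j PhW (t, x)).
  clear i1; move: (dx j psi _) (dx j PhW _) (M ^+ 2) hW => a b c hW; lra.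
have i3 : It (fun q => psi q * rho q) t <= eps / (4 * CP) * It (fun q => psi q ^+ 2) t +
   CP * (eps^-1 * It (fun q => rho q ^+ 2 * Th q) t) + r / 2 * (eps^-1 * It (fun q => rho q ^+ 2) t) + 1 / 2 * v0.
  clear i1 i2.
  rewrite (mulrA CP) (mulrA (r / 2)).
  rewrite -(It_cst oOm bOm (1 / 2) t).
  rewrite -(ItZ oOm bOm (eps / (4 * CP))); [|by regtac|exact: t0].
  rewrite -(ItZ oOm bOm (CP * eps^-1)); [|by regtac|exact: t0].
  rewrite -(ItZ oOm bOm (r / 2 * eps^-1)); [|by regtac|exact: t0].
  rewrite -(ItD oOm bOm); [|by regtac|by regtac|exact: t0].
  rewrite -(ItD oOm bOm); [|by regtac|by regtac|exact: t0].
  rewrite -(ItD oOm bOm); [|by regtac|by regtac|exact: t0].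
  apply: (It_le oOm bOm _ _ t0); [by regtac|by regtac|].
  move=> x _; have d0 := damp0 (t, x); have d1 := damp1 (t, x); have dE := dampE (t, x).
  rewrite /Th; move: (psi _) (rho _) (damp _) d0 d1 dE => y f d d0 d1 dE.
  have -> : y * f = y * f * (1 - d) + y * f * d by ring.
  have h1 : y * f * (1 - d) <= eps / (4 * CP) * y ^+ 2 + CP / eps * (f ^+ 2 * (1 - d)).
    have dd : (1 - d) ^+ 2 <= 1 - d by rewrite expr2 ler_piMr ?subr_ge0// gerBl ltW.
    have ce : 0 < CP / eps by rewrite divr_gt0.
    have h : CP / eps * (f ^+ 2 * (1 - d) ^+ 2) <= CP / eps * (f ^+ 2 * (1 - d)).
      by rewrite ler_pM2l// ler_wpM2l// sqr_ge0.
    apply: le_trans (lerD (lexx _) h).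
    rewrite -subr_ge0.
    have -> : eps / (4 * CP) * y ^+ 2 + CP / eps * (f ^+ 2 * (1 - d) ^+ 2) - y * f * (1 - d) =
      CP / eps * (eps / (2 * CP) * y - f * (1 - d)) ^+ 2 by field; rewrite !gt_eqF.
    by rewrite mulr_ge0 ?sqr_ge0// ltW.
  have h2 : y * f * d <= r / 2 * eps^-1 * f ^+ 2 + 1 / 2.
    have -> : r / 2 * eps^-1 * f ^+ 2 = (2 * r)^-1 * f ^+ 2 by rewrite er; field; rewrite gt_eqF.
    have e1 : r * y ^+ 2 * d ^+ 2 <= 1.
      have -> : r * y ^+ 2 * d ^+ 2 = d * (d * (1 + r * y ^+ 2)) - d ^+ 2 by ring.
      by rewrite dE mulr1; have := sqr_ge0 d; lra.
    have i0 : 0 < (2 * r)^-1 by rewrite invr_gt0 mulr_gt0.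
    have := mulr_ge0 (ltW i0) (sqr_ge0 (f - r * (y * d))).
    have -> : (2 * r)^-1 * (f - r * (y * d)) ^+ 2 = (2 * r)^-1 * f ^+ 2 - y * f * d + 1 / 2 * (r * y ^+ 2 * d ^+ 2).
      by field; rewrite gt_eqF.
    by move: e1; move: (_ * f ^+ 2) (y * f * d) (r * y ^+ 2 * _) => *; lra.
  move: h1 h2; move: (y * f * _) (y * f * d) (_ * y ^+ 2) (_ * (f ^+ 2 * _)) (_ * f ^+ 2) => *; lra.
have i4 := poin rp tp t0.
have i5 := theta_bound.
have h1 := dissipation_bound oOm bOm smOm S Rf eta0 eta1 r0 r1 er t0 L0 cX G00 small1 small2.
have k0 : 0 < kap := kap_gt0 Rf.
have i6 : r / 2 * (eps^-1 * It (fun q => rho q ^+ 2) t) <= 1 / 2 * (diss t + Cdiss).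
  have h : eps^-1 * It (fun q => rho q ^+ 2) t <= diss t + Cdiss / r.
    apply: le_trans h1; rewrite lerDr mulr_ge0 ?(ltW k0)//; apply: It_ge0 => x Ox.
    by rewrite mulr_ge0 ?grad2_ge0//; exact: (sig_ge0 S eta0 (conj t0 Ox : cyl Om (t, x))).
  apply: (@le_trans _ _ (r / 2 * (diss t + Cdiss / r))); first by rewrite ler_pM2l// divr_gt0.
  have -> : r / 2 * (diss t + Cdiss / r) = 1 / 2 * (r * diss t) + 1 / 2 * Cdiss.
    by move: (diss t) (Cdiss) => a b; field; rewrite gt_eqF.
  rewrite [leRHS]mulrDr lerD2r ler_pM2l//.
  by rewrite ler_piMl.
have i7 : eps / (4 * CP) * It (fun q => psi q ^+ 2) t <= 1 / 4 * (eps * It (grad2 psi) t).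
  apply: (@le_trans _ _ (eps / (4 * CP) * (CP * It (grad2 psi) t))).
    by rewrite ler_pM2l// divr_gt0// mulr_gt0.
  rewrite le_eqVlt; apply/orP; left; apply/eqP; move: (It _ t) => a.
  by field; rewrite gt_eqF.
have i8 := ler_wpM2l (ltW CP0) i5.
have i9 := ler_wpM2l (ltW e0) i2.
rewrite mulrDr -i1 in i9.
have e1 : eps <= 1 by rewrite er exprn_ile1// ltW.
have i10 : eps * (3 * M ^+ 2 * v0) <= 3 * M ^+ 2 * v0.
  by rewrite ler_piMl// mulr_ge0// mulr_ge0// sqr_ge0.
clear i1 i2 i4 i5 h1 rs rr rp tp.
have -> : Cfield1 * diss t + Cfield0 = 2 * (CP * ((1 + 3 / kap) * diss t + (3 / kap * Cdiss + 4 * M ^+ 2 * C0)))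
   + (diss t + Cdiss) + v0 + 6 * M ^+ 2 * v0.
  by rewrite /Cfield1 /Cfield0; move: (diss t) (Cdiss) (v0) (C0) (3 / kap) => *; ring.
have e9 : eps * (3 / 4 * It (grad2 psi) t) = 3 / 4 * (eps * It (grad2 psi) t) by rewrite mulrCA.
rewrite e9 in i9.
move: i3 i6 i7 i8 i9 i10.
rewrite -[6 * M ^+ 2 * v0]mulrA.
have -> : 3 * M ^+ 2 * v0 = 3 * (M ^+ 2 * v0) by rewrite mulrA.
move: (eps * (3 * (M ^+ 2 * v0))) (M ^+ 2 * v0) => z1 z2.
move: (CP * ((1 + 3 / kap) * diss t + (3 / kap * Cdiss + 4 * M ^+ 2 * C0))) => z3.
move: (CP * (eps^-1 * It (fun q => rho q ^+ 2 * Th q) t)) (r / 2 * (eps^-1 * It (fun q => rho q ^+ 2) t)) => z4 z5.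
move: (eps / (4 * CP) * It (fun q => psi q ^+ 2) t) (eps * It (grad2 psi) t) => z6 z7.
by move: (It (fun q => psi q * rho q) t) (diss t) (Cdiss) (v0) => *; lra.
Qed.

(** By [ln y <= y - 1] the relative entropy is at most quadratic in the concentration, with [m]
    bounding the reference from below. *)
Lemma entropy_bound z D c Ga : species Om u Phi z D c -> static Om M Ga ->
  (forall q, cyl Om q -> m <= Ga q) -> (forall q, cyl Om q -> c q + eta <= sig q) ->
  It (sdens eta c Ga) t <= m^-1 * It (fun q => sig q ^+ 2) t + (M + 1) * v0.
Proof.
move=> sc sG Gam cs; have rs := reg_sig oOm S eta.
have [rd _] := species_entropy oOm eta0 sc sG Gam m0.
rewrite -(It_cst oOm bOm (M + 1) t).
rewrite -(ItZ oOm bOm m^-1); [|by regtac|exact: t0].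
rewrite -(ItD oOm bOm); [|by regtac|by regtac|exact: t0].
apply: (It_le oOm bOm _ _ t0); [by regtac|by regtac|].
move=> x Ox; have Qx : cyl Om (t, x) by [].
have c0 : 0 < c (t, x) + eta by exact: lt_le_trans eta0 (conc_ge eta sc Qx).
have Am : m <= Ga (t, x) + eta := ref_ge eta0 Gam Qx.
have AM : Ga (t, x) + eta <= M + 1 by apply: lerD; [exact: le_trans (ler_norm _) (st_bound sG Qx)|].
have cS := cs _ Qx.
rewrite /sdens; move: (c _ + eta) (Ga _ + eta) (sig _) c0 Am AM cS => a A s a0 Am AM as_.
have A0 : 0 < A by exact: lt_le_trans Am.
have h : ln a - ln A <= a / A - 1.
  rewrite -ln_div ?posrE//; have := @le_ln1Dx R (a / A - 1).
  have -> : 1 + (a / A - 1) = a / A by ring.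
  by apply; have := divr_gt0 a0 A0; move: (a / A) => y; lra.
have h2 := ler_wpM2l (ltW a0) h.
have h3 : a * (a / A) <= m^-1 * s ^+ 2.
  rewrite mulrA -expr2 mulrC; apply: ler_pM.
  - by rewrite invr_ge0 ltW.
  - exact: sqr_ge0.
  - by rewrite lef_pV2.
  - by apply: lerXn2r => //; rewrite nnegrE ltW// (lt_le_trans a0).
move: h2; rewrite [a * (a / A - 1)]mulrBr mulr1; move: h3; move: (a * (a / A)) (a * (ln a - _)) (m^-1 * _) => *; lra.
Qed.

End FieldBound.

(** * Long-time behaviour *)

Section Evolution.
Context {R : realType}.
Local Notation E3 := 'rV[R]_3.
Local Notation V := (R * 'rV[R]_3)%type.
Variables (Om : set E3).
Hypotheses (oOm : open Om) (bOm : bounded_set Om) (smOm : smooth_boundary Om).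
Local Notation cb := (cb Om).
Local Notation reg := (reg Om).
Local Notation It := (It Om).
Local Notation v0 := (vol Om (fun=> 1)).

Variables (D1 D2 nu K eps : R) (g1 g2 w : E3 -> R) (c1 c2 Phi : V -> R)
  (u : 'I_3 -> V -> R) (p : V -> R).
Hypothesis S : nps Om D1 D2 nu K eps g1 g2 w c1 c2 Phi u p.
Variables (M m : R) (Ga1 Ga2 PhW : V -> R).
Hypothesis Rf : reference Om M m g1 g2 w Ga1 Ga2 PhW.
Hypotheses (eps0 : 0 < eps) (D10 : 0 < D1) (D20 : 0 < D2) (nu0 : 0 < nu) (K0 : 0 < K).
Variables (G0 CP : R).
Hypotheses (G00 : 0 <= G0) (CP1 : 1 <= CP).
Hypotheses (g1G : forall y, boundary Om y -> g1 y <= G0) (g2G : forall y, boundary Om y -> g2 y <= G0).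
Hypothesis poin : forall (F : V -> R) t, reg F -> trz Om F -> 0 < t ->
  It (fun z => F z ^+ 2) t <= CP * It (grad2 F) t.

Let rc1 := sp_reg (n_c1 S).
Let rc2 := sp_reg (n_c2 S).
Let rPhi := n_rPhi S.
Let rdPhi := n_rdPhi S.
Let ru := n_ru S.
Local Notation psi := (psi Phi PhW).
Local Notation rho := (rho c1 c2).
Local Notation s1 := (exc G0 c1).
Local Notation s2 := (exc G0 c2).
Local Notation Yd := (Yd G0 D1 D2 c1 c2).
Let m0 := r_m0 Rf.
Let M0 : 0 < M := lt_le_trans m0 (r_mM Rf).
Let CP0 : 0 < CP := lt_le_trans ltr01 CP1.
Let v00 : 0 <= v0. Proof. by apply: vol_ge0. Qed.

Definition rateY := 3 * Num.min D1 D2 / CP.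

Lemma rateY_gt0 : 0 < rateY.
Proof. by rewrite /rateY divr_gt0// mulr_gt0// lt_min D10. Qed.

(** The length [s0] of the controlled interval depends on the solution, whereas [Y0] does not.
    Gronwall's inequality is started at the smaller of [s0] and [t / 2], so that [s0] disappears
    from the bound. *)
Lemma Yd_decay s0 Y0 (t : R) : 0 < s0 -> 0 <= Y0 ->
  (forall s, 0 < s <= s0 -> It Yd s <= Y0) -> 0 < t ->
  It Yd t <= Y0 / (1 + rateY * (t / 2)).
Proof.
move=> s00 Y00 init t0; pose s := Num.min s0 (t / 2).
have t20 : 0 < t / 2 by rewrite divr_gt0.
have sp : 0 < s by rewrite lt_min s00.
have st : s <= t / 2 by rewrite ge_min lexx orbT.
have s_t : s <= t by apply: le_trans st _; lra.
have rY := reg_Yd oOm G0 (n_c1 S) (n_c2 S) : reg Yd.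
have Ys0 : 0 <= It Yd s.
  apply: It_ge0 => x _; rewrite /Yd addr_ge0// divr_ge0 ?exprn_ge0 ?pos_ge0//.
    by rewrite mulr_ge0// ltW.
  by rewrite mulr_ge0// ltW.
have pos_r x : s <= x <= t -> 0 < x by move=> /andP[+ _]; exact: lt_le_trans.
have dY (x : R) : s <= x <= t -> is_derive x 1 (It Yd) (It (dtt Yd) x).
  by move=> /pos_r x0; exact: is_derive_It.
have ineq x : s <= x <= t -> It (dtt Yd) x <= - rateY * It Yd x + 0.
  move=> /pos_r x0; rewrite addr0.
  exact: (excess_decay oOm bOm smOm ru (n_tu S) (n_div S) rPhi rdPhi D10 D20 eps0 CP1
    (n_c1 S) (n_c2 S) (n_t1 S) (n_t2 S) poin (n_poisson S) G00 g1G g2G x0).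
have := gronwall rateY_gt0 (lexx 0) s_t dY ineq Ys0.
rewrite mul0r add0r => /le_trans; apply.
have h1 : 0 < 1 + rateY * (t / 2) by rewrite ltr_pwDl// mulr_ge0// ltW// rateY_gt0.
have h2 : 1 + rateY * (t / 2) <= 1 + rateY * (t - s).
  by rewrite lerD2l ler_pM2l ?rateY_gt0//; lra.
apply: ler_pM => //; first by rewrite invr_ge0 (le_trans (ltW h1)).
  by apply: init; rewrite sp/= ge_min lexx.
by rewrite lef_pV2// posrE (lt_le_trans h1).
Qed.

Lemma exc4_le (t Y : R) : 0 < t -> It Yd t <= Y ->
  It (fun q => s1 q ^+ 4) t <= 4 * (D1 + D2) * Y /\ It (fun q => s2 q ^+ 4) t <= 4 * (D1 + D2) * Y.
Proof.
move=> t0 YY.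
have ce1 := cb_excX G0 4 rc1; have ce2 := cb_excX G0 4 rc2.
have E : It Yd t = (4 * D1)^-1 * It (fun q => s1 q ^+ 4) t + (4 * D2)^-1 * It (fun q => s2 q ^+ 4) t.
  rewrite -(ItZ oOm bOm _ ce1 t0) -(ItZ oOm bOm _ ce2 t0).
  rewrite -(ItD oOm bOm); [|by regtac|by regtac|exact: t0].
  by apply: eq_It => x _; rewrite /Yd; congr (_ + _); rewrite mulrC.
have Q1 : 0 <= It (fun q => s1 q ^+ 4) t by apply: It_ge0 => x _; rewrite exprn_ge0// pos_ge0.
have Q2 : 0 <= It (fun q => s2 q ^+ 4) t by apply: It_ge0 => x _; rewrite exprn_ge0// pos_ge0.
move: YY; rewrite E; move: (It _ t) (It _ t) Q1 Q2 => b a a0 b0 YY.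
have ia : 0 < (4 * D1)^-1 by rewrite invr_gt0 mulr_gt0.
have ib : 0 < (4 * D2)^-1 by rewrite invr_gt0 mulr_gt0.
have pa := mulr_ge0 (ltW ia) a0; have pb := mulr_ge0 (ltW ib) b0.
have Y0 : 0 <= Y by apply: le_trans YY; exact: addr_ge0.
have h1 : a <= 4 * D1 * Y.
  by rewrite -ler_pdivrMl ?mulr_gt0//; apply: le_trans YY; rewrite lerDl.
have h2 : b <= 4 * D2 * Y.
  by rewrite -ler_pdivrMl ?mulr_gt0//; apply: le_trans YY; rewrite lerDr.
have h3 := mulr_ge0 (ltW D10) Y0; have h4 := mulr_ge0 (ltW D20) Y0.
have -> : 4 * (D1 + D2) * Y = 4 * D1 * Y + 4 * D2 * Y by ring.
have -> : 4 * D1 * Y = 4 * (D1 * Y) by ring.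
have -> : 4 * D2 * Y = 4 * (D2 * Y) by ring.
rewrite -mulrA in h1; rewrite -mulrA in h2.
move: h1 h2 h3 h4; move: (D1 * Y) (D2 * Y) => *; split; lra.
Qed.

Variable eta : R.
Hypotheses (eta0 : 0 < eta) (eta1 : eta <= 1).
Local Notation sig := (sig c1 c2 eta).
Let rs := reg_sig oOm S eta.

Definition Csig Z := v0 + 3 * (height G0 ^+ 2 * v0 + 2 * (v0 + Z)).

Lemma crude_sig (t Z : R) : 0 < t -> It (fun q => s1 q ^+ 4) t <= Z ->
  It (fun q => s2 q ^+ 4) t <= Z -> It (fun q => 1 + sig q ^+ 2) t <= Csig Z.
Proof.
move=> t0 z1 z2.
have h c : reg c -> It (fun q => exc G0 c q ^+ 4) t <= Z -> It (fun q => exc G0 c q ^+ 2) t <= v0 + Z.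
  move=> rc hZ.
  have ce4 := cb_excX G0 4 rc; have ce2 := cb_excX G0 2 rc.
  apply: (@le_trans _ _ (It (fun q => 1 + exc G0 c q ^+ 4) t)).
    apply: (It_le oOm bOm ce2 _ t0); first by regtac.
    move=> x _; move: (exc _ _ _) => s; have -> : s ^+ 4 = s ^+ 2 * s ^+ 2 by ring.
    by have := sqr_ge0 s; have := sqr_ge0 (1 - s ^+ 2); move: (s ^+ 2) => *; lra.
  rewrite (ItD oOm bOm); [|by regtac|by regtac|exact: t0].
  by rewrite (It_cst oOm bOm) mul1r lerD2l.
have h1 := h _ rc1 z1; have h2 := h _ rc2 z2.
have ce1 := cb_excX G0 2 rc1; have ce2 := cb_excX G0 2 rc2.
apply: (@le_trans _ _ (It (fun q => 1 + 3 * (height G0 ^+ 2 + s1 q ^+ 2 + s2 q ^+ 2)) t)).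
  apply: (It_le oOm bOm _ _ t0); [by regtac|by regtac|].
  by move=> x Ox; rewrite lerD2l; exact: (sig2_le S G0 eta0 eta1 (conj t0 Ox : cyl Om (t, x))).
rewrite (ItD oOm bOm); [|by regtac|by regtac|exact: t0].
rewrite (ItZ oOm bOm); [|by regtac|exact: t0].
rewrite (ItD oOm bOm); [|by regtac|by regtac|exact: t0].
rewrite (ItD oOm bOm); [|by regtac|by regtac|exact: t0].
rewrite !(It_cst oOm bOm) mul1r /Csig lerD2l ler_pM2l// -addrA lerD2l.
move: h1 h2; move: (It _ t) (It _ t) (v0) => *; lra.
Qed.

Lemma grad2W_le (t : R) : 0 < t -> It (grad2 PhW) t <= 3 * M ^+ 2 * v0.
Proof.
move=> t0; have rW := st_reg (r_sW Rf).
rewrite -(It_cst oOm bOm (3 * M ^+ 2) t).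
apply: (It_le oOm bOm _ _ t0); [by rewrite /grad2; regtac|by regtac|].
move=> x Ox; have Qx : cyl Om (t, x) by [].
apply: (@le_trans _ _ (\sum_(j < 3) M ^+ 2)).
  apply: ler_sum => j _; rewrite -[leLHS]real_normK ?num_real//.
  by apply: lerXn2r; rewrite ?nnegrE ?(ltW M0)//; exact: st_dbound (r_sW Rf) _ _ Qx.
by rewrite sumr_const card_ord -[leLHS]mulr_natl.
Qed.

Lemma grad2Phi_le (t : R) : 0 < t -> It (grad2 Phi) t <= 2 * It (grad2 psi) t + 6 * M ^+ 2 * v0.
Proof.
move=> t0; have rW := st_reg (r_sW Rf); have rp := reg_psi oOm S Rf.
have cG : cb (grad2 Phi) by rewrite /grad2; regtac.
have cp : cb (grad2 psi) by rewrite /grad2; regtac.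
have cW : cb (grad2 PhW) by rewrite /grad2; regtac.
apply: (@le_trans _ _ (2 * It (grad2 psi) t + 2 * It (grad2 PhW) t)); last first.
  by rewrite lerD2l; have := grad2W_le t0; rewrite -!mulrA; move: (It _ t) (M ^+ 2 * v0) => *; lra.
apply: le_trans (_ : _ <= It (fun q => 2 * grad2 psi q + 2 * grad2 PhW q) t) _; last first.
  rewrite (ItD oOm bOm); [|by regtac|by regtac|exact: t0].
  by rewrite lerD// ?(ItZ oOm bOm _ cp t0) ?(ItZ oOm bOm _ cW t0).
apply: (It_le oOm bOm _ _ t0); [by regtac|by regtac|].
move=> x Ox; have Qx : cyl Om (t, x) by [].
rewrite /grad2 !mulr_sumr -big_split/=; apply: ler_sum => j _.
have -> : dx j Phi (t, x) = dx j psi (t, x) + dx j PhW (t, x) by rewrite (dx_psi S Rf j Qx) subrK.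
by have := sqr_ge0 (dx j psi (t, x) - dx j PhW (t, x)); move: (dx j psi _) (dx j PhW _) => *; lra.
Qed.

Lemma rho2_le_sig2 (t : R) : 0 < t -> It (fun q => rho q ^+ 2) t <= It (fun q => 1 + sig q ^+ 2) t.
Proof.
move=> t0; have rr := reg_rho oOm S.
apply: (It_le oOm bOm _ _ t0); [by regtac|by regtac|].
move=> x Ox; have Qx : cyl Om (t, x) by [].
have := sp_ge0 (n_c1 S) Qx; have := sp_ge0 (n_c2 S) Qx; have e0 := eta0.
rewrite /rho /sig; move: (c1 _) (c2 _) => a b b0 a0.
have -> : a + eta + (b + eta) = (a + b) + 2 * eta by ring.
have h1 := mulr_ge0 a0 b0; have h2 := mulr_ge0 (addr_ge0 a0 b0) (ltW e0); have := sqr_ge0 eta; lra.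
Qed.

(** The energy identity without truncation, with [rho] bounded by [sig] and a factor [1 / eps] lost
    in Young's inequality. It serves at times when the excess may still be large, where such a loss
    only lengthens the waiting time. *)
Lemma crude_field (t : R) : 0 < t ->
  eps * It (grad2 psi) t <= 2 * CP / eps * It (fun q => 1 + sig q ^+ 2) t + 6 * eps * M ^+ 2 * v0.
Proof.
have arith (y z x g e b a k : R) : y = eps * z -> 3 / 4 * x <= z + g -> eps * g <= e -> y <= k + b ->
    k <= 1 / 4 * (eps * x) -> b <= a -> eps * x <= 2 * a + 2 * e.
  move=> yz h1 h2 h3 h4 h5; have := ler_wpM2l (ltW eps0) h1.
  rewrite mulrDr mulrCA -yz; move: h2 h3 h4 h5; move: (eps * x) (eps * g) => *; lra.
move=> t0; have rr := reg_rho oOm S; have rp := reg_psi oOm S Rf; have tp := trz_psi S Rf.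
have rW := st_reg (r_sW Rf).
have cp : cb (grad2 psi) by rewrite /grad2; regtac.
have cW : cb (grad2 PhW) by rewrite /grad2; regtac.
have i1 := poisson_test oOm bOm smOm S rp tp t0.
have i2 : 3 / 4 * It (grad2 psi) t <= It (fun q => \sum_(j < 3) dx j psi q * dx j Phi q) t + It (grad2 PhW) t.
  rewrite -(ItZ oOm bOm _ cp t0).
  rewrite -(ItD oOm bOm); [|by regtac|by regtac|exact: t0].
  apply: (It_le oOm bOm _ _ t0); [by regtac|by regtac|].
  move=> x Ox; have Qx : cyl Om (t, x) by [].
  rewrite /grad2 mulr_sumr -big_split/=; apply: ler_sum => j _.
  have -> : dx j Phi (t, x) = dx j psi (t, x) + dx j PhW (t, x) by rewrite (dx_psi S Rf j Qx) subrK.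
  have := sqr_ge0 (1 / 2 * dx j psi (t, x) + dx j PhW (t, x)).
  clear i1; move: (dx j psi _) (dx j PhW _) => *; lra.
have i3 : It (fun q => psi q * rho q) t <= eps / (4 * CP) * It (fun q => psi q ^+ 2) t +
   CP / eps * It (fun q => rho q ^+ 2) t.
  rewrite -(ItZ oOm bOm (eps / (4 * CP))); [|by regtac|exact: t0].
  rewrite -(ItZ oOm bOm (CP / eps)); [|by regtac|exact: t0].
  rewrite -(ItD oOm bOm); [|by regtac|by regtac|exact: t0].
  apply: (It_le oOm bOm _ _ t0); [by regtac|by regtac|].
  move=> x _; move: (psi _) (rho _) => y f.
  rewrite -subr_ge0.
  have -> : eps / (4 * CP) * y ^+ 2 + CP / eps * f ^+ 2 - y * f = CP / eps * (eps / (2 * CP) * y - f) ^+ 2.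
    by field; rewrite !gt_eqF.
  by apply: mulr_ge0 (sqr_ge0 _); apply: divr_ge0; exact: ltW.
have i4 : eps / (4 * CP) * It (fun q => psi q ^+ 2) t <= 1 / 4 * (eps * It (grad2 psi) t).
  apply: (@le_trans _ _ (eps / (4 * CP) * (CP * It (grad2 psi) t))).
    have k0 : 0 < eps / (4 * CP) by rewrite divr_gt0// mulr_gt0.
    by rewrite (ler_pM2l k0); exact: poin.
  rewrite le_eqVlt; apply/orP; left; apply/eqP; move: (It _ t) => a.
  by field; rewrite gt_eqF.
have i6 := ler_wpM2l (ltW eps0) (grad2W_le t0).
have c0 : 0 <= CP / eps by apply: divr_ge0; exact: ltW.
have i7 := ler_wpM2l c0 (rho2_le_sig2 t0).
have -> : 2 * CP / eps * It (fun q => 1 + sig q ^+ 2) t = 2 * (CP / eps * It (fun q => 1 + sig q ^+ 2) t).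
  by rewrite !mulrA.
have -> : 6 * eps * M ^+ 2 * v0 = 2 * (eps * (3 * M ^+ 2 * v0)) by ring.
exact: (arith _ _ _ _ _ _ _ _ i1 i2 i6 i3 i4 i7).
Qed.

Local Notation F := (free_energy Om K eps c1 c2 Phi u Ga1 Ga2 PhW eta).
Local Notation dF := (free_energy_rate Om K c1 c2 Phi u Ga1 Ga2 PhW eta).

Lemma free_energy_ge0 (t : R) : 0 < t -> 0 <= F t.
Proof.
move=> t0; rewrite /free_energy.
have s_ge0 z D c Ga : species Om u Phi z D c -> (forall q, cyl Om q -> m <= Ga q) ->
    0 <= It (sdens eta c Ga) t.
  move=> sc Gam; apply: It_ge0 => x Ox; have Qx : cyl Om (t, x) by [].
  apply: sdens_ge0; first exact: lt_le_trans eta0 (conc_ge eta sc Qx).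
  exact: lt_le_trans m0 (ref_ge eta0 Gam Qx).
rewrite addr_ge0//; last first.
  rewrite mulr_ge0 ?invr_ge0 ?mulr_ge0 ?(ltW K0)//; apply: It_ge0 => x _.
  by apply: sumr_ge0 => k _; exact: sqr_ge0.
rewrite addr_ge0//; last first.
  by rewrite /field_energy mulr_ge0 ?divr_ge0 ?(ltW eps0)//; apply: It_ge0 => x _; exact: grad2_ge0.
by rewrite addr_ge0//; [exact: s_ge0 (n_c1 S) (r_m1 Rf)|exact: s_ge0 (n_c2 S) (r_m2 Rf)].
Qed.

Lemma free_energy_le (t : R) : 0 < t -> F t <=
  2 * (m^-1 * It (fun q => 1 + sig q ^+ 2) t + (M + 1) * v0) + 1 / 2 * (eps * It (grad2 psi) t) +
  (2 * K)^-1 * It (fun q => \sum_(k < 3) u k q ^+ 2) t.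
Proof.
move=> t0; rewrite /free_energy lerD2r /field_energy.
have sc1 := n_c1 S; have sc2 := n_c2 S.
have k1 q : cyl Om q -> c1 q + eta <= sig q.
  by move=> Qq; rewrite /sig lerDl addr_ge0 ?(ltW eta0)//; exact: sp_ge0 sc2 _ Qq.
have k2 q : cyl Om q -> c2 q + eta <= sig q.
  by move=> Qq; rewrite /sig lerDr addr_ge0 ?(ltW eta0)//; exact: sp_ge0 sc1 _ Qq.
have h1 := entropy_bound oOm bOm S Rf eta0 eta1 t0 sc1 (r_s1 Rf) (r_m1 Rf) k1.
have h2 := entropy_bound oOm bOm S Rf eta0 eta1 t0 sc2 (r_s2 Rf) (r_m2 Rf) k2.
have h3 : m^-1 * It (fun q => sig q ^+ 2) t <= m^-1 * It (fun q => 1 + sig q ^+ 2) t.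
  rewrite ler_pM2l ?invr_gt0//; apply: (It_le oOm bOm _ _ t0); [by regtac|by regtac|].
  by move=> x _; rewrite lerDr.
have -> : eps / 2 * It (grad2 psi) t = 1 / 2 * (eps * It (grad2 psi) t) by move: (It _ t) => a; field.
rewrite lerD2r.
have arith (x y a b v : R) : x <= a + v -> y <= a + v -> a <= b -> x + y <= 2 * (b + v) by move=> *; lra.
exact: (arith _ _ _ _ _ h1 h2 h3).
Qed.

Definition Cpot Z := 2 * CP / eps * Csig Z + 6 * eps * M ^+ 2 * v0.
Definition Cini Z U0 := 2 * (m^-1 * Csig Z + (M + 1) * v0) + 1 / 2 * Cpot Z + (2 * K)^-1 * U0.
Definition Crate Z := 3 / 2 * (D1 + D2) * eta * (2 / eps * Cpot Z + 6 * M ^+ 2 * v0) +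
  (9 / 2 * (D1 + D2) + 6 * K * CP / nu) * grip M m ^+ 2 * Csig Z.

Let dmin0 : 0 < Num.min D1 D2. Proof. by rewrite lt_min D10. Qed.

Let diss_ge0 t : 0 < t -> 0 <= diss Om c1 c2 Phi eta t.
Proof.
move=> t0; apply: addr_ge0; apply: It_ge0 => x Ox; have Qx : cyl Om (t, x) by [].
  by apply: sumr_ge0 => j _; rewrite divr_ge0 ?sqr_ge0// ltW// (lt_le_trans eta0 (conc_ge eta (n_c1 S) Qx)).
by apply: sumr_ge0 => j _; rewrite divr_ge0 ?sqr_ge0// ltW// (lt_le_trans eta0 (conc_ge eta (n_c2 S) Qx)).
Qed.

Let gradu_ge0 t : 0 <= It (fun q => \sum_(k < 3) grad2 (u k) q) t.
Proof. by apply: It_ge0 => x _; apply: sumr_ge0 => k _; exact: grad2_ge0. Qed.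

Lemma crude_field_Z (t Z : R) : 0 < t -> It (fun q => s1 q ^+ 4) t <= Z ->
  It (fun q => s2 q ^+ 4) t <= Z -> eps * It (grad2 psi) t <= Cpot Z.
Proof.
move=> t0 z1 z2; apply: le_trans (crude_field t0) _; rewrite lerD2r.
by apply: ler_wpM2l (crude_sig t0 z1 z2); rewrite divr_ge0 ?mulr_ge0// ltW.
Qed.

Lemma crude_rate (t Z : R) : 0 < t -> It (fun q => s1 q ^+ 4) t <= Z ->
  It (fun q => s2 q ^+ 4) t <= Z -> dF t <= Crate Z.
Proof.
move=> t0 z1 z2.
have h := free_energy_ineq oOm bOm smOm S Rf D10 D20 nu0 K0 eta0 CP1 poin t0.
apply: le_trans h _.
have d0 := diss_ge0 t0; have q0 := gradu_ge0 t.
have a1 : 0 <= Num.min D1 D2 / 2 * diss Om c1 c2 Phi eta t by rewrite mulr_ge0// divr_ge0// ltW.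
have a2 : 0 <= nu / (2 * K) * It (fun q => \sum_(k < 3) grad2 (u k) q) t.
  by rewrite mulr_ge0// divr_ge0 ?mulr_ge0// ltW.
have hs := crude_sig t0 z1 z2.
have hf : It (grad2 Phi) t <= 2 / eps * Cpot Z + 6 * M ^+ 2 * v0.
  apply: le_trans (grad2Phi_le t0) _; rewrite lerD2r.
  have -> : 2 * It (grad2 psi) t = 2 / eps * (eps * It (grad2 psi) t).
    by move: (It _ t) => a; field; rewrite gt_eqF.
  by apply: ler_wpM2l (crude_field_Z t0 z1 z2); rewrite divr_ge0// ltW.
have c1' : 0 <= 3 / 2 * (D1 + D2) * eta by rewrite !mulr_ge0 ?addr_ge0 ?ltW.
have c2' : 0 <= (9 / 2 * (D1 + D2) + 6 * K * CP / nu) * grip M m ^+ 2.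
  by rewrite mulr_ge0 ?sqr_ge0// addr_ge0 ?divr_ge0 ?mulr_ge0 ?addr_ge0// ltW.
have b1 := ler_wpM2l c1' hf; have b2 := ler_wpM2l c2' hs.
rewrite /Crate mulNr.
have arith (x y a b c d : R) : 0 <= x -> 0 <= y -> a <= b -> c <= d -> - x + a + c - y <= b + d by move=> *; lra.
exact: (arith _ _ _ _ _ _ a1 a2 b1 b2).
Qed.

(** At most linear growth of the free energy while the excess decays. As in [Yd_decay], starting at
    the smaller of [s0] and [t] removes [s0] from the bound. *)
Lemma phase1 s0 Z U0 (t : R) : 0 < s0 -> 0 <= Crate Z ->
  (forall t, 0 < t -> It (fun q => s1 q ^+ 4) t <= Z /\ It (fun q => s2 q ^+ 4) t <= Z) ->
  (forall s, 0 < s <= s0 -> It (fun q => \sum_(k < 3) u k q ^+ 2) s <= U0) -> 0 < t ->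
  F t <= Cini Z U0 + Crate Z * t.
Proof.
move=> s00 cr0 hZ hU t0; pose s := Num.min s0 t.
have sp : 0 < s by rewrite lt_min s00.
have st : s <= t by rewrite ge_min lexx orbT.
have [z1 z2] := hZ s sp.
have Fs : F s <= Cini Z U0.
  apply: le_trans (free_energy_le sp) _.
  have hu : It (fun q => \sum_(k < 3) u k q ^+ 2) s <= U0 by apply: hU; rewrite sp/= ge_min lexx.
  have k0 : 0 <= (2 * K)^-1 by rewrite invr_ge0 mulr_ge0// ltW.
  have h1 := ler_wpM2l k0 hu.
  have i0 : 0 <= m^-1 by rewrite invr_ge0 ltW.
  have h2 := ler_wpM2l i0 (crude_sig sp z1 z2); have h3 := crude_field_Z sp z1 z2.
  have arith (x y a b c d v : R) : x <= y -> a <= b -> c <= d ->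
    2 * (a + v) + 1 / 2 * c + x <= 2 * (b + v) + 1 / 2 * d + y by move=> *; lra.
  exact: (arith _ _ _ _ _ _ _ h1 h2 h3).
have h : F t - Crate Z * t <= F s - Crate Z * s.
  apply: (@nincr_derive _ (fun x => F x - Crate Z * x) (fun x => dF x - Crate Z) s t st).
    move=> x /andP[sx _]; have x0 : 0 < x by exact: lt_le_trans sx.
    have h1 := is_derive_free_energy oOm bOm smOm S Rf K0 eta0 x0.
    have h2 := is_derive_sub h1 (is_derive_mul (is_derive_cst (Crate Z) x 1) (is_derive_id x 1)).
    have [k1 k2] := h2; apply: DeriveDef k1 _; rewrite [LHS]k2 /cst; ring.
  move=> x /andP[sx _]; have x0 : 0 < x by exact: lt_le_trans sx.
  by have [y1 y2] := hZ x x0; rewrite subr_le0; exact: crude_rate.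
have arith (x y a b c : R) : x - a <= y - b -> y <= c -> 0 <= b -> x <= c + a by move=> *; lra.
exact: (arith _ _ _ _ _ h Fs (mulr_ge0 cr0 (ltW sp))).
Qed.

End Evolution.

Section LongTime.
Context {R : realType}.
Local Notation E3 := 'rV[R]_3.
Local Notation V := (R * 'rV[R]_3)%type.
Variables (Om : set E3).
Hypotheses (oOm : open Om) (bOm : bounded_set Om) (smOm : smooth_boundary Om).
Local Notation cb := (cb Om).
Local Notation reg := (reg Om).
Local Notation It := (It Om).
Local Notation v0 := (vol Om (fun=> 1)).
Variables (D1 D2 nu K : R) (g1 g2 w : E3 -> R).
Variables (M m : R) (Ga1 Ga2 PhW : V -> R).
Hypothesis Rf : reference Om M m g1 g2 w Ga1 Ga2 PhW.
Hypotheses (D10 : 0 < D1) (D20 : 0 < D2) (nu0 : 0 < nu) (K0 : 0 < K).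
Variables (G0 CP L : R).
Hypotheses (G00 : 0 <= G0) (CP1 : 1 <= CP) (L0 : 0 <= L).
Hypotheses (g1G : forall y, boundary Om y -> g1 y <= G0) (g2G : forall y, boundary Om y -> g2 y <= G0).
Hypothesis poin : forall (F : V -> R) t, reg F -> trz Om F -> 0 < t ->
  It (fun z => F z ^+ 2) t <= CP * It (grad2 F) t.
Hypothesis collars : forall r, 0 < r <= 1 -> exists X, collar Om L r X.

Let m0 := r_m0 Rf.
Let M0 : 0 < M := lt_le_trans m0 (r_mM Rf).
Let CP0 : 0 < CP := lt_le_trans ltr01 CP1.
Let v00 : 0 <= v0. Proof. by apply: vol_ge0. Qed.
Let k0 : 0 < kap M m := kap_gt0 Rf.
Let dm := Num.min D1 D2.
Let dm0 : 0 < dm. Proof. by rewrite /dm lt_min D10. Qed.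
Let Cf1 := Cfield1 M m CP.
Let Cf0 := `|Cfield0 Om M m L G0 CP|.
Let C0 := Csig Om G0 1.
Let Ca := 3 / 2 * (D1 + D2).
Let Cb := (9 / 2 * (D1 + D2) + 6 * K * CP / nu) * grip M m ^+ 2.
(** The shift is [eta = ka0 * eps]. The quotient makes the price of the shift at most [dm / 4] times
    the dissipation, up to a constant; the bound 1 ensures [eta <= 1] when [eps <= 1]. *)
Let ka0 := Num.min 1 (dm / (8 * Ca * Cf1)).
(** The first entry lets the dissipation pay for the field part of [lam * F], the second lets
    viscosity pay for the kinetic part through the Poincaré inequality. *)
Let lam := Num.min (dm / (4 * Cf1)) (nu / (2 * CP)).
Let N0 := M ^+ 2 * v0.
Let E0 := m^-1 * C0 + (M + 1) * v0.
Let C2 := Ca * (2 * Cf0 + 6 * N0) + Cb * C0 + lam * (2 * E0 + 1 / 2 * Cf0).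
Let Cd := `|Cdiss Om M m L G0|.

Let Cf10 : 0 < Cf1.
Proof.
apply: ltr_pwDr => //; apply: mulr_ge0; first by rewrite mulr_ge0// ltW.
by apply: addr_ge0 => //; apply: divr_ge0 => //; exact: ltW.
Qed.
Let Ca0 : 0 < Ca. Proof. by rewrite /Ca mulr_gt0// addr_gt0. Qed.
Let Cb0 : 0 <= Cb.
Proof.
apply: mulr_ge0 (sqr_ge0 _); apply: addr_ge0; first by rewrite mulr_ge0// addr_ge0 ?ltW.
by apply: divr_ge0 (ltW nu0); apply: mulr_ge0 (ltW CP0); rewrite mulr_ge0// ltW.
Qed.
Let ka00 : 0 < ka0.
Proof.
rewrite /ka0 lt_min ltr01; apply: divr_gt0 => //; apply: mulr_gt0 Cf10.
exact: mulr_gt0 Ca0.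
Qed.
Let lam0 : 0 < lam.
Proof.
rewrite /lam lt_min; apply/andP; split; apply: divr_gt0 => //; exact: mulr_gt0.
Qed.
Let Cf00 : 0 <= Cf0. Proof. exact: normr_ge0. Qed.
Let Cd0 : 0 <= Cd. Proof. exact: normr_ge0. Qed.
Let N00 : 0 <= N0. Proof. exact: mulr_ge0 (sqr_ge0 _) v00. Qed.
Let Csig0 Z : 0 <= Z -> 0 <= Csig Om G0 Z.
Proof.
move=> Z0; apply: addr_ge0 => //; apply: mulr_ge0 => //; apply: addr_ge0.
  exact: mulr_ge0 (sqr_ge0 _) v00.
by apply: mulr_ge0 => //; exact: addr_ge0.
Qed.
Let C00 : 0 <= C0. Proof. by apply: Csig0. Qed.
Let E00 : 0 <= E0.
Proof.
apply: addr_ge0; first by apply: mulr_ge0 => //; rewrite invr_ge0 ltW.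
by apply: mulr_ge0 => //; apply: addr_ge0 => //; exact: ltW.
Qed.
Let C20 : 0 <= C2.
Proof.
apply: addr_ge0; first (apply: addr_ge0; last exact: mulr_ge0).
  by apply: mulr_ge0 (ltW Ca0) _; apply: addr_ge0; exact: mulr_ge0.
by apply: mulr_ge0 (ltW lam0) _; apply: addr_ge0; apply: mulr_ge0 => //; exact: divr_ge0.
Qed.

Section Fixed.
Variables (eps r : R) (c1 c2 Phi : V -> R) (u : 'I_3 -> V -> R) (p : V -> R).
Hypothesis S : nps Om D1 D2 nu K eps g1 g2 w c1 c2 Phi u p.
Hypotheses (r0 : 0 < r) (r1 : r <= 1) (er : eps = r ^+ 2).
Let e0 : 0 < eps. Proof. by rewrite er exprn_gt0. Qed.
Let e1 : eps <= 1. Proof. by rewrite er exprn_ile1// ltW. Qed.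
Let eta := ka0 * eps.
Let eta0 : 0 < eta. Proof. by rewrite /eta mulr_gt0. Qed.
Let ka1 : ka0 <= 1. Proof. by rewrite /ka0 ge_min lexx. Qed.
Let eta1 : eta <= 1. Proof. by rewrite /eta mulr_ile1// ltW. Qed.
Local Notation F := (free_energy Om K eps c1 c2 Phi u Ga1 Ga2 PhW eta).
Local Notation dF := (free_energy_rate Om K c1 c2 Phi u Ga1 Ga2 PhW eta).
Local Notation diss := (diss Om c1 c2 Phi eta).

(** Of the available [dm / 2] times the dissipation, [dm / 4] pays for the shift and [dm / 8] for
    the field part of [lam * F]; the last [dm / 8] is kept, because it is what bounds the charge.
    The entropy part of [F] is bounded outright. *)
Lemma relaxation (t : R) : 0 < t -> It (fun q => exc G0 c1 q ^+ 4) t <= r ^+ 8 ->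
  It (fun q => exc G0 c2 q ^+ 4) t <= r ^+ 8 ->
  [/\ 0 <= diss t, dF t <= - lam * F t - dm / 8 * diss t + C2 &
      It (fun q => rho c1 c2 q ^+ 2) t <= eps * diss t + Cd * r].
Proof.
move=> t0 sm1 sm2.
have [X cX] : exists X, collar Om L r X by apply: collars; rewrite r0.
have d0 : 0 <= diss t.
  apply: addr_ge0; apply: It_ge0 => x Ox; have Qx : cyl Om (t, x) by [].
    by apply: sumr_ge0 => j _; rewrite divr_ge0 ?sqr_ge0// ltW// (lt_le_trans eta0 (conc_ge eta (n_c1 S) Qx)).
  by apply: sumr_ge0 => j _; rewrite divr_ge0 ?sqr_ge0// ltW// (lt_le_trans eta0 (conc_ge eta (n_c2 S) Qx)).
have hd := dissipation_bound oOm bOm smOm S Rf eta0 eta1 r0 r1 er t0 L0 cX G00 sm1 sm2.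
have hf := field_bound oOm bOm smOm S Rf eta0 eta1 r0 r1 er t0 L0 cX G00 sm1 sm2 CP1 poin.
have hs := It_1sig2 oOm bOm S eta0 eta1 r0 r1 t0 sm1 sm2.
have hi := free_energy_ineq oOm bOm smOm S Rf D10 D20 nu0 K0 eta0 CP1 poin t0.
have hF := free_energy_le oOm bOm S Rf eta0 eta1 t0.
have hG := grad2Phi_le oOm bOm S Rf t0.
split => //.
  have gu0 : 0 <= It (fun q => \sum_(k < 3) grad2 (u k) q) t.
    by apply: It_ge0 => x _; apply: sumr_ge0 => k _; exact: grad2_ge0.
  have hu : It (fun q => \sum_(k < 3) u k q ^+ 2) t <= CP * It (fun q => \sum_(k < 3) grad2 (u k) q) t.
    have ru := n_ru S; have rdu := n_rdu S.
    have q1 k : cb (fun q => u k q ^+ 2) by regtac.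
    have q2 k : cb (grad2 (u k)) by rewrite /grad2; regtac.
    rewrite (It_sum oOm bOm q1 t0) (It_sum oOm bOm q2 t0) mulr_sumr; apply: ler_sum => k _.
    exact: (poin (ru k) (n_tu S k) t0).
  move: hi hF hG hf hs gu0 hu; rewrite -/dm -/C0.
  move: (It (fun q => \sum_(k < 3) grad2 (u k) q) t) => Gu.
  move: (It (fun q => \sum_(k < 3) u k q ^+ 2) t) => Uu.
  move: (It (grad2 Phi) t) (It (fun q => 1 + sig c1 c2 eta q ^+ 2) t) (It (grad2 (psi Phi PhW)) t) => n2 B X'.
  move: (dF t) (F t) (diss t) d0 => df f d d0 hi hF hG hf hs gu0 hu.
  have hf' : eps * X' <= Cf1 * d + Cf0.
    by apply: le_trans hf _; rewrite lerD2l; exact: ler_norm.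
  have a1 : Ca * eta * n2 <= dm / 4 * d + Ca * (2 * Cf0 + 6 * N0).
    have h1 : eps * n2 <= 2 * (Cf1 * d) + (2 * Cf0 + 6 * N0).
      have h := ler_wpM2l (ltW e0) hG.
      have hN : eps * N0 <= N0 by rewrite ler_piMl.
      have E : eps * (2 * X' + 6 * M ^+ 2 * v0) = 2 * (eps * X') + 6 * (eps * N0) by rewrite /N0; ring.
      rewrite E in h; clear E hi hF hG hf hs gu0 hu.
      move: h hN hf'; move: (eps * X') (eps * n2) (eps * N0) (Cf1 * d) => *; lra.
    have c1' : 0 <= Ca * ka0 by exact: mulr_ge0 (ltW Ca0) (ltW ka00).
    have h2 := ler_wpM2l c1' h1.
    have -> : Ca * eta * n2 = Ca * ka0 * (eps * n2) by rewrite /eta; ring.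
    apply: le_trans h2 _; rewrite mulrDr; apply: lerD.
      have -> : Ca * ka0 * (2 * (Cf1 * d)) = ka0 * (8 * Ca * Cf1) / 4 * d by field.
      have P8 : 0 < 8 * Ca * Cf1 by apply: mulr_gt0 Cf10; exact: mulr_gt0 Ca0.
      have hk : ka0 * (8 * Ca * Cf1) <= dm by rewrite -(ler_pdivlMr _ _ P8) /ka0 ge_min lexx orbT.
      by apply: ler_wpM2r => //; rewrite ler_pM2r.
    apply: ler_wpM2r; first by apply: addr_ge0; exact: mulr_ge0.
    by rewrite ler_piMr// ltW.
  have a2 := ler_wpM2l Cb0 hs.
  have i0 : 0 <= m^-1 by rewrite invr_ge0 ltW.
  have i1 := ler_wpM2l i0 hs.
  have kk : 0 <= (2 * K)^-1 by rewrite invr_ge0 mulr_ge0// ltW.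
  have i2 := ler_wpM2l kk hu.
  have hF' : f <= 2 * E0 + 1 / 2 * (Cf1 * d + Cf0) + (2 * K)^-1 * (CP * Gu).
    apply: le_trans hF _; apply: lerD i2; apply: lerD; last by rewrite ler_pM2l.
    by rewrite ler_pM2l// lerD2r.
  have i3 := ler_wpM2l (ltW lam0) hF'.
  have l1 : lam * (Cf1 * d) <= dm / 4 * d.
    rewrite mulrA ler_wpM2r//.
    have h : lam <= dm / (4 * Cf1) by rewrite /lam ge_min lexx.
    have := ler_wpM2r (ltW Cf10) h.
    by have -> : dm / (4 * Cf1) * Cf1 = dm / 4 by field; rewrite gt_eqF.
  have l2 : lam * ((2 * K)^-1 * (CP * Gu)) <= nu / (2 * K) * Gu.
    have h : lam <= nu / (2 * CP) by rewrite /lam ge_min lexx orbT.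
    have z0 : 0 <= (2 * K)^-1 * (CP * Gu) by apply: mulr_ge0 => //; exact: mulr_ge0 (ltW CP0) gu0.
    apply: le_trans (ler_wpM2r z0 h) _.
    have -> : nu / (2 * CP) * ((2 * K)^-1 * (CP * Gu)) = 1 / 2 * (nu / (2 * K) * Gu).
      by field; rewrite !gt_eqF.
    have : 0 <= nu / (2 * K) * Gu by rewrite mulr_ge0// divr_ge0// ?mulr_ge0// ltW.
    by move: (nu / (2 * K) * Gu) => x x0; lra.
  have E : lam * (2 * E0 + 1 / 2 * (Cf1 * d + Cf0) + (2 * K)^-1 * (CP * Gu)) =
    lam * (2 * E0 + 1 / 2 * Cf0) + 1 / 2 * (lam * (Cf1 * d)) + lam * ((2 * K)^-1 * (CP * Gu)) by ring.
  rewrite E in i3; clear E.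
  have arith (x1 x2 x3 y z dd kd a b c e g : R) : x1 <= - (dd / 2) * kd + a + b - g -> a <= dd / 4 * kd + y ->
    b <= z -> x2 <= e + 1 / 2 * x3 + c -> x3 <= dd / 4 * kd -> c <= g ->
    x1 <= - x2 - dd / 8 * kd + (y + z + e).
    have -> : - (dd / 2) * kd = - (1 / 2) * (dd * kd) by field.
    have -> : dd / 4 * kd = 1 / 4 * (dd * kd) by field.
    have -> : dd / 8 * kd = 1 / 8 * (dd * kd) by field.
    by move: (dd * kd) => *; lra.
  rewrite mulNr /C2.
  exact: (arith _ _ _ _ _ _ _ _ _ _ _ _ hi a1 a2 i3 l1 l2).
have h : eps^-1 * It (fun q => rho c1 c2 q ^+ 2) t <= diss t + Cd / r.
  apply: (@le_trans _ _ (diss t + Cdiss Om M m L G0 / r)).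
    apply: le_trans hd; rewrite lerDr mulr_ge0 ?(ltW k0)//; apply: It_ge0 => x Ox.
    by rewrite mulr_ge0 ?grad2_ge0//; exact: (sig_ge0 S eta0 (conj t0 Ox : cyl Om (t, x))).
  by rewrite lerD2l ler_wpM2r ?invr_ge0 ?(ltW r0)// ler_norm.
move: h; rewrite ler_pdivrMl// => /le_trans; apply.
by rewrite mulrDr lerD2l er le_eqVlt; apply/orP; left; apply/eqP; field; rewrite gt_eqF.
Qed.

End Fixed.

Let Crate0 eps eta Z : 0 < eps -> 0 < eta -> 0 <= Z ->
  0 <= Crate Om D1 D2 nu K eps M m G0 CP eta Z.
Proof.
move=> e0 n0 Z0; apply: addr_ge0; last by apply: mulr_ge0 => //; exact: Csig0.
apply: mulr_ge0; first by apply: mulr_ge0 (ltW n0); exact: ltW Ca0.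
have v6 : 0 <= 6 * M ^+ 2 * v0 by rewrite -mulrA mulr_ge0.
apply: addr_ge0 v6; apply: mulr_ge0; first by rewrite divr_ge0// ltW.
apply: addr_ge0; first by apply: mulr_ge0; [rewrite divr_ge0 ?mulr_ge0// ltW|exact: Csig0].
have -> : 6 * eps * M ^+ 2 * v0 = 6 * (eps * N0) by rewrite /N0; ring.
by rewrite !mulr_ge0// ltW.
Qed.

(** Stands in for bounds at time 0: the integrals are estimated at positive times only, so the data
    act through an initial interval whose length [s0] may depend on the solution while [Y0] and [U0]
    do not. *)
Definition controlled (s0 Y0 U0 : R) (c1 c2 : V -> R) (u : 'I_3 -> V -> R) :=
  forall s, 0 < s <= s0 -> It (Yd G0 D1 D2 c1 c2) s <= Y0 /\
    It (fun q => \sum_(k < 3) u k q ^+ 2) s <= U0.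

Lemma excess_time (Y0 d : R) : 0 <= Y0 -> 0 < d -> exists2 T1, 0 < T1 & forall t, T1 <= t ->
  4 * (D1 + D2) * (Y0 / (1 + rateY D1 D2 CP * (t / 2))) <= d.
Proof.
move=> Y00 d0; have y0 := rateY_gt0 D10 D20 CP1.
pose A := 4 * (D1 + D2) * Y0 / d.
have A0 : 0 <= A by rewrite divr_ge0 ?(ltW d0)// mulr_ge0// mulr_ge0// addr_ge0 ?ltW.
exists (2 * A / rateY D1 D2 CP + 1) => [|t ht].
  by rewrite ltr_pwDr// divr_ge0 ?(ltW y0)// mulr_ge0.
have h : A <= 1 + rateY D1 D2 CP * (t / 2).
  have : rateY D1 D2 CP * (2 * A / rateY D1 D2 CP + 1) <= rateY D1 D2 CP * t by rewrite ler_pM2l.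
  have -> : rateY D1 D2 CP * (2 * A / rateY D1 D2 CP + 1) = 2 * A + rateY D1 D2 CP by field; rewrite gt_eqF.
  have -> : rateY D1 D2 CP * (t / 2) = 1 / 2 * (rateY D1 D2 CP * t) by field.
  by move: (rateY _ _ _) y0 => y y0; move: (y * t) => z; lra.
have p0 : 0 < 1 + rateY D1 D2 CP * (t / 2).
  rewrite ltr_pwDl// mulr_ge0 ?(ltW y0)// divr_ge0//; apply: le_trans ht.
  by rewrite addr_ge0// divr_ge0 ?(ltW y0)// mulr_ge0.
rewrite mulrA ler_pdivrMr// [d * _]mulrC -ler_pdivrMr//; exact: h.
Qed.

(** Here [k] is the cube root of [eps]. The order of quantifiers is the point: [B] precedes [k] and
    the bounds of the data, and [T0] precedes the solution. The conclusion offers a bounded [F]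
    whose derivative, up to the rate [a], dominates the charge, so that any time window can be
    handled by integration. *)
Lemma long_time : exists2 B, 0 <= B & forall k Y0 U0 : R, 0 < k -> 0 <= Y0 ->
  exists2 T0, 0 < T0 & forall c1 c2 Phi u p, nps Om D1 D2 nu K (k ^+ 3) g1 g2 w c1 c2 Phi u p ->
  (exists2 s0, 0 < s0 & controlled s0 Y0 U0 c1 c2 u) ->
  exists (F dF : R -> R) (a b : R), [/\ forall s : R, T0 <= s -> is_derive s 1 F (dF s),
    forall s : R, T0 <= s -> 0 <= F s <= b,
    forall s : R, T0 <= s -> It (fun q => rho c1 c2 q ^+ 2) s <= a - dF s &
    forall tau : R, k ^+ 2 <= tau -> a * tau + b <= B * k * tau].
Proof.
pose q8 := 8 / dm.
have q80 : 0 < q8 by rewrite divr_gt0.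
pose B := C0 + q8 * C2 + Cd + q8 * (C2 / lam + 1).
have b4 : 0 <= q8 * (C2 / lam + 1).
  by apply: mulr_ge0 (ltW q80) _; apply: addr_ge0 => //; exact: divr_ge0 C20 (ltW lam0).
have b2 : 0 <= q8 * C2 by exact: mulr_ge0 (ltW q80) C20.
have B0 : 0 <= B by apply: addr_ge0 b4; apply: addr_ge0 Cd0; exact: addr_ge0 C00 b2.
have CB : C0 <= B.
  have arith (a b c d : R) : 0 <= b -> 0 <= c -> 0 <= d -> a <= a + b + c + d by move=> *; lra.
  exact: arith b2 Cd0 b4.
exists B => // k Y0 U0 kp Y00.
have e0 : 0 < k ^+ 3 by rewrite exprn_gt0.
pose r := Num.min 1 (Num.sqrt (k ^+ 3)).
have r0 : 0 < r by rewrite lt_min ltr01 sqrtr_gt0.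
have [T1 T10 hT1] := excess_time Y00 (exprn_gt0 8 r0).
have y0 := rateY_gt0 D10 D20 CP1.
(* For [eps > 1] boundedness suffices: once the excess is small the charge is at most [C0], hence at
   most [B * k]. Then [F] is taken to be zero, the shift to be 1, and [r] equals 1. *)
have [k1|k1] := leP k 1; last first.
  exists T1 => // c1 c2 Phi u p S [s0 s00 init].
  exists (fun=> 0), (fun=> 0), C0, 0; split.
  - by move=> s _; exact: is_derive_cst.
  - by move=> s _; rewrite lexx.
  - move=> s Ts; have s_gt0 : 0 < s by exact: lt_le_trans Ts.
    have hY := Yd_decay oOm bOm smOm S e0 D10 D20 G00 CP1 g1G g2G poin s00 Y00 (fun s h => (init s h).1) s_gt0.
    have [z1 z2] := exc4_le oOm bOm S D10 D20 s_gt0 hY.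
    have h8 : 4 * (D1 + D2) * (Y0 / (1 + rateY D1 D2 CP * (s / 2))) <= 1.
      by apply: le_trans (hT1 s Ts) _; rewrite exprn_ile1 ?(ltW r0)// ge_min lexx.
    rewrite subr0; apply: le_trans (rho2_le_sig2 oOm bOm S ltr01 s_gt0) _.
    exact: (crude_sig oOm bOm S ltr01 (lexx 1) s_gt0 (le_trans z1 h8) (le_trans z2 h8)).
  - move=> tau ht; have t0 : 0 < tau by apply: lt_le_trans ht; rewrite exprn_gt0.
    rewrite addr0 ler_pM2r//; apply: le_trans CB _.
    by rewrite ler_peMr// ltW.
pose eps := k ^+ 3; rewrite -/eps in e0 *.
have e1 : eps <= 1 by rewrite /eps exprn_ile1// ltW.
have rE : r = Num.sqrt eps.
  apply/min_idPr; rewrite -[leRHS]sqrtr1 ler_sqrt//.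
have er : eps = r ^+ 2 by rewrite rE sqr_sqrtr// ltW.
have r1 : r <= 1 by rewrite ge_min lexx.
pose eta := ka0 * eps.
have eta0 : 0 < eta by rewrite /eta mulr_gt0.
have eta1 : eta <= 1.
  by rewrite /eta mulr_ile1// ?(ltW ka00) ?(ltW e0)// /ka0 ge_min lexx.
pose Z := 4 * (D1 + D2) * Y0.
have Z0 : 0 <= Z by rewrite /Z mulr_ge0// mulr_ge0// addr_ge0 ?ltW.
pose cr := Crate Om D1 D2 nu K eps M m G0 CP eta Z.
have cr0 : 0 <= cr by exact: Crate0.
pose A := Cini Om K eps M m G0 CP Z U0 + cr * T1.
(* After [T1] the excess is small and Gronwall's inequality holds; the further delay reduces the
   contribution of the energy at [T1], bounded by the absolute value of [A], to at most 1. *)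
pose T2 := T1 + `|A| / lam.
have T12 : T1 <= T2 by rewrite /T2 lerDl divr_ge0// ltW.
have T20 : 0 < T2 by exact: lt_le_trans T12.
exists T2 => // c1 c2 Phi u p S [s0 s00 init].
pose F := free_energy Om K eps c1 c2 Phi u Ga1 Ga2 PhW eta.
pose dF := free_energy_rate Om K c1 c2 Phi u Ga1 Ga2 PhW eta.
have hY (s : R) : 0 < s -> It (Yd G0 D1 D2 c1 c2) s <= Y0 / (1 + rateY D1 D2 CP * (s / 2)).
  exact: (Yd_decay oOm bOm smOm S e0 D10 D20 G00 CP1 g1G g2G poin s00 Y00 (fun s h => (init s h).1)).
have hZ (s : R) : 0 < s -> It (fun q => exc G0 c1 q ^+ 4) s <= Z /\ It (fun q => exc G0 c2 q ^+ 4) s <= Z.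
  move=> sp; apply: (exc4_le oOm bOm S D10 D20 sp).
  apply: le_trans (hY s sp) _; rewrite ler_pdivrMr; last by rewrite ltr_pwDl// mulr_ge0 ?(ltW y0)// divr_ge0// ltW.
  by rewrite ler_peMr// lerDl mulr_ge0 ?(ltW y0)// divr_ge0// ltW.
have hR (s : R) : T1 <= s -> [/\ 0 <= diss Om c1 c2 Phi eta s, dF s <= - lam * F s - dm / 8 * diss Om c1 c2 Phi eta s + C2 &
      It (fun q => rho c1 c2 q ^+ 2) s <= eps * diss Om c1 c2 Phi eta s + Cd * r].
  move=> Ts; have sp : 0 < s by exact: lt_le_trans Ts.
  have [z1 z2] := exc4_le oOm bOm S D10 D20 sp (hY s sp).
  exact: (relaxation S r0 r1 er sp (le_trans z1 (hT1 s Ts)) (le_trans z2 (hT1 s Ts))).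
have dFs (s : R) : 0 < s -> is_derive s 1 F (dF s).
  by move=> sp; exact: (is_derive_free_energy oOm bOm smOm S Rf K0 eta0 sp).
have F0 (s : R) : 0 < s -> 0 <= F s by move=> sp; exact: (free_energy_ge0 S Rf e0 K0 eta0 sp).
have FT1 : F T1 <= `|A|.
  apply: le_trans (ler_norm _).
  exact: (phase1 oOm bOm smOm S Rf e0 D10 D20 nu0 K0 CP1 poin eta0 eta1 s00 cr0 hZ (fun s h => (init s h).2) T10).
have FB (s : R) : T2 <= s -> F s <= C2 / lam + 1.
  move=> Ts; have T1s : T1 <= s by exact: le_trans Ts.
  have gr : F s <= C2 / lam + F T1 / (1 + lam * (s - T1)).
    apply: (gronwall (dF := dF) lam0 C20 T1s).
    - by move=> x /andP[xs _]; apply: dFs; exact: lt_le_trans xs.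
    - move=> x /andP[xs _]; have [d0 + _] := hR x xs; move=> /le_trans; apply.
      by rewrite lerD2r gerBl mulr_ge0// divr_ge0// ltW.
    - exact: F0.
  apply: le_trans gr _; rewrite lerD2l ler_pdivrMr ?mul1r.
    apply: le_trans FT1 _.
    have : lam * (`|A| / lam) <= lam * (s - T1) by rewrite ler_pM2l// lerBrDl.
    by rewrite mulrCA divff ?gt_eqF// mulr1; move: (lam * _) `|A| => *; lra.
  by rewrite ltr_pwDl// mulr_ge0 ?(ltW lam0)// subr_ge0.
(* As [q8] is the inverse of [dm / 8], the relaxation inequality gives [diss <= q8 * (C2 - dF)].
   Multiplied by [eps] this bounds the charge up to the layer term [Cd * r], which enters the rate
   [a] but not the bound [b] of the energy. *)
exists (fun s => eps * q8 * F s), (fun s => eps * q8 * dF s), (eps * (q8 * C2) + Cd * r), (eps * (q8 * (C2 / lam + 1))).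
have eq0 : 0 < eps * q8 by rewrite mulr_gt0.
split.
- move=> s Ts; have sp : 0 < s by exact: lt_le_trans Ts.
  have [h1 h2] := is_derive_mul (is_derive_cst (eps * q8) s 1) (dFs s sp).
  by apply: DeriveDef h1 _; rewrite [LHS]h2 /cst mulr0 addr0.
- move=> s Ts; have sp : 0 < s by exact: lt_le_trans Ts.
  by rewrite mulr_ge0 ?(ltW eq0) ?F0//= -mulrA mulrA [leRHS]mulrA ler_pM2l ?FB.
- move=> s Ts; have sp : 0 < s by exact: lt_le_trans Ts.
  have [d0 h1 h2] := hR s (le_trans T12 Ts).
  apply: le_trans h2 _; rewrite -addrA [Cd * r + _]addrC addrA lerD2r.
  have -> : eps * (q8 * C2) - eps * q8 * dF s = eps * (q8 * (C2 - dF s)) by ring.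
  rewrite ler_pM2l//.
  have Fs := mulr_ge0 (ltW lam0) (F0 s sp).
  have h3 : dm / 8 * diss Om c1 c2 Phi eta s <= C2 - dF s.
    move: h1; rewrite mulNr; move: Fs; move: (lam * F s) (dF s) (dm / 8 * _) => *; lra.
  have := ler_wpM2l (ltW q80) h3.
  by have -> : q8 * (dm / 8 * diss Om c1 c2 Phi eta s) = diss Om c1 c2 Phi eta s by move: (diss _ _ _ _ _ _) => x; rewrite /q8; field; rewrite gt_eqF.
- move=> tau ht; have t0 : 0 < tau by apply: lt_le_trans ht; rewrite exprn_gt0.
  have ek : eps <= k by rewrite /eps exprS ler_piMr ?(ltW kp)// exprn_ile1// ltW.
  have rk : r <= k.
    have r2 : r ^+ 2 <= k ^+ 2.
      rewrite -er; have -> : eps = k * k ^+ 2 by rewrite /eps exprS.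
      exact: ler_piMl (sqr_ge0 k) k1.
    by move: r2; rewrite ler_pXn2r// nnegrE ltW.
  have et : eps <= k * tau by rewrite /eps exprS ler_pM2l.
  have kt0 : 0 < k * tau by exact: mulr_gt0.
  have h1 : eps * (q8 * C2) * tau <= q8 * C2 * (k * tau).
    by rewrite mulrAC mulrC ler_wpM2l// ler_pM2r.
  have h2 : Cd * r * tau <= Cd * (k * tau) by rewrite -mulrA ler_wpM2l// ler_pM2r.
  have h3 : eps * (q8 * (C2 / lam + 1)) <= q8 * (C2 / lam + 1) * (k * tau).
    by rewrite mulrC ler_wpM2l.
  have h4 := mulr_ge0 C00 (ltW kt0).
  have -> : B * k * tau = C0 * (k * tau) + q8 * C2 * (k * tau) + Cd * (k * tau) + q8 * (C2 / lam + 1) * (k * tau).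
    by rewrite /B -!mulrDl mulrA.
  rewrite [X in X + _ <= _]mulrDl.
  have arith (a b c x y z d : R) : a <= x -> b <= y -> c <= z -> 0 <= d -> a + b + c <= d + x + y + z by move=> *; lra.
  exact: (arith _ _ _ _ _ _ _ h1 h2 h3 h4).
Qed.

End LongTime.

(** * Proof of the theorem *)

Section Conversion.
Context {R : realType}.
Local Notation E3 := 'rV[R]_3.
Local Notation V := (R * 'rV[R]_3)%type.
Variables (Om : set E3).
Hypotheses (oOm : open Om) (bOm : bounded_set Om) (smOm : smooth_boundary Om).
Local Notation cb := (cb Om).
Local Notation reg := (reg Om).
Local Notation It := (It Om).

Lemma derive_coord (f : V -> E3) (z v : V) k : derivable f z v ->
  ('D_v f z) 0 k = 'D_v (fun z => f z 0 k) z.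
Proof. by move=> df; rewrite derive_mx// mxE. Qed.

Lemma Cn_on_coord n (U : set V) (f : V -> E3) k : open U ->
  Cn_on n U f -> Cn_on n U (fun z => f z 0 k).
Proof.
move=> oU; elim: n f => [|n IH] f [cf df]; split.
- by move=> x Ux; exact: (continuous_comp (cf x Ux) (@coord_continuous _ _ _ 0 k _)).
- by [].
- by move=> x Ux; exact: (continuous_comp (cf x Ux) (@coord_continuous _ _ _ 0 k _)).
move=> v; have [d1 d2] := df v; split=> [x Ux|].
  by have /derivable_mxP := d1 x Ux; apply.
apply: (Cn_on_eq oU _ (IH _ d2)) => x Ux.
by rewrite derive_coord//; exact: d1.
Qed.

Lemma smooth_on_coord (A : set V) (f : V -> E3) k : smooth_on A f ->
  smooth_on A (fun z => f z 0 k).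
Proof.
move=> sf x Ax; have [U [g [oU cg gf]]] := sf x Ax.
exists U, (fun z => g z 0 k); split => //; last by move=> y Ay Uy; rewrite gf.
by move=> n; apply: Cn_on_coord (cg n); case: oU.
Qed.

Lemma derive_sliceW (W : normedModType R) (F : V -> W) (t : R) (x v : E3) :
  'D_v (fun x => F (t, x)) x = 'D_(0, v) F (t, x).
Proof.
rewrite /derive; congr (lim _).
suff -> : (fun h : R => h^-1 *: (((fun x => F (t, x)) \o shift x) (h *: v) - F (t, x)))
  = (fun h => h^-1 *: ((F \o shift (t, x)) (h *: (0, v)) - F (t, x))) by [].
apply/funext => h /=; congr (_ *: (F _ - _)).
by congr pair; rewrite /= scaler0 add0r.
Qed.

Lemma derive_tsliceW (W : normedModType R) (F : V -> W) (t : R) (x : E3) :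
  derive1 (fun s => F (s, x)) t = 'D_(1, 0) F (t, x).
Proof.
rewrite derive1E /derive; congr (lim _).
suff -> : (fun h : R => h^-1 *: (((fun s => F (s, x)) \o shift t) (h *: 1) - F (t, x)))
  = (fun h => h^-1 *: ((F \o shift (t, x)) (h *: (1, 0)) - F (t, x))) by [].
apply/funext => h /=; congr (_ *: (F _ - _)).
by congr pair; rewrite /= ?scaler0 ?add0r.
Qed.

Lemma smooth_reg F : smooth_on (closed_cylinder Om) F -> reg F.
Proof. exact: (smooth_on_C1bd oOm bOm [::]). Qed.

Lemma smooth_reg_dx F j : smooth_on (closed_cylinder Om) F -> reg (dx j F).
Proof. exact: (smooth_on_C1bd oOm bOm [:: (0, ebasis j)]). Qed.

Lemma smooth_btr F g : smooth_on (closed_cylinder Om) F ->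
  (forall t y, 0 <= t -> boundary Om y -> F (t, y) = g y) -> btr Om F g.
Proof.
move=> sF Fg t t0 y by_; rewrite -(Fg t y (ltW t0) by_).
have cz : closed_cylinder Om (t, y) by split; [exact: ltW|case: by_].
apply/cvgrPdist_lt => e e0; rewrite near_withinE.
have h := smooth_on_continuous oOm sF cz e0.
have : nbhs y ((fun x => (t, x) : V) @^-1` [set z' | closed_cylinder Om z' -> `|F z' - F (t, y)| < e]).
  exact: (@continuous_pairr _ _ t y _ h).
apply: filterS => x hx Ox; rewrite distrC; apply: hx.
by split; [exact: ltW|exact: subset_closure].
Qed.

Definition unc (f : R -> E3 -> R) (z : V) := f z.1 z.2.

Lemma grad_unc f t x j : grad (f t) x 0 j = dx j (unc f) (t, x).
Proof. by rewrite mxE /dx -derive_slice. Qed.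

Lemma species_of (z t : R) (c Phi : R -> E3 -> R) (x : E3) :
  divg (fun y => grad (c t) y + (z * c t y) *: grad (Phi t) y) x =
  \sum_(j < 3) dx j (flux (unc Phi) z (unc c) j) (t, x).
Proof.
apply: eq_bigr => j _; rewrite /dx -derive_slice; congr ('D_(_) _ x).
apply/funext => y; rewrite !mxE /flux /dx -!derive_slice /unc/=.
by rewrite mulrA.
Qed.

(** Passage to one function of space-time per component. Coordinates commute with a derivative of
    the vector field only where that field is derivable, which is what the C^2 regularity of [u]
    provides for the viscous term. *)
Lemma nps_of_solution D1 D2 nu K eps g1 g2 w c1 c2 Phi u p :
  smooth_NPS_solution Om D1 D2 nu K eps g1 g2 w c1 c2 Phi u p ->
  nps Om D1 D2 nu K eps g1 g2 w (unc c1) (unc c2) (unc Phi) (fun k z => u z.1 z.2 0 k) (unc p).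
Proof.
move=> S; have [s1 s2 sP su sp] := S; move=> p1 p2 e1 e2 po st di b1 b2 bP bu.
have suk k := smooth_on_coord k su.
pose f (z : V) := u z.1 z.2.
have Cu : Cn_on 2 (cyl Om) f by exact: (smooth_on_Cn oOm 2 su).
have du (z v : V) : cyl Om z -> derivable f z v by have [_ /(_ v)[]] := Cu; move=> h _; exact: h.
have ddu (z v v' : V) : cyl Om z -> derivable ('D_v f) z v'.
  by have [_ /(_ v)[_ [_ /(_ v')[]]]] := Cu; move=> h _; exact: h.
have dotE t x c : dot (u t x) (grad (c t) x) = \sum_(j < 3) u t x 0 j * dx j (unc c) (t, x).
  by apply: eq_bigr => j _; rewrite grad_unc.
split.
- split; [exact: smooth_reg|by move=> j; exact: smooth_reg_dx| |].
    by move=> [t x] [t0 Ox]; apply: p1; [exact: ltW|exact: subset_closure].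
  move=> [t x] [t0 Ox]; rewrite -species_of.
  have := e1 t x t0 Ox; rewrite dotE /dt (derive_tsliceW (unc c1)) => ->.
  by congr (_ * divg _ x); apply/funext => y; rewrite mul1r.
- split; [exact: smooth_reg|by move=> j; exact: smooth_reg_dx| |].
    by move=> [t x] [t0 Ox]; apply: p2; [exact: ltW|exact: subset_closure].
  move=> [t x] [t0 Ox]; rewrite -species_of.
  have := e2 t x t0 Ox; rewrite dotE /dt (derive_tsliceW (unc c2)) => ->.
  by congr (_ * divg _ x); apply/funext => y; rewrite mulN1r scaleNr.
- by move=> k; exact: smooth_reg.
- by move=> k j; exact: smooth_reg_dx.
- by move=> k; apply: smooth_btr => // t y t0 by_; rewrite bu// mxE.
- move=> [t x] [t0 Ox]; rewrite -[RHS](di t x t0 Ox); apply: eq_bigr => j _.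
  by rewrite /dx -derive_slice.
- exact: smooth_reg.
- by move=> j; exact: smooth_reg_dx.
- exact: smooth_reg.
- move=> [t x] [t0 Ox]; apply: etrans _ (po t x t0 Ox); apply: (congr1 ( *%R (- eps))); apply: eq_bigr => j _.
  apply: etrans (esym (derive_slice (dx j (unc Phi)) t x (ebasis j))) _.
  apply: (congr1 (fun h => 'D_(ebasis j) h x)); apply/funext => y.
  exact: esym (derive_slice (unc Phi) t y (ebasis j)).
- move=> k [t x] [t0 Ox]; have Qx : cyl Om (t, x) by [].
  have := congr1 (fun M : E3 => M 0 k) (st t x t0 Ox).
  rewrite /dt (derive_tsliceW f) /laplacian !mxE summxE /dx -(derive_slice (unc p)) -(derive_slice (unc Phi)).
  move=> <-; apply: (congr2 (fun a b => a - nu * b + _)); first by rewrite derive_coord//; exact: du.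
  apply: eq_bigr => j _.
  have -> : (fun y => 'D_(ebasis j) (u t) y) = (fun y => 'D_(0, ebasis j) f (t, y)).
    by apply/funext => y; exact: (derive_sliceW f).
  rewrite (derive_sliceW ('D_(0, ebasis j) f)) derive_coord; last exact: ddu.
  apply: near_eq_derive.
  have [oC nC] : open_nbhs (t, x) (cyl Om) by split => //; exact: open_cyl.
  have : nbhs (t, x) (cyl Om) by exact: open_nbhs_nbhs.
  by apply: filterS => z Qz; rewrite derive_coord//; exact: du.
- by apply: smooth_btr => // t y t0 by_; exact: b1.
- by apply: smooth_btr => // t y t0 by_; exact: b2.
- by apply: smooth_btr => // t y t0 by_; exact: bP.
Qed.

(** On the set where [F] exceeds [N + 1] in absolute value, [1 / t] is locally bounded: near time 0
    the set is empty, because there [F] is within 1 of its initial values. By compactness [1 / t] is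
    bounded on this set up to time 1, so its points stay away from time 0. *)
Lemma uniform_initial_bound (F : V -> R) N : smooth_on (closed_cylinder Om) F ->
  (forall x, closure Om x -> `|F (0, x)| <= N) ->
  exists2 s0, 0 < s0 & forall s x, 0 < s <= s0 -> Om x -> `|F (s, x)| <= N + 1.
Proof.
move=> sF FN.
have := @local_bounded _ Om bOm (fun z : V => closed_cylinder Om z /\ N + 1 < `|F z|) (fun z : V => z.1^-1) 1.
case=> [z cz|M HM].
  have [z0|z0] := eqVneq z.1 0.
    exists 0; apply: filterS (smooth_on_continuous oOm sF cz ltr01) => z' h [cz' Nz].
    have h1 := h cz'; have h2 := FN z.2 cz.2.
    have Ez : F z = F (0, z.2) by rewrite -z0; case: (z).
    rewrite -Ez in h2; have := ler_normD (F z' - F z) (F z); rewrite subrK => h3.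
    exfalso; lra.
  have zp : 0 < z.1 by rewrite lt_neqAle eq_sym z0; case: cz.
  exists (2 / z.1).
  have o : open_nbhs z [set z' : V | z.1 / 2 < z'.1].
    split; last by rewrite /=; lra.
    by apply: (@open_comp _ _ fst [set s | z.1 / 2 < s]); [move=> y _; exact: cvg_fst|exact: open_gt].
  have : nbhs z [set z' : V | z.1 / 2 < z'.1] by exact: open_nbhs_nbhs.
  apply: filterS => z' /= hz _.
  have z'p : 0 < z'.1 by apply: lt_trans hz; rewrite divr_gt0.
  rewrite normfV (gtr0_norm z'p) -[2 / z.1]invf_div lef_pV2 ?posrE ?divr_gt0//.
  exact: ltW.
exists (Num.min 1 (`|M| + 1)^-1) => [|s x /andP[sp ss0] Ox].
  by rewrite lt_min ltr01 invr_gt0 ltr_pwDr.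
rewrite leNgt; apply/negP => hN.
move: ss0; rewrite le_min => /andP[s1 sM].
have cz : closed_cylinder Om (s, x) by split; [exact: ltW|exact: subset_closure].
have := HM (s, x) (conj cz hN); rewrite /= (ltW sp) s1 => /(_ isT (subset_closure Ox)).
have M1 : 0 < `|M| + 1 by rewrite ltr_pwDr.
rewrite normfV (gtr0_norm sp).
have : `|M| + 1 <= s^-1 by rewrite -[leLHS]invrK lef_pV2// posrE invr_gt0.
by have := ler_norm M; move: `|M| (s^-1) => *; lra.
Qed.

(** Compactness applied to the reciprocal of [F], with [local_bounded] restricted to the boundary at
    time 1. *)
Lemma boundary_lower_bound (F : V -> R) : smooth_on (closed_cylinder Om) F ->
  (forall y, boundary Om y -> 0 < F (1, y)) ->
  exists2 m, 0 < m & forall y, boundary Om y -> m <= F (1, y).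
Proof.
move=> sF Fp.
have cB : closed (boundary Om).
  by apply: closedI; [exact: closed_closure|apply: open_closedC; exact: open_interior].
pose P (z : V) := z.1 = 1 /\ boundary Om z.2.
have cP : closed P.
  have -> : P = ((fst @^-1` [set s : R | s <= 1]) `&` (fst @^-1` [set s : R | 1 <= s])) `&` (snd @^-1` boundary Om).
    apply/seteqP; split=> [z [z1 bz]|z [[/= h1 h2] bz]]; first by rewrite /= z1 lexx.
    by split => //; apply/eqP; rewrite eq_le h1.
  apply: closedI; first apply: closedI.
  - by apply: closed_comp; [move=> z _; exact: cvg_fst|exact: closed_le].
  - by apply: closed_comp; [move=> z _; exact: cvg_fst|exact: closed_ge].
  - by apply: closed_comp; [move=> z _; exact: cvg_snd|exact: cB].
have := @local_bounded _ Om bOm P (fun z : V => (F z)^-1) 1.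
case=> [z cz|M HM].
  have [Pz|nPz] := pselect (P z).
    have Fz : 0 < F z by case: Pz => [z1 bz]; have := Fp _ bz; rewrite -z1; case: (z).
    exists (2 / F z).
    have F20 : 0 < F z / 2 by rewrite divr_gt0.
    apply: filterS (smooth_on_continuous oOm sF cz F20) => z' h [z1 bz].
    have cz' : closed_cylinder Om z' by split; [rewrite z1|case: bz].
    have := h cz'; rewrite ltr_norml => /andP[h1 h2].
    have h3 : F z / 2 <= F z' by lra.
    have Fz' : 0 < F z' by exact: lt_le_trans h3.
    by rewrite normfV (gtr0_norm Fz') -[2 / F z]invf_div lef_pV2.
  exists 0; have o : open_nbhs z (~` P) by split => //; exact: closed_openC.
  have : nbhs z (~` P) by exact: open_nbhs_nbhs.
  by apply: filterS => z' nP /nP.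
exists (`|M| + 1)^-1 => [|y by_]; first by rewrite invr_gt0 ltr_pwDr.
have Fy := Fp y by_.
have := HM (1, y) (conj erefl by_); rewrite /= ler01 lexx => /(_ isT by_.1).
rewrite normfV (gtr0_norm Fy) => h.
have M1 : 0 < `|M| + 1 by rewrite ltr_pwDr.
rewrite -[leRHS]invrK lef_pV2 ?posrE ?invr_gt0//.
by have := ler_norm M; move: `|M| (F _)^-1 h => *; lra.
Qed.

Lemma static_intro F : reg F -> (forall s t x, F (s, x) = F (t, x)) ->
  exists M, static Om M F.
Proof.
have arith (a b c d : R) : 0 <= a -> 0 <= b -> 0 <= c -> 0 <= d ->
    [/\ b <= a + b + c + d, c <= a + b + c + d & d <= a + b + c + d] by move=> *; split; lra.
move=> rF tF.
have dF j s x : dx j F (s, x) = dx j F (1, x).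
  by rewrite /dx -!derive_slice; congr ('D_(_) _ x); apply/funext => y; exact: tF.
have [_ /(_ 2)[M0 H0]] := reg_cb rF.
have Hj j : exists M, forall x, Om x -> `|dx j F (1, x)| <= M.
  have [_ /(_ 2)[Mj Hj]] := cb_dx j rF; exists Mj => x Ox.
  by apply: Hj; [split|rewrite /before/=; lra].
have [B0 b0] := Hj ord0; have [B1 b1] := Hj (lift ord0 ord0); have [B2 b2] := Hj (lift ord0 (lift ord0 ord0)).
exists (`|M0| + `|B0| + `|B1| + `|B2|); split => //.
- move=> [s x] [s0 Ox]; rewrite (tF s 1).
  apply: le_trans (H0 (1, x) _ _) _; [by split|by rewrite /before/=; lra|].
  by rewrite -!addrA (le_trans (ler_norm M0))// lerDl !addr_ge0.
- move=> j [s x] [s0 Ox]; rewrite dF.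
  have [[[n0 n1] n2] n3] := (normr_ge0 M0, normr_ge0 B0, normr_ge0 B1, normr_ge0 B2).
  have c0 := le_trans (b0 x Ox) (ler_norm B0).
  have c1 := le_trans (b1 x Ox) (ler_norm B1).
  have c2 := le_trans (b2 x Ox) (ler_norm B2).
  have [l0 l1 l2] := arith _ _ _ _ n0 n1 n2 n3.
  case: (unliftP ord0 j) => [i ->|->]; last exact: le_trans c0 l0.
  case: (unliftP ord0 i) => [k ->|->]; last exact: le_trans c1 l1.
  by rewrite (ord1 k); exact: le_trans c2 l2.
Qed.

Lemma static_le M M' F : static Om M F -> M <= M' -> static Om M' F.
Proof.
move=> [a b c d] MM; split => // [q Qq|j q Qq]; first exact: le_trans (c q Qq) MM.
exact: le_trans (d j q Qq) MM.
Qed.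

End Conversion.

(** * Averages over time windows *)

Section TimeAverages.
Context {R : realType}.
Local Notation leb := (@lebesgue_measure R).
Variables (E : R -> \bar R) (q F dF : R -> R) (a b T0 : R).
Hypotheses (T00 : 0 < T0) (E0 : forall s, (0 <= E s)%E).
Hypothesis Eq : forall s, 0 < s -> E s = (q s)%:E.
Hypothesis cq : forall s : R, 0 < s -> {for s, continuous q}.
Hypothesis dFs : forall s : R, T0 <= s -> is_derive s 1 F (dF s).
Hypothesis Fb : forall s, T0 <= s -> 0 <= F s <= b.
Hypothesis qF : forall s, T0 <= s -> q s <= a - dF s.

Let within_cq c d : 0 < c -> {within `[c, d], continuous q}.
Proof.
move=> c0; apply: continuous_in_subspaceT => x.
by rewrite inE/= in_itv/= => /andP[cx _]; apply: cq; exact: lt_le_trans cx.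
Qed.

(** With [Q] a primitive of [q], the function [Q + F - a * x] is nonincreasing; the variation of [F]
    over the window is at most [b]. *)
Lemma integral_le_rate T tau : T0 <= T -> 0 < tau ->
  (\int[leb]_(s in `[T, (T + tau)%R]) E s <= (a * tau + b)%:E)%E.
Proof.
move=> TT tau0; have Tp : 0 < T by exact: lt_le_trans TT.
(* The primitive starts before [T], and [q] is integrable beyond the end of the window, so that [Q]
   is differentiable at both endpoints. *)
pose c := T / 2; have c0 : 0 < c by rewrite /c divr_gt0.
have cT : c < T by rewrite /c; lra.
pose d := T + tau; have Td : T < d by rewrite /d ltrDl.
have iq : leb.-integrable `[c, (d + 1)%R] (EFin \o q).
  by apply: continuous_compact_integrable; [exact: segment_compact|exact: within_cq].
pose Q (y : R) := \int[leb]_(t in [set` `[c, y]]) (q t).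
have dQ (x : R) : T <= x <= d -> is_derive x 1 Q (q x).
  move=> /andP[Tx xd]; have cx : c < x by exact: lt_le_trans Tx.
  have xd1 : x < d + 1 by apply: le_lt_trans xd _; rewrite ltrDl.
  have [h1 h2] := continuous_FTC1_closed xd1 iq cx (cq (lt_trans c0 cx)).
  by rewrite derive1E in h2; exact: DeriveDef h1 h2.
have cQ (x : R) : T <= x <= d -> {for x, continuous Q}.
  by move=> xTd; exact: is_derive_continuous (dQ x xTd).
have -> : (\int[leb]_(s in `[T, d]) E s = (Q d)%:E - (Q T)%:E)%E.
  rewrite -(@continuous_FTC2 _ q Q T d Td).
  - apply: eq_integral => s; rewrite inE/= in_itv/= => /andP[Ts _].
    by rewrite Eq//; exact: lt_le_trans Ts.
  - exact: within_cq.
  - split.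
    + move=> x; rewrite in_itv/= => /andP[Tx xd].
      by have [] := dQ x; rewrite ?(ltW Tx) ?(ltW xd).
    + by apply: cvg_at_right_filter; apply: cQ; rewrite lexx ltW.
    + by apply: cvg_at_left_filter; apply: cQ; rewrite lexx ltW.
  - move=> x; rewrite in_itv/= => /andP[Tx xd].
    rewrite derive1E; have xTd : T <= x <= d by rewrite !ltW.
    by have [_ ->] := dQ x xTd.
have h : Q d + F d - a * d <= Q T + F T - a * T.
  apply: (@nincr_derive _ (fun x => Q x + F x - a * x) (fun x => q x + dF x - a) T d (ltW Td)).
    move=> x xTd; have T0x : T0 <= x by case/andP: xTd => + _; exact: le_trans.
    have [k1 k2] := is_derive_sub (is_derive_add (dQ x xTd) (dFs T0x))
      (is_derive_mul (is_derive_cst a x 1) (is_derive_id x 1)).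
    by apply: DeriveDef k1 _; rewrite [LHS]k2 /cst; ring.
  move=> x /andP[Tx _]; have := qF (le_trans TT Tx).
  by move: (q x) (dF x) => *; lra.
rewrite -EFinB lee_fin.
have /andP[_ FT] := Fb TT; have /andP[Fd _] := Fb (le_trans TT (ltW Td)).
have e : a * d = a * T + a * tau by rewrite /d mulrDr.
rewrite e in h; move: h FT Fd; move: (Q d) (Q T) (F d) (F T) (a * T) (a * tau) => *; lra.
Qed.

(** The window starts at 0, before the estimates hold. The stretch up to [T0] and the bound [b]
    contribute at most a constant [C], which the strict gap between [a] and [B] absorbs as soon as
    [t] exceeds [T0 + C / (B - a)]. *)
Lemma limsup_le B : 0 <= a ->
  (exists N, forall s, 0 < s <= T0 -> q s <= N) -> a < B ->
  (limf_esup (fun t : R => (t^-1)%:E * \int[leb]_(s in `[0%R, (0 + t)%R]) E s)%E (pinfty_nbhs R) <= B%:E)%E.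
Proof.
move=> a0 [N qN] aB.
pose N' := Num.max 0 N.
have N0 : 0 <= N' by rewrite le_max lexx.
pose C := N' * T0 + `|b|.
have C0 : 0 <= C by rewrite /C addr_ge0// mulr_ge0// ltW.
have Ba : 0 < B - a by rewrite subr_gt0.
pose T1 := T0 + C / (B - a).
apply: ge_ereal_inf; exists (ereal_sup ((fun t : R => (t^-1)%:E * \int[leb]_(s in `[0%R, (0 + t)%R]) E s)%E @` [set t | T1 < t])).
  by exists [set t | T1 < t] => //; exists T1; split => //; exact: num_real.
apply: ge_ereal_sup => _ [t /= Tt <-].
have T01 : T0 <= T1 by rewrite /T1 lerDl divr_ge0// ltW.
have T0t : T0 < t by exact: le_lt_trans Tt.
have t0 : 0 < t by exact: lt_trans T0t.
rewrite add0r.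
pose P : set R := `]0, +oo[%classic.
have mp : measurable_fun P E.
  apply: (@eq_measurable_fun _ _ _ _ _ (EFin \o q)).
    by move=> s; rewrite inE /P/= in_itv/= andbT => s0; rewrite Eq.
  apply/measurable_EFinP.
  apply: open_continuous_measurable_fun; first exact: interval_open.
  by move=> s; rewrite inE /P/= in_itv/= andbT; exact: cq.
have mS (A : set R) : A `<=` P -> measurable_fun A E.
  by move=> AP; apply: measurable_funS AP mp; exact: measurable_itv.
have mE : measurable_fun `]0, t] E.
  by apply: mS => s; rewrite /P/= !in_itv/= => /andP[-> _].
(* The time 0 is removed from the window, since [E] agrees with [q] at positive times only. *)
rewrite -(integral_itv_obnd_cbnd mE).
have U : `]0, t]%classic = `]0, T0]%classic `|` `]T0, t]%classic :> set R.
  apply/seteqP; split=> s; rewrite /= !in_itv/=.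
    by move=> /andP[s0 st]; have [sT|Ts] := leP s T0; [left; rewrite s0|right].
  by move=> [/andP[s0 sT]|/andP[Ts ->]]; rewrite ?(lt_trans T00 Ts)// s0 (le_trans sT)// ltW.
have i1 : (\int[leb]_(s in `]0%R, T0]) E s <= (N' * T0)%:E)%E.
  have m1 : measurable_fun `]0, T0] E.
    by apply: mS => s; rewrite /P/= !in_itv/= => /andP[-> _].
  apply: (@le_trans _ _ (\int[leb]_(s in `]0%R, T0]) (cst N'%:E s))%E).
    apply: ge0_le_integral => //.
    move=> s; rewrite /= in_itv/= => s0T; have /andP[s0 _] := s0T.
    by rewrite Eq// lee_fin le_max qN// orbT.
  rewrite integral_cst//= lebesgue_measure_itv/= lte_fin T00 -EFinB subr0.
  by rewrite -EFinM.
have i2 : (\int[leb]_(s in `]T0, t]) E s <= (a * (t - T0) + b)%:E)%E.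
  have tp : 0 < t - T0 by rewrite subr_gt0.
  apply: le_trans _ (integral_le_rate (lexx T0) tp).
  rewrite [T0 + _]addrC subrK.
  apply: ge0_subset_integral => //.
    by apply: mS => s; rewrite /P/= !in_itv/= andbT => /andP[+ _]; exact: lt_le_trans.
  by move=> s; rewrite /= !in_itv/= => /andP[/ltW -> ->].
have i3 : (\int[leb]_(s in `]0%R, t]) E s <= (C + a * t)%:E)%E.
  rewrite U ge0_integral_setU//.
  - apply: (le_trans (leeD i1 i2)); rewrite -EFinD lee_fin /C mulrBr.
    have aT : 0 <= a * T0 by rewrite mulr_ge0// ltW.
    have := ler_norm b; move: aT; move: (N' * T0) (a * t) (a * T0) `|b| => *; lra.
  - by rewrite -U.
  - rewrite disj_set2E; apply/eqP/seteqP; split=> // s [] /=; rewrite !in_itv/=.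
    by move=> /andP[_ h1] /andP[h2 _]; have := lt_le_trans h2 h1; rewrite ltxx.
apply: le_trans (lee_wpmul2l _ i3) _; first by rewrite lee_fin invr_ge0 ltW.
rewrite -EFinM lee_fin mulrC ler_pdivrMr//.
have : C <= (B - a) * t.
  rewrite mulrC -ler_pdivrMr//; apply: ltW; apply: le_lt_trans Tt.
  by rewrite /T1 lerDr ltW.
by rewrite mulrBl; move: (B * t) (a * t) => *; lra.
Qed.

End TimeAverages.

Transparent It.

(** * Reference fields, control by the initial data, conclusion *)

Section Assembly.
Context {R : realType}.
Local Notation E3 := 'rV[R]_3.
Local Notation V := (R * 'rV[R]_3)%type.
Variables (Om : set E3).
Hypotheses (oOm : open Om) (bOm : bounded_set Om) (smOm : smooth_boundary Om).
Local Notation cb := (cb Om).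
Local Notation reg := (reg Om).
Local Notation It := (It Om).
Local Notation v0 := (vol Om (fun=> 1)).

Lemma volume_integral_It (f : V -> R) (s : R) : cb f -> 0 < s ->
  volume_integral Om (fun x => (f (s, x))%:E) = (It f s)%:E.
Proof.
move=> cf s0; have i := bc_integrable oOm bOm (cb_slice cf s0).
rewrite /It /vol /Rintegral fineK//; apply: integrable_fin_num i.
exact: measurable_dom.
Qed.

(* Lifts [y] above a positive floor without moving the values [y >= m]. *)
Definition lift_above (m y : R) := y + pos (m - y) ^+ 3.

Lemma lift_above_ge m y : 0 < m -> 0 <= y -> Num.min (m / 2) ((m / 2) ^+ 3) <= lift_above m y.
Proof.
move=> m0 y0; rewrite /lift_above; have p0 := pos_ge0 (m - y).
have m20 : 0 < m / 2 by rewrite divr_gt0.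
have [h|h] := leP (m / 2) y.
  rewrite ge_min (le_trans h)// lerDl exprn_ge0//.
have h2 : m / 2 <= pos (m - y).
  rewrite pos_id; last by rewrite subr_ge0; apply: le_trans (ltW h) _; lra.
  by lra.
rewrite ge_min; apply/orP; right.
apply: (@le_trans _ _ (pos (m - y) ^+ 3)); last by rewrite lerDr.
by apply: lerXn2r => //; rewrite nnegrE// ltW.
Qed.

(** The slice of a solution at time 1 has the right traces but may vanish inside, where logarithms
    degenerate. Adding [pos (m1 - y) ^+ 3] lifts it above a positive floor, does not change the
    boundary values, which are at least [m1], and keeps it C^1. The potential is used as it is. *)
Lemma reference_of D1 D2 nu K eps g1 g2 w c1 c2 Phi u p m1 :
  nps Om D1 D2 nu K eps g1 g2 w c1 c2 Phi u p -> 0 < m1 ->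
  (forall y, boundary Om y -> m1 <= g1 y) -> (forall y, boundary Om y -> m1 <= g2 y) ->
  exists M m Ga1 Ga2 PhW, reference Om M m g1 g2 w Ga1 Ga2 PhW.
Proof.
move=> S m10 mg1 mg2.
pose Ga (c : V -> R) (z : V) := fz 1 c z + pos (m1 - fz 1 c z) ^+ 3.
have rGa c : reg c -> reg (Ga c).
  move=> rc; have rf := reg_fz oOm rc ltr01.
  have rm : reg (fun z => m1 - fz 1 c z) by regtac.
  have rp := @C1bd_pos _ _ _ _ _ 1 (fun z => m1 - fz 1 c z) (open_cyl oOm) rm : reg (fun z => pos (m1 - fz 1 c z) ^+ 3).
  by rewrite /Ga; regtac.
have tGa c g : btr Om c g -> (forall y, boundary Om y -> m1 <= g y) -> btr Om (Ga c) g.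
  move=> tc mg; have tf := btr_fz tc ltr01.
  have tp : btr Om (fun z => pos (m1 - fz 1 c z) ^+ 3) (fun y => pos (m1 - g y) ^+ 3).
    apply: (@btr_comp _ _ (fun z => m1 - fz 1 c z) (fun y => m1 - g y) (fun s => pos s ^+ 3)).
      exact (btrB (@btr_cst R Om m1) tf).
    by move=> y _; exact: continuous_posX.
  apply: (@btr_eq _ _ _ _ _ _ (btrD tf tp)) => // y by_.
  by rewrite pos_0 ?expr0n ?addr0// subr_le0 mg.
have gGa z D c : species Om u Phi z D c -> forall q, cyl Om q -> Num.min (m1 / 2) ((m1 / 2) ^+ 3) <= Ga c q.
  move=> sc [t x] [t0 Ox]; apply: lift_above_ge => //.
  by apply: (sp_ge0 sc (conj ltr01 Ox : cyl Om (1, x))).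
have r1 := sp_reg (n_c1 S); have r2 := sp_reg (n_c2 S).
have [M1 s1] := static_intro (rGa _ r1) (fun s t x => erefl).
have [M2 s2] := static_intro (rGa _ r2) (fun s t x => erefl).
have [MW sW] := static_intro (reg_fz oOm (n_rPhi S) ltr01) (fun s t x => erefl).
pose m := Num.min (m1 / 2) ((m1 / 2) ^+ 3).
have m0 : 0 < m by rewrite lt_min exprn_gt0 ?divr_gt0.
have [n1 n2 nW] := And3 (normr_ge0 M1) (normr_ge0 M2) (normr_ge0 MW).
have [l1 l2 lW] := And3 (ler_norm M1) (ler_norm M2) (ler_norm MW).
exists (`|M1| + `|M2| + `|MW| + m), m, (Ga c1), (Ga c2), (fz 1 Phi); split => //.
- by apply: static_le s1 _; move: m0 n1 n2 nW l1; move: m `|M1| `|M2| `|MW| => *; lra.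
- by apply: static_le s2 _; move: m0 n1 n2 nW l2; move: m `|M1| `|M2| `|MW| => *; lra.
- by apply: static_le sW _; move: m0 n1 n2 nW lW; move: m `|M1| `|M2| `|MW| => *; lra.
- by rewrite lerDr !addr_ge0.
- exact: gGa (n_c1 S).
- exact: gGa (n_c2 S).
- exact: tGa (n_t1 S) mg1.
- exact: tGa (n_t2 S) mg2.
- exact: btr_fz (n_tPhi S) ltr01.
- by move=> y by_; exact: lt_le_trans (mg1 y by_).
- by move=> y by_; exact: lt_le_trans (mg2 y by_).
Qed.

Definition bounded_data (N : R) (c10 c20 : E3 -> R) (u0 : E3 -> E3) := forall x, closure Om x ->
  [/\ `|c10 x| <= N, `|c20 x| <= N & forall k, `|u0 x 0 k| <= N].

Section Solution.
Variables (D1 D2 nu K eps : R) (g1 g2 w : E3 -> R) (c1 c2 Phi : R -> E3 -> R)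
  (u : R -> E3 -> E3) (p : R -> E3 -> R).
Hypotheses (D10 : 0 < D1) (D20 : 0 < D2).
Hypothesis S : smooth_NPS_solution Om D1 D2 nu K eps g1 g2 w c1 c2 Phi u p.
Let uk (k : 'I_3) (z : V) := u z.1 z.2 0 k.
Let suk k : smooth_on (closed_cylinder Om) (uk k) := smooth_on_coord k (nps_smooth_u S).
Let Sn := nps_of_solution oOm bOm S.

Lemma bounded_initial c10 c20 u0 : initial_data Om c10 c20 u0 c1 c2 u ->
  exists N, bounded_data N c10 c20 u0.
Proof.
move=> I0.
have [N1 h1] := smooth_on_bounded oOm bOm 1 (nps_smooth_c1 S).
have [N2 h2] := smooth_on_bounded oOm bOm 1 (nps_smooth_c2 S).
have [Na ha] := smooth_on_bounded oOm bOm 1 (suk ord0).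
have [Nb hb] := smooth_on_bounded oOm bOm 1 (suk (lift ord0 ord0)).
have [Nc hc] := smooth_on_bounded oOm bOm 1 (suk (lift ord0 (lift ord0 ord0))).
exists (Num.max N1 (Num.max N2 (Num.max Na (Num.max Nb Nc)))) => x cx.
have [e1 e2 e3] := I0 x cx; rewrite -e1 -e2 -e3.
have z01 : 0 <= ((0, x) : V).1 <= 1 by rewrite /= lexx ler01.
split=> [||k]; rewrite !le_max.
- by rewrite (h1 (0, x) z01 cx).
- by rewrite (h2 (0, x) z01 cx) orbT.
have [a1 [b1 d1]] := (ha (0, x) z01 cx, (hb (0, x) z01 cx, hc (0, x) z01 cx)).
case: (unliftP ord0 k) => [i ->|->]; last by move: a1; rewrite /uk/= => ->; rewrite !orbT.
case: (unliftP ord0 i) => [j ->|->]; last by move: b1; rewrite /uk/= => ->; rewrite !orbT.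
by rewrite (ord1 j); move: d1; rewrite /uk/= => ->; rewrite !orbT.
Qed.

(** The majorants depend on the data through [N] alone; [N + 1] is the margin granted by
    [uniform_initial_bound] on a short interval, and [0 <= G0] makes the excess no larger than the
    concentration. *)
Lemma initial_control G0 N c10 c20 u0 : 0 <= G0 -> initial_data Om c10 c20 u0 c1 c2 u ->
  bounded_data N c10 c20 u0 ->
  exists2 s0, 0 < s0 & controlled Om D1 D2 G0 s0
    (((N + 1) ^+ 4 / (4 * D1) + (N + 1) ^+ 4 / (4 * D2)) * v0) (3 * (N + 1) ^+ 2 * v0)
    (unc c1) (unc c2) uk.
Proof.
move=> G00 I0 BN.
have b1 x : closure Om x -> `|unc c1 (0, x)| <= N by move=> cx; have [h _ _] := BN x cx; have [e _ _] := I0 x cx; rewrite /unc/= e.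
have b2 x : closure Om x -> `|unc c2 (0, x)| <= N by move=> cx; have [_ h _] := BN x cx; have [_ e _] := I0 x cx; rewrite /unc/= e.
have bu k x : closure Om x -> `|uk k (0, x)| <= N by move=> cx; have [_ _ h] := BN x cx; have [_ _ e] := I0 x cx; rewrite /uk/= e.
have [t1 t10 h1] := uniform_initial_bound oOm bOm (nps_smooth_c1 S) b1.
have [t2 t20 h2] := uniform_initial_bound oOm bOm (nps_smooth_c2 S) b2.
have [ta ta0 ha] := uniform_initial_bound oOm bOm (suk ord0) (bu ord0).
have [tb tb0 hb] := uniform_initial_bound oOm bOm (suk (lift ord0 ord0)) (bu _).
have [tc tc0 hc] := uniform_initial_bound oOm bOm (suk (lift ord0 (lift ord0 ord0))) (bu _).
exists (Num.min t1 (Num.min t2 (Num.min ta (Num.min tb tc)))) => [|s /andP[s0]].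
  by rewrite !lt_min t10 t20 ta0 tb0 tc0.
rewrite !le_min => /and5P[s1 s2 sa sb sc].
have hu k x : Om x -> `|uk k (s, x)| <= N + 1.
  move=> Ox; case: (unliftP ord0 k) => [i ->|->]; last by apply: ha => //; rewrite s0.
  case: (unliftP ord0 i) => [j ->|->]; last by apply: hb => //; rewrite s0.
  by rewrite (ord1 j); apply: hc => //; rewrite s0.
have rc1 := sp_reg (n_c1 Sn); have rc2 := sp_reg (n_c2 Sn).
have ru : forall k, reg (uk k) := n_ru Sn.
have ex (c : R -> E3 -> R) x : Om x -> `|unc c (s, x)| <= N + 1 -> exc G0 (unc c) (s, x) ^+ 4 <= (N + 1) ^+ 4.
  move=> Ox hN; have N0 := le_trans (normr_ge0 _) hN.
  apply: lerXn2r; rewrite ?nnegrE ?pos_ge0// /exc /pos ge_max N0 andbT.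
  by have := le_trans (ler_norm _) hN; move: (unc _ _) => *; lra.
split.
  have rY := reg_Yd oOm G0 (n_c1 Sn) (n_c2 Sn).
  rewrite -(It_cst oOm bOm _ s).
  apply: (It_le oOm bOm (reg_cb rY) _ s0); first exact: cb_cst.
  move=> x Ox; rewrite /Yd; apply: lerD.
    rewrite ler_wpM2r ?invr_ge0 ?mulr_ge0 ?(ltW D10)//; apply: ex => //; apply: h1 => //.
    by rewrite s0.
  rewrite ler_wpM2r ?invr_ge0 ?mulr_ge0 ?(ltW D20)//; apply: ex => //; apply: h2 => //.
  by rewrite s0.
rewrite -(It_cst oOm bOm _ s).
apply: (It_le oOm bOm _ _ s0); [by regtac|exact: cb_cst|].
move=> x Ox; apply: (@le_trans _ _ (\sum_(k < 3) (N + 1) ^+ 2)).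
  apply: ler_sum => k _; rewrite -[leLHS]real_normK ?num_real//.
  have h := hu k x Ox.
  by apply: lerXn2r => //; rewrite nnegrE// (le_trans _ h).
by rewrite sumr_const card_ord -[leLHS]mulr_natl.
Qed.

Lemma charge_bounded (T : R) : exists N, forall s, 0 < s <= T ->
  It (fun q => rho (unc c1) (unc c2) q ^+ 2) s <= N.
Proof.
have [N1 h1] := smooth_on_bounded oOm bOm T (nps_smooth_c1 S).
have [N2 h2] := smooth_on_bounded oOm bOm T (nps_smooth_c2 S).
have rr := reg_rho oOm Sn.
exists ((N1 + N2) ^+ 2 * v0) => s /andP[s0 sT].
rewrite -(It_cst oOm bOm _ s).
apply: (It_le oOm bOm _ _ s0); [by regtac|exact: cb_cst|].
move=> x Ox; have cx := subset_closure Ox.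
have z : 0 <= ((s, x) : V).1 <= T by rewrite /= (ltW s0).
have := h1 (s, x) z cx; have := h2 (s, x) z cx; rewrite /rho /unc/= => k2 k1.
have k := le_trans (ler_normB (c1 s x) (c2 s x)) (lerD k1 k2).
rewrite -[leLHS]real_normK ?num_real//.
by apply: lerXn2r => //; rewrite nnegrE// (le_trans _ k).
Qed.

End Solution.

End Assembly.

Theorem theorem4 (R : realType) (Omega : set 'rV[R]_3)
    (D1 D2 nu K : R) (gamma1 gamma2 W : 'rV[R]_3 -> R)
    (Omega_open : open Omega) (Omega_connected : connected Omega)
    (Omega_bounded : bounded_set Omega) (Omega_smooth : smooth_boundary Omega)
    (D1_gt0 : 0 < D1) (D2_gt0 : 0 < D2) (nu_gt0 : 0 < nu) (K_gt0 : 0 < K)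
    (gamma1_smooth : smooth_on (boundary Omega) gamma1)
    (gamma2_smooth : smooth_on (boundary Omega) gamma2)
    (W_smooth : smooth_on (boundary Omega) W)
    (gamma1_gt0 : forall x, boundary Omega x -> 0 < gamma1 x)
    (gamma2_gt0 : forall x, boundary Omega x -> 0 < gamma2 x) :
  exists B1 : R,
    forall (eps : R), 0 < eps ->
    forall (c10 c20 : 'rV[R]_3 -> R) (u0 : 'rV[R]_3 -> 'rV[R]_3),
    exists Teps : R, 0 <= Teps /\
      forall (c1 c2 Phi : R -> 'rV[R]_3 -> R) (u : R -> 'rV[R]_3 -> 'rV[R]_3)
             (p : R -> 'rV[R]_3 -> R),
      smooth_NPS_solution Omega D1 D2 nu K eps gamma1 gamma2 W c1 c2 Phi u p ->
      initial_data Omega c10 c20 u0 c1 c2 u ->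
      (forall tau T : R, eps `^ (2 / 3) <= tau -> Teps <= T ->
        (mean_sq_charge Omega c1 c2 T tau <= (B1 * eps `^ (1 / 3))%:E)%E) /\
      (limf_esup (mean_sq_charge Omega c1 c2 0) (pinfty_nbhs R)
         <= (B1 * eps `^ (1 / 3))%:E)%E.
Proof.
have oO := Omega_open; have bO := Omega_bounded; have smO := Omega_smooth.
pose solvable := exists eps c1 c2 Phi u p,
  smooth_NPS_solution Omega D1 D2 nu K eps gamma1 gamma2 W c1 c2 Phi u p.
(* This solution, with its own parameter [es], is picked before [eps]; the constants built from it
   serve every [eps] and all initial data. *)
have [[es [a1 [a2 [aP [au [ap Sa]]]]]]|nosol] := pselect solvable; last first.
  exists 0 => eps e0 c10 c20 u0; exists 0; split => // c1 c2 Phi u p S _.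
  by exfalso; apply: nosol; exists eps, c1, c2, Phi, u, p.
have San := nps_of_solution oO bO Sa.
have [m1 m10 h1] : exists2 m, 0 < m & forall y, boundary Omega y -> m <= unc a1 (1, y).
  apply: (boundary_lower_bound oO bO (nps_smooth_c1 Sa)) => y by_.
  by rewrite /= (nps_bc_c1 Sa)// gamma1_gt0.
have [m2 m20 h2] : exists2 m, 0 < m & forall y, boundary Omega y -> m <= unc a2 (1, y).
  apply: (boundary_lower_bound oO bO (nps_smooth_c2 Sa)) => y by_.
  by rewrite /= (nps_bc_c2 Sa)// gamma2_gt0.
pose mm := Num.min m1 m2.
have mm0 : 0 < mm by rewrite lt_min m10.
have lo1 y : boundary Omega y -> mm <= gamma1 y.
  by move=> by_; have := h1 y by_; rewrite /unc/= (nps_bc_c1 Sa)// => h; rewrite ge_min h.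
have lo2 y : boundary Omega y -> mm <= gamma2 y.
  by move=> by_; have := h2 y by_; rewrite /unc/= (nps_bc_c2 Sa)// => h; rewrite ge_min h orbT.
have [M [m [Ga1 [Ga2 [PhW Rf]]]]] := reference_of oO San mm0 lo1 lo2.
have [N1 k1] := smooth_on_bounded oO bO 1 (nps_smooth_c1 Sa).
have [N2 k2] := smooth_on_bounded oO bO 1 (nps_smooth_c2 Sa).
pose G0 := Num.max 0 (Num.max N1 N2).
have G00 : 0 <= G0 by rewrite le_max lexx.
have z11 (y : 'rV[R]_3) : 0 <= ((1 : R), y).1 <= 1 by rewrite /= ler01 lexx.
have up1 y : boundary Omega y -> gamma1 y <= G0.
  move=> by_; have := le_trans (ler_norm _) (k1 (1, y) (z11 y) by_.1).
  by rewrite /= (nps_bc_c1 Sa)// /G0 !le_max => ->; rewrite orbT.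
have up2 y : boundary Omega y -> gamma2 y <= G0.
  move=> by_; have := le_trans (ler_norm _) (k2 (1, y) (z11 y) by_.1).
  by rewrite /= (nps_bc_c2 Sa)// /G0 !le_max => ->; rewrite !orbT.
have [CP CP1 poin] := poincare oO bO smO.
have [L L0 collars] := collar_exists oO bO smO.
have [B B0 HB] := long_time oO bO smO Rf D1_gt0 D2_gt0 nu_gt0 K_gt0 G00 CP1 L0 up1 up2 poin collars.
(* The added 1 makes the rate strictly smaller than the claimed bound, as [limsup_le] demands. *)
exists (B + 1) => eps e0 c10 c20 u0.
pose k := eps `^ (1 / 3).
have k0 : 0 < k by exact: powR_gt0.
have k3 : k ^+ 3 = eps.
  rewrite -powR_mulrn ?(ltW k0)// /k -powRrM (_ : 1 / 3 * 3%:R = 1) ?powRr1 ?(ltW e0)//.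
  by field.
have k2' : eps `^ (2 / 3) = k ^+ 2.
  rewrite -powR_mulrn ?(ltW k0)// /k -powRrM; congr (_ `^ _); by field.
(* A smooth solution is bounded at time 0 on the closure, so unbounded initial data admit none and
   any waiting time will do. *)
have [[N BN]|noN] := pselect (exists N, bounded_data Omega N c10 c20 u0); last first.
  exists 0; split => // c1 c2 Phi u p S I0; exfalso; apply: noN.
  exact: (bounded_initial oO bO S I0).
pose Y0 := ((N + 1) ^+ 4 / (4 * D1) + (N + 1) ^+ 4 / (4 * D2)) * vol Omega (fun=> 1).
pose U0 := 3 * (N + 1) ^+ 2 * vol Omega (fun=> 1).
have Y00 : 0 <= Y0.
  apply: mulr_ge0; last by apply: vol_ge0.
  have h4 : 0 <= (N + 1) ^+ 4 by rewrite (_ : 4 = 2 * 2)%N// exprM exprn_ge0// sqr_ge0.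
  by apply: addr_ge0; apply: divr_ge0 => //; apply: mulr_ge0 => //; exact: ltW.
have [T0 T00 HT] := HB k Y0 U0 k0 Y00.
exists T0; split; first exact: ltW.
move=> c1 c2 Phi u p S I0; have Sn := nps_of_solution oO bO S.
have ctl := initial_control oO bO D1_gt0 D2_gt0 S G00 I0 BN.
rewrite -k3 in Sn.
have [F [dF [a [b [dFs Fb qF ab]]]]] := HT _ _ _ _ _ Sn ctl.
pose q s := It Omega (fun z => rho (unc c1) (unc c2) z ^+ 2) s.
pose E s := volume_integral Omega (fun x => ((c1 s x - c2 s x) ^+ 2)%:E).
have rr := reg_rho oO Sn.
have rr2 : reg Omega (fun z => rho (unc c1) (unc c2) z ^+ 2) by regtac.
have Eq (s : R) : 0 < s -> E s = (q s)%:E.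
  by move=> s0; rewrite /E -(volume_integral_It oO bO (reg_cb rr2) s0).
have E0 s : (0 <= E s)%E.
  by apply: integral_ge0 => x _; rewrite lee_fin sqr_ge0.
have cq (s : R) : 0 < s -> {for s, continuous q}.
  by move=> s0; exact: (is_derive_continuous (is_derive_It oO bO rr2 s0)).
have tau0 (tau : R) : k ^+ 2 <= tau -> 0 < tau by apply: lt_le_trans; rewrite exprn_gt0.
have b0 : 0 <= b by have /andP[x y] := Fb T0 (lexx _); exact: le_trans x y.
split=> [tau T|].
  rewrite k2' => ht hT; have tp := tau0 _ ht.
  have h := integral_le_rate T00 Eq cq dFs Fb qF hT tp.
  rewrite /mean_sq_charge -/k.
  apply: le_trans (lee_wpmul2l _ h) _; first by rewrite lee_fin invr_ge0 ltW.
  rewrite -EFinM lee_fin mulrC ler_pdivrMr//; apply: le_trans (ab tau ht) _.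
  by rewrite ler_pM2r// ler_pM2r// lerDl.
(* The estimate on the shortest admissible window [k ^+ 2], with the nonnegative [b] dropped,
   isolates the rate. *)
have ak : a <= B * k.
  have h := ab _ (lexx (k ^+ 2)); have kp : 0 < k ^+ 2 by rewrite exprn_gt0.
  by rewrite -(ler_pM2r kp); apply: le_trans h; rewrite lerDl.
have [N' qN] := charge_bounded oO bO S T0.
pose a' := Num.max 0 a.
have qF' (s : R) : T0 <= s -> q s <= a' - dF s.
  by move=> Ts; apply: le_trans (qF s Ts) _; rewrite lerD2r le_max lexx orbT.
apply: (limsup_le T00 E0 Eq cq dFs Fb qF'); first by rewrite le_max lexx.
  by exists N'.
rewrite -/k mulrDl mul1r gt_max ltr_pwDr ?mulr_ge0 ?(ltW k0)//=.
by apply: le_lt_trans ak _; rewrite ltrDl.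
Qed.
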